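(* Assume the Generalized Riemann Hypothesis. Let $s=\sigma+it$ where $1/2< \sigma<1$ and $t\in \mathbb{R}$, and let $x$ be large. Then there are $\gg x^{1/2}$ primes $p\leq x$ such that $$ \log |L(s,\chi_p)|\geq (\beta(s)+o(1))(\log x)^{1-\sigma}(\log_2 x)^{-\sigma},$$ and $\gg x^{1/2}$ primes $q\leq x$ such that $$ \log |L(s,\chi_q)|\leq -(\beta(s)+o(1))(\log x)^{1-\sigma}(\log_2 x)^{-\sigma},$$ where $\beta(\sigma)=(2\log 2)^{\sigma-1}/(1-\sigma)$ (the case $t=0$), and $\beta(s)=\beta(\sigma)t^2/\left((1-\sigma)^2+4 t^2\right)$ if $t\neq 0$.
   Context: For a prime $p$, $\chi_p=\left(\frac{\cdot}{p}\right)$ is the Legendre symbol modulo $p$ and $L(s,\chi_p)$ its Dirichlet $L$-function. $\log_2=\log\log$. *)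

(* Defs.v *)
From Stdlib Require Import Reals Lra ZArith Znumtheory List Arith.
From Coquelicot Require Import Coquelicot.
Open Scope R_scope.

Definition cpow_neg (n : nat) (s : C) : C :=
  (exp (- Re s * ln (INR n)) * cos (Im s * ln (INR n)),
   - (exp (- Re s * ln (INR n)) * sin (Im s * ln (INR n)))).

Fixpoint DS_partial (a : nat -> C) (s : C) (N : nat) : C :=
  match N with
  | O => RtoC 0
  | S N' => Cplus (DS_partial a s N') (Cmult (a N) (cpow_neg N s))
  end.

(* l is the value of the Dirichlet series sum_{n>=1} a(n) n^{-s}, defined as
   the limit of its partial sums.  For a non-principal Dirichlet character and
   Re s > 0 this series converges and its sum is L(s,chi) (analytic continuation). *)
Definition is_DSval (a : nat -> C) (s : C) (l : C) : Prop :=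
  filterlim (DS_partial a s) eventually (locally l).

Definition dirichlet_char (q : nat) (chi : nat -> C) : Prop :=
  (1 <= q)%nat /\
  (forall m n, chi (m * n)%nat = Cmult (chi m) (chi n)) /\
  (forall n, chi (n + q)%nat = chi n) /\
  (forall n, chi n <> RtoC 0 <-> Nat.gcd n q = 1%nat).

Definition nonprincipal (chi : nat -> C) : Prop :=
  exists n, chi n <> RtoC 0 /\ chi n <> RtoC 1.

(* Dirichlet eta function coefficients: eta(s) = (1 - 2^{1-s}) zeta(s). *)
Definition eta_coef (n : nat) : C := RtoC ((-1) ^ (n - 1)).

(* Generalized Riemann Hypothesis: no zeros of zeta (through eta, whose extra
   zeros lie on Re s = 1) nor of L(s,chi) (chi non-principal) with
   1/2 < Re s < 1.  (The principal case reduces to zeta, and zeros in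
   0 < Re s < 1/2 are excluded by the functional equation.) *)
Definition GRH : Prop :=
  (forall s l, 1/2 < Re s < 1 -> is_DSval eta_coef s l -> l <> RtoC 0) /\
  (forall q chi, dirichlet_char q chi -> nonprincipal chi ->
     forall s l, 1/2 < Re s < 1 -> is_DSval chi s l -> l <> RtoC 0).

Definition legendre (p n : nat) : Z :=
  if Nat.eqb (n mod p) 0 then 0%Z
  else if existsb (fun x => Nat.eqb ((x * x) mod p) (n mod p)) (seq 0 p)
       then 1%Z else (-1)%Z.

Definition chi_leg (p : nat) : nat -> C := fun n => RtoC (IZR (legendre p n)).

Definition beta_sigma (sigma : R) : R :=
  Rpower (2 * ln 2) (sigma - 1) / (1 - sigma).

Definition beta (sigma t : R) : R :=
  if Req_EM_T t 0 then beta_sigma sigma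
  else beta_sigma sigma * t ^ 2 / ((1 - sigma) ^ 2 + 4 * t ^ 2).

Definition scale (sigma x : R) : R :=
  Rpower (ln x) (1 - sigma) * Rpower (ln (ln x)) (- sigma).

(* Main.v *)
(** Expand [L(s, chi)], or [(s - 1) zeta(s)], in powers of [s - s0] with [Re s0 >= 3]. Since there are no zeros with
    [Re s > 1/2] (GRH, and the classical arguments on [Re s >= 1]), a Borel-Caratheodory estimate bounds the Taylor
    coefficients of the logarithmic derivative, i.e. the sums of [vonM n * chi n * n^(-s0) * (log n)^j]. For
    [s0 = D] large, the partial sums of the exponential series turn these into smoothly truncated sums of
    [vonM n * chi n] with square-root error; this gives the prime number theorem and, by quadratic reciprocity,
    cancellation in the average of [(q_1 ... q_k / p)] over primes [p <= x].

    Averaging the nonnegative weight [prod_(q <= Y) (1 + eps_q (q / p))] over [p], where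
    [Y ~ log x loglog x / (2 log 2)] keeps [2^pi(Y)] below [x^(1/2)], yields at least [x^(1/2)] primes [p] with
    [(q / p) = eps_q] for all odd primes [q <= Y]; a second moment shows that for most of them the primes
    [Y < q <= (log x)^c] contribute little. For such [p], [log |L(s, chi_p)|] is
    [sum_(q <= Y) eps_q cos(t log q) q^(-sigma) + O(1)]. Take [eps_q] to be plus or minus the sign of
    [cos(t log q)] and use [|cos| >= cos^2]. *)

Require Import Defs.
From Stdlib Require Import Reals ZArith Znumtheory List Permutation Lra Lia ClassicalEpsilon.
From Coquelicot Require Import Coquelicot.
From HB Require structures.
From mathcomp Require all_boot all_order all_algebra all_fingroup all_solvable all_field.
Open Scope nat_scope.
Open Scope R_scope.

Notation lg n := (ln (INR n)).

Ltac pos := first [lra | apply lt_0_INR; lia | apply pos_INR | apply Rabs_pos | apply pow2_ge_0 | apply INR_fact_lt_0 | apply exp_pos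
  | apply Rinv_0_lt_compat; pos | apply pow_lt; pos | apply pow_le; pos
  | apply Rmult_lt_0_compat; pos | apply Rmult_le_pos; pos | left; pos].

(** * Logarithmic derivatives of power series *)

(** No contour is integrated: a complex power series is a pair of real coefficient sequences, and
    harmonicity of the log modulus enters as an ODE in the log radius for its Fourier coefficients
    on circles. The far centre [D] turns GRH into square-root cancellation. A zero-free disk of
    radius [D - 1/2] bounds the [j]-th coefficient of the logarithmic derivative by about
    [(D - 1/2)^(-j-1)]. Weighting with [D^j] for [j < K] gives [(D/(D - 1/2))^K], about [e^(T/2)]
    for [T = K/D], while the pole of zeta gives [(D/(D - 1))^K], about [e^T]; and [e^T] is the
    cutoff point. With [L = log x], the cutoff is put at [T = (1 - delta/4) L]. The weight expands
    into at most [e^((1/2 - delta) L)] character sums, each about [e^((1/2 + delta/4) L)], so the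
    main mass [e^T] wins. A single prime weighs at most [e^((1/2 - delta) L) L], so more than
    [sqrt x] primes share that mass. This budget is the origin of [2 log 2] in [beta]. For [t <> 0]
    the extra factor in [beta] bounds from below the oscillating primitive of
    [e^((1 - sigma) x) cos^2 (t x)]. *)

Definition geom_bound (a : nat -> R) (C rho : R) : Prop :=
  forall m, Rabs (a m) <= C / rho ^ m.

Lemma geom_bound_radius (a : nat -> R) (C rho x : R) :
  0 < rho -> geom_bound a C rho -> Rabs x < rho -> Rbar_lt (Rabs x) (CV_radius a).
Proof.
intros Hrho Ha Hx.
apply Rbar_lt_le_trans with (Finite rho); [exact Hx|].
destruct (CV_radius_bounded a) as [H _]. apply H.
exists C. intros n.
rewrite Rabs_mult. rewrite <- RPow_abs. rewrite (Rabs_pos_eq rho) by lra.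
assert (0 < rho ^ n) by pos.
replace C with (C / rho ^ n * rho ^ n) by (field; lra).
apply Rmult_le_compat_r; [lra|apply Ha].
Qed.

Lemma geom_bound_weaken (a : nat -> R) (C rho rho' : R) :
  0 < rho' <= rho -> 0 <= C -> geom_bound a C rho -> geom_bound a C rho'.
Proof.
intros [H1 H2] HC H m. eapply Rle_trans; [apply H|].
unfold Rdiv. apply Rmult_le_compat_l; [exact HC|].
apply Rinv_le_contravar; [pos|apply pow_incr; lra].
Qed.

Lemma geom_bound_pow (a : nat -> R) (C rho x : R) (m : nat) :
  0 < rho -> geom_bound a C rho -> Rabs (a m * x ^ m) <= C * (Rabs x / rho) ^ m.
Proof.
intros Hrho Ha. rewrite Rabs_mult, <- RPow_abs.
unfold Rdiv. rewrite Rpow_mult_distr, pow_inv.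
assert (0 <= Rabs x ^ m) by (apply pow_le, Rabs_pos).
specialize (Ha m). unfold Rdiv in Ha. nra.
Qed.

Section Ray.
Variables (a b p q : nat -> R).
Hypothesis Ha : forall m, PS_derive a m = PS_mult p a m - PS_mult q b m.
Hypothesis Hb : forall m, PS_derive b m = PS_mult p b m + PS_mult q a m.

(* The log-derivative relation [l' = (p + i q) l] makes [|l|^2 exp (-2 Re log)] constant. *)
Lemma modulus_along_ray (C rho x : R) :
  0 < rho -> geom_bound a C rho -> geom_bound b C rho ->
  geom_bound p C rho -> geom_bound q C rho -> Rabs x < rho ->
  PSeries a x ^ 2 + PSeries b x ^ 2 =
  (a 0%nat ^ 2 + b 0%nat ^ 2) * exp (2 * PSeries (PS_Int p) x).
Proof.
intros Hrho Ba Bb Bp Bq Hx.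
set (g := fun x => (PSeries a x ^ 2 + PSeries b x ^ 2) * exp (- 2 * PSeries (PS_Int p) x)).
assert (Hg : forall y, Rabs y < rho -> is_derive g y 0).
{ intros y Hy.
  pose proof (geom_bound_radius a C rho y Hrho Ba Hy) as Ra.
  pose proof (geom_bound_radius b C rho y Hrho Bb Hy) as Rb.
  pose proof (geom_bound_radius p C rho y Hrho Bp Hy) as Rp.
  pose proof (geom_bound_radius q C rho y Hrho Bq Hy) as Rq.
  assert (Da := is_derive_PSeries a y Ra).
  assert (Db := is_derive_PSeries b y Rb).
  assert (Rip : Rbar_lt (Rabs y) (CV_radius (PS_Int p))) by (rewrite CV_radius_Int; exact Rp).
  assert (Dp := is_derive_PSeries (PS_Int p) y Rip).
  rewrite (PSeries_ext (PS_derive a) (PS_plus (PS_mult p a) (PS_opp (PS_mult q b)))) in Da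
    by (intros n; rewrite Ha; unfold PS_plus, PS_opp, plus, opp; simpl; ring).
  rewrite PSeries_plus, PSeries_opp in Da by
    (try apply (ex_pseries_opp (PS_mult q b)); apply ex_pseries_mult; assumption).
  rewrite !PSeries_mult in Da by assumption.
  rewrite (PSeries_ext (PS_derive b) (PS_plus (PS_mult p b) (PS_mult q a))) in Db
    by (intros n; rewrite Hb; unfold PS_plus, plus; simpl; ring).
  rewrite PSeries_plus in Db by (apply ex_pseries_mult; assumption).
  rewrite !PSeries_mult in Db by assumption.
  rewrite (PSeries_ext (PS_derive (PS_Int p)) p) in Dp.
  2:{ intros n. unfold PS_derive, PS_Int. field. apply not_0_INR. lia. }
  unfold g. evar_last.
  { apply (is_derive_mult (fun x => PSeries a x ^ 2 + PSeries b x ^ 2)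
             (fun x => exp (-2 * PSeries (PS_Int p) x))).
    - apply (is_derive_plus (fun x => PSeries a x ^ 2) (fun x => PSeries b x ^ 2)).
      + apply is_derive_pow. exact Da.
      + apply is_derive_pow. exact Db.
    - apply (is_derive_comp exp (fun x => -2 * PSeries (PS_Int p) x)).
      + apply is_derive_exp.
      + apply is_derive_scal. exact Dp.
    - intros; apply Rmult_comm. }
  unfold plus, mult, scal; simpl. unfold mult; simpl. ring. }
assert (H0 : g 0 = a 0%nat ^ 2 + b 0%nat ^ 2).
{ unfold g. rewrite !PSeries_0. simpl. rewrite Rmult_0_r, exp_0. ring. }
assert (Hc : g x = g 0).
{ apply Rabs_def2 in Hx. destruct Hx as [Hx1 Hx2].
  destruct (Rtotal_order x 0) as [L|[E|G]].
  - apply (eq_is_derive g x 0); [|exact L]. intros t Ht. apply Hg. apply Rabs_def1; lra.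
  - rewrite E; reflexivity.
  - symmetry. apply (eq_is_derive g 0 x); [|exact G]. intros t Ht. apply Hg. apply Rabs_def1; lra. }
rewrite H0 in Hc. rewrite <- Hc. unfold g.
rewrite Rmult_assoc, <- exp_plus.
replace (-2 * PSeries (PS_Int p) x + 2 * PSeries (PS_Int p) x) with 0 by ring.
rewrite exp_0; ring.
Qed.

(* Coefficients of the power series and of its log-derivative seen along the ray of angle [th]. *)
Definition rot (a b : nat -> R) (th : R) (m : nat) : R :=
  a m * cos (INR m * th) - b m * sin (INR m * th).
Definition rot1 (p q : nat -> R) (th : R) (m : nat) : R :=
  p m * cos (INR (S m) * th) - q m * sin (INR (S m) * th).

End Ray.

Lemma rot_bound (a b : nat -> R) (C rho th : R) :
  0 < rho -> geom_bound a C rho -> geom_bound b C rho -> geom_bound (rot a b th) (2 * C) rho.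
Proof.
intros Hr Ha Hb m. unfold rot.
specialize (Ha m). specialize (Hb m).
assert (Rabs (a m * cos (INR m * th)) <= Rabs (a m)).
{ rewrite Rabs_mult. rewrite <- (Rmult_1_r (Rabs (a m))) at 2.
  apply Rmult_le_compat_l; [apply Rabs_pos|]. apply Rabs_le. apply COS_bound. }
assert (Rabs (b m * sin (INR m * th)) <= Rabs (b m)).
{ rewrite Rabs_mult. rewrite <- (Rmult_1_r (Rabs (b m))) at 2.
  apply Rmult_le_compat_l; [apply Rabs_pos|]. apply Rabs_le. apply SIN_bound. }
unfold Rminus. eapply Rle_trans; [apply Rabs_triang|]. rewrite Rabs_Ropp.
unfold Rdiv in *. nra.
Qed.

Lemma rot1_bound (p q : nat -> R) (C rho th : R) :
  0 < rho -> geom_bound p C rho -> geom_bound q C rho -> geom_bound (rot1 p q th) (2 * C) rho.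
Proof.
intros Hr Ha Hb m. unfold rot1. set (y := INR (S m) * th).
specialize (Ha m). specialize (Hb m).
assert (Rabs (p m * cos y) <= Rabs (p m)).
{ rewrite Rabs_mult. rewrite <- (Rmult_1_r (Rabs (p m))) at 2.
  apply Rmult_le_compat_l; [apply Rabs_pos|]. apply Rabs_le. apply COS_bound. }
assert (Rabs (q m * sin y) <= Rabs (q m)).
{ rewrite Rabs_mult. rewrite <- (Rmult_1_r (Rabs (q m))) at 2.
  apply Rmult_le_compat_l; [apply Rabs_pos|]. apply Rabs_le. apply SIN_bound. }
unfold Rminus. eapply Rle_trans; [apply Rabs_triang|]. rewrite Rabs_Ropp.
unfold Rdiv in *. nra.
Qed.

Lemma geom_bound_opp (a : nat -> R) (C rho : R) :
  geom_bound a C rho -> geom_bound (fun m => - a m) C rho.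
Proof. intros H m. rewrite Rabs_Ropp. apply H. Qed.

(* [rot b (-a)] is the imaginary part along the ray, as [Im ((a+ib)e^{iy}) = b cos y + a sin y]. *)
Lemma log_derivative_rotated (a b p q : nat -> R) (th : R) :
  (forall m, PS_derive a m = PS_mult p a m - PS_mult q b m) ->
  (forall m, PS_derive b m = PS_mult p b m + PS_mult q a m) ->
  let a' := rot a b th in let b' := rot b (fun m => - a m) th in
  let p' := rot1 p q th in let q' := rot1 q (fun m => - p m) th in
  (forall m, PS_derive a' m = PS_mult p' a' m - PS_mult q' b' m) /\
  (forall m, PS_derive b' m = PS_mult p' b' m + PS_mult q' a' m).
Proof.
intros Ha Hb a' b' p' q'.
assert (Hcs : forall m k, (k <= m)%nat ->
  cos (INR (S m) * th) = cos (INR (S k) * th) * cos (INR (m - k) * th)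
      - sin (INR (S k) * th) * sin (INR (m - k) * th) /\
  sin (INR (S m) * th) = sin (INR (S k) * th) * cos (INR (m - k) * th)
      + cos (INR (S k) * th) * sin (INR (m - k) * th)).
{ intros m k Hk. rewrite <- cos_plus, <- sin_plus.
  replace (INR (S k) * th + INR (m - k) * th) with (INR (S m) * th); [split; reflexivity|].
  rewrite <- Rmult_plus_distr_r, <- plus_INR. repeat f_equal. lia. }
split; intros m; unfold PS_mult;
  [rewrite <- minus_sum | rewrite <- plus_sum].
- transitivity (PS_derive a m * cos (INR (S m) * th) - PS_derive b m * sin (INR (S m) * th)).
  { unfold PS_derive, a', rot. ring. }
  rewrite Ha, Hb. unfold PS_mult. rewrite <- minus_sum, <- plus_sum, !(Rmult_comm (sum_f_R0 _ _)).
  rewrite !scal_sum, <- minus_sum. apply sum_eq. intros k Hk.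
  destruct (Hcs m k Hk) as [E1 E2]. rewrite E1, E2.
  unfold a', b', p', q', rot, rot1. ring.
- transitivity (PS_derive b m * cos (INR (S m) * th) + PS_derive a m * sin (INR (S m) * th)).
  { unfold PS_derive, b', rot. ring. }
  rewrite Ha, Hb. unfold PS_mult. rewrite <- minus_sum, <- plus_sum, !(Rmult_comm (sum_f_R0 _ _)).
  rewrite !scal_sum, <- plus_sum. apply sum_eq. intros k Hk.
  destruct (Hcs m k Hk) as [E1 E2]. rewrite E1, E2.
  unfold a', b', p', q', rot, rot1. ring.
Qed.

Lemma exp_term_le (y : R) (m : nat) : 0 <= y -> y ^ m / INR (fact m) <= exp y.
Proof.
intros Hy. eapply Rle_trans; [|apply (exp_ge_taylor y m Hy)].
destruct m; simpl sum_f_R0; [apply Rle_refl|].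
assert (0 <= sum_f_R0 (fun k => y ^ k / INR (fact k)) m).
{ apply cond_pos_sum. intros k. apply Rmult_le_pos; [apply pow_le; exact Hy|].
  left; apply Rinv_0_lt_compat, INR_fact_lt_0. }
simpl in *; lra.
Qed.

Lemma inv_fact_bound (f : nat -> R) (rho : R) : 0 < rho -> (forall m, Rabs (f m) <= 1) ->
  geom_bound (fun m => f m / INR (fact m)) (exp rho) rho.
Proof.
intros Hr Hf m. unfold Rdiv. rewrite Rabs_mult.
rewrite (Rabs_pos_eq (/ _)) by pos.
pose proof (exp_term_le rho m (Rlt_le _ _ Hr)) as H.
assert (Hp : 0 < rho ^ m) by pos.
apply Rmult_le_reg_r with (rho ^ m); [exact Hp|].
replace (exp rho * / rho ^ m * rho ^ m) with (exp rho) by (field; lra).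
eapply Rle_trans; [|exact H]. unfold Rdiv.
assert (0 < / INR (fact m)) by pos.
specialize (Hf m). apply Rle_trans with (1 * / INR (fact m) * rho ^ m); [|lra].
apply Rmult_le_compat_r; [lra|]. apply Rmult_le_compat_r; lra.
Qed.

Lemma Rabs_cos_le (x : R) : Rabs (cos x) <= 1.
Proof. apply Rabs_le, COS_bound. Qed.

Lemma Rabs_sin_le (x : R) : Rabs (sin x) <= 1.
Proof. apply Rabs_le, SIN_bound. Qed.

Definition exp_cos (th : R) (m : nat) := cos (INR m * th) / INR (fact m).
Definition exp_sin (th : R) (m : nat) := sin (INR m * th) / INR (fact m).

(* [exp (x e^{i th})] as a power series in [x], by uniqueness for [y' = e^{i th} y]. *)
Lemma exp_polar_PSeries (th x : R) :
  PSeries (exp_cos th) x = exp (x * cos th) * cos (x * sin th) /\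
  PSeries (exp_sin th) x = exp (x * cos th) * sin (x * sin th).
Proof.
assert (Rc : forall y, Rbar_lt (Rabs y) (CV_radius (exp_cos th))).
{ intros y. apply (geom_bound_radius _ (exp (Rabs y + 1)) (Rabs y + 1)).
  - pose proof (Rabs_pos y); lra.
  - apply inv_fact_bound; [pose proof (Rabs_pos y); lra|intros; apply Rabs_cos_le].
  - lra. }
assert (Rs : forall y, Rbar_lt (Rabs y) (CV_radius (exp_sin th))).
{ intros y. apply (geom_bound_radius _ (exp (Rabs y + 1)) (Rabs y + 1)).
  - pose proof (Rabs_pos y); lra.
  - apply inv_fact_bound; [pose proof (Rabs_pos y); lra|intros; apply Rabs_sin_le].
  - lra. }
set (A := PSeries (exp_cos th)). set (B := PSeries (exp_sin th)).
assert (HS : forall n, INR (S n) / INR (fact (S n)) = / INR (fact n)).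
{ intros n. rewrite fact_simpl, mult_INR. field. split; [apply INR_fact_neq_0|apply not_0_INR; lia]. }
assert (DA : forall y, is_derive A y (cos th * A y - sin th * B y)).
{ intros y. evar_last; [apply is_derive_PSeries, Rc|].
  rewrite (PSeries_ext _ (PS_plus (PS_scal (cos th) (exp_cos th)) (PS_opp (PS_scal (sin th) (exp_sin th))))).
  - rewrite PSeries_plus, PSeries_opp, !PSeries_scal; [reflexivity| |].
    + apply (ex_pseries_scal (cos th) (exp_cos th) y); [apply Rmult_comm|apply CV_radius_inside, Rc].
    + apply (ex_pseries_opp (PS_scal (sin th) (exp_sin th))), (ex_pseries_scal (sin th) (exp_sin th) y); [apply Rmult_comm|apply CV_radius_inside, Rs].
  - intros n. unfold PS_plus, PS_opp, PS_scal, PS_derive, exp_cos, exp_sin, plus, opp, scal; simpl; unfold mult; simpl.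
    replace (match n with O => 1 | S _ => INR n + 1 end) with (INR (S n)) by reflexivity.
    replace (fact n + n * fact n)%nat with (fact (S n)) by reflexivity.
    transitivity (cos (INR (S n) * th) * (INR (S n) / INR (fact (S n)))); [unfold Rdiv; ring|].
    rewrite HS, S_INR, Rmult_plus_distr_r, Rmult_1_l, cos_plus. unfold Rdiv; ring. }
assert (DB : forall y, is_derive B y (sin th * A y + cos th * B y)).
{ intros y. evar_last; [apply is_derive_PSeries, Rs|].
  rewrite (PSeries_ext _ (PS_plus (PS_scal (sin th) (exp_cos th)) (PS_scal (cos th) (exp_sin th)))).
  - rewrite PSeries_plus, !PSeries_scal; [reflexivity| |].
    + apply (ex_pseries_scal (sin th) (exp_cos th) y); [apply Rmult_comm|apply CV_radius_inside, Rc].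
    + apply (ex_pseries_scal (cos th) (exp_sin th) y); [apply Rmult_comm|apply CV_radius_inside, Rs].
  - intros n. unfold PS_plus, PS_scal, PS_derive, exp_cos, exp_sin, plus, opp, scal; simpl; unfold mult; simpl.
    replace (match n with O => 1 | S _ => INR n + 1 end) with (INR (S n)) by reflexivity.
    replace (fact n + n * fact n)%nat with (fact (S n)) by reflexivity.
    transitivity (sin (INR (S n) * th) * (INR (S n) / INR (fact (S n)))); [unfold Rdiv; ring|].
    rewrite HS, S_INR, Rmult_plus_distr_r, Rmult_1_l, sin_plus. unfold Rdiv; ring. }
set (E := fun y => exp (- (y * cos th))).
(* [g1 + i g2] is [exp (- y e^(i th))] times [A + i B], hence constant. *)
set (g1 := fun y => E y * (A y * cos (y * sin th) + B y * sin (y * sin th))).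
set (g2 := fun y => E y * (B y * cos (y * sin th) - A y * sin (y * sin th))).
assert (G1 : forall y, is_derive g1 y 0).
{ intros y. unfold g1, E. auto_derive.
  - repeat split; eexists; [apply DA|apply DB].
  - change (Derive (fun x => A x) y) with (Derive A y); change (Derive (fun x => B x) y) with (Derive B y).
    rewrite (is_derive_unique _ _ _ (DA y)), (is_derive_unique _ _ _ (DB y)). ring. }
assert (G2 : forall y, is_derive g2 y 0).
{ intros y. unfold g2, E. auto_derive.
  - repeat split; eexists; [apply DB|apply DA].
  - change (Derive (fun x => A x) y) with (Derive A y); change (Derive (fun x => B x) y) with (Derive B y).
    rewrite (is_derive_unique _ _ _ (DA y)), (is_derive_unique _ _ _ (DB y)). ring. }
assert (Hc : forall g : R -> R, (forall y, is_derive g y 0) -> g x = g 0).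
{ intros g Hg. destruct (Rtotal_order x 0) as [L|[Eq|G]].
  - apply (eq_is_derive g x 0); auto.
  - rewrite Eq; reflexivity.
  - symmetry. apply (eq_is_derive g 0 x); auto. }
apply Hc in G1. apply Hc in G2.
assert (A0 : A 0 = 1).
{ unfold A. rewrite PSeries_0. unfold exp_cos. simpl. rewrite Rmult_0_l, cos_0. field. }
assert (B0 : B 0 = 0).
{ unfold B. rewrite PSeries_0. unfold exp_sin. simpl. rewrite Rmult_0_l, sin_0. field. }
unfold g1, g2, E in G1, G2. rewrite A0, B0, ?Rmult_0_l, ?Ropp_0, ?exp_0, ?cos_0, ?sin_0 in G1, G2.
try rewrite cos_0 in G1. try rewrite sin_0 in G2. try rewrite cos_0 in G2. fold A; fold B.
set (c := cos (x * sin th)) in *. set (s := sin (x * sin th)) in *.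
assert (Hcs : s * s + c * c = 1) by (pose proof (sin2_cos2 (x * sin th)); unfold Rsqr in *; exact H).
assert (He : exp (x * cos th) * exp (- (x * cos th)) = 1) by (rewrite <- exp_plus, Rplus_opp_r; apply exp_0).
set (e := exp (- (x * cos th))) in *. set (f := exp (x * cos th)) in *.
assert (X1 : A x * c + B x * s = f).
{ transitivity (f * e * (A x * c + B x * s)); [rewrite He; ring|]. rewrite Rmult_assoc, G1. ring. }
assert (X2 : B x * c - A x * s = 0).
{ transitivity (f * e * (B x * c - A x * s)); [rewrite He; ring|]. rewrite Rmult_assoc, G2. ring. }
split.
- transitivity (A x * (s * s + c * c)); [rewrite Hcs; ring|].
  transitivity ((A x * c + B x * s) * c - (B x * c - A x * s) * s); [ring|]. rewrite X1, X2; ring.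
- transitivity (B x * (s * s + c * c)); [rewrite Hcs; ring|].
  transitivity ((A x * c + B x * s) * s + (B x * c - A x * s) * c); [ring|]. rewrite X1, X2; ring.
Qed.

Lemma PSeries_geom_tail (a : nat -> R) (C rho x : R) (M : nat) :
  0 < rho -> 0 <= C -> geom_bound a C rho -> Rabs x < rho ->
  Rabs (PSeries a x - sum_f_R0 (fun m => a m * x ^ m) M)
    <= C * (Rabs x / rho) ^ (S M) / (1 - Rabs x / rho).
Proof.
intros Hr HC Ha Hx. set (t := Rabs x / rho).
assert (Ht : 0 <= t < 1).
{ unfold t. split; [apply Rmult_le_pos; [apply Rabs_pos|pos]|].
  apply Rlt_div_l; lra. }
assert (Ex : ex_series (fun m => Rabs (a m * x ^ m))) by
  (apply CV_disk_inside, (geom_bound_radius a C rho); assumption).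
unfold PSeries. rewrite (Series_incr_n _ (S M)); [|lia|apply ex_series_Rabs; exact Ex].
simpl pred.
match goal with |- Rabs (?A + ?B - ?A') <= _ => replace (A + B - A') with B by ring end.
assert (Hg : ex_series (fun k => C * t ^ (S M) * t ^ k)).
{ apply (ex_series_scal (C * t ^ S M) (fun k => t ^ k)), ex_series_geom. rewrite Rabs_pos_eq; lra. }
assert (Hk : forall k, Rabs (a (S M + k)%nat * x ^ (S M + k)) <= C * t ^ (S M) * t ^ k).
{ intros k. rewrite Rmult_assoc, <- pow_add. apply geom_bound_pow; assumption. }
eapply Rle_trans; [apply Series_Rabs|].
{ apply (@ex_series_le R_AbsRing R_CompleteNormedModule _ (fun k => C * t ^ (S M) * t ^ k)); [|exact Hg].
  intros k. unfold norm; simpl. unfold abs; simpl. rewrite Rabs_Rabsolu. apply (Hk k). }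
eapply Rle_trans; [apply Series_le; [intros k; split; [apply Rabs_pos|apply (Hk k)]|exact Hg]|].
rewrite Series_scal_l, Series_geom by (rewrite Rabs_pos_eq; lra). unfold Rdiv. lra.
Qed.

Lemma sum_geom_bound (a : nat -> R) (C rho x : R) (M : nat) :
  0 < rho -> 0 <= C -> geom_bound a C rho -> Rabs x < rho ->
  Rabs (sum_f_R0 (fun m => a m * x ^ m) M) <= C / (1 - Rabs x / rho).
Proof.
intros Hr HC Ha Hx. set (t := Rabs x / rho).
assert (Ht : 0 <= t < 1).
{ unfold t. split; [apply Rmult_le_pos; [apply Rabs_pos|pos]|].
  apply Rlt_div_l; lra. }
eapply Rle_trans; [apply Rsum_abs|].
eapply Rle_trans; [apply sum_Rle; intros n _; apply (geom_bound_pow a C rho x n Hr Ha)|].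
fold t.
apply Rle_trans with (C * sum_f_R0 (fun n => t ^ n) M).
{ rewrite scal_sum. right. apply sum_eq. intros; ring. }
unfold Rdiv. apply Rmult_le_compat_l; [exact HC|].
rewrite tech3 by lra. unfold Rdiv.
assert (0 < / (1 - t)) by pos.
assert (0 <= t ^ S M) by pos. nra.
Qed.

Lemma is_lim_seq_geom_tail (C t : R) : 0 <= t < 1 ->
  is_lim_seq (fun M => C * t ^ (S M) / (1 - t)) 0.
Proof.
intros Ht.
apply is_lim_seq_ext with (fun M => (C * / (1 - t)) * t ^ (S M)); [intros; unfold Rdiv; ring|].
replace (Finite 0) with (Rbar_mult (Finite (C * / (1 - t))) (Finite 0)) by (simpl; f_equal; ring).
apply is_lim_seq_scal_l. apply -> (is_lim_seq_incr_1 (fun n => t ^ n)). apply is_lim_seq_geom. rewrite Rabs_pos_eq; lra.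
Qed.

Lemma ratio_lt_1 (x rho : R) : 0 < rho -> Rabs x < rho -> 0 <= Rabs x / rho < 1.
Proof.
intros Hr Hx. split; [apply Rmult_le_pos; [apply Rabs_pos|pos]|].
apply Rlt_div_l; lra.
Qed.

Lemma PSeries_geom_bound (a : nat -> R) (C rho x : R) :
  0 < rho -> 0 <= C -> geom_bound a C rho -> Rabs x < rho ->
  Rabs (PSeries a x) <= C / (1 - Rabs x / rho).
Proof.
intros Hr HC Ha Hx.
pose proof (ratio_lt_1 x rho Hr Hx) as Ht.
apply Rnot_lt_le. intros Hlt.
pose proof (is_lim_seq_geom_tail C (Rabs x / rho) Ht) as HL.
apply is_lim_seq_spec in HL.
assert (He : 0 < Rabs (PSeries a x) - C / (1 - Rabs x / rho)) by lra.
destruct (HL (mkposreal _ He)) as [M HM]. specialize (HM M (Nat.le_refl M)). simpl in HM.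
pose proof (PSeries_geom_tail a C rho x M Hr HC Ha Hx) as H1.
pose proof (sum_geom_bound a C rho x M Hr HC Ha Hx) as H2.
rewrite Rminus_0_r in HM. apply Rabs_def2 in HM. simpl pow in H1.
pose proof (Rabs_triang_inv (PSeries a x) (sum_f_R0 (fun m => a m * x ^ m) M)). lra.
Qed.

(** Tannery's theorem: the common geometric bound makes all tails beyond one [M] small at once, and
    the finite sums converge term by term. It carries identities for Dirichlet polynomials over to
    their limits. *)
Lemma PSeries_dominated (a : nat -> nat -> R) (l : nat -> R) (C rho x : R) :
  0 < rho -> 0 <= C -> (forall N, geom_bound (a N) C rho) ->
  (forall m, is_lim_seq (fun N => a N m) (l m)) -> Rabs x < rho ->
  geom_bound l C rho /\ is_lim_seq (fun N => PSeries (a N) x) (PSeries l x).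
Proof.
intros Hr HC Ha Hl Hx.
assert (Bl : geom_bound l C rho).
{ intros m. apply (is_lim_seq_le (fun N => Rabs (a N m)) (fun _ => C / rho ^ m) (Rabs (l m)) (C / rho ^ m)).
  - intros N. apply Ha.
  - apply (is_lim_seq_abs _ (l m)), Hl.
  - apply is_lim_seq_const. }
split; [exact Bl|].
pose proof (ratio_lt_1 x rho Hr Hx) as Ht.
pose proof (is_lim_seq_geom_tail C (Rabs x / rho) Ht) as HL.
apply is_lim_seq_spec in HL. apply is_lim_seq_spec. intros eps.
assert (He : 0 < eps / 3) by (destruct eps; simpl; lra).
destruct (HL (mkposreal _ He)) as [M HM]. specialize (HM M (Nat.le_refl M)). simpl in HM.
rewrite Rminus_0_r in HM. apply Rabs_def2 in HM.
assert (HS : is_lim_seq (fun N => sum_f_R0 (fun m => a N m * x ^ m) M) (sum_f_R0 (fun m => l m * x ^ m) M)).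
{ clear HM. induction M; simpl.
  - apply (is_lim_seq_scal_r (fun N => a N 0%nat) 1 (l 0%nat)), Hl.
  - apply (is_lim_seq_plus' _ _ _ _ IHM).
    apply (is_lim_seq_scal_r (fun N => a N (S M)) (x * x ^ M) (l (S M))), Hl. }
apply is_lim_seq_spec in HS. destruct (HS (mkposreal _ He)) as [N0 HN].
exists N0. intros N HN'. specialize (HN N HN'). simpl in HN.
pose proof (PSeries_geom_tail (a N) C rho x M Hr HC (Ha N) Hx) as H1.
pose proof (PSeries_geom_tail l C rho x M Hr HC Bl Hx) as H2.
simpl pow in H1, H2.
replace (PSeries (a N) x - PSeries l x) with
 ((PSeries (a N) x - sum_f_R0 (fun m => a N m * x ^ m) M) +
  (sum_f_R0 (fun m => a N m * x ^ m) M - sum_f_R0 (fun m => l m * x ^ m) M) -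
  (PSeries l x - sum_f_R0 (fun m => l m * x ^ m) M)) by ring.
unfold Rminus at 1. eapply Rle_lt_trans; [apply Rabs_triang|].
rewrite Rabs_Ropp. eapply Rle_lt_trans; [apply Rplus_le_compat_r, Rabs_triang|].
lra.
Qed.

(** * Fourier coefficients of harmonic functions on circles *)

Lemma locally_lt (x y : R) : x < y -> locally x (fun z => z < y).
Proof.
intros H. assert (Hp : 0 < y - x) by lra. exists (mkposreal _ Hp).
intros z Hz. unfold ball in Hz; simpl in Hz; unfold AbsRing_ball, abs, minus, plus, opp in Hz; simpl in Hz.
apply Rabs_def2 in Hz. lra.
Qed.

Lemma continuity_2d_snd (f : R -> R -> R) (x y : R) :
  continuity_2d_pt f x y -> continuous (fun t => f x t) y.
Proof.
intros H. apply filterlim_locally. intros eps. destruct (H eps) as [d Hd].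
exists d. intros t Ht. apply Hd; [|exact Ht].
rewrite Rminus_diag, Rabs_R0. apply cond_pos.
Qed.

Lemma ex_RInt_cont (f : R -> R) (a b : R) : (forall x, continuous f x) -> ex_RInt f a b.
Proof. intros H. apply (ex_RInt_continuous (V := R_CompleteNormedModule)). intros; apply H. Qed.

(** The variable [r] will be a log radius, so a disk around the origin is a half-line [r < r0]. *)
Lemma is_derive_RInt_below (f f' : R -> R -> R) (r0 a b r : R) :
  (forall x t, x < r0 -> is_derive (fun z => f z t) x (f' x t)) ->
  (forall x t, x < r0 -> continuous (fun t => f x t) t) ->
  (forall x t, x < r0 -> continuity_2d_pt f' x t) ->
  r < r0 ->
  is_derive (fun x => RInt (fun t => f x t) a b) r (RInt (fun t => f' r t) a b).
Proof.
intros Hd Hc H2 Hr.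
assert (E : RInt (fun t => f' r t) a b = RInt (fun t => Derive (fun u => f u t) r) a b).
{ apply RInt_ext. intros t _. symmetry. apply is_derive_unique, Hd, Hr. }
rewrite E. apply is_derive_RInt_param.
- apply (filter_imp (fun z => z < r0)); [|apply locally_lt, Hr].
  intros z Hz t _. eexists; apply Hd, Hz.
- intros t _. apply (continuity_2d_pt_ext_loc f'); [|apply H2, Hr].
  assert (Hp : 0 < r0 - r) by lra. exists (mkposreal _ Hp). intros u v Hu _. simpl in Hu.
  symmetry. apply is_derive_unique, Hd. apply Rabs_def2 in Hu; lra.
- apply (filter_imp (fun z => z < r0)); [|apply locally_lt, Hr].
  intros z Hz. apply ex_RInt_cont. intros t. apply Hc, Hz.
Qed.

Lemma continuous_is_derive (f : R -> R) (x l : R) : is_derive f x l -> continuous f x.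
Proof. intros H. apply (ex_derive_continuous (K := R_AbsRing) (V := R_NormedModule)). exists l. exact H. Qed.

Lemma continuous_cos_lin (w ph x : R) : continuous (fun t => cos (w * t + ph)) x.
Proof. eapply continuous_is_derive. auto_derive; [exact I|reflexivity]. Qed.

Lemma continuous_mul_cos (f : R -> R) (k : nat) (ph t : R) : continuous f t -> continuous (fun t => f t * cos (INR k * t + ph)) t.
Proof. intros H. apply (continuous_mult (K := R_AbsRing) f); [exact H|apply continuous_cos_lin]. Qed.

Lemma continuity_2d_cos_lin (w ph x y : R) : continuity_2d_pt (fun _ t => cos (w * t + ph)) x y.
Proof.
apply (continuity_1d_2d_pt_comp cos (fun _ t => w * t + ph)).
- apply continuity_cos.
- apply continuity_2d_pt_plus; [apply continuity_2d_pt_mult|]; try apply continuity_2d_pt_const.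
  apply continuity_2d_pt_id2.
Qed.

(* [u] is harmonic in the coordinates (log radius, angle): [u_r = d], [u_th = - v], [d_r = v_th = h]. *)
Section Harmonic.
Variables (u d v h : R -> R -> R) (r0 : R).
Hypothesis Hur : forall r t, r < r0 -> is_derive (fun x => u x t) r (d r t).
Hypothesis Hdr : forall r t, r < r0 -> is_derive (fun x => d x t) r (h r t).
Hypothesis Hut : forall r t, r < r0 -> is_derive (fun x => u r x) t (- v r t).
Hypothesis Hvt : forall r t, r < r0 -> is_derive (fun x => v r x) t (h r t).
Hypothesis Cd : forall r t, r < r0 -> continuity_2d_pt d r t.
Hypothesis Ch : forall r t, r < r0 -> continuity_2d_pt h r t.
Hypothesis Pu : forall r, u r (2 * PI) = u r 0.
Hypothesis Pv : forall r, v r (2 * PI) = v r 0.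

Definition fourier (k : nat) (ph r : R) : R :=
  RInt (fun t => u r t * cos (INR k * t + ph)) 0 (2 * PI).

Lemma cos_period_nat (k : nat) (ph : R) : cos (INR k * (2 * PI) + ph) = cos ph.
Proof.
replace (INR k * (2 * PI) + ph) with (ph + 2 * INR k * PI) by ring. apply cos_period.
Qed.

Lemma sin_period_nat (k : nat) (ph : R) : sin (INR k * (2 * PI) + ph) = sin ph.
Proof.
replace (INR k * (2 * PI) + ph) with (ph + 2 * INR k * PI) by ring. apply sin_period.
Qed.

Lemma fourier_derive (k : nat) (ph r : R) : r < r0 ->
  is_derive (fourier k ph) r (RInt (fun t => d r t * cos (INR k * t + ph)) 0 (2 * PI)).
Proof.
intros Hr. unfold fourier.
apply (is_derive_RInt_below (fun r t => u r t * cos (INR k * t + ph))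
   (fun r t => d r t * cos (INR k * t + ph)) r0); [| | |exact Hr].
- intros x t Hx. evar_last.
  { apply (is_derive_scal_l (fun z => u z t) x (d x t) (cos (INR k * t + ph))). apply Hur, Hx. }
  reflexivity.
- intros x t Hx. apply (continuous_mult (K := R_AbsRing) (fun t => u x t) (fun t => cos (INR k * t + ph))).
  + eapply continuous_is_derive. apply Hut, Hx.
  + apply continuous_cos_lin.
- intros x t Hx. apply continuity_2d_pt_mult; [apply Cd, Hx|apply continuity_2d_cos_lin].
Qed.

(** Since [h = v_t] and [u_t = - v], two integrations by parts in the angle move the derivatives
    onto the cosine; a Fourier coefficient therefore solves [U'' = k^2 U]. *)
Lemma fourier_derive2 (k : nat) (ph r : R) : r < r0 ->
  is_derive (fun r => RInt (fun t => d r t * cos (INR k * t + ph)) 0 (2 * PI)) r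
    (INR k ^ 2 * fourier k ph r).
Proof.
intros Hr.
assert (Cu : forall t, continuous (fun t => u r t) t)
  by (intros t; eapply continuous_is_derive; apply Hut, Hr).
assert (Chr : forall t, continuous (fun t => h r t) t)
  by (intros t; apply continuity_2d_snd, Ch, Hr).
assert (E : RInt (fun t => h r t * cos (INR k * t + ph)) 0 (2 * PI) = INR k ^ 2 * fourier k ph r).
(* [w] collects the boundary terms of both integrations by parts; they cancel over a period. *)
{ set (w := fun t => v r t * cos (INR k * t + ph) - INR k * (u r t * sin (INR k * t + ph))).
  assert (HI : is_RInt (fun t => h r t * cos (INR k * t + ph) - INR k ^ 2 * (u r t * cos (INR k * t + ph)))
             0 (2 * PI) (minus (w (2 * PI)) (w 0))).
  { apply (is_RInt_derive w).
    - intros t _. unfold w.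
      assert (Dv := Hvt r t Hr). assert (Du := Hut r t Hr).
      auto_derive.
      + repeat split; [exists (h r t); exact Dv|exists (- v r t); exact Du].
      + change (Derive (fun x => v r x) t) with (Derive (v r) t).
        change (Derive (fun x => u r x) t) with (Derive (u r) t).
        rewrite (is_derive_unique (v r) t _ Dv), (is_derive_unique (u r) t _ Du). ring.
    - intros t _. apply (continuous_minus (V := R_NormedModule)).
      + apply continuous_mul_cos; apply Chr.
      + apply (continuous_mult (K := R_AbsRing) (fun t => INR k ^ 2)); [apply continuous_const|].
        apply continuous_mul_cos; apply Cu. }
  apply (is_RInt_unique (V := R_CompleteNormedModule)) in HI.
  rewrite (RInt_minus (V := R_CompleteNormedModule) (fun t => h r t * cos (INR k * t + ph))
     (fun t => INR k ^ 2 * (u r t * cos (INR k * t + ph)))) in HI.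
  - rewrite (RInt_scal (V := R_CompleteNormedModule) (fun t => u r t * cos (INR k * t + ph))) in HI.
    + unfold fourier. unfold w in HI. rewrite Pu, Pv, cos_period_nat, sin_period_nat, Rmult_0_r, Rplus_0_l in HI.
      unfold minus, plus, opp, scal in HI; simpl in HI; unfold mult in HI; simpl in HI.
      simpl. lra.
    + apply ex_RInt_cont. intros t. apply continuous_mul_cos; apply Cu.
  - apply ex_RInt_cont. intros t. apply continuous_mul_cos; apply Chr.
  - apply ex_RInt_cont. intros t. apply (continuous_mult (K := R_AbsRing) (fun t => INR k ^ 2)); [apply continuous_const|].
    apply continuous_mul_cos; apply Cu. }
rewrite <- E.
apply (is_derive_RInt_below (fun r t => d r t * cos (INR k * t + ph))
   (fun r t => h r t * cos (INR k * t + ph)) r0); [| | |exact Hr].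
- intros x t Hx. apply (is_derive_scal_l (fun z => d z t) x (h x t) (cos (INR k * t + ph))). apply Hdr, Hx.
- intros x t Hx. apply (continuous_mult (K := R_AbsRing) (fun t => d x t) (fun t => cos (INR k * t + ph))).
  + apply continuity_2d_snd, Cd, Hx.
  + apply continuous_cos_lin.
- intros x t Hx. apply continuity_2d_pt_mult; [apply Ch, Hx|apply continuity_2d_cos_lin].
Qed.

End Harmonic.

Lemma derive_0_const_below (g : R -> R) (r0 x y : R) :
  (forall r, r < r0 -> is_derive g r 0) -> x < r0 -> y < r0 -> g x = g y.
Proof.
intros Hg Hx Hy. destruct (Rtotal_order x y) as [L|[E|G]].
- apply (eq_is_derive g x y); [|exact L]. intros t Ht. apply Hg; lra.
- rewrite E; reflexivity.
- symmetry. apply (eq_is_derive g y x); [|exact G]. intros t Ht. apply Hg; lra.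
Qed.

(** Solutions of [U'' = k^2 U] combine [e^(kr)] and [e^(-kr)], or [1] and [r] when [k = 0];
    boundedness as [r -> -oo], that is at the centre of the disk, excludes the second solution. *)
Lemma bounded_exponential_ode (U A : R -> R) (k : nat) (r0 r1 B : R) :
  (forall r, r < r0 -> is_derive U r (A r)) ->
  (forall r, r < r0 -> is_derive A r (INR k ^ 2 * U r)) ->
  (forall r, r < r1 -> Rabs (U r) <= B) ->
  forall x y, x < r0 -> y < r0 -> U x * exp (- INR k * x) = U y * exp (- INR k * y).
Proof.
intros HU HA HB x y Hx Hy. set (K := INR k) in *.
assert (HK : k = 0%nat \/ 1 <= K).
{ destruct k; [left; reflexivity|right]. unfold K. rewrite S_INR. pose proof (pos_INR k); lra. }
destruct HK as [HK|HK].
- assert (K0 : K = 0) by (unfold K; rewrite HK; reflexivity). rewrite K0 in *. clear K0.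
  assert (Ac : forall r, r < r0 -> A r = A x).
  { intros r Hr. apply (derive_0_const_below A r0); [|exact Hr|exact Hx].
    intros z Hz. evar_last; [apply HA, Hz|]. simpl; ring. }
  assert (Uc : forall r, r < r0 -> U r - A x * r = U x - A x * x).
  { intros r Hr. apply (derive_0_const_below (fun r => U r - A x * r) r0); [|exact Hr|exact Hx].
    intros z Hz. evar_last.
    - apply (is_derive_minus (V := R_NormedModule) U (fun r => A x * r)); [apply HU, Hz|].
      apply (is_derive_scal (fun r => r)). apply (is_derive_id (K := R_AbsRing)).
    - rewrite (Ac z Hz). unfold minus, plus, opp, one; simpl. ring. }
  assert (A0 : A x = 0).
  { apply NNPP. intros NA.
    set (c := U x - A x * x) in *.
    (* So far to the left that a nonzero slope [A x] would push [U z] beyond the bound [B]. *)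
    set (z := - ((B + Rabs c + 1) / Rabs (A x) + Rabs r0 + Rabs r1 + 1)).
    assert (HAx : 0 < Rabs (A x)) by (apply Rabs_pos_lt, NA).
    assert (B0 : 0 <= B).
    { eapply Rle_trans; [apply Rabs_pos|apply (HB (r1 - 1)); lra]. }
    assert (Hq : 0 <= (B + Rabs c + 1) / Rabs (A x)).
    { apply Rmult_le_pos; [pose proof (Rabs_pos c); lra|pos]. }
    assert (Hz0 : z < r0).
    { unfold z. pose proof (Rabs_pos r1). pose proof (Rle_abs (- r0)). rewrite Rabs_Ropp in *. lra. }
    assert (Hz1 : z < r1).
    { unfold z. pose proof (Rabs_pos r0). pose proof (Rle_abs (- r1)). rewrite Rabs_Ropp in *. lra. }
    specialize (Uc z Hz0). specialize (HB z Hz1).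
    assert (Hb : Rabs (A x * z) <= B + Rabs c).
    { replace (A x * z) with (U z - c) by lra. unfold Rminus.
      eapply Rle_trans; [apply Rabs_triang|]. rewrite Rabs_Ropp. lra. }
    rewrite Rabs_mult in Hb.
    assert (Hz : (B + Rabs c + 1) / Rabs (A x) <= Rabs z).
    { unfold z. rewrite Rabs_Ropp. eapply Rle_trans; [|apply Rle_abs]. pose proof (Rabs_pos r0); pose proof (Rabs_pos r1); lra. }
    assert (Rabs (A x) * ((B + Rabs c + 1) / Rabs (A x)) <= Rabs (A x) * Rabs z) by
      (apply Rmult_le_compat_l; lra).
    replace (Rabs (A x) * ((B + Rabs c + 1) / Rabs (A x))) with (B + Rabs c + 1) in H by (field; lra).
    lra. }
  specialize (Uc y Hy). rewrite A0 in Uc.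
  replace (- 0 * x) with 0 by ring. replace (- 0 * y) with 0 by ring. rewrite exp_0. lra.
(* First integrals with [2 K U = c2 e^(Kr) - c1 e^(-Kr)]; the aim is [c1 = 0]. *)
- set (c1 := fun r => (A r - K * U r) * exp (K * r)).
  set (c2 := fun r => (A r + K * U r) * exp (- K * r)).
  assert (C1 : forall r, r < r0 -> c1 r = c1 x).
  { intros r Hr. apply (derive_0_const_below c1 r0); [|exact Hr|exact Hx].
    intros z Hz. unfold c1. auto_derive.
    - repeat split; eexists; [apply HA|apply HU]; exact Hz.
    - change (Derive (fun x => A x) z) with (Derive A z); change (Derive (fun x => U x) z) with (Derive U z).
      rewrite (is_derive_unique _ _ _ (HA z Hz)), (is_derive_unique _ _ _ (HU z Hz)). ring. }
  assert (C2 : forall r, r < r0 -> c2 r = c2 x).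
  { intros r Hr. apply (derive_0_const_below c2 r0); [|exact Hr|exact Hx].
    intros z Hz. unfold c2. auto_derive.
    - repeat split; eexists; [apply HA|apply HU]; exact Hz.
    - change (Derive (fun x => A x) z) with (Derive A z); change (Derive (fun x => U x) z) with (Derive U z).
      rewrite (is_derive_unique _ _ _ (HA z Hz)), (is_derive_unique _ _ _ (HU z Hz)). ring. }
  assert (HUr : forall r, r < r0 -> 2 * K * U r = c2 x * exp (K * r) - c1 x * exp (- K * r)).
  { intros r Hr. rewrite <- (C1 r Hr), <- (C2 r Hr). unfold c1, c2.
    assert (E : exp (K * r) * exp (- K * r) = 1) by (rewrite <- exp_plus; replace (K * r + - K * r) with 0 by ring; apply exp_0).
    transitivity ((A r + K * U r) * (exp (K * r) * exp (- K * r)) - (A r - K * U r) * (exp (K * r) * exp (- K * r))); [rewrite E; ring|ring]. }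
  assert (Z1 : c1 x = 0).
  { apply NNPP. intros NA. assert (HC : 0 < Rabs (c1 x)) by (apply Rabs_pos_lt, NA).
    assert (B0 : 0 <= B) by (eapply Rle_trans; [apply Rabs_pos|apply (HB (r1 - 1)); lra]).
    set (Q := (2 * K * B + Rabs (c2 x)) / Rabs (c1 x)).
    assert (HQ : 0 <= Q).
    { apply Rmult_le_pos; [pose proof (Rabs_pos (c2 x)); nra|pos]. }
    set (z := - (Q + Rabs r0 + Rabs r1 + 1)).
    assert (Hz0 : z < r0).
    { unfold z. pose proof (Rabs_pos r1). pose proof (Rle_abs (- r0)). rewrite Rabs_Ropp in *. lra. }
    assert (Hz1 : z < r1).
    { unfold z. pose proof (Rabs_pos r0). pose proof (Rle_abs (- r1)). rewrite Rabs_Ropp in *. lra. }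
    assert (HzQ : z <= - Q - 1) by (unfold z; pose proof (Rabs_pos r0); pose proof (Rabs_pos r1); lra).
    specialize (HUr z Hz0). specialize (HB z Hz1).
    assert (E1 : 1 + Q < exp (- K * z)).
    { apply Rle_lt_trans with (1 + (- K * z)); [nra|]. apply exp_ineq1. nra. }
    assert (E2 : 0 < exp (K * z) <= 1).
    { split; [apply exp_pos|]. rewrite <- exp_0.
      destruct (Req_dec (K * z) 0) as [->|]; [lra|]. left. apply exp_increasing. nra. }
    assert (Hm : Rabs (c1 x) * exp (- K * z) <= 2 * K * B + Rabs (c2 x)).
    { assert (E3 : c1 x * exp (- K * z) = c2 x * exp (K * z) - 2 * K * U z) by lra.
      apply (f_equal Rabs) in E3. rewrite Rabs_mult, (Rabs_pos_eq (exp (- K * z))) in E3 by pos.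
      rewrite E3. unfold Rminus. eapply Rle_trans; [apply Rabs_triang|]. rewrite Rabs_Ropp, !Rabs_mult.
      rewrite (Rabs_pos_eq 2), (Rabs_pos_eq K), (Rabs_pos_eq (exp (K * z))) by lra.
      pose proof (Rabs_pos (c2 x)). nra. }
    assert (Rabs (c1 x) * (1 + Q) <= 2 * K * B + Rabs (c2 x)) by nra.
    unfold Q in H. replace (Rabs (c1 x) * (1 + (2 * K * B + Rabs (c2 x)) / Rabs (c1 x)))
      with (Rabs (c1 x) + (2 * K * B + Rabs (c2 x))) in H by (field; lra). lra. }
  assert (F : forall r, r < r0 -> U r * exp (- K * r) = c2 x / (2 * K)).
  { intros r Hr. specialize (HUr r Hr). rewrite Z1 in HUr.
    assert (E : exp (K * r) * exp (- K * r) = 1) by (rewrite <- exp_plus; replace (K * r + - K * r) with 0 by ring; apply exp_0).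
    replace (U r) with (c2 x * exp (K * r) / (2 * K)) by (apply (Rmult_eq_reg_l (2 * K)); [|lra]; rewrite HUr; field; lra).
    transitivity (c2 x / (2 * K) * (exp (K * r) * exp (- K * r))); [field; lra|rewrite E; ring]. }
  rewrite (F x Hx), (F y Hy). reflexivity.
Qed.

Definition oppseq (a : nat -> R) (m : nat) : R := - a m.

(* Real part of [sum_{m<=M} m^i (a_m + i b_m) z^m] at [z = exp (r + i t)]; with [(b, oppseq a)] in
   place of [(a, b)] it is the imaginary part. *)
Definition pol (a b : nat -> R) (i M : nat) (r t : R) : R :=
  sum_f_R0 (fun m => INR m ^ i * exp (INR m * r) * rot a b t m) M.

Lemma pol_dr a b i M r t : is_derive (fun x => pol a b i M x t) r (pol a b (S i) M r t).
Proof.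
unfold pol. induction M as [|M IH].
- simpl sum_f_R0. auto_derive; [exact I|]. simpl. ring.
- simpl sum_f_R0. apply (is_derive_plus (V := R_NormedModule) _ _ _ _ _ IH).
  auto_derive; [exact I|]. simpl pow. ring.
Qed.

Lemma rot_dt a b m t : is_derive (fun x => rot a b x m) t (- INR m * rot b (oppseq a) t m).
Proof. unfold rot, oppseq. auto_derive; [exact I|]. ring. Qed.

Lemma pol_dt a b i M r t : is_derive (fun x => pol a b i M r x) t (- pol b (oppseq a) (S i) M r t).
Proof.
assert (T : forall m, is_derive (fun x => INR m ^ i * exp (INR m * r) * rot a b x m) t
   (- (INR m ^ S i * exp (INR m * r) * rot b (oppseq a) t m))).
{ intros m. evar_last; [apply (is_derive_scal (fun x => rot a b x m)), rot_dt|]. simpl. ring. }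
unfold pol. induction M as [|M IH]; simpl sum_f_R0; [exact (T 0%nat)|].
evar_last; [apply (is_derive_plus (V := R_NormedModule) _ _ _ _ _ IH (T (S M)))|].
unfold plus; simpl. ring.
Qed.

Lemma pol_neg a b i M r t : pol (oppseq a) (oppseq b) i M r t = - pol a b i M r t.
Proof.
unfold pol. induction M as [|M IH]; simpl sum_f_R0; [|rewrite IH]; unfold rot, oppseq; ring.
Qed.

Lemma pol_dt' a b i M r t : is_derive (fun x => pol b (oppseq a) i M r x) t (pol a b (S i) M r t).
Proof. evar_last; [apply pol_dt|]. rewrite pol_neg. ring. Qed.

Lemma rot_cont2 a b m r t : continuity_2d_pt (fun _ y => rot a b y m) r t.
Proof.
apply (continuity_1d_2d_pt_comp (fun y => rot a b y m) (fun _ y => y)); [|apply continuity_2d_pt_id2].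
apply continuity_pt_filterlim. eapply continuous_is_derive, rot_dt.
Qed.

Lemma exp_cont2 c r t : continuity_2d_pt (fun x _ => exp (c * x)) r t.
Proof.
apply (continuity_1d_2d_pt_comp exp (fun x _ => c * x)).
- apply derivable_continuous_pt, derivable_pt_exp.
- apply continuity_2d_pt_mult; [apply continuity_2d_pt_const|apply continuity_2d_pt_id1].
Qed.

Lemma pol_cont2 a b i M r t : continuity_2d_pt (pol a b i M) r t.
Proof.
assert (T : forall m, continuity_2d_pt (fun x y => INR m ^ i * exp (INR m * x) * rot a b y m) r t).
{ intros m. apply continuity_2d_pt_mult; [apply continuity_2d_pt_mult|apply rot_cont2].
  - apply continuity_2d_pt_const.
  - apply exp_cont2. }
unfold pol. induction M as [|M IH]; simpl sum_f_R0; [exact (T 0%nat)|].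
apply continuity_2d_pt_plus; [exact IH|exact (T (S M))].
Qed.

Lemma pol_period a b i M r : pol a b i M r (2 * PI) = pol a b i M r 0.
Proof.
unfold pol. apply sum_eq. intros m _. f_equal. unfold rot.
rewrite <- (Rplus_0_r (INR m * (2 * PI))), cos_period_nat, sin_period_nat, Rmult_0_r. reflexivity.
Qed.

Definition pnorm (a b : nat -> R) (M : nat) (r t : R) : R :=
  pol a b 0 M r t ^ 2 + pol b (oppseq a) 0 M r t ^ 2.

Section LogModulus.
Variables (a b : nat -> R) (M : nat) (r0 : R).
Hypothesis Hpos : forall r t, r < r0 -> 0 < pnorm a b M r t.

Let A i := pol a b i M.
Let B i := pol b (oppseq a) i M.
(** For the polynomial [P = A 0 + i B 0]: [u = log |P|], [d + i v = z P'/P], and [h] is the real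
    part of [z d/dz] applied to [z P'/P]. For polynomials all derivatives and the joint continuity
    are elementary; infinite series are reached later by truncation. *)
Let u r t := / 2 * ln (pnorm a b M r t).
Let d r t := (A 0%nat r t * A 1%nat r t + B 0%nat r t * B 1%nat r t) / pnorm a b M r t.
Let v r t := (A 0%nat r t * B 1%nat r t - B 0%nat r t * A 1%nat r t) / pnorm a b M r t.
Let h r t := (A 0%nat r t * A 2%nat r t + B 0%nat r t * B 2%nat r t) / pnorm a b M r t
              - (d r t ^ 2 - v r t ^ 2).

Let DA i r t : is_derive (fun x => A i x t) r (A (S i) r t) := pol_dr a b i M r t.
Let DB i r t : is_derive (fun x => B i x t) r (B (S i) r t) := pol_dr b (oppseq a) i M r t.
Let TA i r t : is_derive (fun x => A i r x) t (- B (S i) r t) := pol_dt a b i M r t.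
Let TB i r t : is_derive (fun x => B i r x) t (A (S i) r t) := pol_dt' a b i M r t.

Lemma log_modulus_fourier_const (k : nat) (ph K r1 : R) :
  (forall r, r < r1 -> Rabs (fourier u k ph r) <= K) ->
  forall x y, x < r0 -> y < r0 ->
  fourier u k ph x * exp (- INR k * x) = fourier u k ph y * exp (- INR k * y).
Proof.
intros HK.
assert (CA : forall i r t, continuity_2d_pt (A i) r t) by (intros; apply pol_cont2).
assert (CB : forall i r t, continuity_2d_pt (B i) r t) by (intros; apply pol_cont2).
assert (CN : forall r t, continuity_2d_pt (pnorm a b M) r t).
{ intros r t. apply (continuity_2d_pt_ext (fun r t => A 0%nat r t * A 0%nat r t + B 0%nat r t * B 0%nat r t)).
  - intros x y. unfold pnorm, A, B. ring.
  - apply continuity_2d_pt_plus; apply continuity_2d_pt_mult; auto. }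
assert (CI : forall r t, r < r0 -> continuity_2d_pt (fun r t => / pnorm a b M r t) r t).
{ intros r t Hr. apply continuity_2d_pt_inv; [apply CN|]. specialize (Hpos r t Hr). lra. }
assert (Cd : forall r t, r < r0 -> continuity_2d_pt d r t).
{ intros r t Hr. unfold d, Rdiv. apply continuity_2d_pt_mult; [|apply CI, Hr].
  apply continuity_2d_pt_plus; apply continuity_2d_pt_mult; auto. }
assert (Cv : forall r t, r < r0 -> continuity_2d_pt v r t).
{ intros r t Hr. unfold v, Rdiv. apply continuity_2d_pt_mult; [|apply CI, Hr].
  apply continuity_2d_pt_minus; apply continuity_2d_pt_mult; auto. }
assert (Ch : forall r t, r < r0 -> continuity_2d_pt h r t).
{ intros r t Hr. unfold h.
  apply (continuity_2d_pt_ext (fun r t => (A 0%nat r t * A 2%nat r t + B 0%nat r t * B 2%nat r t) * / pnorm a b M r t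
            - (d r t * d r t - v r t * v r t))).
  - intros x y. unfold Rdiv. ring.
  - apply continuity_2d_pt_minus; [|apply continuity_2d_pt_minus; apply continuity_2d_pt_mult; auto].
    apply continuity_2d_pt_mult; [|apply CI, Hr].
    apply continuity_2d_pt_plus; apply continuity_2d_pt_mult; auto. }
assert (Eu : forall r t, u r t = / 2 * ln (A 0%nat r t ^ 2 + B 0%nat r t ^ 2)) by reflexivity.
assert (Nz : forall r t, r < r0 -> 0 < A 0%nat r t ^ 2 + B 0%nat r t ^ 2) by (intros; apply Hpos; assumption).
assert (Hur : forall r t, r < r0 -> is_derive (fun x => u x t) r (d r t)).
{ intros r t Hr. assert (Hn := Nz r t Hr).
  apply (is_derive_ext (fun x => / 2 * ln (A 0%nat x t ^ 2 + B 0%nat x t ^ 2))); [intros; apply Eu|].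
  evar_last.
  { apply (is_derive_scal (fun x => ln (A 0%nat x t ^ 2 + B 0%nat x t ^ 2))).
    apply (is_derive_comp ln (fun x => A 0%nat x t ^ 2 + B 0%nat x t ^ 2)).
    - apply is_derive_ln. exact Hn.
    - apply (is_derive_plus (V := R_NormedModule) (fun x => A 0%nat x t ^ 2) (fun x => B 0%nat x t ^ 2));
       apply is_derive_pow; [apply DA|apply DB]. }
  unfold d, pnorm. fold (A 0%nat r t). fold (B 0%nat r t).
  unfold plus, scal; simpl; unfold mult; simpl. field. simpl in Hn. lra. }
assert (Hut : forall r t, r < r0 -> is_derive (fun x => u r x) t (- v r t)).
{ intros r t Hr. assert (Hn := Nz r t Hr).
  apply (is_derive_ext (fun x => / 2 * ln (A 0%nat r x ^ 2 + B 0%nat r x ^ 2))); [intros; apply Eu|].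
  evar_last.
  { apply (is_derive_scal (fun x => ln (A 0%nat r x ^ 2 + B 0%nat r x ^ 2))).
    apply (is_derive_comp ln (fun x => A 0%nat r x ^ 2 + B 0%nat r x ^ 2)).
    - apply is_derive_ln. exact Hn.
    - apply (is_derive_plus (V := R_NormedModule) (fun x => A 0%nat r x ^ 2) (fun x => B 0%nat r x ^ 2));
       apply is_derive_pow; [apply TA|apply TB]. }
  unfold v, pnorm. fold (A 0%nat r t). fold (B 0%nat r t).
  unfold plus, scal; simpl; unfold mult; simpl. field. simpl in Hn. lra. }
assert (Hdr : forall r t, r < r0 -> is_derive (fun x => d x t) r (h r t)).
{ intros r t Hr. assert (Hn := Nz r t Hr).
  apply (is_derive_ext (fun x => (A 0%nat x t * A 1%nat x t + B 0%nat x t * B 1%nat x t) / (A 0%nat x t ^ 2 + B 0%nat x t ^ 2)));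
    [intros; reflexivity|].
  evar_last.
  { apply (is_derive_div (fun x => A 0%nat x t * A 1%nat x t + B 0%nat x t * B 1%nat x t)
            (fun x => A 0%nat x t ^ 2 + B 0%nat x t ^ 2)); [| |lra].
    - apply (is_derive_plus (V := R_NormedModule) (fun x => A 0%nat x t * A 1%nat x t) (fun x => B 0%nat x t * B 1%nat x t)).
      + apply (is_derive_mult (fun x => A 0%nat x t) (fun x => A 1%nat x t) r _ _ (DA 0%nat r t) (DA 1%nat r t)). intros; apply Rmult_comm.
      + apply (is_derive_mult (fun x => B 0%nat x t) (fun x => B 1%nat x t) r _ _ (DB 0%nat r t) (DB 1%nat r t)). intros; apply Rmult_comm.
    - apply (is_derive_plus (V := R_NormedModule) (fun x => A 0%nat x t ^ 2) (fun x => B 0%nat x t ^ 2));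
       apply is_derive_pow; [apply DA|apply DB]. }
  unfold h, d, v, pnorm. fold (A 0%nat r t). fold (B 0%nat r t).
  unfold plus, mult; simpl. field. simpl in Hn. lra. }
assert (Hvt : forall r t, r < r0 -> is_derive (fun x => v r x) t (h r t)).
{ intros r t Hr. assert (Hn := Nz r t Hr).
  apply (is_derive_ext (fun x => (A 0%nat r x * B 1%nat r x - B 0%nat r x * A 1%nat r x) / (A 0%nat r x ^ 2 + B 0%nat r x ^ 2)));
    [intros; reflexivity|].
  evar_last.
  { apply (is_derive_div (fun x => A 0%nat r x * B 1%nat r x - B 0%nat r x * A 1%nat r x)
            (fun x => A 0%nat r x ^ 2 + B 0%nat r x ^ 2)); [| |lra].
    - apply (is_derive_minus (V := R_NormedModule) (fun x => A 0%nat r x * B 1%nat r x) (fun x => B 0%nat r x * A 1%nat r x)).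
      + apply (is_derive_mult (fun x => A 0%nat r x) (fun x => B 1%nat r x) t _ _ (TA 0%nat r t) (TB 1%nat r t)). intros; apply Rmult_comm.
      + apply (is_derive_mult (fun x => B 0%nat r x) (fun x => A 1%nat r x) t _ _ (TB 0%nat r t) (TA 1%nat r t)). intros; apply Rmult_comm.
    - apply (is_derive_plus (V := R_NormedModule) (fun x => A 0%nat r x ^ 2) (fun x => B 0%nat r x ^ 2));
       apply is_derive_pow; [apply TA|apply TB]. }
  unfold h, d, v, pnorm. fold (A 0%nat r t). fold (B 0%nat r t).
  unfold minus, plus, opp, mult; simpl. field. simpl in Hn. lra. }
assert (Pu : forall r, u r (2 * PI) = u r 0).
{ intros r. unfold u, pnorm. rewrite !pol_period. reflexivity. }
assert (Pv : forall r, v r (2 * PI) = v r 0).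
{ intros r. unfold v, pnorm, A, B. rewrite !pol_period. reflexivity. }
apply (bounded_exponential_ode (fourier u k ph)
   (fun r => RInt (fun t => d r t * cos (INR k * t + ph)) 0 (2 * PI)) k r0 r1 K); [| |exact HK].
- intros r Hr. apply (fourier_derive u d v r0); assumption.
- intros r Hr. apply (fourier_derive2 u d v h r0); assumption.
Qed.
End LogModulus.

Lemma pow_le_one (x : R) (n : nat) : 0 <= x <= 1 -> x ^ n <= 1.
Proof.
intros Hx. induction n; simpl; [lra|]. nra.
Qed.

Lemma ln_le_minus_1 (x : R) : 0 < x -> ln x <= x - 1.
Proof.
intros Hx. destruct (Req_dec (ln x) 0) as [E|E].
- assert (x = 1) by (rewrite <- (exp_ln x Hx), E; apply exp_0). rewrite E. lra.
- pose proof (exp_ineq1 (ln x) E). rewrite exp_ln in H by exact Hx. lra.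
Qed.

Lemma ln_lipschitz (x y m : R) : 0 < m -> m <= x -> m <= y -> Rabs (ln x - ln y) <= Rabs (x - y) / m.
Proof.
assert (Aux : forall x y, 0 < m -> m <= x -> m <= y -> ln x - ln y <= Rabs (x - y) / m).
{ intros X Y Hm HX HY. rewrite <- ln_div by lra.
  eapply Rle_trans; [apply ln_le_minus_1; pos|].
  replace (X / Y - 1) with ((X - Y) * / Y) by (field; lra).
  eapply Rle_trans; [apply Rmult_le_compat_r; [pos|apply Rle_abs]|].
  unfold Rdiv. apply Rmult_le_compat_l; [apply Rabs_pos|]. apply Rinv_le_contravar; lra. }
intros Hm Hx Hy. apply Rabs_le. split.
- assert (H := Aux y x Hm Hy Hx). rewrite Rabs_minus_sym in H. lra.
- apply Aux; assumption.
Qed.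

Lemma is_RInt_cos_nat (k : nat) (ph : R) : (1 <= k)%nat ->
  is_RInt (fun t => cos (INR k * t + ph)) 0 (2 * PI) 0.
Proof.
intros Hk. assert (HK : INR k <> 0) by (apply not_0_INR; lia).
evar_last.
{ apply (is_RInt_derive (fun t => / INR k * sin (INR k * t + ph))).
  - intros t _. auto_derive; [exact I|field; exact HK].
  - intros t _. apply continuous_cos_lin. }
rewrite sin_period_nat, Rmult_0_r, Rplus_0_l. unfold minus, plus, opp; simpl. ring.
Qed.

Lemma is_RInt_const_R (a b c : R) : is_RInt (fun _ => c) a b ((b - a) * c).
Proof. apply (is_RInt_const (V := R_NormedModule)). Qed.

Lemma is_RInt_plus_R (f g : R -> R) (a b lf lg : R) :
  is_RInt f a b lf -> is_RInt g a b lg -> is_RInt (fun x => f x + g x) a b (lf + lg).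
Proof. apply (is_RInt_plus (V := R_NormedModule)). Qed.

Lemma is_RInt_scal_R (f : R -> R) (a b k lf : R) :
  is_RInt f a b lf -> is_RInt (fun x => k * f x) a b (k * lf).
Proof. apply (is_RInt_scal (V := R_NormedModule)). Qed.

Lemma is_RInt_ext_R (f g : R -> R) (a b l : R) :
  (forall x, f x = g x) -> is_RInt f a b l -> is_RInt g a b l.
Proof. intros H. apply (is_RInt_ext (V := R_NormedModule)). intros x _. apply H. Qed.

Lemma is_RInt_cos_cos (m k : nat) (p q ph : R) : (1 <= m <= k)%nat ->
  is_RInt (fun t => (p * cos (INR m * t) - q * sin (INR m * t)) * cos (INR k * t + ph)) 0 (2 * PI)
    (if Nat.eqb m k then PI * (p * cos ph + q * sin ph) else 0).
Proof.
intros Hm.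
apply (is_RInt_ext_R (fun t =>
   (/ 2 * p) * cos (INR (k + m) * t + ph) + ((/ 2 * - q) * cos (INR (k + m) * t + (ph - PI / 2)) +
   ((/ 2 * p) * cos (INR (k - m) * t + ph) + (/ 2 * q) * cos (INR (k - m) * t + (ph - PI / 2)))))).
{ intros t. rewrite plus_INR, minus_INR by lia.
  replace ((INR k + INR m) * t + (ph - PI / 2)) with ((INR k + INR m) * t + ph - PI / 2) by ring.
  replace ((INR k - INR m) * t + (ph - PI / 2)) with ((INR k - INR m) * t + ph - PI / 2) by ring.
  rewrite !(cos_minus _ (PI / 2)), cos_PI2, sin_PI2.
  replace ((INR k + INR m) * t + ph) with ((INR k * t + ph) + INR m * t) by ring.
  replace ((INR k - INR m) * t + ph) with ((INR k * t + ph) - INR m * t) by ring.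
  set (y := INR k * t + ph). set (z := INR m * t).
  rewrite cos_plus, cos_minus, sin_plus, sin_minus. field. }
destruct (Nat.eqb_spec m k) as [E|E].
- subst m. rewrite Nat.sub_diag.
  evar_last.
  { apply is_RInt_plus_R; [apply is_RInt_scal_R, is_RInt_cos_nat; lia|].
    apply is_RInt_plus_R; [apply is_RInt_scal_R, is_RInt_cos_nat; lia|].
    apply is_RInt_plus_R; apply is_RInt_scal_R.
    - apply (is_RInt_ext_R (fun _ => cos ph)); [|apply is_RInt_const_R].
      intros; simpl. rewrite Rmult_0_l, Rplus_0_l; reflexivity.
    - apply (is_RInt_ext_R (fun _ => sin ph)); [|apply is_RInt_const_R].
      intros; simpl. rewrite Rmult_0_l, Rplus_0_l, cos_minus, cos_PI2, sin_PI2. ring. }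
  field.
- evar_last.
  { apply is_RInt_plus_R; [apply is_RInt_scal_R, is_RInt_cos_nat; lia|].
    apply is_RInt_plus_R; [apply is_RInt_scal_R, is_RInt_cos_nat; lia|].
    apply is_RInt_plus_R; apply is_RInt_scal_R, is_RInt_cos_nat; lia. }
  ring.
Qed.

Lemma PS_Int_bound (p : nat -> R) (C rho : R) : 0 < rho -> 0 <= C ->
  geom_bound p C rho -> geom_bound (PS_Int p) (C * rho) rho.
Proof.
intros Hr HC Hp m. unfold PS_Int. destruct m as [|m].
- rewrite Rabs_R0. simpl. rewrite Rdiv_1_r. nra.
- unfold Rdiv. rewrite Rabs_mult, (Rabs_pos_eq (/ INR (S m))) by pos.
  simpl pow. rewrite Rinv_mult.
  replace (C * rho * (/ rho * / rho ^ m)) with (C * / rho ^ m) by (field; split; [apply pow_nonzero|]; lra).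
  specialize (Hp m).
  apply Rle_trans with (Rabs (p m) * 1); [|unfold Rdiv in Hp; lra].
  apply Rmult_le_compat_l; [apply Rabs_pos|].
  rewrite <- Rinv_1. apply Rinv_le_contravar; [lra|]. rewrite S_INR. pose proof (pos_INR m); lra.
Qed.

(** * The Borel-Caratheodory estimate for truncations *)

Section BorelCaratheodory.
Variables (a b p q : nat -> R) (C rho : R).
Hypothesis Hrho : 0 < rho.
Hypothesis HC : 0 <= C.
Hypothesis Ba : geom_bound a C rho.
Hypothesis Bb : geom_bound b C rho.
Hypothesis Bp : geom_bound p C rho.
Hypothesis Bq : geom_bound q C rho.
Hypothesis Ha : forall m, PS_derive a m = PS_mult p a m - PS_mult q b m.
Hypothesis Hb : forall m, PS_derive b m = PS_mult p b m + PS_mult q a m.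
Hypothesis H0 : 0 < a 0%nat ^ 2 + b 0%nat ^ 2.

Let lam := / 2 * ln (a 0%nat ^ 2 + b 0%nat ^ 2).
Let T k x t := sum_f_R0 (fun m => PS_Int (rot1 p q t) m * x ^ m) k.

Lemma exp_nat_pow (m : nat) (r : R) : exp (INR m * r) = exp r ^ m.
Proof.
induction m; [simpl; rewrite Rmult_0_l; apply exp_0|].
rewrite S_INR, Rmult_plus_distr_r, Rmult_1_l, exp_plus, IHm. simpl. ring.
Qed.

Lemma pol_pow (i M : nat) (c e : nat -> R) (r t : R) :
  pol c e 0 M r t = sum_f_R0 (fun m => rot c e t m * exp r ^ m) M.
Proof. unfold pol. apply sum_eq. intros m _. rewrite exp_nat_pow. simpl. ring. Qed.

(** Truncation at degree [M >= k] changes the series only by [O(x^(M+1))], and [modulus_along_ray]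
    gives the logarithm of the full modulus. So close to the centre the log modulus of the
    truncation agrees with the Taylor polynomial of degree [k] of the full logarithm. *)
Lemma log_modulus_expansion (k M : nat) : (k <= M)%nat ->
  exists K r1, 0 <= K /\ forall r t, r < r1 ->
    0 < pnorm a b M r t /\
    Rabs (/ 2 * ln (pnorm a b M r t) - (lam + T k (exp r) t)) <= K * exp r ^ (S k).
Proof.
intros HkM.
set (Cl := a 0%nat ^ 2 + b 0%nat ^ 2) in *.
(* Lower bound for the squared modulus of the full series near the centre: it equals
   [Cl * exp (2 F)] with [|F| <= 4 C rho]. *)
set (c := Cl * exp (- (8 * (C * rho)))).
assert (Hc : 0 < c) by (apply Rmult_lt_0_compat; [exact H0|apply exp_pos]).
set (K1 := 64 * C * C * (/ rho) ^ (S M)).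
assert (Hir : 0 < / rho) by pos.
assert (HK1 : 0 <= K1).
{ apply Rmult_le_pos; [nra|]. apply pow_le. lra. }
set (x1 := Rmin (Rmin (rho / 2) 1) (c / (2 * (K1 + 1)))).
assert (Hx1 : 0 < x1).
{ unfold x1. apply Rmin_glb_lt; [apply Rmin_glb_lt; lra|]. apply Rdiv_lt_0_compat; lra. }
exists (K1 / c + 4 * (C * rho) * (/ rho) ^ (S k)), (ln x1). split.
{ apply Rplus_le_le_0_compat; [pos|].
  apply Rmult_le_pos; [|pos]. nra. }
intros r t Hr. set (x := exp r).
assert (Hx : 0 < x < x1).
{ split; [apply exp_pos|]. unfold x. rewrite <- (exp_ln x1 Hx1). apply exp_increasing, Hr. }
assert (Hxr : x < rho / 2) by (apply Rlt_le_trans with x1; [lra|eapply Rle_trans; [apply Rmin_l|apply Rmin_l]]).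
assert (Hx1' : x < 1) by (apply Rlt_le_trans with x1; [lra|eapply Rle_trans; [apply Rmin_l|apply Rmin_r]]).
assert (HxK : x < c / (2 * (K1 + 1))) by (apply Rlt_le_trans with x1; [lra|apply Rmin_r]).
assert (Habs : Rabs x = x) by (apply Rabs_pos_eq; lra).
assert (Hxrho : Rabs x < rho) by (rewrite Habs; lra).
assert (Hq : x / rho <= / 2).
{ apply Rle_div_l; lra. }
assert (Hi : / (1 - x / rho) <= 2).
{ assert (X : / (1 - x / rho) <= / (/ 2)) by (apply Rinv_le_contravar; lra). rewrite Rinv_inv in X. exact X. }
assert (Hpw : forall n, (x / rho) ^ n = x ^ n * (/ rho) ^ n) by (intros; unfold Rdiv; apply Rpow_mult_distr).
set (a' := rot a b t). set (b' := rot b (oppseq a) t).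
set (p' := rot1 p q t). set (q' := rot1 q (oppseq p) t).
assert (Ba' : geom_bound a' (2 * C) rho) by (apply rot_bound; assumption).
assert (Bb' : geom_bound b' (2 * C) rho) by (apply rot_bound; [|assumption|apply geom_bound_opp]; assumption).
assert (Bp' : geom_bound p' (2 * C) rho) by (apply rot1_bound; assumption).
assert (Bq' : geom_bound q' (2 * C) rho) by (apply rot1_bound; [|assumption|apply geom_bound_opp]; assumption).
destruct (log_derivative_rotated a b p q t Ha Hb) as [Ha' Hb'].
assert (HM := modulus_along_ray a' b' p' q' Ha' Hb' (2 * C) rho x Hrho Ba' Bb' Bp' Bq' Hxrho).
set (F := PSeries (PS_Int p') x) in *.
assert (Ea0 : a' 0%nat ^ 2 + b' 0%nat ^ 2 = Cl).
{ unfold a', b', rot, oppseq, Cl. simpl INR. rewrite Rmult_0_l, cos_0, sin_0. ring. }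
rewrite Ea0 in HM.
assert (BI : geom_bound (PS_Int p') (2 * C * rho) rho) by (apply PS_Int_bound; [assumption|lra|assumption]).
assert (HCr : 0 <= C * rho) by nra.
assert (FB : Rabs F <= 4 * (C * rho)).
{ eapply Rle_trans; [apply (PSeries_geom_bound _ (2 * C * rho) rho); [assumption|nra|exact BI|exact Hxrho]|].
  rewrite Habs. unfold Rdiv at 1. nra. }
assert (FT : Rabs (F - T k x t) <= 4 * (C * rho) * (/ rho) ^ S k * x ^ S k).
{ eapply Rle_trans; [apply (PSeries_geom_tail _ (2 * C * rho) rho x k); [assumption|nra|exact BI|exact Hxrho]|].
  rewrite Habs, Hpw. unfold Rdiv at 1.
  assert (0 <= 2 * C * rho * (x ^ S k * (/ rho) ^ S k)).
  { apply Rmult_le_pos; [nra|]. apply Rmult_le_pos; apply pow_le; lra. }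
  assert (2 * C * rho * (x ^ S k * (/ rho) ^ S k) * / (1 - x / rho) <= 2 * C * rho * (x ^ S k * (/ rho) ^ S k) * 2) by (apply Rmult_le_compat_l; lra).
  lra. }
set (A := PSeries a' x) in *. set (B := PSeries b' x) in *.
set (A0 := pol a b 0 M r t). set (B0 := pol b (oppseq a) 0 M r t).
assert (tail : forall f f', geom_bound f' (2 * C) rho -> f = sum_f_R0 (fun m => f' m * x ^ m) M ->
   Rabs (PSeries f' x) <= 4 * C /\ Rabs f <= 4 * C /\ Rabs (PSeries f' x - f) <= 4 * C * (x ^ S M * (/ rho) ^ S M)).
{ intros f f' Bf Ef. split; [|split].
  - eapply Rle_trans; [apply (PSeries_geom_bound _ (2 * C) rho); [assumption|lra|exact Bf|exact Hxrho]|].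
    rewrite Habs. unfold Rdiv at 1. nra.
  - rewrite Ef. eapply Rle_trans; [apply (sum_geom_bound _ (2 * C) rho); [assumption|lra|exact Bf|exact Hxrho]|].
    rewrite Habs. unfold Rdiv at 1. nra.
  - rewrite Ef. eapply Rle_trans; [apply (PSeries_geom_tail _ (2 * C) rho); [assumption|lra|exact Bf|exact Hxrho]|].
    rewrite Habs, Hpw. unfold Rdiv at 1.
    assert (0 <= 2 * C * (x ^ S M * (/ rho) ^ S M)).
    { apply Rmult_le_pos; [lra|]. apply Rmult_le_pos; apply pow_le; lra. }
    assert (2 * C * (x ^ S M * (/ rho) ^ S M) * / (1 - x / rho) <= 2 * C * (x ^ S M * (/ rho) ^ S M) * 2) by (apply Rmult_le_compat_l; lra).
    lra. }
destruct (tail A0 a' Ba' (pol_pow 0%nat M a b r t)) as (A1 & A2 & A3).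
destruct (tail B0 b' Bb' (pol_pow 0%nat M b (oppseq a) r t)) as (B1 & B2 & B3).
fold A in A1, A3. fold B in B1, B3.
set (eps := x ^ S M * (/ rho) ^ S M) in *.
assert (Hdiff : Rabs (pnorm a b M r t - (A ^ 2 + B ^ 2)) <= K1 * x ^ S M).
{ unfold pnorm. fold A0 B0.
  replace (A0 ^ 2 + B0 ^ 2 - (A ^ 2 + B ^ 2)) with (- ((A - A0) * (A + A0)) + - ((B - B0) * (B + B0))) by ring.
  eapply Rle_trans; [apply Rabs_triang|]. rewrite !Rabs_Ropp, !Rabs_mult.
  assert (Rabs (A + A0) <= 8 * C) by (eapply Rle_trans; [apply Rabs_triang|lra]).
  assert (Rabs (B + B0) <= 8 * C) by (eapply Rle_trans; [apply Rabs_triang|lra]).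
  assert (Rabs (A - A0) * Rabs (A + A0) <= 4 * C * eps * (8 * C)) by (apply Rmult_le_compat; auto using Rabs_pos).
  assert (Rabs (B - B0) * Rabs (B + B0) <= 4 * C * eps * (8 * C)) by (apply Rmult_le_compat; auto using Rabs_pos).
  unfold K1. replace (64 * C * C * (/ rho) ^ S M * x ^ S M) with (64 * C * C * eps) by (unfold eps; ring). lra. }
assert (HL : c <= A ^ 2 + B ^ 2).
{ rewrite HM. unfold c. apply Rmult_le_compat_l; [lra|].
  destruct (Req_dec (- (8 * (C * rho))) (2 * F)) as [->|NE]; [lra|]. left. apply exp_increasing.
  apply Rabs_le_between in FB. lra. }
assert (HxM : x ^ S M <= x).
{ simpl. assert (X : x ^ M <= 1); [apply pow_le_one; lra|nra]. }
assert (Hs : K1 * x ^ S M <= c / 2).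
{ apply Rle_trans with (K1 * x); [apply Rmult_le_compat_l; lra|].
  assert ((K1 + 1) * x <= (K1 + 1) * (c / (2 * (K1 + 1)))) by (apply Rmult_le_compat_l; [lra|left; exact HxK]).
  replace ((K1 + 1) * (c / (2 * (K1 + 1)))) with (c / 2) in H by (field; lra). lra. }
assert (HN : c / 2 <= pnorm a b M r t).
{ assert (X := Rle_abs (- (pnorm a b M r t - (A ^ 2 + B ^ 2)))). rewrite Rabs_Ropp in X. lra. }
split; [lra|].
assert (HlnL : / 2 * ln (A ^ 2 + B ^ 2) = lam + F).
{ rewrite HM, ln_mult, ln_exp; [unfold lam; fold Cl; field|exact H0|apply exp_pos]. }
assert (Hln : Rabs (/ 2 * ln (pnorm a b M r t) - / 2 * ln (A ^ 2 + B ^ 2)) <= K1 / c * x ^ S k).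
{ rewrite <- Rmult_minus_distr_l, Rabs_mult, (Rabs_pos_eq (/ 2)) by lra.
  assert (HLip := ln_lipschitz (pnorm a b M r t) (A ^ 2 + B ^ 2) (c / 2) ltac:(lra) HN ltac:(lra)).
  apply Rle_trans with (/ 2 * (K1 * x ^ S M / (c / 2))).
  { apply Rmult_le_compat_l; [lra|]. eapply Rle_trans; [exact HLip|].
    unfold Rdiv at 1 3. apply Rmult_le_compat_r; [pos|exact Hdiff]. }
  replace (/ 2 * (K1 * x ^ S M / (c / 2))) with (K1 / c * x ^ S M) by (field; lra).
  apply Rmult_le_compat_l; [pos|].
  replace (S M) with (S k + (M - k))%nat by lia. rewrite pow_add.
  assert (0 < x ^ S k) by pos.
  assert (x ^ (M - k) <= 1) by (apply pow_le_one; lra).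
  nra. }
replace (/ 2 * ln (pnorm a b M r t) - (lam + T k x t)) with
  ((/ 2 * ln (pnorm a b M r t) - / 2 * ln (A ^ 2 + B ^ 2)) + (F - T k x t)) by (rewrite HlnL; ring).
eapply Rle_trans; [apply Rabs_triang|]. fold x. lra.
Qed.

Lemma is_RInt_T (k n : nat) (x ph : R) : (n <= k)%nat -> (1 <= k)%nat ->
  is_RInt (fun t => (lam + T n x t) * cos (INR k * t + ph)) 0 (2 * PI)
    (if Nat.eqb n k then PI * (p (k - 1)%nat * cos ph + q (k - 1)%nat * sin ph) / INR k * x ^ k else 0).
Proof.
intros Hn Hk. induction n as [|n IH].
- unfold T. simpl sum_f_R0. destruct k; [lia|]. simpl Nat.eqb. cbv iota.
  evar_last.
  + apply (is_RInt_ext_R (fun t => lam * cos (INR (S k) * t + ph))).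
    * intros t. ring.
    * apply is_RInt_scal_R, is_RInt_cos_nat; lia.
  + ring.
- specialize (IH ltac:(lia)). destruct (Nat.eqb_spec n k) as [E|_]; [lia|].
  assert (HJ := is_RInt_cos_cos (S n) k (p n) (q n) ph ltac:(lia)).
  apply (is_RInt_ext_R (fun t => (lam + T n x t) * cos (INR k * t + ph) +
     (x ^ S n / INR (S n)) * ((p n * cos (INR (S n) * t) - q n * sin (INR (S n) * t)) * cos (INR k * t + ph)))).
  + intros t. unfold T. rewrite tech5. unfold PS_Int at 3, rot1. unfold Rdiv. ring.
  + evar_last; [apply is_RInt_plus_R; [exact IH|apply is_RInt_scal_R, HJ]|].
    destruct (Nat.eqb_spec (S n) k) as [E|E]; [|ring].
    subst k. replace (S n - 1)%nat with n by lia. field. apply not_0_INR; lia.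
Qed.

Lemma is_RInt_T0 (x : R) : is_RInt (fun t => (lam + T 0 x t) * cos (INR 0 * t + 0)) 0 (2 * PI) (2 * PI * lam).
Proof.
evar_last.
- apply (is_RInt_ext_R (fun t => lam)); [|apply is_RInt_const_R].
  intros t. unfold T. simpl. replace (0 * t + 0) with 0 by ring. rewrite cos_0. ring.
- ring.
Qed.

Lemma small_eq (x y K : R) (r1 : R) : 0 <= K -> (forall r, r < r1 -> Rabs (x - y) <= K * exp r) -> x = y.
Proof.
intros HK H. apply Rminus_diag_uniq. apply NNPP. intros N.
assert (Hp : 0 < Rabs (x - y)) by (apply Rabs_pos_lt, N).
set (e := Rabs (x - y) / (2 * (K + 1))).
assert (He : 0 < e) by pos.
set (r := Rmin (ln e) (r1 - 1)).
assert (Hr : r < r1) by (eapply Rle_lt_trans; [apply Rmin_r|lra]).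
specialize (H r Hr).
assert (exp r <= e).
{ rewrite <- (exp_ln e He). destruct (Rmin_l (ln e) (r1 - 1)) as [L|E]; [left; apply exp_increasing; exact L|].
  unfold r. rewrite E. lra. }
assert (K * exp r <= (K + 1) * e) by (pose proof (exp_pos r); nra).
unfold e in H2. replace ((K + 1) * (Rabs (x - y) / (2 * (K + 1)))) with (Rabs (x - y) / 2) in H2 by (field; lra).
lra.
Qed.

(** By [log_modulus_fourier_const] the left side does not depend on [r]; it is evaluated as
    [r -> -oo], where the expansion differs from it by [O(e^r)]. *)
Lemma fourier_limit (M k : nat) (r0 ph L : R) : (k <= M)%nat ->
  (forall r t, r < r0 -> 0 < pnorm a b M r t) ->
  (forall x, is_RInt (fun t => (lam + T k x t) * cos (INR k * t + ph)) 0 (2 * PI) (L * x ^ k)) ->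
  forall r, r < r0 ->
  fourier (fun r t => / 2 * ln (pnorm a b M r t)) k ph r * exp (- INR k * r) = L.
Proof.
intros HkM Hpos HL r Hr.
destruct (log_modulus_expansion k M HkM) as (K & r1 & HK & Hexp).
set (u := fun r t => / 2 * ln (pnorm a b M r t)).
assert (Cu : forall x t, x < r0 -> continuous (fun t => u x t * cos (INR k * t + ph)) t).
{ intros x t Hx. apply (continuous_mult (K := R_AbsRing) (fun t => u x t) (fun t => cos (INR k * t + ph))); [|apply continuous_cos_lin].
  unfold u. specialize (Hpos x t Hx). unfold pnorm in *.
  eapply continuous_is_derive. auto_derive; [|reflexivity].
  repeat split; [eexists; apply pol_dt|eexists; apply pol_dt|]. simpl in *. lra. }
assert (Hclose : forall x, x < r0 -> x < r1 -> Rabs (fourier u k ph x - L * exp x ^ k) <= 2 * PI * (K * exp x ^ S k)).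
{ intros x Hx0 Hx1.
  assert (E1 : ex_RInt (fun t => u x t * cos (INR k * t + ph)) 0 (2 * PI)) by (apply ex_RInt_cont; intros; apply Cu, Hx0).
  assert (HI : is_RInt (fun t => u x t * cos (INR k * t + ph) - (lam + T k (exp x) t) * cos (INR k * t + ph)) 0 (2 * PI)
      (fourier u k ph x - L * exp x ^ k)).
  { apply (is_RInt_minus (V := R_NormedModule)); [apply (RInt_correct (V := R_CompleteNormedModule)), E1|apply HL]. }
  replace (2 * PI * (K * exp x ^ S k)) with ((2 * PI - 0) * (K * exp x ^ S k)) by ring.
  apply (norm_RInt_le_const (V := R_NormedModule) (fun t => u x t * cos (INR k * t + ph) - (lam + T k (exp x) t) * cos (INR k * t + ph)) 0 (2 * PI) (fourier u k ph x - L * exp x ^ k) (K * exp x ^ S k)); [pose proof PI_RGT_0; lra| |exact HI].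
  intros t _. unfold norm; simpl. unfold abs; simpl.
  rewrite <- Rmult_minus_distr_r, Rabs_mult.
  destruct (Hexp x t Hx1) as [_ He]. fold (u x t) in He.
  pose proof (Rabs_cos_le (INR k * t + ph)). pose proof (Rabs_pos (u x t - (lam + T k (exp x) t))).
  apply Rle_trans with (Rabs (u x t - (lam + T k (exp x) t)) * 1); [apply Rmult_le_compat_l; lra|]. simpl in *; lra. }
assert (HP : 0 < PI) by apply PI_RGT_0.
assert (HB : forall x, x < Rmin (Rmin r0 r1) 0 -> Rabs (fourier u k ph x) <= Rabs L + 2 * PI * K).
{ intros x Hx.
  assert (x < r0) by (eapply Rlt_le_trans; [exact Hx|eapply Rle_trans; [apply Rmin_l|apply Rmin_l]]).
  assert (x < r1) by (eapply Rlt_le_trans; [exact Hx|eapply Rle_trans; [apply Rmin_l|apply Rmin_r]]).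
  assert (x < 0) by (eapply Rlt_le_trans; [exact Hx|apply Rmin_r]).
  specialize (Hclose x H H1).
  assert (He : forall n, 0 <= exp x ^ n <= 1).
  { intros n. assert (0 < exp x < 1) by (split; [apply exp_pos|rewrite <- exp_0; apply exp_increasing; lra]).
    split; [pos|apply pow_le_one; lra]. }
  replace (fourier u k ph x) with ((fourier u k ph x - L * exp x ^ k) + L * exp x ^ k) by ring.
  eapply Rle_trans; [apply Rabs_triang|]. rewrite Rabs_mult, (Rabs_pos_eq (exp x ^ k)) by apply He.
  pose proof (He k). pose proof (He (S k)). pose proof (Rabs_pos L).
  assert (K * exp x ^ S k <= K) by nra. nra. }
assert (Hconst := log_modulus_fourier_const a b M r0 Hpos k ph _ _ HB).
fold u in Hconst.
apply (small_eq _ _ (2 * PI * K) (Rmin r0 r1)); [nra|].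
intros x Hx.
assert (Hx0 : x < r0) by (eapply Rlt_le_trans; [exact Hx|apply Rmin_l]).
assert (Hx1 : x < r1) by (eapply Rlt_le_trans; [exact Hx|apply Rmin_r]).
rewrite (Hconst r x Hr Hx0). specialize (Hclose x Hx0 Hx1).
assert (E : exp x ^ k * exp (- INR k * x) = 1).
{ rewrite <- exp_nat_pow, <- exp_plus. replace (INR k * x + - INR k * x) with 0 by ring. apply exp_0. }
replace (fourier u k ph x * exp (- INR k * x) - L) with ((fourier u k ph x - L * exp x ^ k) * exp (- INR k * x)).
2:{ rewrite Rmult_minus_distr_r, Rmult_assoc, E. ring. }
rewrite Rabs_mult, (Rabs_pos_eq (exp (- INR k * x))) by pos.
apply Rle_trans with (2 * PI * (K * exp x ^ S k) * exp (- INR k * x)).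
{ apply Rmult_le_compat_r; [pos|exact Hclose]. }
simpl pow. right. transitivity (2 * PI * K * exp x * (exp x ^ k * exp (- INR k * x))); [ring|rewrite E; ring].
Qed.

(** For [k >= 1] the constant [A] can be subtracted from [u] without changing the [k]-th Fourier
    coefficient. As [u <= A], the coefficient is at most the integral of [A - u], which is
    [2 PI (A - lam)] by the mean value property. The phases [0] and [PI/2] isolate [p] and [q]. *)
Lemma poly_borel_caratheodory (M k : nat) (r0 r A : R) : (1 <= k <= M)%nat ->
  (forall r t, r < r0 -> 0 < pnorm a b M r t) -> r < r0 ->
  (forall t, / 2 * ln (pnorm a b M r t) <= A) ->
  Rabs (p (k - 1)%nat) <= 2 * INR k * (A - lam) * exp (- INR k * r) /\
  Rabs (q (k - 1)%nat) <= 2 * INR k * (A - lam) * exp (- INR k * r).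
Proof.
intros Hk Hpos Hr HA.
set (u := fun r t => / 2 * ln (pnorm a b M r t)).
assert (Cu : forall j ph t, continuous (fun t => u r t * cos (INR j * t + ph)) t).
{ intros j ph t. apply (continuous_mult (K := R_AbsRing) (fun t => u r t) (fun t => cos (INR j * t + ph))); [|apply continuous_cos_lin].
  unfold u. specialize (Hpos r t Hr). unfold pnorm in *.
  eapply continuous_is_derive. auto_derive; [|reflexivity].
  repeat split; [eexists; apply pol_dt|eexists; apply pol_dt|]. simpl in *. lra. }
assert (U0 : is_RInt (fun t => u r t) 0 (2 * PI) (2 * PI * lam)).
{ assert (F0 := fourier_limit M 0 r0 0 (2 * PI * lam) ltac:(lia) Hpos).
  assert (E : fourier u 0 0 r = 2 * PI * lam).
  { rewrite <- (F0 ltac:(intros x; evar_last; [apply is_RInt_T0|simpl; ring]) r Hr). fold u. simpl INR.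
    replace (- 0 * r) with 0 by ring. rewrite exp_0. ring. }
  rewrite <- E. apply (is_RInt_ext_R (fun t => u r t * cos (INR 0 * t + 0))).
  - intros t. simpl. replace (0 * t + 0) with 0 by ring. rewrite cos_0; ring.
  - apply (RInt_correct (V := R_CompleteNormedModule)), ex_RInt_cont. intros; apply Cu. }
assert (HkR : 0 < INR k) by pos.
assert (Key : forall ph, Rabs (p (k - 1)%nat * cos ph + q (k - 1)%nat * sin ph)
          <= 2 * INR k * (A - lam) * exp (- INR k * r)).
{ intros ph. set (w := p (k - 1)%nat * cos ph + q (k - 1)%nat * sin ph).
  assert (Fk := fourier_limit M k r0 ph (PI * w / INR k) ltac:(lia) Hpos).
  specialize (Fk ltac:(intros x; evar_last; [apply (is_RInt_T k k x ph); lia|rewrite Nat.eqb_refl; unfold w; ring]) r Hr).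
  fold u in Fk.
  assert (HI : is_RInt (fun t => u r t * cos (INR k * t + ph) + - A * cos (INR k * t + ph)) 0 (2 * PI) (fourier u k ph r)).
  { evar_last; [apply is_RInt_plus_R; [apply (RInt_correct (V := R_CompleteNormedModule)), ex_RInt_cont; intros; apply Cu|
      apply is_RInt_scal_R, is_RInt_cos_nat; lia]|]. unfold fourier. ring. }
  assert (HJ : is_RInt (fun t => A + -1 * u r t) 0 (2 * PI) (2 * PI * A + -1 * (2 * PI * lam))).
  { evar_last; [apply is_RInt_plus_R; [apply is_RInt_const_R|apply is_RInt_scal_R, U0]|]. ring. }
  assert (HF : Rabs (fourier u k ph r) <= 2 * PI * A + -1 * (2 * PI * lam)).
  { apply (norm_RInt_le (V := R_NormedModule) (fun t => u r t * cos (INR k * t + ph) + - A * cos (INR k * t + ph)) (fun t => A + -1 * u r t) 0 (2 * PI)); [pose proof PI_RGT_0; lra| |exact HI|exact HJ].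
    intros t _. unfold norm; simpl. unfold abs; simpl.
    rewrite <- Rmult_plus_distr_r, Rabs_mult. specialize (HA t). fold (u r t) in HA.
    pose proof (Rabs_cos_le (INR k * t + ph)).
    rewrite (Rabs_left1 (u r t + - A)) by lra.
    assert (X : (A - u r t) * Rabs (cos (INR k * t + ph)) <= (A - u r t) * 1) by (apply Rmult_le_compat_l; lra). lra. }
  assert (Ew : w = fourier u k ph r * exp (- INR k * r) * INR k / PI).
  { rewrite Fk. field. pose proof PI_RGT_0; split; lra. }
  rewrite Ew. unfold Rdiv. rewrite !Rabs_mult.
  rewrite (Rabs_pos_eq (exp (- INR k * r))) by pos.
  rewrite (Rabs_pos_eq (INR k)) by lra.
  assert (HPi : 0 < / PI) by (apply Rinv_0_lt_compat, PI_RGT_0).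
  rewrite (Rabs_pos_eq (/ PI)) by lra.
  apply Rle_trans with ((2 * PI * A + -1 * (2 * PI * lam)) * exp (- INR k * r) * INR k * / PI).
  - apply Rmult_le_compat_r; [lra|]. apply Rmult_le_compat_r; [lra|]. apply Rmult_le_compat_r; [pos|exact HF].
  - right. field. pose proof PI_RGT_0; lra. }
split.
- specialize (Key 0). rewrite cos_0, sin_0 in Key. replace (p (k - 1)%nat) with (p (k - 1)%nat * 1 + q (k - 1)%nat * 0) by ring. exact Key.
- specialize (Key (PI / 2)). rewrite cos_PI2, sin_PI2 in Key. replace (q (k - 1)%nat) with (p (k - 1)%nat * 0 + q (k - 1)%nat * 1) by ring. exact Key.
Qed.

End BorelCaratheodory.

(** * Power series without zeros in a disk *)

Lemma rot_shift (a b : nat -> R) (t : R) (k : nat) (m : nat) :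
  rot a b (t + 2 * INR k * PI) m = rot a b t m.
Proof.
unfold rot. replace (INR m * (t + 2 * INR k * PI)) with (INR m * t + 2 * INR (m * k) * PI) by (rewrite mult_INR; ring).
rewrite cos_period, sin_period. reflexivity.
Qed.

Lemma angle_reduction (t : R) : exists t0 k, 0 <= t0 <= 2 * PI /\
  (t = t0 + 2 * INR k * PI \/ t0 = t + 2 * INR k * PI).
Proof.
pose proof PI_RGT_0 as HP.
set (y := t / (2 * PI)). destruct (base_Int_part y) as [H1 H2].
set (z := Int_part y) in *.
assert (Ht : t = y * (2 * PI)) by (unfold y; field; lra).
destruct (Z_le_gt_dec 0 z) as [Hz|Hz].
- exists (t - 2 * INR (Z.to_nat z) * PI), (Z.to_nat z).
  rewrite INR_IZR_INZ, Z2Nat.id by lia. split; [|left; ring]. rewrite Ht. nra.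
- exists (t + 2 * INR (Z.to_nat (- z)) * PI), (Z.to_nat (- z)).
  rewrite INR_IZR_INZ, Z2Nat.id by lia. split; [|right; ring]. rewrite opp_IZR, Ht. nra.
Qed.

Lemma pow_cont2 (m : nat) (x t : R) : continuity_2d_pt (fun x _ => x ^ m) x t.
Proof.
apply (continuity_1d_2d_pt_comp (fun y => y ^ m) (fun x _ => x)); [|apply continuity_2d_pt_id1].
apply derivable_continuous_pt, derivable_pt_pow.
Qed.

Lemma rot_PSeries_cont2 (a b : nat -> R) (C R1 x t : R) :
  0 < R1 -> 0 <= C -> geom_bound a C R1 -> geom_bound b C R1 -> Rabs x < R1 ->
  continuity_2d_pt (fun x t => PSeries (rot a b t) x) x t.
Proof.
intros HR HC Ha Hb Hx eps.
set (x2 := (Rabs x + R1) / 2). assert (Hx2 : 0 < x2 < R1) by (unfold x2; pose proof (Rabs_pos x); lra).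
assert (Hq : 0 <= x2 / R1 < 1).
{ rewrite <- (Rabs_pos_eq x2) by lra. apply ratio_lt_1; [lra|]. rewrite Rabs_pos_eq; lra. }
pose proof (is_lim_seq_geom_tail (2 * C) (x2 / R1) Hq) as HL.
apply is_lim_seq_spec in HL.
assert (He : 0 < eps / 3) by (destruct eps; simpl; lra).
destruct (HL (mkposreal _ He)) as [M HM]. specialize (HM M (Nat.le_refl M)). simpl in HM.
rewrite Rminus_0_r in HM. apply Rabs_def2 in HM.
assert (Hc : continuity_2d_pt (fun x t => sum_f_R0 (fun m => rot a b t m * x ^ m) M) x t).
{ assert (T : forall m, continuity_2d_pt (fun x t => rot a b t m * x ^ m) x t).
  { intros m. apply continuity_2d_pt_mult; [apply rot_cont2|apply pow_cont2]. }
  clear HM. induction M as [|M IH]; simpl sum_f_R0; [exact (T 0%nat)|].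
  apply continuity_2d_pt_plus; [exact IH|exact (T (S M))]. }
destruct (Hc (mkposreal _ He)) as [d Hd]. simpl in Hd.
assert (Hd2 : 0 < Rmin d (x2 - Rabs x)) by (apply Rmin_glb_lt; [apply cond_pos|unfold x2; lra]).
exists (mkposreal _ Hd2). simpl. intros u v Hu Hv.
assert (Hu1 : Rabs (u - x) < d) by (eapply Rlt_le_trans; [exact Hu|apply Rmin_l]).
assert (Hv1 : Rabs (v - t) < d) by (eapply Rlt_le_trans; [exact Hv|apply Rmin_l]).
assert (Hu2 : Rabs u < x2).
{ assert (Rabs (u - x) < x2 - Rabs x) by (eapply Rlt_le_trans; [exact Hu|apply Rmin_r]).
  pose proof (Rabs_triang (u - x) x). replace (u - x + x) with u in * by ring. lra. }
specialize (Hd u v Hu1 Hv1).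
assert (tail : forall y s, Rabs y <= x2 -> Rabs (PSeries (rot a b s) y - sum_f_R0 (fun m => rot a b s m * y ^ m) M) < eps / 3).
{ intros y s Hy. eapply Rle_lt_trans; [apply (PSeries_geom_tail _ (2 * C) R1 y M HR ltac:(lra) (rot_bound a b C R1 s HR Ha Hb)); lra|].
  eapply Rle_lt_trans; [|apply HM].
  assert (Q1 : Rabs y / R1 <= x2 / R1) by (apply Rmult_le_compat_r; [left; apply Rinv_0_lt_compat|]; lra).
  assert (Q0 : 0 <= Rabs y / R1) by (apply Rmult_le_pos; [apply Rabs_pos|pos]).
  unfold Rdiv at 1 3. apply Rmult_le_compat.
  - apply Rmult_le_pos; [lra|apply pow_le; exact Q0].
  - left; apply Rinv_0_lt_compat; lra.
  - apply Rmult_le_compat_l; [lra|]. apply (pow_incr _ _ (S M)). lra.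
  - apply Rinv_le_contravar; lra. }
assert (T1 := tail u v ltac:(lra)). assert (T2 := tail x t ltac:(unfold x2; lra)).
replace (PSeries (rot a b v) u - PSeries (rot a b t) x) with
  ((PSeries (rot a b v) u - sum_f_R0 (fun m => rot a b v m * u ^ m) M) +
   (sum_f_R0 (fun m => rot a b v m * u ^ m) M - sum_f_R0 (fun m => rot a b t m * x ^ m) M) -
   (PSeries (rot a b t) x - sum_f_R0 (fun m => rot a b t m * x ^ m) M)) by ring.
unfold Rminus at 1. eapply Rle_lt_trans; [apply Rabs_triang|]. rewrite Rabs_Ropp.
eapply Rle_lt_trans; [apply Rplus_le_compat_r, Rabs_triang|]. lra.
Qed.

Lemma positive_inf_rectangle (G : R -> R -> R) (x1 y1 : R) :
  (forall x y, 0 <= x <= x1 -> 0 <= y <= y1 -> continuity_2d_pt G x y /\ 0 < G x y) ->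
  exists e, 0 < e /\ forall x y, 0 <= x <= x1 -> 0 <= y <= y1 -> e <= G x y.
Proof.
intros HG.
assert (Hd : forall x y, exists d : posreal, 0 <= x <= x1 -> 0 <= y <= y1 ->
   forall u v, Rabs (u - x) < d -> Rabs (v - y) < d -> pos d <= G u v).
{ intros x y. destruct (classic (0 <= x <= x1 /\ 0 <= y <= y1)) as [[Hx Hy]|N].
  - destruct (HG x y Hx Hy) as [Hc Hp].
    assert (Hp2 : 0 < G x y / 2) by lra.
    destruct (Hc (mkposreal _ Hp2)) as [d Hd].
    (* One number serves both as radius of the neighbourhood and as lower bound of [G] on it, so the
       uniform value given by [compactness_value_2d] is itself a lower bound. *)
    assert (Hm : 0 < Rmin d (G x y / 2)) by (apply Rmin_glb_lt; [apply cond_pos|lra]).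
    exists (mkposreal _ Hm). simpl. intros _ _ u v Hu Hv.
    assert (X : Rabs (G u v - G x y) < G x y / 2).
    { apply Hd; eapply Rlt_le_trans; [exact Hu|apply Rmin_l|exact Hv|apply Rmin_l]. }
    apply Rabs_def2 in X. eapply Rle_trans; [apply Rmin_r|]. lra.
  - exists (mkposreal 1 Rlt_0_1). tauto. }
pose (delta := fun x y => proj1_sig (constructive_indefinite_description _ (Hd x y))).
assert (Hdelta := fun x y => proj2_sig (constructive_indefinite_description _ (Hd x y))).
destruct (compactness_value_2d 0 x1 0 y1 delta) as [e He].
exists e. split; [apply cond_pos|]. intros x y Hx Hy.
apply NNPP. intros N. apply (He x y Hx Hy). intros (u & v & Hu & Hv & H1 & H2 & H3).
apply N. eapply Rle_trans; [exact H3|]. apply (Hdelta u v Hu Hv); assumption.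
Qed.

Section PowerSeries.
Variables (a b p q : nat -> R) (C0 R1 C rho R0 : R).
Hypothesis HR : 0 < R0 < R1.
Hypothesis HC0 : 0 < C0.
Hypothesis Ba : geom_bound a C0 R1.
Hypothesis Bb : geom_bound b C0 R1.
Hypothesis Hrho : 0 < rho.
Hypothesis HC : 0 <= C.
Hypothesis Bp : geom_bound p C rho.
Hypothesis Bq : geom_bound q C rho.
Hypothesis Ha : forall m, PS_derive a m = PS_mult p a m - PS_mult q b m.
Hypothesis Hb : forall m, PS_derive b m = PS_mult p b m + PS_mult q a m.
Hypothesis NV : forall x t, 0 <= x < R0 ->
  ~ (PSeries (rot a b t) x = 0 /\ PSeries (rot b (oppseq a) t) x = 0).

(** The modulus has a positive minimum on the closed disk of radius [x1], and the truncations
    converge uniformly there. *)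
Lemma truncations_nonzero (x1 : R) : 0 < x1 < R0 ->
  exists M0, forall M, (M0 <= M)%nat -> forall r t, exp r <= x1 -> 0 < pnorm a b M r t.
Proof.
intros Hx1.
set (G := fun x t => PSeries (rot a b t) x * PSeries (rot a b t) x
             + PSeries (rot b (oppseq a) t) x * PSeries (rot b (oppseq a) t) x).
assert (Bna : geom_bound (oppseq a) C0 R1) by (apply geom_bound_opp, Ba).
destruct (positive_inf_rectangle G x1 (2 * PI)) as (e & He & HG).
{ intros x t Hx Ht. split.
  - apply continuity_2d_pt_plus; apply continuity_2d_pt_mult; (apply (rot_PSeries_cont2 _ _ C0 R1); [lra|lra|assumption|assumption|rewrite Rabs_pos_eq; lra]).
  - assert (N := NV x t ltac:(lra)). unfold G.
    destruct (Req_dec (PSeries (rot a b t) x) 0) as [E1|E1]; [|nra].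
    destruct (Req_dec (PSeries (rot b (oppseq a) t) x) 0) as [E2|E2]; [tauto|nra]. }
assert (HG' : forall x t, 0 <= x <= x1 -> e <= G x t).
{ intros x t Hx. destruct (angle_reduction t) as (t0 & k & Ht0 & [E|E]).
  - replace (G x t) with (G x t0); [apply HG; assumption|].
    unfold G. rewrite E. rewrite !(PSeries_ext (rot _ _ (t0 + _)) _ x (rot_shift _ _ _ _)). reflexivity.
  - replace (G x t) with (G x t0); [apply HG; assumption|].
    unfold G. rewrite E. rewrite !(PSeries_ext (rot _ _ (t + _)) _ x (rot_shift _ _ _ _)). reflexivity. }
assert (Hq : 0 <= x1 / R1 < 1).
{ rewrite <- (Rabs_pos_eq x1) by lra. apply ratio_lt_1; [lra|]. rewrite Rabs_pos_eq; lra. }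
pose proof (is_lim_seq_geom_tail (2 * C0) (x1 / R1) Hq) as HL.
apply is_lim_seq_spec in HL.
assert (He2 : 0 < sqrt e / 2) by (pose proof (sqrt_lt_R0 e He); lra).
destruct (HL (mkposreal _ He2)) as [M0 HM]. simpl in HM.
exists M0. intros M HMM r t Hr. specialize (HM M HMM). rewrite Rminus_0_r in HM. apply Rabs_def2 in HM.
set (x := exp r) in *. assert (Hx : 0 < x) by apply exp_pos.
assert (tail : forall f g, geom_bound f C0 R1 -> geom_bound g C0 R1 ->
   Rabs (PSeries (rot f g t) x - pol f g 0 M r t) < sqrt e / 2).
{ intros f g Bf Bg. rewrite (pol_pow 0%nat). fold x.
  eapply Rle_lt_trans; [apply (PSeries_geom_tail _ (2 * C0) R1 x M ltac:(lra) ltac:(lra) (rot_bound f g C0 R1 t ltac:(lra) Bf Bg)); rewrite Rabs_pos_eq; lra|].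
  eapply Rle_lt_trans; [|apply HM]. rewrite Rabs_pos_eq by lra.
  assert (Q1 : x / R1 <= x1 / R1) by (apply Rmult_le_compat_r; [left; apply Rinv_0_lt_compat|]; lra).
  assert (Q0 : 0 <= x / R1) by pos.
  unfold Rdiv at 1 3. apply Rmult_le_compat.
  - apply Rmult_le_pos; [lra|apply pow_le; exact Q0].
  - left; apply Rinv_0_lt_compat; lra.
  - apply Rmult_le_compat_l; [lra|]. apply (pow_incr _ _ (S M)). lra.
  - apply Rinv_le_contravar; lra. }
assert (T1 := tail a b Ba Bb). assert (T2 := tail b (oppseq a) Bb Bna).
specialize (HG' x t ltac:(lra)). unfold G in HG'.
unfold pnorm.
set (A := PSeries (rot a b t) x) in *. set (B := PSeries (rot b (oppseq a) t) x) in *.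
set (A' := pol a b 0 M r t) in *. set (B' := pol b (oppseq a) 0 M r t) in *.
destruct (Req_dec A' 0) as [E1|E1]; [|nra]. destruct (Req_dec B' 0) as [E2|E2]; [|nra].
exfalso. rewrite E1, Rminus_0_r in T1. rewrite E2, Rminus_0_r in T2.
assert (S := sqrt_sqrt e ltac:(lra)). set (s := sqrt e) in *.
apply Rabs_def2 in T1. apply Rabs_def2 in T2. nra.
Qed.

Lemma pow_bound_limit (c B : R) (k : nat) : 0 <= c ->
  (forall x, 0 < x < R0 -> c * x ^ k <= B) -> c * R0 ^ k <= B.
Proof.
intros Hc H. apply (is_lim_seq_le (fun n => c * (R0 * (1 - / INR (S (S n)))) ^ k) (fun _ => B) (c * R0 ^ k) B).
- intros n. apply H.
  assert (0 < / INR (S (S n)) < 1).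
  { assert (1 < INR (S (S n))) by (rewrite !S_INR; pose proof (pos_INR n); lra).
    split; [pos|]. rewrite <- Rinv_1. apply Rinv_lt_contravar; lra. }
  destruct HR. split; nra.
- apply (is_lim_seq_continuous (fun x => c * x ^ k) (fun n => R0 * (1 - / INR (S (S n)))) R0).
  + apply derivable_continuous_pt. apply derivable_pt_scal. apply derivable_pt_pow.
  + replace (Finite R0) with (Rbar_mult (Finite R0) (Finite (1 - 0))) by (simpl; f_equal; ring).
    apply is_lim_seq_scal_l. apply is_lim_seq_minus'; [apply is_lim_seq_const|].
    apply (is_lim_seq_incr_1 (fun n => / INR (S n))). apply (is_lim_seq_incr_1 (fun n => / INR n)).
    evar_last; [apply is_lim_seq_inv; [apply is_lim_seq_INR|discriminate]|reflexivity].
- apply is_lim_seq_const.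
Qed.

(** The radius [rho] on which the logarithmic derivative is known to converge may be small.
    Borel-Caratheodory for zero-free truncations, on circles tending to radius [R0], yields the
    Cauchy estimate at the full radius [R0]. The first logarithm in [A] bounds the log modulus on
    that disk through the larger radius [R1]. *)
Theorem log_derivative_coef_bound (j : nat) : 0 < a 0%nat ^ 2 + b 0%nat ^ 2 ->
  let A := ln (4 * C0 * R1 / (R1 - R0)) - / 2 * ln (a 0%nat ^ 2 + b 0%nat ^ 2) in
  Rabs (p j) <= 2 * INR (S j) * A / R0 ^ S j /\ Rabs (q j) <= 2 * INR (S j) * A / R0 ^ S j.
Proof.
intros H0 A.
set (rho' := Rmin rho R1). set (C' := Rmax C C0).
assert (Hrho' : 0 < rho') by (apply Rmin_glb_lt; lra).
assert (HC' : 0 <= C') by (eapply Rle_trans; [exact HC|apply Rmax_l]).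
assert (W : forall f K r', 0 <= K <= C' -> rho' <= r' -> geom_bound f K r' -> geom_bound f C' rho').
{ intros f K r' HK Hr Hf m. eapply Rle_trans; [apply Hf|].
  unfold Rdiv. apply Rmult_le_compat; [lra|pos|lra|].
  apply Rinv_le_contravar; [pos|apply pow_incr; lra]. }
assert (HCC : 0 <= C0 <= C') by (split; [lra|apply Rmax_r]).
assert (HCC2 : 0 <= C <= C') by (split; [lra|apply Rmax_l]).
assert (Ba' : geom_bound a C' rho') by (apply (W a C0 R1); [exact HCC|apply Rmin_r|exact Ba]).
assert (Bb' : geom_bound b C' rho') by (apply (W b C0 R1); [exact HCC|apply Rmin_r|exact Bb]).
assert (Bp' : geom_bound p C' rho') by (apply (W p C rho); [exact HCC2|apply Rmin_l|exact Bp]).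
assert (Bq' : geom_bound q C' rho') by (apply (W q C rho); [exact HCC2|apply Rmin_l|exact Bq]).
assert (Key : forall x, 0 < x < R0 ->
   Rabs (p j) * x ^ S j <= 2 * INR (S j) * A /\ Rabs (q j) * x ^ S j <= 2 * INR (S j) * A).
{ intros x Hx. set (x1 := (x + R0) / 2). assert (Hx1 : x < x1 < R0) by (unfold x1; lra).
  destruct (truncations_nonzero x1 ltac:(lra)) as [M0 HM0].
  set (M := Nat.max M0 (S j)).
  assert (Hpos : forall r t, r < ln x1 -> 0 < pnorm a b M r t).
  { intros r t Hr. apply HM0; [unfold M; lia|]. rewrite <- (exp_ln x1) by lra. left; apply exp_increasing, Hr. }
  set (r := ln x). assert (Er : exp r = x) by (apply exp_ln; lra).
  assert (Hr : r < ln x1) by (apply ln_increasing; lra).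
  assert (HA : forall t, / 2 * ln (pnorm a b M r t) <= ln (4 * C0 * R1 / (R1 - R0))).
  { intros t. set (D := 2 * C0 * R1 / (R1 - R0)).
    assert (HD : 0 < D) by (apply Rdiv_lt_0_compat; [|lra]; pos).
    assert (bd : forall f g, geom_bound f C0 R1 -> geom_bound g C0 R1 -> Rabs (pol f g 0 M r t) <= D).
    { intros f g Bf Bg. rewrite (pol_pow 0%nat), Er.
      eapply Rle_trans; [apply (sum_geom_bound _ (2 * C0) R1 x M ltac:(lra) ltac:(lra) (rot_bound f g C0 R1 t ltac:(lra) Bf Bg)); rewrite Rabs_pos_eq; lra|].
      rewrite Rabs_pos_eq by lra. unfold D.
      replace (2 * C0 / (1 - x / R1)) with (2 * C0 * R1 / (R1 - x)) by (field; lra).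
      unfold Rdiv. apply Rmult_le_compat_l; [pos|]. apply Rinv_le_contravar; lra. }
    assert (D1 := bd a b Ba Bb). assert (D2 := bd b (oppseq a) Bb (geom_bound_opp _ _ _ Ba)).
    assert (HN : pnorm a b M r t <= (2 * D) ^ 2).
    { unfold pnorm.
      rewrite <- (pow2_abs (pol a b 0 M r t)), <- (pow2_abs (pol b (oppseq a) 0 M r t)).
      assert (Rabs (pol a b 0 M r t) ^ 2 <= D ^ 2) by (apply pow_incr; split; [apply Rabs_pos|exact D1]).
      assert (Rabs (pol b (oppseq a) 0 M r t) ^ 2 <= D ^ 2) by (apply pow_incr; split; [apply Rabs_pos|exact D2]).
      simpl in *. nra. }
    replace (4 * C0 * R1 / (R1 - R0)) with (2 * D) by (unfold D; field; lra).
    apply Rle_trans with (/ 2 * ln ((2 * D) ^ 2)).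
    - apply Rmult_le_compat_l; [lra|]. apply ln_le; [apply Hpos, Hr|exact HN].
    - rewrite ln_pow by lra. simpl INR. lra. }
  assert (BC := poly_borel_caratheodory a b p q C' rho' Hrho' HC' Ba' Bb' Bp' Bq' Ha Hb H0
     M (S j) (ln x1) r _ ltac:(unfold M; lia) Hpos Hr HA).
  replace (S j - 1)%nat with j in BC by lia. fold A in BC.
  assert (E : exp (- INR (S j) * r) * x ^ S j = 1).
  { rewrite <- Er, <- exp_nat_pow, <- exp_plus. replace (- INR (S j) * r + INR (S j) * r) with 0 by ring. apply exp_0. }
  assert (Hxp : 0 < x ^ S j) by pos.
  destruct BC as [B1 B2]. split.
  - apply (Rmult_le_compat_r (x ^ S j)) in B1; [|lra]. rewrite Rmult_assoc, E in B1. lra.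
  - apply (Rmult_le_compat_r (x ^ S j)) in B2; [|lra]. rewrite Rmult_assoc, E in B2. lra. }
assert (HRp : 0 < R0 ^ S j) by pos.
split; apply Rmult_le_reg_r with (R0 ^ S j); try exact HRp;
  unfold Rdiv; rewrite (Rmult_assoc _ (/ _)), Rinv_l, Rmult_1_r by lra;
  apply pow_bound_limit; try apply Rabs_pos; intros x Hx; apply (Key x Hx).
Qed.

End PowerSeries.

(** * Taylor coefficients of Dirichlet series *)

(* [S1 f N = f 1 + ... + f N], the indexing of [DS_partial]. *)
Fixpoint S1 (f : nat -> R) (N : nat) : R :=
  match N with O => 0 | S N' => S1 f N' + f N end.

Lemma S1_ext (f g : nat -> R) (N : nat) :
  (forall n, (1 <= n <= N)%nat -> f n = g n) -> S1 f N = S1 g N.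
Proof.
induction N; intros H; simpl; [reflexivity|].
rewrite IHN by (intros; apply H; lia). rewrite H by lia. reflexivity.
Qed.

Lemma S1_plus (f g : nat -> R) (N : nat) : S1 (fun n => f n + g n) N = S1 f N + S1 g N.
Proof. induction N; simpl; [ring|rewrite IHN; ring]. Qed.

Lemma S1_minus (f g : nat -> R) (N : nat) : S1 (fun n => f n - g n) N = S1 f N - S1 g N.
Proof. induction N; simpl; [ring|rewrite IHN; ring]. Qed.

Lemma S1_scal (c : R) (f : nat -> R) (N : nat) : S1 (fun n => c * f n) N = c * S1 f N.
Proof. induction N; simpl; [ring|rewrite IHN; ring]. Qed.

Lemma S1_opp (f : nat -> R) (N : nat) : S1 (fun n => - f n) N = - S1 f N.
Proof. induction N; simpl; [ring|rewrite IHN; ring]. Qed.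

Lemma S1_le (f g : nat -> R) (N : nat) :
  (forall n, (1 <= n <= N)%nat -> f n <= g n) -> S1 f N <= S1 g N.
Proof.
induction N; intros H; simpl; [lra|].
apply Rplus_le_compat; [apply IHN; intros; apply H; lia|apply H; lia].
Qed.

Lemma S1_zero (N : nat) : S1 (fun _ => 0) N = 0.
Proof. induction N; simpl; lra. Qed.

Lemma S1_pos (f : nat -> R) (N : nat) : (forall n, (1 <= n <= N)%nat -> 0 <= f n) -> 0 <= S1 f N.
Proof. intros H. rewrite <- (S1_zero N). apply S1_le. exact H. Qed.

Lemma S1_abs (f : nat -> R) (N : nat) : Rabs (S1 f N) <= S1 (fun n => Rabs (f n)) N.
Proof.
induction N; simpl; [rewrite Rabs_R0; lra|].
eapply Rle_trans; [apply Rabs_triang|lra].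
Qed.

Lemma S1_abs_le (f g : nat -> R) (N : nat) :
  (forall n, (1 <= n <= N)%nat -> Rabs (f n) <= g n) -> Rabs (S1 f N) <= S1 g N.
Proof. intros H. eapply Rle_trans; [apply S1_abs|apply S1_le; exact H]. Qed.

Lemma S1_exchange (f : nat -> nat -> R) (M N : nat) :
  S1 (fun i => S1 (fun j => f i j) M) N = S1 (fun j => S1 (fun i => f i j) N) M.
Proof.
induction N; simpl; [symmetry; apply S1_zero|]. rewrite IHN, <- S1_plus. reflexivity.
Qed.

Lemma S1_mono (f : nat -> R) (M N : nat) : (M <= N)%nat ->
  (forall n, (M < n <= N)%nat -> 0 <= f n) -> S1 f M <= S1 f N.
Proof.
intros H. induction H as [|N H IH]; intros Hf; [lra|]. simpl.
assert (0 <= f (S N)) by (apply Hf; lia). assert (S1 f M <= S1 f N) by (apply IH; intros; apply Hf; lia). lra.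
Qed.

Lemma S1_const (c : R) (N : nat) : S1 (fun _ => c) N = INR N * c.
Proof. induction N; [simpl; ring|]. rewrite S_INR. simpl S1. rewrite IHN. ring. Qed.

Lemma S1_single (f : nat -> R) (k N : nat) : (1 <= k <= N)%nat ->
  (forall n, (1 <= n <= N)%nat -> n <> k -> f n = 0) -> S1 f N = f k.
Proof.
intros Hk H. induction N; [lia|]. simpl.
destruct (Nat.eq_dec k (S N)) as [->|E].
- rewrite (S1_ext f (fun _ => 0) N), S1_zero by (intros; apply H; lia). ring.
- rewrite IHN, (H (S N)) by (try lia; intros; apply H; lia). ring.
Qed.

Lemma S1_conv (f g : nat -> R) (B : R) :
  (forall n, (1 <= n)%nat -> Rabs (f n) <= g n) -> (forall N, S1 g N <= B) ->
  exists l : R, is_lim_seq (S1 f) l.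
Proof.
intros Hf Hg.
assert (mono : forall h, (forall n, (1 <= n)%nat -> 0 <= h n) -> (forall N, S1 h N <= 2 * B) -> ex_finite_lim_seq (S1 h)).
{ intros h Hh HB. apply ex_finite_lim_seq_incr with (2 * B); [|exact HB].
  intros n. simpl. specialize (Hh (S n) ltac:(lia)). lra. }
destruct (mono (fun n => f n + Rabs (f n))) as [l1 H1].
{ intros n _. pose proof (Rle_abs (- f n)). rewrite Rabs_Ropp in H. lra. }
{ intros N. eapply Rle_trans; [|apply Rmult_le_compat_l; [lra|apply (Hg N)]]. rewrite <- S1_scal. apply S1_le.
  intros n Hn. specialize (Hf n ltac:(lia)). pose proof (Rle_abs (f n)). lra. }
destruct (mono (fun n => Rabs (f n))) as [l2 H2].
{ intros n _. apply Rabs_pos. }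
{ intros N. eapply Rle_trans; [|apply Rmult_le_compat_l; [lra|apply (Hg N)]]. rewrite <- S1_scal. apply S1_le.
  intros n Hn. specialize (Hf n ltac:(lia)). pose proof (Rabs_pos (f n)). lra. }
exists (l1 - l2). apply (is_lim_seq_ext (fun N => S1 (fun n => f n + Rabs (f n)) N - S1 (fun n => Rabs (f n)) N)).
- intros N. rewrite <- S1_minus. apply S1_ext. intros; ring.
- apply is_lim_seq_minus'; assumption.
Qed.

(** [real] sends an infinite limit to [0]; the value is meaningful once convergence is known, as in
    [Slim_correct]. *)
Definition Slim (f : nat -> R) : R := real (Lim_seq (S1 f)).

Lemma Slim_correct (f g : nat -> R) (B : R) :
  (forall n, (1 <= n)%nat -> Rabs (f n) <= g n) -> (forall N, S1 g N <= B) ->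
  is_lim_seq (S1 f) (Slim f).
Proof.
intros Hf Hg. destruct (S1_conv f g B Hf Hg) as [l Hl].
unfold Slim. rewrite (is_lim_seq_unique _ _ Hl). exact Hl.
Qed.

(** This is [n^(-s)]. As [ln 0 = 0], its value at [n = 0] is [1], and most estimates hold for all
    [n]. *)
Definition pw (n : nat) (s : R) : R := exp (- s * lg n).

Lemma pw_pos n s : 0 < pw n s. Proof. apply exp_pos. Qed.

Lemma ln_INR_pos n : 0 <= lg n.
Proof.
destruct n as [|n].
- simpl. unfold ln. destruct (Rlt_dec 0 0) as [H|H]; [exfalso; apply (Rlt_irrefl 0 H)|apply Rle_refl].
- rewrite <- ln_1. apply ln_le; [lra|]. rewrite S_INR. pose proof (pos_INR n); lra.
Qed.

Lemma exp_le_compat x y : x <= y -> exp x <= exp y.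
Proof. intros [H|H]; [left; apply exp_increasing, H|rewrite H; lra]. Qed.

Lemma pw_le n s s' : s <= s' -> pw n s' <= pw n s.
Proof. intros H. apply exp_le_compat. pose proof (ln_INR_pos n). nra. Qed.

Lemma pw_plus n s s' : pw n (s + s') = pw n s * pw n s'.
Proof. unfold pw. rewrite <- exp_plus. f_equal. ring. Qed.

Lemma pw_mult m n s : (1 <= m)%nat -> (1 <= n)%nat -> pw (m * n) s = pw m s * pw n s.
Proof.
intros Hm Hn. unfold pw. rewrite mult_INR, ln_mult, <- exp_plus by pos. f_equal. ring.
Qed.

Lemma pw_1 s : pw 1 s = 1.
Proof. unfold pw. simpl. rewrite ln_1, Rmult_0_r. apply exp_0. Qed.

Lemma pw_le_1 n s : 0 <= s -> pw n s <= 1.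
Proof. intros H. unfold pw. rewrite <- exp_0. apply exp_le_compat. pose proof (ln_INR_pos n). nra. Qed.

Lemma pw_one n : (1 <= n)%nat -> pw n 1 = / INR n.
Proof.
intros H. unfold pw. replace (- (1) * lg n) with (- lg n) by ring.
rewrite exp_Ropp, exp_ln by pos. reflexivity.
Qed.

Lemma pw_decr m n s : 0 <= s -> (1 <= m <= n)%nat -> pw n s <= pw m s.
Proof.
intros Hs H. unfold pw. apply exp_le_compat.
assert (lg m <= lg n) by (apply ln_le; [pos|apply le_INR; lia]). nra.
Qed.

Lemma ln_succ_diff n : (1 <= n)%nat -> lg (S n) - lg n <= / INR n.
Proof.
intros H. assert (0 < INR n) by pos.
rewrite S_INR, <- ln_div by lra. eapply Rle_trans; [apply ln_le_minus_1, Rdiv_lt_0_compat; lra|].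
right. field. lra.
Qed.

(** Replaces comparison with an integral: [n^(-s)/s] serves as discrete primitive of [n^(-1-s)]. *)
Lemma pw_telescope n s : 0 < s -> (1 <= n)%nat -> pw (S n) (1 + s) <= / s * (pw n s - pw (S n) s).
Proof.
intros Hs Hn. rewrite pw_plus, pw_one by lia.
assert (HN : 0 < INR n) by pos.
assert (HS : 0 < INR (S n)) by pos.
assert (Hl : / INR (S n) <= lg (S n) - lg n).
{ assert (lg n - lg (S n) <= - / INR (S n)); [|lra].
  rewrite <- ln_div by lra. eapply Rle_trans; [apply ln_le_minus_1, Rdiv_lt_0_compat; lra|].
  right. rewrite S_INR. field. rewrite <- S_INR. lra. }
assert (E : pw n s = pw (S n) s * exp (s * (lg (S n) - lg n))).
{ unfold pw. rewrite <- exp_plus. f_equal. ring. }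
rewrite E. pose proof (pw_pos (S n) s) as Hp.
assert (Hx : 1 + s * / INR (S n) <= exp (s * (lg (S n) - lg n))).
{ eapply Rle_trans; [|apply exp_ineq1_le]. nra. }
assert (0 < / s) by pos.
apply Rle_trans with (/ s * (pw (S n) s * (1 + s * / INR (S n)) - pw (S n) s)).
- right. field. split; lra.
- apply Rmult_le_compat_l; [lra|]. assert (pw (S n) s * (1 + s * / INR (S n)) <= pw (S n) s * exp (s * (lg (S n) - lg n))) by (apply Rmult_le_compat_l; lra). lra.
Qed.

Lemma S1_pw_bound s N : 0 < s -> S1 (fun n => pw n (1 + s)) N <= 1 + / s.
Proof.
intros Hs. assert (0 < / s) by pos.
destruct N as [|N]; [simpl; lra|].
assert (S1 (fun n => pw n (1 + s)) (S N) <= 1 + / s * (1 - pw (S N) s)).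
{ induction N as [|N IH].
  - simpl S1. rewrite !pw_1. lra.
  - change (S1 (fun n => pw n (1 + s)) (S (S N))) with (S1 (fun n => pw n (1 + s)) (S N) + pw (S (S N)) (1 + s)).
    pose proof (pw_telescope (S N) s Hs ltac:(lia)). lra. }
pose proof (pw_pos (S N) s). nra.
Qed.

Lemma S1_tail (f : nat -> R) (s : R) (M N : nat) : 0 < s -> (1 <= M <= N)%nat ->
  (forall n, (M < n <= N)%nat -> Rabs (f n) <= pw n (1 + s)) ->
  Rabs (S1 f N - S1 f M) <= / s * pw M s.
Proof.
intros Hs H Hf. assert (0 < / s) by pos.
assert (X : Rabs (S1 f N - S1 f M) <= / s * (pw M s - pw N s)).
{ destruct H as [HM H]. induction H as [|N H IH].
  - rewrite !Rminus_diag, Rabs_R0. lra.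
  - simpl. replace (S1 f N + f (S N) - S1 f M) with ((S1 f N - S1 f M) + f (S N)) by ring.
    eapply Rle_trans; [apply Rabs_triang|].
    assert (A1 := IH ltac:(intros; apply Hf; lia)). assert (A2 := Hf (S N) ltac:(lia)).
    pose proof (pw_telescope N s Hs ltac:(lia)). lra. }
pose proof (pw_pos N s). nra.
Qed.

Lemma S1_abel (al g : nat -> R) (N : nat) :
  S1 (fun n => al n * g n) (S N) = S1 al (S N) * g (S N) + S1 (fun n => S1 al n * (g n - g (S n))) N.
Proof.
induction N as [|N IH]; [simpl; ring|].
change (S1 (fun n => al n * g n) (S (S N))) with (S1 (fun n => al n * g n) (S N) + al (S (S N)) * g (S (S N))).
rewrite IH.
change (S1 (fun n => S1 al n * (g n - g (S n))) (S N)) with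
  (S1 (fun n => S1 al n * (g n - g (S n))) N + S1 al (S N) * (g (S N) - g (S (S N)))).
change (S1 al (S (S N))) with (S1 al (S N) + al (S (S N))). ring.
Qed.

(** Coefficient of [z^m] in [exp (- (s + z) x)], hence in [n^(-(s+z))] for [x = log n]. [Gp] and
    [Gpp] lower the index by one and two, as differentiation in [x] does. *)
Definition G (s : R) (m : nat) (x : R) : R := exp (- s * x) * ((- x) ^ m / INR (fact m)).
Definition Gp (s : R) (m : nat) (x : R) : R := match m with O => 0 | S m' => G s m' x end.
Definition Gpp (s : R) (m : nat) (x : R) : R := match m with O => 0 | S m' => Gp s m' x end.

Lemma G_derive s m x : is_derive (G s m) x (- s * G s m x - Gp s m x).
Proof.
unfold G, Gp. destruct m as [|m].
- simpl. auto_derive; [exact I|]. field.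
- unfold G. pose proof (INR_fact_neq_0 m). assert (INR (S m) <> 0) by (apply not_0_INR; lia).
  assert (E : INR (fact (S m)) = INR (S m) * INR (fact m)) by (rewrite fact_simpl, mult_INR; reflexivity).
  set (c := INR (fact (S m))) in *. clearbody c. auto_derive; [exact I|]. rewrite E. simpl Nat.pred.
  change (match m with O => 1 | S _ => INR m + 1 end) with (INR (S m)). set (k := INR (S m)) in *. simpl pow. field. split; assumption.
Qed.

Lemma Gp_derive s m x : is_derive (Gp s m) x (- s * Gp s m x - Gpp s m x).
Proof.
destruct m as [|m]; simpl.
- evar_last; [apply (is_derive_const (K := R_AbsRing) (V := R_NormedModule))|]. unfold zero; simpl; ring.
- apply G_derive.
Qed.

(** A single term [(r x)^m / m!] is at most [exp (r x)]. This is a Cauchy estimate at radius [r],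
    uniform in [m], with [s] replaced by [s - r]. *)
Lemma G_bound s m x r : 0 <= r -> 0 <= x -> r ^ m * Rabs (G s m x) <= exp (- (s - r) * x).
Proof.
intros Hr Hx. unfold G. rewrite Rabs_mult, (Rabs_pos_eq (exp _)) by pos.
unfold Rdiv. rewrite Rabs_mult, <- RPow_abs, Rabs_Ropp, (Rabs_pos_eq x) by exact Hx.
rewrite (Rabs_pos_eq (/ _)) by pos.
replace (- (s - r) * x) with (- s * x + r * x) by ring. rewrite exp_plus.
replace (r ^ m * (exp (- s * x) * (x ^ m * / INR (fact m)))) with (exp (- s * x) * ((r * x) ^ m / INR (fact m)))
  by (rewrite Rpow_mult_distr; unfold Rdiv; ring).
apply Rmult_le_compat_l; [pos|]. apply exp_term_le. nra.
Qed.

Lemma Gp_bound s m x r : 0 <= r -> 0 <= x -> r ^ m * Rabs (Gp s m x) <= r * exp (- (s - r) * x).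
Proof.
intros Hr Hx. destruct m as [|m]; simpl.
- rewrite Rabs_R0, Rmult_0_r. pose proof (exp_pos (- (s - r) * x)). nra.
- rewrite Rmult_assoc. apply Rmult_le_compat_l; [exact Hr|]. apply G_bound; assumption.
Qed.

Lemma Gpp_bound s m x r : 0 <= r -> 0 <= x -> r ^ m * Rabs (Gpp s m x) <= r * (r * exp (- (s - r) * x)).
Proof.
intros Hr Hx. destruct m as [|m]; simpl.
- rewrite Rabs_R0, Rmult_0_r. pose proof (exp_pos (- (s - r) * x)).
  apply Rmult_le_pos; [exact Hr|nra].
- rewrite Rmult_assoc. apply Rmult_le_compat_l; [exact Hr|]. apply Gp_bound; assumption.
Qed.

(** Phase [0] gives the real part and phase [PI/2] the imaginary part of the coefficient of [z^m] in
    [n^(-(s+it+z))], as [cos (y + PI/2) = - sin y]. *)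
Definition kern (s t ph : R) (m n : nat) : R := G s m (lg n) * cos (t * lg n + ph).

Lemma kern_bound s t ph m n r : 0 <= r -> r ^ m * Rabs (kern s t ph m n) <= pw n (s - r).
Proof.
intros Hr. unfold kern. rewrite Rabs_mult, <- Rmult_assoc.
pose proof (G_bound s m (lg n) r Hr (ln_INR_pos n)) as HG.
pose proof (Rabs_cos_le (t * lg n + ph)). fold (pw n (s - r)) in HG.
assert (0 <= r ^ m * Rabs (G s m (lg n))) by (apply Rmult_le_pos; [apply pow_le; exact Hr|apply Rabs_pos]).
nra.
Qed.

(* Mean value theorem on [ln n, ln (n+1)], an interval of length at most 1/n. *)
Lemma variation_bound (f f' : R -> R) (c D : R) (n : nat) : (1 <= n)%nat -> 0 <= c -> 0 <= D ->
  (forall x, is_derive f x (f' x)) -> (forall x, 0 <= x -> Rabs (f' x) <= D * exp (- c * x)) ->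
  forall y, lg n <= y <= lg (S n) -> Rabs (f (lg n) - f y) <= D * pw n (1 + c).
Proof.
intros Hn Hc HD Hf Hb y Hy.
destruct (MVT_gen f (lg n) y f') as (x & Hx & E).
- intros; apply Hf.
- intros z _. apply derivable_continuous_pt. exists (f' z). apply is_derive_Reals, Hf.
- rewrite Rabs_minus_sym, E, Rabs_mult.
  rewrite Rmin_left, Rmax_right in Hx by lra.
  pose proof (ln_INR_pos n) as Hl. specialize (Hb x ltac:(lra)).
  rewrite (Rabs_pos_eq (y - _)) by lra.
  pose proof (ln_succ_diff n Hn) as Hd.
  rewrite pw_plus, pw_one by exact Hn.
  assert (exp (- c * x) <= pw n c) by (apply exp_le_compat; nra).
  pose proof (Rabs_pos (f' x)). apply Rle_trans with (D * pw n c * / INR n); [|right; ring].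
  apply Rmult_le_compat; try lra. apply Rle_trans with (D * exp (- c * x)); [exact Hb|apply Rmult_le_compat_l; lra].
Qed.

Lemma kern_variation s t ph m n r : (1 <= n)%nat -> 0 <= r <= s ->
  r ^ m * Rabs (kern s t ph m n - kern s t ph m (S n)) <= (s + Rabs t + r) * pw n (1 + (s - r)).
Proof.
intros Hn Hr.
set (f := fun x => r ^ m * (G s m x * cos (t * x + ph))).
assert (H := variation_bound f (fun x => r ^ m * ((- s * G s m x - Gp s m x) * cos (t * x + ph) - t * G s m x * sin (t * x + ph)))
   (s - r) (s + Rabs t + r) n Hn ltac:(lra) ltac:(pose proof (Rabs_pos t); lra)).
assert (Hrm : 0 <= r ^ m) by pos.
replace (r ^ m * Rabs (kern s t ph m n - kern s t ph m (S n))) with (Rabs (f (lg n) - f (lg (S n)))).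
2:{ unfold f, kern. rewrite <- Rmult_minus_distr_l, Rabs_mult, (Rabs_pos_eq (r ^ m)) by exact Hrm. reflexivity. }
apply H; [| |split; [|lra]].
- intros x. unfold f. apply is_derive_scal. evar_last.
  { apply (is_derive_mult (G s m) (fun x => cos (t * x + ph)) x (- s * G s m x - Gp s m x) (- t * sin (t * x + ph))); [apply G_derive| |intros; apply Rmult_comm].
    auto_derive; [exact I|ring]. }
  unfold plus, mult; simpl. ring.
- intros x Hx. rewrite Rabs_mult, (Rabs_pos_eq (r ^ m)) by exact Hrm.
  assert (G1 := G_bound s m x r ltac:(lra) Hx). assert (G2 := Gp_bound s m x r ltac:(lra) Hx).
  set (e := exp (- (s - r) * x)) in *.
  pose proof (Rabs_cos_le (t * x + ph)) as Hc. pose proof (Rabs_sin_le (t * x + ph)) as Hs.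
  set (cc := cos (t * x + ph)) in *. set (ss := sin (t * x + ph)) in *.
  set (g := G s m x) in *. set (g' := Gp s m x) in *.
  assert (B : Rabs ((- s * g - g') * cc - t * g * ss) <= s * Rabs g + Rabs g' + Rabs t * Rabs g).
  { unfold Rminus at 1. eapply Rle_trans; [apply Rabs_triang|]. rewrite Rabs_Ropp, !Rabs_mult.
    assert (Rabs (- s * g - g') <= s * Rabs g + Rabs g').
    { unfold Rminus. eapply Rle_trans; [apply Rabs_triang|]. rewrite !Rabs_Ropp, Rabs_mult, Rabs_Ropp, (Rabs_pos_eq s) by lra. lra. }
    pose proof (Rabs_pos (- s * g - g')).
    assert (0 <= Rabs t * Rabs g) by pos.
    assert (Rabs (- s * g - g') * Rabs cc <= Rabs (- s * g - g') * 1) by (apply Rmult_le_compat_l; lra).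
    assert (Rabs t * Rabs g * Rabs ss <= Rabs t * Rabs g * 1) by (apply Rmult_le_compat_l; lra). lra. }
  apply Rle_trans with (r ^ m * (s * Rabs g + Rabs g' + Rabs t * Rabs g)); [apply Rmult_le_compat_l; assumption|].
  replace (r ^ m * (s * Rabs g + Rabs g' + Rabs t * Rabs g)) with ((s + Rabs t) * (r ^ m * Rabs g) + r ^ m * Rabs g') by ring.
  assert ((s + Rabs t) * (r ^ m * Rabs g) <= (s + Rabs t) * e) by (apply Rmult_le_compat_l; [pose proof (Rabs_pos t)|]; lra).
  lra.
- apply ln_le; [pos|apply le_INR; lia].
Qed.

Definition coefN (al : nat -> R) (s t ph : R) (N m : nat) : R := S1 (fun n => al n * kern s t ph m n) N.
Definition coef (al : nat -> R) (s t ph : R) (m : nat) : R := Slim (fun n => al n * kern s t ph m n).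

(** Partial summation against the bounded sums of [al] reaches every radius [r < s], that is the
    half-plane [Re > 0], beyond absolute convergence. *)
Lemma coefN_bound (al : nat -> R) (B s t ph r : R) : (forall N, Rabs (S1 al N) <= B) -> 0 < r < s ->
  forall N, geom_bound (coefN al s t ph N) (B * (1 + (s + Rabs t + r) * (1 + / (s - r)))) r.
Proof.
intros HB Hr N m.
assert (HB0 : 0 <= B) by (eapply Rle_trans; [apply Rabs_pos|apply (HB 0%nat)]).
assert (Hrm : 0 < r ^ m) by pos.
assert (Hi : 0 < / (s - r)) by pos.
assert (Ht := Rabs_pos t).
set (D := s + Rabs t + r). assert (HD : 0 < D) by (unfold D; lra).
apply Rmult_le_reg_l with (r ^ m); [exact Hrm|].
replace (r ^ m * (B * (1 + D * (1 + / (s - r))) / r ^ m)) with (B * (1 + D * (1 + / (s - r)))) by (field; split; lra).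
unfold coefN. destruct N as [|N].
- simpl. rewrite Rabs_R0, Rmult_0_r. apply Rmult_le_pos; [exact HB0|nra].
- rewrite S1_abel.
  apply Rle_trans with (r ^ m * (B * Rabs (kern s t ph m (S N)) + S1 (fun n => B * Rabs (kern s t ph m n - kern s t ph m (S n))) N)).
  { apply Rmult_le_compat_l; [lra|]. eapply Rle_trans; [apply Rabs_triang|]. apply Rplus_le_compat.
    - rewrite Rabs_mult. apply Rmult_le_compat_r; [apply Rabs_pos|apply HB].
    - apply S1_abs_le. intros n _. rewrite Rabs_mult. apply Rmult_le_compat_r; [apply Rabs_pos|apply HB]. }
  rewrite S1_scal.
  replace (r ^ m * (B * Rabs (kern s t ph m (S N)) + B * S1 (fun n => Rabs (kern s t ph m n - kern s t ph m (S n))) N))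
    with (B * (r ^ m * Rabs (kern s t ph m (S N)) + S1 (fun n => r ^ m * Rabs (kern s t ph m n - kern s t ph m (S n))) N))
    by (rewrite S1_scal; ring).
  apply Rmult_le_compat_l; [exact HB0|]. apply Rplus_le_compat.
  + eapply Rle_trans; [apply kern_bound; lra|]. apply pw_le_1; lra.
  + apply Rle_trans with (S1 (fun n => D * pw n (1 + (s - r))) N).
    * apply S1_le. intros n Hn. apply kern_variation; [lia|lra].
    * rewrite S1_scal. apply Rmult_le_compat_l; [lra|]. apply S1_pw_bound; lra.
Qed.

Lemma coef_lim (al : nat -> R) (s t ph : R) (m : nat) : (forall n, Rabs (al n) <= 1) -> 3 <= s ->
  is_lim_seq (fun N => coefN al s t ph N m) (coef al s t ph m).
Proof.
intros Hal Hs. apply (Slim_correct _ (fun n => pw n (1 + 1)) (1 + / 1)).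
- intros n _. rewrite Rabs_mult. specialize (Hal n).
  assert (K := kern_bound s t ph m n 1 ltac:(lra)). rewrite pow1, Rmult_1_l in K.
  assert (P := pw_le n (1 + 1) (s - 1) ltac:(lra)).
  pose proof (Rabs_pos (kern s t ph m n)). nra.
- intros N. apply S1_pw_bound; lra.
Qed.

(* [dval al s t ph N] is the real part of [exp (-i ph) * sum_{n<=N} al(n) n^{-(s+it)}]. *)
Definition dval (al : nat -> R) (s t ph : R) (N : nat) : R :=
  S1 (fun n => al n * (pw n s * cos (t * lg n + ph))) N.

Lemma kern_shift s t ph m n : kern s t (ph + PI / 2) m n = - (G s m (lg n) * sin (t * lg n + ph)).
Proof.
unfold kern. rewrite <- Rplus_assoc, cos_plus, cos_PI2, sin_PI2. ring.
Qed.

Lemma is_series_ext_R (a b : nat -> R) (l : R) : (forall n, a n = b n) -> is_series a l -> is_series b l.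
Proof. intros H. apply (is_series_ext (V := R_NormedModule)). exact H. Qed.

Lemma is_series_0 : is_series (fun _ : nat => 0) 0.
Proof.
apply (filterlim_ext (fun _ => 0)); [|apply filterlim_const].
intros n. rewrite sum_n_const. symmetry; apply Rmult_0_r.
Qed.

Lemma kern_PSeries s t ph n x th :
  is_series (fun m => rot (fun m => kern s t ph m n) (fun m => kern s t (ph + PI / 2) m n) th m * x ^ m)
    (pw n (s + x * cos th) * cos ((t + x * sin th) * lg n + ph)).
Proof.
set (L := lg n). set (y := t * L + ph).
destruct (exp_polar_PSeries th (- L * x)) as [E1 E2].
assert (Rc : forall f, (forall m, Rabs (f m) <= 1) -> ex_series (fun m => f m / INR (fact m) * (- L * x) ^ m)).
{ intros f Hf. apply (ex_series_Rabs), CV_disk_inside.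
  apply (geom_bound_radius _ (exp (Rabs (- L * x) + 1)) (Rabs (- L * x) + 1)); [pose proof (Rabs_pos (- L * x)); lra| |lra].
  apply inv_fact_bound; [pose proof (Rabs_pos (- L * x)); lra|exact Hf]. }
assert (S1' : is_series (fun m => exp_cos th m * (- L * x) ^ m) (PSeries (exp_cos th) (- L * x))).
{ apply Series_correct. apply (Rc (fun m => cos (INR m * th))). intros; apply Rabs_cos_le. }
assert (S2' : is_series (fun m => exp_sin th m * (- L * x) ^ m) (PSeries (exp_sin th) (- L * x))).
{ apply Series_correct. apply (Rc (fun m => sin (INR m * th))). intros; apply Rabs_sin_le. }
rewrite E1 in S1'. rewrite E2 in S2'.
evar_last.
- apply (is_series_ext_R (fun m => (exp (- s * L) * cos y) * (exp_cos th m * (- L * x) ^ m) +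
      (exp (- s * L) * sin y) * (exp_sin th m * (- L * x) ^ m))).
  + intros m. unfold rot. rewrite kern_shift. unfold kern, G, exp_cos, exp_sin. fold L y.
    rewrite Rpow_mult_distr. unfold Rdiv. ring.
  + apply (is_series_plus (V := R_NormedModule));
    apply (is_series_scal (V := R_NormedModule)); [exact S1'|exact S2'].
- unfold plus, scal; simpl; unfold mult; simpl. unfold pw. fold L.
  replace (- (s + x * cos th) * L) with (- s * L + - L * x * cos th) by ring. rewrite exp_plus.
  replace ((t + x * sin th) * L + ph) with (y - - L * x * sin th) by (unfold y; ring).
  rewrite cos_minus. ring.
Qed.

Lemma dval_PSeries (al : nat -> R) (s t ph x th : R) (N : nat) :
  PSeries (rot (coefN al s t ph N) (coefN al s t (ph + PI / 2) N) th) x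
  = dval al (s + x * cos th) (t + x * sin th) ph N.
Proof.
unfold PSeries. apply is_series_unique. induction N as [|N IH].
- apply (is_series_ext_R (fun _ => 0)); [intros; unfold rot, coefN; simpl; ring|].
  apply is_series_0.
- unfold dval. simpl S1. fold (dval al (s + x * cos th) (t + x * sin th) ph N).
  apply (is_series_ext_R (fun m => rot (coefN al s t ph N) (coefN al s t (ph + PI / 2) N) th m * x ^ m +
     al (S N) * (rot (fun m => kern s t ph m (S N)) (fun m => kern s t (ph + PI / 2) m (S N)) th m * x ^ m))).
  + intros m. unfold rot, coefN. simpl S1. ring.
  + apply (is_series_plus (V := R_NormedModule)); [exact IH|].
    apply (is_series_scal (V := R_NormedModule)), kern_PSeries.
Qed.

(** * The von Mangoldt function *)

Module VonMangoldt.
Import structures ssreflect ssrfun ssrbool eqtype ssrnat seq div fintype bigop prime.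
Local Open Scope nat_scope.

Lemma prime_natP (p : nat) : Znumtheory.prime (Z.of_nat p) <-> prime.prime p.
Proof.
split.
- move/prime_alt => [H1 H2]. apply/primeP; split; first by apply/ltP; lia.
move=> d /dvdnP[k]; rewrite -multE => Ek; rewrite /= .
have Hd0 : d <> 0 by move=> E; lia.
case: (Nat.eq_dec d 1) => [->|N1]; first by rewrite eqxx.
case: (Nat.eq_dec d p) => [->|N2]; first by rewrite eqxx orbT.
exfalso; apply: (H2 (Z.of_nat d)).
+ have k0 : k <> 0 by move=> E; rewrite E in Ek; lia.
  nia.
+ by exists (Z.of_nat k); lia.
- move=> Hp; apply/prime_alt; split; first by move/prime_gt1/ltP: Hp; lia.
move=> n Hn [k Ek].
have Hd : Z.to_nat n %| p.
  apply/dvdnP; exists (Z.to_nat k); rewrite -multE.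
  have : (0 <= k)%Z by nia.
  by move=> Hk; rewrite -Z2Nat.inj_mul; lia.
case/primeP: Hp => _ /(_ _ Hd) /orP[/eqP E|/eqP E]; lia.
Qed.

Definition vonM (n : nat) : R := if primes n is [:: p] then lg p else 0%R.

Lemma vonM_prime (p : nat) : Znumtheory.prime (Z.of_nat p) -> vonM p = lg p.
Proof. by move/prime_natP=> Hp; rewrite /vonM primes_prime. Qed.

Lemma vonM_primepow (n : nat) : vonM n <> 0%R ->
  exists p k : nat, [/\ prime.prime p, 0 < k, n = p ^ k & vonM n = lg p].
Proof.
rewrite /vonM. case E: (primes n) => [|p [|q s]] // _.
have Hp : p \in primes n by rewrite E inE.
move: (Hp); rewrite mem_primes => /and3P[pp n0 pn].
exists p, (logn p n); split=> //; first by rewrite logn_gt0.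
by rewrite {1}(prod_prime_decomp n0) prime_decompE E /= big_cons big_nil muln1.
Qed.

Lemma vonM_primepow_nat (n : nat) : vonM n <> 0%R ->
  exists p k : nat, Znumtheory.prime (Z.of_nat p) /\ (1 <= k)%coq_nat /\ n = Nat.pow p k /\ vonM n = lg p.
Proof.
move/vonM_primepow=> [p [k [pp k0 En Ev]]]; exists p, k.
split; first exact/prime_natP. split; first exact/leP. split=> //.
by rewrite En; elim: k {k0 En} => [|k IH] //; rewrite expnS IH.
Qed.

Lemma vonM_pow (p k : nat) : prime.prime p -> 0 < k -> vonM (p ^ k) = lg p.
Proof. by move=> Hp Hk; rewrite /vonM primesX // primes_prime. Qed.

Lemma vonM_ge0 (n : nat) : (0 <= vonM n)%R.
Proof. rewrite /vonM; case: (primes n) => [|p [|q s]]; try lra. exact: ln_INR_pos. Qed.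

Lemma vonM_le_ln (n : nat) : (vonM n <= lg n)%R.
Proof.
case: (Req_dec (vonM n) 0) => [->|/vonM_primepow[p [k [pp k0 -> ->]]]]; first exact: ln_INR_pos.
apply: ln_le; first by apply: lt_0_INR; apply/ltP; exact: prime_gt0.
apply: le_INR; apply/leP. rewrite -{1}(expn1 p). by rewrite leq_exp2l ?prime_gt1.
Qed.

Lemma Rplus_0_l' : left_id 0%R Rplus. Proof. move=> x; exact: Rplus_0_l. Qed.
Lemma Rplus_assoc' : associative Rplus. Proof. move=> x y z; by rewrite Rplus_assoc. Qed.
HB.instance Definition _ := Monoid.isComLaw.Build R 0%R Rplus Rplus_assoc' Rplus_comm Rplus_0_l'.

Lemma S1_big (f : nat -> R) (N : nat) : S1 f N = \big[Rplus/0%R]_(1 <= i < N.+1) f i.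
Proof. by elim: N => [|N IH]; [rewrite big_geq|rewrite big_nat_recr //= -IH]. Qed.

(** Induction along [n = p m] with [p] the least prime factor. A divisor of [n] that does not divide
    [m] contains the full power [p^k] of [p] in [n]; the only prime power among these is [p^k]
    itself, which contributes [log p]. *)
Lemma vonM_divisor_sum_big (n N : nat) : 0 < n <= N ->
  \big[Rplus/0%R]_(1 <= d < N.+1 | d %| n) vonM d = lg n.
Proof.
elim/ltn_ind: n => n IH /andP[n0 nN].
case: (ltngtP n 1) => [|n1|->]; first by case: n n0 {IH nN}.
2:{ rewrite big1_seq ?ln_1 //= => d; rewrite dvdn1 => /andP[/eqP-> _] //. }
move: (pdiv_prime n1) (pdiv_dvd n); move: (pdiv n) => p pp /dvdnP[m Em].
have m0 : 0 < m by move: n0; rewrite Em; case: (m).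
have mn : m < n by rewrite Em -{1}(muln1 m) ltn_pmul2l ?prime_gt1.
have {}IH := IH m mn _. rewrite m0 /= in IH. have {}IH := IH (leq_trans (ltnW mn) nN).
set k := logn p n.
have Ek : k = (logn p m).+1 by rewrite /k Em (lognM p m0 (prime_gt0 pp)) (pfactorK 1 pp) addn1.
have pkn : p ^ k %| n by rewrite pfactor_dvdn.
have pkm : ~~ (p ^ k %| m) by rewrite pfactor_dvdn // Ek -ltnNge.
rewrite (bigID (fun d => d %| m)) /=.
have -> : \big[Rplus/0%R]_(1 <= d < N.+1 | (d %| n) && (d %| m)) vonM d = lg m.
rewrite -IH; apply: eq_bigl => d; case E: (d %| m); rewrite ?andbF ?andbT //.
by rewrite Em dvdn_mulr.
have -> : \big[Rplus/0%R]_(1 <= d < N.+1 | (d %| n) && ~~ (d %| m)) vonM d = lg p.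
have Hin : p ^ k \in index_iota 1 N.+1.
  by rewrite mem_index_iota expn_gt0 prime_gt0 //= ltnS (leq_trans (dvdn_leq n0 pkn) nN).
rewrite big_mkcond (bigD1_seq (p ^ k)) ?iota_uniq //=.
rewrite pkn pkm /= vonM_pow ?Ek // big1 ?Rplus_0_r // => d dk.
case: ifP => // /andP[dn dm].
case: (Req_dec (vonM d) 0) => // /vonM_primepow[q [j [qp j0 Ed _]]].
exfalso; move: dn dm dk; rewrite -?Ek Ed.
have [->|npq] := eqVneq q p.
- rewrite !pfactor_dvdn // -/k Ek -ltnNge => H1 H2.
  have -> : j = (logn p m).+1 by apply/eqP; rewrite eqn_leq H1 H2.
  by rewrite eqxx.
- rewrite Em Gauss_dvdl; first by move=> ->.
  rewrite coprimeXl // prime_coprime // dvdn_prime2 //.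
by rewrite Em mult_INR ln_mult //; apply: lt_0_INR; apply/ltP => //; exact: prime_gt0.
Qed.

Lemma dvdn_mod (d n : nat) : (d %| n) = Nat.eqb (Nat.modulo n d) 0.
Proof.
apply/idP/idP.
- move/dvdnP=> [k ->]. apply/PeanoNat.Nat.eqb_spec. case: d => [|d]; first by rewrite muln0.
by rewrite -multE PeanoNat.Nat.Div0.mod_mul.
- move/PeanoNat.Nat.eqb_spec => H. case: d H => [|d] H; first by move: H => /= ->.
apply/dvdnP. exists (Nat.div n d.+1). rewrite -multE.
have := PeanoNat.Nat.div_mod_eq n d.+1. lia.
Qed.

Lemma vonM_divisor_sum (n N : nat) : (1 <= n)%coq_nat /\ (n <= N)%coq_nat ->
  S1 (fun d => if Nat.eqb (Nat.modulo n d) 0 then vonM d else 0%R) N = lg n.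
Proof.
move=> [/leP H1 /leP H2]. rewrite S1_big -(@vonM_divisor_sum_big n N) ?H1 //.
rewrite [in RHS]big_mkcond. by apply: eq_bigr => d _; rewrite dvdn_mod.
Qed.

(* Multiplication by a unit [a] permutes the residues, so the period sum is [f a] times itself. *)
Lemma period_sum_zero (f : nat -> R) (q a : nat) : 0 < q ->
  (forall m n, f (m * n) = (f m * f n)%R) -> (forall n, f (n + q) = f n) ->
  coprime a q -> f a <> 1%R -> \big[Rplus/0%R]_(i < q) f i = 0%R.
Proof.
move=> q0 fM fP ca fa.
have fmod n : f (n %% q) = f n.
rewrite {2}(divn_eq n q). elim: (n %/ q) => [|k IH]; first by rewrite mul0n add0n.
by rewrite mulSn -addnA addnC fP.
have Hlt (i : 'I_q) : (a * i) %% q < q by rewrite ltn_mod.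
pose h (i : 'I_q) := Ordinal (Hlt i).
have hinj : injective h.
move=> i j /(congr1 val) /= /eqP E. apply: val_inj => /=. apply/eqP.
rewrite -(modn_small (ltn_ord i)) -(modn_small (ltn_ord j)).
move: E; case: (leqP i j) => [le|/ltnW le].
- rewrite eq_sym eqn_mod_dvd ?leq_mul2l ?le ?orbT // -mulnBr Gauss_dvdr 1?coprime_sym //.
  by rewrite [in X in _ -> X]eq_sym eqn_mod_dvd.
- rewrite eqn_mod_dvd ?leq_mul2l ?le ?orbT // -mulnBr Gauss_dvdr 1?coprime_sym //.
  by rewrite eqn_mod_dvd.
have E : \big[Rplus/0%R]_(i < q) f i = (f a * \big[Rplus/0%R]_(i < q) f i)%R.
rewrite {1}(reindex_inj hinj) /=.
apply: (big_rec2 (fun x y => x = (f a * y)%R)); first by rewrite Rmult_0_r.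
by move=> i x y _ ->; rewrite /= fmod fM Rmult_plus_distr_l.
nra.
Qed.

Lemma S1_period_zero (f : nat -> R) (q a : nat) : (1 <= q)%coq_nat ->
  (forall m n, f (m * n)%coq_nat = (f m * f n)%R) -> (forall n, f (n + q)%coq_nat = f n) ->
  Nat.gcd a q = 1 -> f a <> 1%R -> S1 f q = 0%R.
Proof.
move=> /leP q0 fM fP ca fa.
have ca' : coprime a q.
rewrite /coprime. apply/eqP.
have D1 : gcdn a q %| a by exact: dvdn_gcdl. have D2 : gcdn a q %| q by exact: dvdn_gcdr.
case/dvdnP: D1 => u Eu. case/dvdnP: D2 => v Ev.
have : Nat.divide (gcdn a q) (Nat.gcd a q).
  apply: PeanoNat.Nat.gcd_greatest; [exists u|exists v]; rewrite multE; assumption.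
rewrite ca => /PeanoNat.Nat.divide_1_r //.
rewrite S1_big. transitivity (\big[Rplus/0%R]_(i < q) f i); last exact: (@period_sum_zero f q a).
rewrite -(big_mkord xpredT f) /=.
case: q q0 fP {ca ca'} => // q _ fP.
rewrite [RHS]big_nat_recl // [LHS]big_nat_recr //= Rplus_comm.
have -> : f q.+1 = f 0 by rewrite -(fP 0).
by congr Rplus; rewrite big_add1.
Qed.

End VonMangoldt.
Import VonMangoldt.

(** * Quadratic reciprocity *)

Module QuadraticReciprocity.
Import structures all_boot all_order all_algebra all_fingroup all_solvable all_field.
Import GRing.Theory.
Local Open Scope ring_scope.

Lemma modnE (n p : nat) : Nat.modulo n p = (n %% p)%N.
Proof.
case: p => [|p]; first by rewrite modn0.
symmetry; apply: (PeanoNat.Nat.mod_unique _ _ (n %/ p.+1)%N).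
- by apply/ltP; rewrite ltn_mod.
- by rewrite multE plusE mulnC -divn_eq.
Qed.

Section FiniteFieldRoots.
Variable (K : finFieldType).

Lemma finField_prim_root : exists z : K, (#|K|.-1).-primitive_root z.
Proof.
have K1 : (0 < #|K|.-1)%N by rewrite -subn1 subn_gt0 finNzRing_gt1.
have := @has_prim_root K #|K|.-1 [seq x <- enum K | x != 0] K1.
case/(_ _ _ _)/hasP; last by move=> z _ Hz; exists z.
- apply/allP=> x; rewrite mem_filter => /andP[x0 _].
rewrite unity_rootE. apply/eqP. apply: (mulfI x0).
by rewrite -exprS prednK ?mulr1 ?expf_card // (leq_trans _ (finNzRing_gt1 K)).
- by rewrite filter_uniq ?enum_uniq.
- rewrite size_filter. have := count_predC (fun x : K => x == 0) (enum K).
rewrite -cardE. have -> : count (fun x : K => x == 0) (enum K) = 1%N.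
  have := count_uniq_mem 0 (enum_uniq K). by rewrite mem_enum.
by move=> <-; rewrite add1n /= .
Qed.
End FiniteFieldRoots.

Section Legendre.
Variable (p : nat).
Hypothesis (pp : prime.prime p).
Hypothesis (podd : odd p).

Let F := 'F_p.

Lemma two_neq0 (K : fieldType) : p \in [pchar K] -> (1 : K) != -1.
Proof.
move=> ch; rewrite -subr_eq0 opprK -mulr2n -(dvdn_pcharf ch).
apply/negP=> /dvdn_leq => /(_ isT).
case: p pp podd => [|[|[|n]]] //.
Qed.

Lemma half_pred : p.-1 = (p.-1./2 * 2)%N.
Proof. rewrite muln2. case: p pp podd => // n _ /= H. by rewrite even_halfK //; move: H; case: (odd n). Qed.

(** For a primitive root [z] one has [z^((p-1)/2) = -1], so the power is [(-1)^i] when [a = z^i],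
    and the squares are the even exponents. *)
Lemma euler_Fp (a : F) : a != 0 -> a ^+ (p.-1./2) = if [exists x : F, x ^+ 2 == a] then 1 else -1.
Proof.
move=> a0. set h := p.-1./2.
have h0 : (0 < h)%N by rewrite /h; case: p pp podd => [|[|[|n]]] //.
have [z] := finField_prim_root F. rewrite card_Fp // => Hz.
have Fermat (x : F) : x != 0 -> x ^+ p.-1 = 1.
move=> x0; apply: (mulfI x0). rewrite -exprS prednK ?prime_gt0 // mulr1.
by have := expf_card x; rewrite card_Fp.
have Hzh : z ^+ h = -1.
have : (z ^+ h) ^+ 2 == 1 by rewrite -exprM -half_pred (prim_expr_order Hz).
rewrite sqrf_eq1 => /orP[|/eqP //].
rewrite -(prim_order_dvd Hz) => /dvdn_leq => /(_ h0).
rewrite {1}half_pred -/h -{2}(muln1 h) leq_pmul2l //.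
have [i Ei] := prim_rootP Hz (Fermat a a0).
have Ha : a ^+ h = (-1) ^+ i by rewrite Ei -exprM mulnC exprM Hzh.
case: ifP => [/existsP[x /eqP Ex]|/existsP Hn].
- rewrite -Ex -exprM mulnC -half_pred Fermat //.
by apply: contraNneq a0 => x0; rewrite -Ex x0 expr0n.
- rewrite Ha -signr_odd. case E: (odd i) => //=. exfalso; apply: Hn.
exists (z ^+ i./2). by rewrite Ei -exprM muln2 even_halfK ?E.
Qed.

Lemma legendreE (n : nat) :
  legendre p n = if (p %| n)%N then Z0 else if [exists x : F, x ^+ 2 == n%:R] then (Zpos xH) else (Zneg xH).
Proof.
rewrite /legendre !modnE.
have -> : Nat.eqb (n %% p) 0 = (p %| n)%N by rewrite /dvdn; apply/PeanoNat.Nat.eqb_spec/eqP.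
case: ifP => // _. 
suff -> : List.existsb (fun x => Nat.eqb (Nat.modulo (x * x)%coq_nat p) (n %% p)) (List.seq 0 p) = [exists x : F, x ^+ 2 == n%:R] by [].
apply/idP/existsP.
- move/List.existsb_exists => [x [_ /PeanoNat.Nat.eqb_spec]]. rewrite modnE multE => E.
exists x%:R. apply/eqP. rewrite -natrX -mulnn.
by rewrite -(Fp_nat_mod pp (x * x)) E Fp_nat_mod.
- move=> [x /eqP Ex]. apply/List.existsb_exists. exists (nat_of_ord x). split.
+ apply/List.in_seq. split; first by apply/leP.
  apply/ltP. change (0 + p)%coq_nat with p. apply: (leq_trans (ltn_ord x)). by rewrite (Fp_cast pp).
+ apply/PeanoNat.Nat.eqb_spec. rewrite modnE multE mulnn.
  have := congr1 (@nat_of_ord _) Ex. rewrite val_Fp_nat // => <-.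
  by rewrite -val_Fp_nat // natrX natr_Zp.
Qed.

(** Legendre symbols carried into the ring where the Gauss sum lives; in odd characteristic nothing
    is lost on the values [-1], [0], [1] ([sgK_inj]). *)
Definition sgK (K : nzRingType) (z : Z) : K := match z with Z0 => 0 | Zpos _ => 1 | Zneg _ => -1 end.

Lemma legendre_val (n : nat) : [\/ legendre p n = Z0, legendre p n = (Zpos xH) | legendre p n = (Zneg xH)].
Proof. rewrite legendreE; case: ifP => _; [exact: Or31|]. case: ifP => _; [exact: Or32|exact: Or33]. Qed.

Lemma euler_criterion (n : nat) : (n%:R : F) ^+ (p.-1./2) = sgK F (legendre p n).
Proof.
rewrite legendreE. case: ifP => pn.
- have -> : (n%:R : F) = 0 by apply/eqP; rewrite -(dvdn_pcharf (pchar_Fp pp)).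
rewrite expr0n /=. case: p pp podd => [|[|[|m]]] //.
- rewrite euler_Fp; last by rewrite -(dvdn_pcharf (pchar_Fp pp)) pn.
by case: ifP.
Qed.

Lemma sgK_inj (K : fieldType) (y z : Z) : p \in [pchar K] ->
  [\/ y = Z0, y = (Zpos xH) | y = (Zneg xH)] -> [\/ z = Z0, z = (Zpos xH) | z = (Zneg xH)] ->
  sgK K y = sgK K z -> y = z.
Proof.
move=> ch; have N := two_neq0 K ch; have O := oner_neq0 K.
case=> ->; case=> -> //= /eqP; rewrite ?oppr_eq0 ?(eq_sym 0) ?oppr_eq0 ?(negbTE O) ?(negbTE N) // eq_sym (negbTE N) //.
Qed.

Lemma sgK_mul (K : nzRingType) (y z : Z) : sgK K (Z.mul y z) = sgK K y * sgK K z.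
Proof. case: y => [|y|y]; case: z => [|z|z] /=; rewrite ?mulr0 ?mul0r ?mulr1 ?mul1r ?mulrNN ?mulr1 //. Qed.

Lemma legendre_mul (m n : nat) : legendre p (m * n)%coq_nat = Z.mul (legendre p m) (legendre p n).
Proof.
apply: (@sgK_inj F _ _ (pchar_Fp pp)).
- exact: legendre_val.
- by case: (legendre_val m) => ->; case: (legendre_val n) => ->; [apply: Or31|apply: Or31|apply: Or31|apply: Or31|apply: Or32|apply: Or33|apply: Or31|apply: Or33|apply: Or32].
- by rewrite sgK_mul -!euler_criterion multE natrM exprMn.
Qed.

Lemma legendre_nonresidue : exists n : nat, legendre p n = (Zneg xH).
Proof.
have [z] := finField_prim_root F. rewrite card_Fp // => Hz.
exists (nat_of_ord z). apply: (@sgK_inj F _ _ (pchar_Fp pp)); first exact: legendre_val.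
- exact: Or33.
rewrite -euler_criterion natr_Zp /=.
have h0 : (0 < p.-1./2)%N by case: p pp podd => [|[|[|n]]] //.
have : (z ^+ p.-1./2) ^+ 2 == 1 by rewrite -exprM -half_pred (prim_expr_order Hz).
rewrite sqrf_eq1 => /orP[|/eqP //].
rewrite -(prim_order_dvd Hz) => /dvdn_leq => /(_ h0).
by rewrite {1}half_pred -{2}(muln1 (p.-1./2)) leq_pmul2l.
Qed.

End Legendre.

Section Reciprocity.
Variables (p q : nat).
Hypotheses (pp : prime.prime p) (podd : odd p) (qp : prime.prime q) (qodd : odd q) (npq : p != q).

(** The field with [p^(q-1)] elements works because [q] divides [p^(q-1) - 1]. The Gauss sum
    argument then takes place in characteristic [p], where raising to the power [p] is additive. *)
Lemma field_with_root : exists (K : finFieldType) (w : K), p \in [pchar K] /\ q.-primitive_root w.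
Proof.
have q0 : (0 < q.-1)%N by case: q qp => [|[|n]].
have [K ch cK] := pPrimePowerField pp q0.
have [z Hz] := finField_prim_root K.
have dq : (q %| #|K|.-1)%N.
rewrite cK -subn1 -eqn_mod_dvd ?expn_gt0 ?prime_gt0 //.
have cpq : coprime p q by rewrite prime_coprime // dvdn_prime2.
by have := Euler_exp_totient cpq; rewrite totient_prime // => ->.
exists K, (z ^+ (#|K|.-1 %/ q)); split=> //.
have := exp_prim_root Hz (#|K|.-1 %/ q).
have K1 : (0 < #|K|.-1)%N by rewrite -subn1 subn_gt0 finNzRing_gt1.
have [m Em] := dvdnP dq. have m0 : (0 < m)%N by move: K1; rewrite Em; case: (m).
by rewrite Em mulnK ?prime_gt0 // (gcdn_idPl (dvdn_mulr _ (dvdnn m))) mulKn.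
Qed.

Let Q := 'F_q.

Section Gauss.
Variables (K : finFieldType) (w : K).
Hypotheses (ch : p \in [pchar K]) (Hw : q.-primitive_root w).

Let L (a : Q) : K := sgK K (legendre q (nat_of_ord a)).

Lemma Lnat (n : nat) : L (n%:R) = sgK K (legendre q n).
Proof.
rewrite /L. congr sgK. rewrite !legendreE // val_Fp_nat //.
have -> : (q %| n %% q)%N = (q %| n)%N by rewrite /dvdn modn_mod.
by case: ifP => // _; rewrite Fp_nat_mod.
Qed.

Lemma L0 : L 0 = 0. Proof. by rewrite -[0 : Q]/(0%:R) Lnat legendreE // dvdn0. Qed.

Lemma LM (a b : Q) : L (a * b) = L a * L b.
Proof. by rewrite -(natr_Zp a) -(natr_Zp b) -natrM !Lnat -multE legendre_mul // sgK_mul. Qed.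

Lemma Lsq (a : Q) : a != 0 -> L a * L a = 1.
Proof.
move=> a0. rewrite /L legendreE //.
have -> : (q %| a)%N = false.
apply/negbTE. rewrite (dvdn_pcharf (pchar_Fp qp)) natr_Zp //.
by case: ifP => _ /=; rewrite ?mulr1 ?mulrNN ?mulr1.
Qed.

Lemma Lpow (a : Q) : L a ^+ p = L a.
Proof.
rewrite /L; case: (legendre q a) => [|u|u] /=; first by rewrite expr0n; case: p pp.
- by rewrite expr1n.
- by rewrite -signr_odd podd expr1.
Qed.

Definition e (a : Q) : K := w ^+ (nat_of_ord a).
Arguments e : simpl never.

Lemma e0 : e 0 = 1. Proof. by rewrite /e expr0. Qed.

Lemma w_mod (n : nat) : e (n%:R) = w ^+ n.
Proof. by rewrite /e val_Fp_nat // prim_expr_mod. Qed.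

Lemma w_add (a b : Q) : e (a + b) = e a * e b.
Proof. by rewrite {2 3}/e -exprD -[in RHS]w_mod natrD !natr_Zp. Qed.

Lemma sum_w (d : Q) : \sum_(a : Q) e (a * d) = if d == 0 then q%:R else 0.
Proof.
case: eqVneq => [->|d0].
- under eq_bigr do rewrite mulr0 e0. by rewrite sumr_const card_Fp.
- set S := \sum_(a : Q) _.
have E : S = w * S.
  rewrite /S [LHS](reindex_inj (addrI d^-1)) /= [RHS]mulr_sumr; apply: eq_bigr => a _.
  rewrite mulrDl mulVf // w_add. congr (_ * _).
have w1 : w != 1.
  apply/negP=> /eqP E1. have := prim_order_dvd Hw 1. rewrite E1 expr1n eqxx dvdn1.
  by case: q qp => [|[|n]].
apply/eqP. have : (1 - w) * S == 0 by rewrite mulrBl mul1r -E subrr.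
by rewrite mulf_eq0 subr_eq0 eq_sym (negbTE w1).
Qed.

Lemma sum_L : \sum_(a : Q) L a = 0.
Proof.
have [n En] := legendre_nonresidue q qp qodd.
have n0 : (n%:R : Q) != 0.
rewrite -(dvdn_pcharf (pchar_Fp qp)). apply/negP=> H. by move: En; rewrite legendreE // H.
set S := \sum_(a : Q) _.
have E : S = - S.
rewrite /S [LHS](reindex_inj (mulfI n0)) /= -[RHS]sumrN; apply: eq_bigr => a _.
by rewrite LM Lnat En /= mulN1r.
have N := two_neq0 p pp podd K ch.
apply/eqP. have : S *+ 2 == 0 by rewrite mulr2n {1}E addNr.
rewrite -mulr_natl mulf_eq0 => /orP[|//].
by rewrite -[2%:R]/(1 + 1) addr_eq0 (negbTE N).
Qed.

Definition gauss := \sum_(a : Q) L a * e a.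

(** Replacing the second variable by [a c] turns the phase into [a (1 + c)]; orthogonality in [a]
    singles out [c = -1], and the terms missing at [a = 0] sum to zero by [sum_L]. *)
Lemma gauss_sq : gauss ^+ 2 = L (-1) * q%:R.
Proof.
rewrite expr2 {1}/gauss mulr_suml.
have E1 (a : Q) : L a * e a * gauss =
 \sum_(c : Q) (if a == 0 then 0 else L c * e (a * (1 + c))).
case: (eqVneq a 0) => [->|a0]; first by rewrite L0 !mul0r big1.
rewrite /gauss (reindex_inj (mulfI a0)) /= mulr_sumr; apply: eq_bigr => c _.
rewrite LM mulrDr mulr1 w_add mulrACA. congr (_ * _). by rewrite mulrA Lsq // mul1r.
under eq_bigr do rewrite E1.
rewrite exchange_big /=.
have E2 (c : Q) : \sum_(a : Q) (if a == 0 then 0 else L c * e (a * (1 + c))) =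
 L c * (if 1 + c == 0 then q%:R else 0) - L c.
rewrite -sum_w [in LHS](bigD1 (0 : Q)) //= [in RHS](bigD1 (0 : Q)) //= ?eqxx add0r mul0r e0 mulrDr mulr1 addrAC subrr add0r.
rewrite mulr_sumr; apply: eq_bigr => a /negbTE -> //.
under eq_bigr do rewrite E2.
rewrite sumrB sum_L subr0 (bigD1 (-1)) //= subrr eqxx big1 ?addr0 // => c Hc.
rewrite addrC addr_eq0 (negbTE Hc) mulr0 //.
Qed.

Lemma gauss_pow : gauss ^+ p = L p%:R * gauss.
Proof.
rewrite -(pFrobenius_autE ch) /gauss rmorph_sum /= mulr_sumr.
have p0 : (p%:R : Q) != 0.
by rewrite -(dvdn_pcharf (pchar_Fp qp)) dvdn_prime2 // eq_sym.
rewrite [in RHS](reindex_inj (mulfI p0)) /=. apply: eq_bigr => a _.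
rewrite LM mulrA mulrA Lsq // mul1r rmorphM /= !pFrobenius_autE Lpow. congr (_ * _).
by rewrite /e -exprM -/(e (p%:R * a)) -[in RHS](natr_Zp a) -natrM w_mod mulnC.
Qed.

(** Two evaluations of [gauss ^+ p.-1]: Frobenius ([gauss_pow]) gives the symbol of [p] modulo [q],
    while [gauss_sq] raised to the power [(p-1)/2] gives the right side by Euler's criterion. *)
Lemma reciprocity_in_K : sgK K (legendre q p) = (L (-1)) ^+ (p.-1./2) * sgK K (legendre p q).
Proof.
have q0 : (q%:R : K) != 0 by rewrite -(dvdn_pcharf ch) dvdn_prime2.
have L1 : L (-1) != 0.
have : L (-1) * L (-1) = 1 by apply: Lsq; rewrite oppr_eq0 oner_neq0.
by move=> H; apply/eqP => E; move: H; rewrite E mul0r => /eqP; rewrite eq_sym oner_eq0.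
have g0 : gauss != 0.
apply/eqP=> E. have := gauss_sq. rewrite E expr0n /= => /eqP. by rewrite eq_sym mulf_eq0 (negbTE L1) (negbTE q0).
have Eg : gauss ^+ p.-1 = L p%:R.
apply: (mulIf g0). by rewrite -exprSr prednK ?prime_gt0 // gauss_pow.
rewrite -Lnat -Eg {1}(half_pred p pp podd) mulnC exprM gauss_sq exprMn. congr (_ * _).
have H := euler_criterion p pp podd q.
(* Euler's criterion is known in ['F_p]; a congruence of integers modulo [p] persists in [K], which
   has characteristic [p]. *)
have transfer (m n : nat) : (m%:R : 'F_p) = n%:R -> (m%:R : K) = n%:R.
move=> E. have := congr1 (@nat_of_ord _) E. rewrite !val_Fp_nat // => E'.
by rewrite -(GRing.natr_mod_pchar ch m) E' GRing.natr_mod_pchar.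
move: H; rewrite -!natrX.
case: (legendre_val p pp q) => -> /= H.
- by rewrite (transfer _ 0%N H).
- by rewrite (transfer _ 1%N H).
- apply/eqP. rewrite -subr_eq0 opprK. apply/eqP.
have := transfer (q ^ p.-1./2 + 1)%N 0%N. rewrite !natrD => -> //. by rewrite H addNr.
Qed.

End Gauss.

Lemma quadratic_reciprocity :
  legendre q p = if (p %% 4 == 3)%N && (q %% 4 == 3)%N then Z.opp (legendre p q) else legendre p q.
Proof.
have [K [w [ch Hw]]] := field_with_root.
have R := reciprocity_in_K K w ch Hw.
have V1 := legendre_val q qp p. have V2 := legendre_val p pp q.
have L1 : sgK K (legendre q (nat_of_ord (-1 : Q))) = (-1) ^+ (q.-1./2).
have E : (nat_of_ord (-1 : Q)) = q.-1.
  have : (-1 : Q) = (q.-1)%:R.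
    apply/eqP. rewrite eq_sym -addr_eq0 -[1 : Q]/(1%:R) -natrD addn1 prednK ?prime_gt0 //.
    by rewrite -(dvdn_pcharf (pchar_Fp qp)).
  move=> ->. rewrite val_Fp_nat // modn_small // prednK ?prime_gt0 //.
have H := euler_criterion q qp qodd q.-1.
have Em : (q.-1%:R : Q) = -1.
  apply/eqP. rewrite -addr_eq0 -[1 : Q]/(1%:R) -natrD addn1 prednK ?prime_gt0 //.
  by rewrite -(dvdn_pcharf (pchar_Fp qp)).
rewrite E. rewrite Em -signr_odd in H. rewrite -signr_odd.
have N := two_neq0 q qp qodd 'F_q (pchar_Fp qp).
case: (legendre_val q qp q.-1) H => ->; case: (odd _) => //= /eqP.
- by rewrite expr1 oppr_eq0 (negbTE (oner_neq0 _)).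
- by rewrite expr1 eq_sym (negbTE N).
- by rewrite expr0 (negbTE N).
rewrite L1 -exprM -signr_odd oddM in R.
have half4 (m : nat) : odd m -> odd (m.-1./2) = (m %% 4 == 3)%N.
move=> om. rewrite {1}(divn_eq m 4). have : (m %% 4 < 4)%N by rewrite ltn_mod.
have : odd (m %% 4) by rewrite odd_mod.
case: (m %% 4)%N => [|[|[|[|]]]] // _ _.
+ rewrite addn1 /= -[4%N]/(2 * 2)%N mulnA muln2 doubleK muln2 odd_double //.
+ rewrite addn3 /= -[4%N]/(2 * 2)%N mulnA muln2 doubleK muln2 /= odd_double //.
rewrite (half4 p podd) (half4 q qodd) andbC in R.
apply: (sgK_inj p pp podd K _ _ ch).
- exact: legendre_val.
- by case: ifP => _ //; case: V2 => -> /=; [apply: Or31|apply: Or33|apply: Or32].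
- rewrite R. case: ifP => _ /=; last by rewrite mul1r.
by case: (legendre p q) => [|u|u] /=; rewrite ?mulr0 ?mulN1r ?opprK ?oppr0.
Qed.

End Reciprocity.

Lemma quadratic_reciprocity_nat (p q : nat) :
  prime.prime p -> odd p -> prime.prime q -> odd q -> p <> q ->
  legendre q p = if Nat.eqb (Nat.modulo p 4) 3 && Nat.eqb (Nat.modulo q 4) 3
    then Z.opp (legendre p q) else legendre p q.
Proof.
move=> pp po qp qo /eqP npq.
have eqbE (a b : nat) : Nat.eqb a b = (a == b) by apply/PeanoNat.Nat.eqb_spec/eqP.
by rewrite !modnE !eqbE quadratic_reciprocity.
Qed.

End QuadraticReciprocity.
Import QuadraticReciprocity.

(** * Real characters *)

Definition odd_prime (p : nat) : Prop := prime (Z.of_nat p) /\ (2 < p)%nat.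

(** Real nonprincipal characters: a real character is nonprincipal exactly when it takes the value
    [-1]. *)
Definition rchar (q : nat) (ch : nat -> R) : Prop :=
  (1 <= q)%nat /\
  (forall m n, ch (m * n)%nat = ch m * ch n) /\
  (forall n, ch (n + q)%nat = ch n) /\
  (forall n, ch n = -1 \/ ch n = 0 \/ ch n = 1) /\
  (forall n, ch n <> 0 <-> Nat.gcd n q = 1%nat) /\
  (exists n, ch n = -1).

Lemma rchar_dirichlet q ch : rchar q ch ->
  dirichlet_char q (fun n => RtoC (ch n)) /\ nonprincipal (fun n => RtoC (ch n)).
Proof.
intros (H1 & H2 & H3 & H4 & H5 & n & Hn). split.
- split; [exact H1|split; [|split]].
  + intros a b. rewrite H2, RtoC_mult. reflexivity.
  + intros a. rewrite H3. reflexivity.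
  + intros a. rewrite <- H5. split; intros H E; apply H.
    * rewrite E; reflexivity.
    * apply (f_equal Re) in E. exact E.
- exists n. rewrite Hn. split; intros E; apply (f_equal Re) in E; simpl in E; lra.
Qed.

Lemma rchar_abs q ch n : rchar q ch -> Rabs (ch n) <= 1.
Proof.
intros (_ & _ & _ & H & _). destruct (H n) as [->|[->| ->]];
[rewrite Rabs_left; lra|rewrite Rabs_R0; lra|rewrite Rabs_R1; lra].
Qed.

Lemma rchar_one q ch : rchar q ch -> ch 1%nat = 1.
Proof.
intros (_ & H2 & _ & _ & H5 & _). specialize (H2 1%nat 1%nat). simpl in H2.
assert (ch 1%nat <> 0) by (apply H5; apply Nat.divide_1_r, Nat.gcd_divide_l). nra.
Qed.

Lemma rchar_sum_bound q ch N : rchar q ch -> Rabs (S1 ch N) <= INR q.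
Proof.
intros HC. pose proof HC as (H1 & H2 & H3 & H4 & H5 & a & Ha).
assert (Hz : S1 ch q = 0).
{ apply (S1_period_zero ch q a); [exact H1|exact H2|exact H3| |rewrite Ha; lra].
  apply H5. rewrite Ha; lra. }
assert (Hsh : forall M, S1 ch (q + M) = S1 ch M).
{ intros M. induction M as [|M IH]; [rewrite Nat.add_0_r; exact Hz|].
  rewrite Nat.add_succ_r. simpl S1. rewrite IH. f_equal.
  replace (S (q + M)) with (S M + q)%nat by lia. apply H3. }
assert (Hk : forall k M, S1 ch (k * q + M) = S1 ch M).
{ induction k as [|k IH]; intros M; [reflexivity|].
  replace (S k * q + M)%nat with (q + (k * q + M))%nat by lia. rewrite Hsh. apply IH. }
rewrite (Nat.div_mod_eq N q), Nat.mul_comm, Hk.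
assert (Hm : (N mod q < q)%nat) by (apply Nat.mod_upper_bound; lia).
eapply Rle_trans; [apply (S1_abs_le _ (fun _ => 1)); intros; eapply rchar_abs; exact HC|].
rewrite S1_const, Rmult_1_r. apply le_INR. lia.
Qed.

Lemma odd_prime_ssr p : odd_prime p -> is_true (prime.prime p) /\ is_true (ssrnat.odd p).
Proof.
intros [Hp H2]. apply prime_natP in Hp. split; [exact Hp|].
destruct (prime.even_prime Hp) as [E|E]; [lia|exact E].
Qed.

Lemma leg_mul p m n : odd_prime p -> legendre p (m * n) = (legendre p m * legendre p n)%Z.
Proof. intros H. destruct (odd_prime_ssr p H) as [H1 H2]. apply legendre_mul; assumption. Qed.

Lemma leg_values p n : legendre p n = (-1)%Z \/ legendre p n = 0%Z \/ legendre p n = 1%Z.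
Proof. unfold legendre. destruct (Nat.eqb _ _); [tauto|]. destruct (existsb _ _); tauto. Qed.

Lemma leg_mod p m n : (m mod p = n mod p)%nat -> legendre p m = legendre p n.
Proof. intros H. unfold legendre. rewrite H. reflexivity. Qed.

Lemma leg_period p n : legendre p (n + p) = legendre p n.
Proof.
apply leg_mod. destruct p as [|p]; [rewrite Nat.add_0_r; reflexivity|].
rewrite <- (Nat.mul_1_l (S p)) at 1. rewrite Nat.Div0.mod_add. reflexivity.
Qed.

Lemma leg_one p : odd_prime p -> legendre p 1 = 1%Z.
Proof.
intros [_ H]. unfold legendre. rewrite (Nat.mod_small 1 p) by lia. simpl Nat.eqb. cbv iota.
replace (existsb _ _) with true; [reflexivity|]. symmetry. apply existsb_exists.
exists 1%nat. split; [apply in_seq; lia|]. rewrite Nat.mod_small by (simpl; lia). reflexivity.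
Qed.

Lemma leg_zero p n : odd_prime p -> legendre p n = 0%Z <-> Nat.divide p n.
Proof.
intros [_ H]. unfold legendre. destruct (Nat.eqb_spec (n mod p) 0) as [E|E].
- split; [intros _; apply Nat.Lcm0.mod_divide; exact E|reflexivity].
- split; [destruct (existsb _ _); discriminate|]. intros D. exfalso. apply E. apply Nat.Lcm0.mod_divide; exact D.
Qed.

Lemma leg_nonresidue p : odd_prime p -> exists n, legendre p n = (-1)%Z.
Proof. intros H. destruct (odd_prime_ssr p H) as [H1 H2]. apply legendre_nonresidue; assumption. Qed.

Lemma leg_reciprocity p q : odd_prime p -> odd_prime q -> p <> q ->
  legendre q p = if (Nat.eqb (p mod 4) 3 && Nat.eqb (q mod 4) 3)%bool then (- legendre p q)%Z else legendre p q.
Proof.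
intros Hp Hq N. destruct (odd_prime_ssr p Hp) as [P1 P2]. destruct (odd_prime_ssr q Hq) as [Q1 Q2].
apply quadratic_reciprocity_nat; assumption.
Qed.

Lemma prime_not_divide_gcd q n : prime (Z.of_nat q) -> ~ Nat.divide q n <-> Nat.gcd n q = 1%nat.
Proof.
intros Hq. split; intros H.
- assert (D1 := Nat.gcd_divide_l n q). assert (D2 := Nat.gcd_divide_r n q).
  set (g := Nat.gcd n q) in *.
  assert (DZ : (Z.of_nat g | Z.of_nat q)%Z) by (destruct D2 as [k Ek]; exists (Z.of_nat k); lia).
  apply prime_divisors in DZ; [|exact Hq].
  pose proof (prime_ge_2 _ Hq).
  destruct DZ as [E|[E|[E|E]]]; try lia. assert (Eg : g = q) by lia. rewrite Eg in D1. contradiction.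
- intros D. assert (Nat.divide q (Nat.gcd n q)) by (apply Nat.gcd_greatest; [exact D|apply Nat.divide_refl]).
  rewrite H in H0. apply Nat.divide_1_r in H0. subst q. destruct Hq; lia.
Qed.

Lemma gcd_mult_1 n a b : Nat.gcd n (a * b) = 1%nat <-> Nat.gcd n a = 1%nat /\ Nat.gcd n b = 1%nat.
Proof.
split.
- intros H. split; apply Nat.divide_1_r; rewrite <- H; apply Nat.gcd_greatest.
  + apply Nat.gcd_divide_l.
  + eapply Nat.divide_trans; [apply Nat.gcd_divide_r|]. exists b. lia.
  + apply Nat.gcd_divide_l.
  + eapply Nat.divide_trans; [apply Nat.gcd_divide_r|]. exists a. lia.
- intros [Ha Hb]. set (g := Nat.gcd n (a * b)).
  assert (G1 : Nat.divide g n) by apply Nat.gcd_divide_l.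
  assert (G2 : Nat.divide g (a * b)) by apply Nat.gcd_divide_r.
  assert (Ga : Nat.gcd g a = 1%nat).
  { apply Nat.divide_1_r. rewrite <- Ha. apply Nat.gcd_greatest; [|apply Nat.gcd_divide_r].
    eapply Nat.divide_trans; [apply Nat.gcd_divide_l|exact G1]. }
  apply Nat.gauss in G2; [|exact Ga].
  apply Nat.divide_1_r. rewrite <- Hb. apply Nat.gcd_greatest; assumption.
Qed.

(* Quadratic character modulo 4 twisting [legendre q] into the symbol [(q / p)] as a function of [p]. *)
Definition twist4 (q n : nat) : Z :=
  match (n mod 4)%nat with
  | 1%nat => 1%Z
  | 3%nat => if Nat.eqb (q mod 4) 3 then (-1)%Z else 1%Z
  | _ => 0%Z
  end.

Lemma twist4_mul q m n : twist4 q (m * n) = (twist4 q m * twist4 q n)%Z.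
Proof.
unfold twist4. rewrite Nat.Div0.mul_mod.
assert (Hm : (m mod 4 < 4)%nat) by (apply Nat.mod_upper_bound; lia).
assert (Hn : (n mod 4 < 4)%nat) by (apply Nat.mod_upper_bound; lia).
destruct (m mod 4)%nat as [|[|[|[|]]]]; destruct (n mod 4)%nat as [|[|[|[|]]]]; try lia;
destruct (Nat.eqb (q mod 4) 3); reflexivity.
Qed.

Lemma twist4_values q n : twist4 q n = (-1)%Z \/ twist4 q n = 0%Z \/ twist4 q n = 1%Z.
Proof.
unfold twist4. destruct (n mod 4) as [|[|[|[|]]]]; try tauto. destruct (Nat.eqb (q mod 4) 3); tauto.
Qed.

Lemma twist4_zero q n : twist4 q n <> 0%Z <-> Nat.gcd n 4 = 1%nat.
Proof.
unfold twist4. rewrite Nat.gcd_comm, <- Nat.Lcm0.gcd_mod, Nat.gcd_comm.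
assert (Hn : (n mod 4 < 4)%nat) by (apply Nat.mod_upper_bound; lia).
destruct (n mod 4) as [|[|[|[|]]]]; try lia; destruct (Nat.eqb (q mod 4) 3);
split; intros H; first [reflexivity | exfalso; apply H; reflexivity | vm_compute in H; discriminate H | discriminate].
Qed.

(** At an odd prime [n = p] this is [(q/p)] by reciprocity ([psi_prime]), so averages over [p]
    become sums of a character modulo [4 q_1 ... q_k]. The factor [4] is kept for every [q], so the
    character need not be primitive. *)
Definition psi1 (q n : nat) : Z := (legendre q n * twist4 q n)%Z.
Definition psi (I : list nat) (n : nat) : Z := fold_right (fun q z => psi1 q n * z)%Z 1%Z I.
Definition prodl (I : list nat) : nat := fold_right Nat.mul 1%nat I.

Lemma psi_mul I m n : List.Forall odd_prime I -> psi I (m * n) = (psi I m * psi I n)%Z.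
Proof.
induction 1 as [|q I Hq HI IH]; [reflexivity|]. simpl. rewrite IH. unfold psi1.
rewrite leg_mul, twist4_mul by exact Hq. ring.
Qed.

Lemma twist4_period q n k : twist4 q (n + 4 * k) = twist4 q n.
Proof. unfold twist4. rewrite (Nat.mul_comm 4), Nat.Div0.mod_add. reflexivity. Qed.

Lemma leg_period_mul p n k : legendre p (n + p * k) = legendre p n.
Proof.
apply leg_mod. destruct p as [|p]; [rewrite Nat.mul_0_l, Nat.add_0_r; reflexivity|].
rewrite (Nat.mul_comm (S p)), Nat.Div0.mod_add. reflexivity.
Qed.

Lemma psi_period_mul I n k : psi I (n + 4 * prodl I * k) = psi I n.
Proof.
enough (H : forall J m, (exists k', m = 4 * prodl J * k')%nat -> psi J (n + m) = psi J n) by (apply H; exists k; reflexivity).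
induction J as [|q J IH]; intros m [k' Ek]; [reflexivity|]. simpl in *.
rewrite IH by (exists (q * k')%nat; rewrite Ek; ring). f_equal. unfold psi1.
f_equal.
- rewrite <- (leg_period_mul q n (4 * prodl J * k')). f_equal. rewrite Ek. ring.
- rewrite <- (twist4_period q n (q * prodl J * k')). f_equal. rewrite Ek. ring.
Qed.

Lemma psi_values I n : psi I n = (-1)%Z \/ psi I n = 0%Z \/ psi I n = 1%Z.
Proof.
induction I as [|q I IH]; simpl; [tauto|]. unfold psi1.
destruct (leg_values q n) as [->|[->| ->]]; destruct (twist4_values q n) as [->|[->| ->]];
destruct IH as [->|[->| ->]]; simpl; tauto.
Qed.

Lemma psi_zero I n : List.Forall odd_prime I -> I <> nil ->
  psi I n <> 0%Z <-> Nat.gcd n (4 * prodl I) = 1%nat.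
Proof.
intros HI NI.
assert (H : psi I n <> 0%Z <-> (List.Forall (fun q => Nat.gcd n q = 1%nat) I /\ Nat.gcd n 4 = 1%nat)).
{ destruct I as [|q0 I0]; [congruence|]. clear NI.
  assert (H1 : forall q, odd_prime q -> psi1 q n <> 0%Z <-> Nat.gcd n q = 1%nat /\ Nat.gcd n 4 = 1%nat).
  { intros q Hq. unfold psi1. rewrite <- (twist4_zero q n), <- (prime_not_divide_gcd q n) by apply Hq.
    rewrite <- (leg_zero q n Hq). nia. }
  assert (H2 : forall J, List.Forall odd_prime J -> Nat.gcd n 4 = 1%nat -> psi J n <> 0%Z <-> List.Forall (fun q => Nat.gcd n q = 1%nat) J).
  { intros J HJ H4. induction HJ as [|q J Hq HJ IH]; simpl.
    - split; [constructor|discriminate].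
    - rewrite List.Forall_cons_iff, <- IH. specialize (H1 q Hq). nia. }
  inversion HI; subst. simpl. rewrite List.Forall_cons_iff.
  specialize (H1 q0 H3). specialize (H2 I0 H4).
  split.
  - intros H. assert (A : psi1 q0 n <> 0%Z) by nia. assert (B : psi I0 n <> 0%Z) by nia.
    apply H1 in A. destruct A as [A1 A2]. apply (H2 A2) in B. tauto.
  - intros [[A1 A2] A3]. assert (psi I0 n <> 0%Z) by (apply H2; assumption). nia. }
rewrite H, gcd_mult_1. clear H HI NI.
assert (E : List.Forall (fun q => Nat.gcd n q = 1%nat) I <-> Nat.gcd n (prodl I) = 1%nat); [|tauto].
induction I as [|q I IH]; simpl.
- split; [intros _; apply Nat.divide_1_r, Nat.gcd_divide_r|constructor].
- rewrite List.Forall_cons_iff, IH, gcd_mult_1. tauto.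
Qed.

Lemma prime_coprime_4 q : odd_prime q -> Nat.gcd q 4 = 1%nat.
Proof.
intros [Hq H2]. rewrite Nat.gcd_comm. apply prime_not_divide_gcd; [exact Hq|].
intros [k Ek]. assert (k = 0 \/ k = 1 \/ 2 <= k)%nat by lia.
assert (q = 4)%nat by nia. subst q. apply prime_divisors with (a := 2%Z) in Hq; [lia|]. exists 2%Z; reflexivity.
Qed.

Lemma coprime_prodl q I : odd_prime q -> List.Forall odd_prime I -> ~ In q I -> Nat.gcd q (4 * prodl I) = 1%nat.
Proof.
intros Hq HI NI. apply gcd_mult_1. split; [apply prime_coprime_4, Hq|].
induction HI as [|r I Hr HI IH]; simpl; [apply Nat.divide_1_r, Nat.gcd_divide_r|].
apply gcd_mult_1. split; [|apply IH; intros H; apply NI; right; exact H].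
rewrite Nat.gcd_comm. apply prime_not_divide_gcd; [apply Hq|]. intros [k Ek].
assert (D : (Z.of_nat q | Z.of_nat r)%Z) by (exists (Z.of_nat k); lia).
apply prime_divisors in D; [|apply Hr]. destruct Hq as [Hq Hq2]. destruct Hr as [Hr Hr2].
destruct D as [D|[D|[D|D]]]; try lia. apply NI. left. lia.
Qed.

Lemma crt q m r : (1 <= q)%nat -> (1 <= m)%nat -> Nat.gcd q m = 1%nat ->
  exists n : nat, (n mod q = r mod q)%nat /\ exists k, (n = 1 + m * k)%nat.
Proof.
intros Hq Hm H.
destruct (Nat.gcd_bezout_pos m q ltac:(lia)) as (u & v & E). rewrite Nat.gcd_comm, H in E.
(* [r + (q - 1)] stands for [r - 1] modulo [q], avoiding truncated subtraction when [r = 0]. *)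
exists (1 + m * (u * (r + (q - 1))))%nat. split; [|exists (u * (r + (q - 1)))%nat; ring].
replace (1 + m * (u * (r + (q - 1))))%nat with (1 + (u * m) * (r + (q - 1)))%nat by ring.
rewrite E. replace (1 + (1 + v * q) * (r + (q - 1)))%nat with (r + (1 + v * (r + (q - 1))) * q)%nat by nia.
apply Nat.Div0.mod_add.
Qed.

Lemma psi_nonprincipal I : List.Forall odd_prime I -> NoDup I -> I <> nil -> exists n, psi I n = (-1)%Z.
Proof.
intros HI ND NI. destruct I as [|q I]; [congruence|]. inversion HI; subst. inversion ND; subst.
destruct (leg_nonresidue q H1) as [r Hr].
assert (Hpos : forall J, List.Forall odd_prime J -> (1 <= prodl J)%nat).
{ induction 1 as [|x J [_ Hx] HJ IH]; simpl; nia. }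
(* [n] is a nonresidue modulo [q] and [1] modulo [4] and all other primes, so exactly one factor is
   [-1]. *)
destruct (crt q (4 * prodl I) r) as (n & E1 & k & E2).
- destruct H1; lia.
- specialize (Hpos I H2); lia.
- apply coprime_prodl; assumption.
- exists n. simpl. replace (psi I n) with 1%Z.
  + unfold psi1. rewrite (leg_mod q n r E1), Hr.
    replace (twist4 q n) with 1%Z; [reflexivity|].
    rewrite E2. replace (1 + 4 * prodl I * k)%nat with (1 + 4 * (prodl I * k))%nat by ring.
    rewrite twist4_period. reflexivity.
  + rewrite E2, psi_period_mul. clear -H2. induction H2 as [|x J Hx HJ IH]; [reflexivity|].
    simpl. rewrite <- IH. unfold psi1. rewrite leg_one by exact Hx. reflexivity.
Qed.

Theorem psi_rchar I : List.Forall odd_prime I -> NoDup I -> I <> nil ->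
  rchar (4 * prodl I) (fun n => IZR (psi I n)).
Proof.
intros HI ND NI. split; [|split; [|split; [|split; [|split]]]].
- assert (Hpos : forall J, List.Forall odd_prime J -> (1 <= prodl J)%nat).
  { induction 1 as [|x J [_ Hx] HJ IH]; simpl; nia. }
  specialize (Hpos I HI). lia.
- intros m n. rewrite psi_mul, mult_IZR by exact HI. reflexivity.
- intros n. f_equal. rewrite <- (psi_period_mul I n 1). f_equal. lia.
- intros n. destruct (psi_values I n) as [->|[->| ->]]; auto.
- intros n. rewrite <- (psi_zero I n HI NI). split; intros H E; apply H; [rewrite E; reflexivity|apply eq_IZR; exact E].
- destruct (psi_nonprincipal I HI ND NI) as [n Hn]. exists n. rewrite Hn. reflexivity.
Qed.

Lemma psi_prime I p : List.Forall odd_prime I -> odd_prime p ->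
  psi I p = fold_right (fun q z => legendre p q * z)%Z 1%Z I.
Proof.
intros HI Hp. induction HI as [|q I Hq HI IH]; [reflexivity|]. simpl. rewrite IH. f_equal.
unfold psi1. destruct (Nat.eq_dec p q) as [->|N].
- rewrite (proj2 (leg_zero q q Hq)) by apply Nat.divide_refl. reflexivity.
- rewrite (leg_reciprocity p q Hp Hq N).
  assert (C : Nat.gcd p 4 = 1%nat) by (apply prime_coprime_4, Hp).
  assert (Hm : (p mod 4 = 1 \/ p mod 4 = 3)%nat).
  { rewrite Nat.gcd_comm, <- Nat.Lcm0.gcd_mod, Nat.gcd_comm in C.
    assert (Hn : (p mod 4 < 4)%nat) by (apply Nat.mod_upper_bound; lia).
    destruct (p mod 4) as [|[|[|[|]]]]; try lia; simpl in C; lia. }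
  unfold twist4. destruct Hm as [-> | ->]; destruct (Nat.eqb (q mod 4) 3);
    [change (1 =? 3)%nat with false|change (1 =? 3)%nat with false|change (3 =? 3)%nat with true|change (3 =? 3)%nat with true];
    cbv [andb]; ring.
Qed.

Theorem leg_rchar p : odd_prime p -> rchar p (fun n => IZR (legendre p n)).
Proof.
intros Hp. split; [|split; [|split; [|split; [|split]]]].
- destruct Hp; lia.
- intros m n. rewrite leg_mul, mult_IZR by exact Hp. reflexivity.
- intros n. rewrite leg_period. reflexivity.
- intros n. destruct (leg_values p n) as [->|[->| ->]]; auto.
- intros n. rewrite <- (prime_not_divide_gcd p n) by apply Hp. rewrite <- (leg_zero p n Hp).
  split; intros H E; apply H; [rewrite E; reflexivity|apply eq_IZR; exact E].
- destruct (leg_nonresidue p Hp) as [n Hn]. exists n. rewrite Hn. reflexivity.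
Qed.

(** * The logarithmic derivative of a Dirichlet series *)

Lemma ln_le_pw (n : nat) (e : R) : 0 < e -> lg n <= / e * pw n (- e).
Proof.
intros He. unfold pw. replace (- - e * lg n) with (e * lg n) by ring.
pose proof (exp_ineq1_le (e * lg n)). apply Rmult_le_reg_l with e; [exact He|]. rewrite <- Rmult_assoc, Rinv_r; lra.
Qed.

Lemma S1_multiples (H : nat -> R) (d N : nat) : (1 <= d)%nat ->
  S1 (fun n => if Nat.eqb (n mod d) 0 then H n else 0) N =
  S1 (fun e => if Nat.leb (d * e) N then H (d * e)%nat else 0) N.
Proof.
intros Hd. transitivity (S1 (fun e => H (d * e)%nat) (N / d)).
- induction N as [|N IH]; [rewrite Nat.Div0.div_0_l; reflexivity|].
  simpl S1. rewrite IH.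
  pose proof (Nat.div_mod_eq N d). pose proof (Nat.div_mod_eq (S N) d).
  pose proof (Nat.mod_upper_bound N d ltac:(lia)). pose proof (Nat.mod_upper_bound (S N) d ltac:(lia)).
  destruct (Nat.eqb_spec (S N mod d) 0) as [E|E].
  + assert (E2 : (S N / d = S (N / d))%nat) by nia. rewrite E2. simpl S1. f_equal. f_equal. nia.
  + assert (E2 : (S N / d = N / d)%nat) by nia. rewrite E2. ring.
- assert (HM : (N / d <= N)%nat) by (apply Nat.Div0.div_le_upper_bound; nia).
  assert (Hs : forall M, (N / d <= M)%nat -> S1 (fun e => if Nat.leb (d * e) N then H (d * e)%nat else 0) M = S1 (fun e => H (d * e)%nat) (N / d)).
  { intros M HMM. pose proof (Nat.div_mod_eq N d). pose proof (Nat.mod_upper_bound N d ltac:(lia)).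
    induction HMM as [|M HMM IH].
    - apply S1_ext. intros e He. destruct (Nat.leb_spec (d * e) N); [reflexivity|nia].
    - simpl S1. rewrite IH. destruct (Nat.leb_spec (d * S M) N); [nia|ring]. }
  rewrite Hs by exact HM. reflexivity.
Qed.

Lemma S1_sum (f : nat -> nat -> R) (m N : nat) :
  S1 (fun n => sum_f_R0 (fun j => f j n) m) N = sum_f_R0 (fun j => S1 (f j) N) m.
Proof.
induction m as [|m IH]; simpl; [reflexivity|]. rewrite <- IH, <- S1_plus. reflexivity.
Qed.

Lemma S1_mul (f g : nat -> R) (M N : nat) : S1 f M * S1 g N = S1 (fun d => S1 (fun e => f d * g e) N) M.
Proof.
induction M as [|M IH]; simpl; [ring|]. rewrite Rmult_plus_distr_r, IH, S1_scal. reflexivity.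
Qed.

(** Coefficient form of [exp (- (s+z) (x+y)) = exp (- (s+z) x) exp (- (s+z) y)]; it makes the
    Dirichlet convolution factor into a Cauchy product. *)
Lemma G_add s m x y : G s m (x + y) = sum_f_R0 (fun j => G s j x * G s (m - j) y) m.
Proof.
unfold G. replace (- s * (x + y)) with (- s * x + - s * y) by ring. rewrite exp_plus.
replace (- (x + y)) with (- x + - y) by ring. rewrite binomial. unfold Rdiv.
rewrite (Rmult_comm (sum_f_R0 _ _)), !scal_sum. apply sum_eq. intros j Hj. unfold Binomial.C.
field. repeat split; apply INR_fact_neq_0.
Qed.

Lemma kern_mult s t m d e : (1 <= d)%nat -> (1 <= e)%nat ->
  kern s t 0 m (d * e) = sum_f_R0 (fun j => kern s t 0 j d * kern s t 0 (m - j) e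
      - kern s t (PI / 2) j d * kern s t (PI / 2) (m - j) e) m /\
  kern s t (PI / 2) m (d * e) = sum_f_R0 (fun j => kern s t 0 j d * kern s t (PI / 2) (m - j) e
      + kern s t (PI / 2) j d * kern s t 0 (m - j) e) m.
Proof.
intros Hd He. unfold kern.
rewrite mult_INR, ln_mult by pos.
set (x := lg d). set (y := lg e). rewrite G_add.
rewrite !(Rmult_comm (sum_f_R0 _ _)), !scal_sum.
rewrite !Rplus_0_r, Rmult_plus_distr_l.
split; apply sum_eq; intros j _.
- rewrite cos_plus. replace (t * x + PI / 2) with (PI / 2 + t * x) by ring. replace (t * y + PI / 2) with (PI / 2 + t * y) by ring.
  rewrite !(cos_plus (PI / 2)), cos_PI2, sin_PI2. ring.
- replace (t * x + t * y + PI / 2) with (PI / 2 + (t * x + t * y)) by ring.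
  replace (t * x + PI / 2) with (PI / 2 + t * x) by ring. replace (t * y + PI / 2) with (PI / 2 + t * y) by ring.
  rewrite !(cos_plus (PI / 2)), cos_PI2, sin_PI2, sin_plus. ring.
Qed.

Section CompletelyMultiplicative.
Variable (al : nat -> R).
Hypothesis Hmul : forall m n, al (m * n)%nat = al m * al n.
Hypothesis Habs : forall n, Rabs (al n) <= 1.

Definition lamal (n : nat) : R := - (vonM n * al n).

Lemma lamal_abs n : Rabs (lamal n) <= lg n.
Proof.
unfold lamal. rewrite Rabs_Ropp, Rabs_mult, (Rabs_pos_eq (vonM n)) by apply vonM_ge0.
pose proof (vonM_ge0 n). pose proof (vonM_le_ln n). pose proof (Habs n). nra.
Qed.

Lemma lamal_kern_bound s t ph m n r e : 0 <= r -> 0 < e ->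
  r ^ m * Rabs (lamal n * kern s t ph m n) <= / e * pw n (s - r - e).
Proof.
intros Hr He. rewrite Rabs_mult.
pose proof (kern_bound s t ph m n r Hr) as K. pose proof (lamal_abs n) as La. pose proof (ln_le_pw n e He) as Le.
replace (s - r - e) with (- e + (s - r)) by ring. rewrite pw_plus, <- (Rmult_assoc (/ e)).
replace (r ^ m * (Rabs (lamal n) * Rabs (kern s t ph m n))) with (Rabs (lamal n) * (r ^ m * Rabs (kern s t ph m n))) by ring.
apply Rmult_le_compat; [apply Rabs_pos|apply Rmult_le_pos; [apply pow_le; exact Hr|apply Rabs_pos]|lra|exact K].
Qed.

Lemma pcoef_lim s t ph m : 3 <= s -> is_lim_seq (fun N => coefN lamal s t ph N m) (coef lamal s t ph m).
Proof.
intros Hs. apply (Slim_correct _ (fun n => / (1/2) * pw n (1 + 1/2)) (/ (1/2) * (1 + / (1/2)))).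
- intros n _. assert (K := lamal_kern_bound s t ph m n 1 (1/2) ltac:(lra) ltac:(lra)).
  rewrite pow1, Rmult_1_l in K. eapply Rle_trans; [exact K|]. apply Rmult_le_compat_l; [lra|]. apply pw_le. lra.
- intros N. rewrite S1_scal. apply Rmult_le_compat_l; [lra|]. apply S1_pw_bound; lra.
Qed.

Lemma coefN_abs_bound s t ph N r e : 0 < r -> 0 < e -> s - r >= 1 + e ->
  geom_bound (coefN al s t ph N) (1 + / e) r.
Proof.
intros Hr He Hs m. assert (Hrm : 0 < r ^ m) by (apply pow_lt; exact Hr).
apply Rmult_le_reg_l with (r ^ m); [exact Hrm|].
replace (r ^ m * ((1 + / e) / r ^ m)) with (1 + / e) by (field; lra).
eapply Rle_trans; [|apply (S1_pw_bound e N He)].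
unfold coefN. rewrite <- (Rabs_pos_eq (r ^ m)) by lra. rewrite <- Rabs_mult, <- S1_scal.
apply S1_abs_le. intros n _.
rewrite Rabs_mult, (Rabs_pos_eq (r ^ m)), Rabs_mult by lra.
pose proof (kern_bound s t ph m n r ltac:(lra)) as K. pose proof (Habs n). assert (P := pw_le n (1 + e) (s - r) ltac:(lra)).
assert (0 <= r ^ m * Rabs (kern s t ph m n)) by (apply Rmult_le_pos; [lra|apply Rabs_pos]). nra.
Qed.

Lemma coefN_lamal_bound s t ph N r e : 0 < r -> 0 < e -> s - r >= 1 + 2 * e ->
  geom_bound (coefN lamal s t ph N) (/ e * (1 + / e)) r.
Proof.
intros Hr He Hs m. assert (Hrm : 0 < r ^ m) by (apply pow_lt; exact Hr).
assert (Hie : 0 < / e) by pos.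
apply Rmult_le_reg_l with (r ^ m); [exact Hrm|].
replace (r ^ m * ((/ e * (1 + / e)) / r ^ m)) with (/ e * (1 + / e)) by (field; lra).
apply Rle_trans with (/ e * S1 (fun n => pw n (1 + e)) N).
2:{ apply Rmult_le_compat_l; [lra|]. apply S1_pw_bound, He. }
unfold coefN. rewrite <- (Rabs_pos_eq (r ^ m)) by lra. rewrite <- Rabs_mult, <- !S1_scal.
apply S1_abs_le. intros n _. rewrite Rabs_mult, (Rabs_pos_eq (r ^ m)) by lra.
eapply Rle_trans; [apply (lamal_kern_bound s t ph m n r e); lra|].
apply Rmult_le_compat_l; [lra|]. apply pw_le. lra.
Qed.

Lemma coef_abs_bound s t ph r e : 3 <= s -> 0 < r -> 0 < e -> s - r >= 1 + e ->
  geom_bound (coef al s t ph) (1 + / e) r.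
Proof.
intros H3 Hr He Hs m.
apply (is_lim_seq_le (fun N => Rabs (coefN al s t ph N m)) (fun _ => (1 + / e) / r ^ m) (Rabs (coef al s t ph m)) ((1 + / e) / r ^ m)).
- intros N. apply coefN_abs_bound; assumption.
- apply (is_lim_seq_abs _ (coef al s t ph m)). apply coef_lim; assumption.
- apply is_lim_seq_const.
Qed.

Lemma pcoef_bound s t ph r e : 3 <= s -> 0 < r -> 0 < e -> s - r >= 1 + 2 * e ->
  geom_bound (coef lamal s t ph) (/ e * (1 + / e)) r.
Proof.
intros H3 Hr He Hs m.
apply (is_lim_seq_le (fun N => Rabs (coefN lamal s t ph N m)) (fun _ => (/ e * (1 + / e)) / r ^ m) (Rabs (coef lamal s t ph m)) ((/ e * (1 + / e)) / r ^ m)).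
- intros N. apply coefN_lamal_bound; assumption.
- apply (is_lim_seq_abs _ (coef lamal s t ph m)). apply pcoef_lim; assumption.
- apply is_lim_seq_const.
Qed.

(* [log = vonM * 1] as a Dirichlet convolution, up to the pairs [d e > N]. *)
Lemma convolution_error s t ph m N : 3 <= s -> (1 <= N)%nat ->
  Rabs (S1 (fun n => - lg n * (al n * kern s t ph m n)) N
     - S1 (fun d => S1 (fun e => - vonM d * (al (d * e)%nat * kern s t ph m (d * e))) N) N)
  <= 36 * pw N (1/4).
Proof.
intros Hs HN. set (H := fun n => al n * kern s t ph m n).
assert (E1 : S1 (fun n => - lg n * H n) N =
   S1 (fun d => S1 (fun e => if Nat.leb (d * e) N then - vonM d * H (d * e)%nat else 0) N) N).
{ transitivity (S1 (fun n => S1 (fun d => if Nat.eqb (n mod d) 0 then - vonM d * H n else 0) N) N).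
  - apply S1_ext. intros n Hn. rewrite <- (vonM_divisor_sum n N) by lia.
    rewrite <- S1_opp, Rmult_comm, <- S1_scal. apply S1_ext. intros d _. destruct (Nat.eqb (n mod d) 0); ring.
  - rewrite S1_exchange. apply S1_ext. intros d Hd.
    transitivity (S1 (fun n => if Nat.eqb (n mod d) 0 then (fun n => - vonM d * H n) n else 0) N); [reflexivity|].
    rewrite S1_multiples by lia. reflexivity. }
change (S1 (fun n => - lg n * (al n * kern s t ph m n)) N) with (S1 (fun n => - lg n * H n) N). rewrite E1, <- S1_minus.
(* Of the decay [(d e)^(-2)], the part [(d e)^(-1/4) <= N^(-1/4)] is split off; of the remaining
   [(d e)^(-7/4)], a power [d^(1/4)] pays for [vonM d <= 4 d^(1/4)]. The sums over [d] and [e] are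
   at most [3] each, hence [36]. *)
assert (HB : forall d e, (1 <= d)%nat -> (1 <= e)%nat -> (N < d * e)%nat ->
   Rabs (vonM d * H (d * e)%nat) <= 4 * pw N (1/4) * (pw d (1 + 1/2) * pw e (1 + 1/2))).
{ intros d e Hd He Hde. rewrite Rabs_mult, (Rabs_pos_eq (vonM d)) by apply vonM_ge0.
  assert (K := kern_bound s t ph m (d * e) 1 ltac:(lra)). rewrite pow1, Rmult_1_l in K.
  assert (HH : Rabs (H (d * e)%nat) <= pw (d * e) (1/4 + 7/4)).
  { unfold H. rewrite Rabs_mult. pose proof (Habs (d * e)). assert (P := pw_le (d * e) (1/4 + 7/4) (s - 1) ltac:(lra)). pose proof (Rabs_pos (kern s t ph m (d * e))). nra. }
  rewrite pw_plus in HH.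
  assert (P1 : pw (d * e) (1/4) <= pw N (1/4)) by (apply pw_decr; [lra|lia]).
  rewrite (pw_mult d e (7/4)) in HH by lia.
  assert (V : vonM d <= 4 * pw d (- (1/4))).
  { eapply Rle_trans; [apply vonM_le_ln|]. eapply Rle_trans; [apply (ln_le_pw d (1/4)); lra|].
    right. replace (/ (1 / 4)) with 4 by field. reflexivity. }
  assert (Ed : pw d (- (1/4)) * pw d (7/4) = pw d (1 + 1/2)) by (rewrite <- pw_plus; f_equal; lra).
  assert (Ee : pw e (7/4) <= pw e (1 + 1/2)) by (apply pw_le; lra).
  pose proof (pw_pos d (7/4)). pose proof (pw_pos N (1/4)).
  pose proof (vonM_ge0 d). pose proof (Rabs_pos (H (d * e)%nat)). apply Rle_trans with (4 * pw d (- (1/4)) * (pw N (1/4) * (pw d (7/4) * pw e (7/4)))).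
  - apply Rmult_le_compat; [lra|lra|exact V|].
    eapply Rle_trans; [exact HH|]. apply Rmult_le_compat_r; [pos|exact P1].
  - rewrite <- Ed. replace (4 * pw d (- (1 / 4)) * (pw N (1 / 4) * (pw d (7 / 4) * pw e (7 / 4))))
      with (4 * pw N (1 / 4) * (pw d (- (1 / 4)) * pw d (7 / 4)) * pw e (7/4)) by ring.
    rewrite <- (Rmult_assoc (4 * pw N (1/4)) (pw d (- (1 / 4)) * pw d (7 / 4))). apply Rmult_le_compat_l; [|exact Ee].
    apply Rmult_le_pos; [lra|]. apply Rmult_le_pos; lra. }
eapply Rle_trans; [apply (S1_abs_le _ (fun d => S1 (fun e => 4 * pw N (1/4) * (pw d (1 + 1/2) * pw e (1 + 1/2))) N))|].
{ intros d Hd. rewrite <- S1_minus. apply S1_abs_le. intros e He.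
  destruct (Nat.leb_spec (d * e) N) as [L|L].
  - replace (- vonM d * H (d * e)%nat - - vonM d * (al (d * e)%nat * kern s t ph m (d * e))) with 0 by (unfold H; ring).
    rewrite Rabs_R0. pose proof (pw_pos N (1/4)). pose proof (pw_pos d (1 + 1/2)). pose proof (pw_pos e (1 + 1/2)).
    apply Rmult_le_pos; [lra|]. apply Rmult_le_pos; lra.
  - replace (0 - - vonM d * (al (d * e)%nat * kern s t ph m (d * e))) with (vonM d * H (d * e)%nat) by (unfold H; ring).
    apply HB; lia. }
assert (E : S1 (fun d => S1 (fun e => 4 * pw N (1/4) * (pw d (1 + 1/2) * pw e (1 + 1/2))) N) N =
   4 * pw N (1/4) * (S1 (fun d => pw d (1 + 1/2)) N * S1 (fun e => pw e (1 + 1/2)) N)).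
{ rewrite S1_mul, <- S1_scal. apply S1_ext. intros d _. rewrite <- S1_scal. reflexivity. }
rewrite E. assert (B := S1_pw_bound (1/2) N ltac:(lra)). replace (1 + / (1/2)) with 3 in B by field.
assert (0 <= S1 (fun d => pw d (1 + 1/2)) N) by (apply S1_pos; intros; left; apply pw_pos).
pose proof (pw_pos N (1/4)). assert (S1 (fun d => pw d (1 + 1/2)) N * S1 (fun d => pw d (1 + 1/2)) N <= 9) by nra. nra.
Qed.

Lemma pw_lim0 c : 0 < c -> is_lim_seq (fun N => pw N c) 0.
Proof.
intros Hc. apply is_lim_seq_spec. intros eps.
destruct (nfloor_ex (exp (- ln eps / c) + 1)) as [n0 Hn0]; [pose proof (exp_pos (- ln eps / c)); lra|].
exists (S n0). intros n Hn. rewrite Rminus_0_r, Rabs_pos_eq by pos.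
unfold pw. rewrite <- (exp_ln eps) by apply cond_pos. apply exp_increasing.
assert (H : exp (- ln eps / c) < INR n).
{ apply le_INR in Hn. rewrite S_INR in Hn. lra. }
assert (H2 : - ln eps / c < lg n).
{ rewrite <- (ln_exp (- ln eps / c)). apply ln_increasing; [apply exp_pos|exact H]. }
apply Rmult_lt_compat_l with (r := c) in H2; [|exact Hc].
replace (c * (- ln eps / c)) with (- ln eps) in H2 by (field; lra). lra.
Qed.

(** Differentiating in [z] multiplies the [n]-th term by [- log n]; complete multiplicativity of
    [al] together with [kern_mult] splits the convolution into a Cauchy product with the series of
    [lamal]. *)
Theorem dirichlet_log_derivative s t : 3 <= s ->
  let a := coef al s t 0 in let b := coef al s t (PI / 2) in
  let p := coef lamal s t 0 in let q := coef lamal s t (PI / 2) in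
  (forall m, PS_derive a m = PS_mult p a m - PS_mult q b m) /\
  (forall m, PS_derive b m = PS_mult p b m + PS_mult q a m).
Proof.
intros Hs a b p q.
assert (Hlhs : forall ph m, is_lim_seq (S1 (fun n => - lg n * (al n * kern s t ph m n))) (PS_derive (coef al s t ph) m)).
{ intros ph m. unfold PS_derive.
  apply is_lim_seq_ext with (fun N => INR (S m) * coefN al s t ph N (S m)).
  - intros N. unfold coefN. rewrite <- S1_scal. apply S1_ext. intros n _. unfold kern, G.
    rewrite fact_simpl, mult_INR. simpl pow. field. split; [apply INR_fact_neq_0|apply not_0_INR; lia].
  - apply (is_lim_seq_scal_l _ (INR (S m)) (coef al s t ph (S m))). apply coef_lim; assumption. }
assert (Hsum : forall (f g : nat -> nat -> R) (lf lg : nat -> R) m,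
   (forall j, is_lim_seq (fun N => f N j) (lf j)) -> (forall j, is_lim_seq (fun N => g N j) (lg j)) ->
   is_lim_seq (fun N => PS_mult (f N) (g N) m) (PS_mult lf lg m)).
{ intros f g lf lg m Hf Hg. unfold PS_mult.
  assert (X : forall k, is_lim_seq (fun N => sum_f_R0 (fun j => f N j * g N (m - j)%nat) k) (sum_f_R0 (fun j => lf j * lg (m - j)%nat) k)).
  { induction k; simpl; [apply is_lim_seq_mult'; auto|]. apply is_lim_seq_plus'; [exact IHk|apply is_lim_seq_mult'; auto]. }
  apply X. }
assert (Herr : forall ph m, is_lim_seq (fun N => S1 (fun n => - lg n * (al n * kern s t ph m n)) N
   - S1 (fun d => S1 (fun e => - vonM d * (al (d * e)%nat * kern s t ph m (d * e))) N) N) 0).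
{ intros ph m. apply is_lim_seq_abs_0.
  apply is_lim_seq_le_le_loc with (fun _ => 0) (fun N => 36 * pw N (1/4)).
  - exists 1%nat. intros N HN. split; [apply Rabs_pos|apply convolution_error; [exact Hs|lia]].
  - apply is_lim_seq_const.
  - replace (Finite 0) with (Rbar_mult (Finite 36) (Finite 0)) by (simpl; f_equal; ring).
    apply is_lim_seq_scal_l, pw_lim0. lra. }
assert (Fin : forall ph m (rhs : nat -> R) (l : R),
   (forall N, S1 (fun d => S1 (fun e => - vonM d * (al (d * e)%nat * kern s t ph m (d * e))) N) N = rhs N) ->
   is_lim_seq rhs l -> PS_derive (coef al s t ph) m = l).
{ intros ph m rhs l HE Hl.
  assert (X : is_lim_seq (fun N => S1 (fun n => - lg n * (al n * kern s t ph m n)) N - rhs N) (PS_derive (coef al s t ph) m - l)).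
  { apply is_lim_seq_minus'; [apply Hlhs|exact Hl]. }
  assert (Y := Herr ph m).
  assert (Z : is_lim_seq (fun N => S1 (fun n => - lg n * (al n * kern s t ph m n)) N - rhs N) 0).
  { eapply is_lim_seq_ext; [|exact Y]. intros N. simpl. rewrite HE. reflexivity. }
  apply is_lim_seq_unique in X. apply is_lim_seq_unique in Z. rewrite X in Z. injection Z as Z. lra. }
split; intros m.
- apply (Fin 0 m (fun N => PS_mult (coefN lamal s t 0 N) (coefN al s t 0 N) m - PS_mult (coefN lamal s t (PI/2) N) (coefN al s t (PI/2) N) m)).
  + intros N. unfold PS_mult. rewrite <- minus_sum.
    rewrite (sum_eq _ (fun j => S1 (fun d => S1 (fun e => - vonM d * (al d * al e) * (kern s t 0 j d * kern s t 0 (m - j) e - kern s t (PI/2) j d * kern s t (PI/2) (m - j) e)) N) N)).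
    * rewrite <- S1_sum. apply S1_ext. intros d Hd. rewrite <- S1_sum. apply S1_ext. intros e He.
      rewrite (proj1 (kern_mult s t m d e ltac:(lia) ltac:(lia))), Hmul, <- Rmult_assoc, scal_sum.
      apply sum_eq. intros; ring.
    * intros j _. unfold coefN. rewrite !S1_mul, <- S1_minus. apply S1_ext. intros d _. rewrite <- S1_minus. apply S1_ext. intros e _. unfold lamal. ring.
  + apply is_lim_seq_minus'; (apply Hsum; intros j; [apply pcoef_lim; assumption|apply coef_lim; assumption]).
- apply (Fin (PI/2) m (fun N => PS_mult (coefN lamal s t 0 N) (coefN al s t (PI/2) N) m + PS_mult (coefN lamal s t (PI/2) N) (coefN al s t 0 N) m)).
  + intros N. unfold PS_mult. rewrite <- plus_sum.
    rewrite (sum_eq _ (fun j => S1 (fun d => S1 (fun e => - vonM d * (al d * al e) * (kern s t 0 j d * kern s t (PI/2) (m - j) e + kern s t (PI/2) j d * kern s t 0 (m - j) e)) N) N)).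
    * rewrite <- S1_sum. apply S1_ext. intros d Hd. rewrite <- S1_sum. apply S1_ext. intros e He.
      rewrite (proj2 (kern_mult s t m d e ltac:(lia) ltac:(lia))), Hmul, <- Rmult_assoc, scal_sum.
      apply sum_eq. intros; ring.
    * intros j _. unfold coefN. rewrite !S1_mul, <- S1_plus. apply S1_ext. intros d _. rewrite <- S1_plus. apply S1_ext. intros e _. unfold lamal. ring.
  + apply is_lim_seq_plus'; (apply Hsum; intros j; [apply pcoef_lim; assumption|apply coef_lim; assumption]).
Qed.

End CompletelyMultiplicative.

Lemma S1_S (f : nat -> R) (N : nat) : S1 f (S N) = S1 f N + f (S N).
Proof. reflexivity. Qed.

Lemma pow2_ge (m : nat) : INR (S m) <= 2 ^ m.
Proof.
induction m; [simpl; lra|]. rewrite S_INR. simpl pow.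
assert (1 <= 2 ^ m) by (apply pow_R1_Rle; lra). lra.
Qed.

(** * The zeta function *)

Lemma PS_mult_abs (a b : nat -> R) (A B r : R) (m : nat) : 0 < r -> 0 <= A -> 0 <= B ->
  geom_bound a A r -> geom_bound b B r -> Rabs (PS_mult a b m) <= INR (S m) * (A * B / r ^ m).
Proof.
intros Hr HA HB Ha Hb. unfold PS_mult. eapply Rle_trans; [apply Rsum_abs|].
apply Rle_trans with (sum_f_R0 (fun _ => A * B / r ^ m) m).
- apply sum_Rle. intros k Hk. rewrite Rabs_mult.
  apply Rle_trans with (A / r ^ k * (B / r ^ (m - k))).
  + apply Rmult_le_compat; auto using Rabs_pos.
  + right. replace m with (k + (m - k))%nat at 2 by lia. rewrite pow_add. field.
    split; apply pow_nonzero; lra.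
- rewrite sum_cte. right; ring.
Qed.

(** The number [m + 1] of terms in a Cauchy product is absorbed by [2^m], at the price of half the
    radius. *)
Lemma PS_mult_bound (a b : nat -> R) (A B r : R) : 0 < r -> 0 <= A -> 0 <= B ->
  geom_bound a A r -> geom_bound b B r -> geom_bound (PS_mult a b) (A * B) (r / 2).
Proof.
intros Hr HA HB Ha Hb m. eapply Rle_trans; [apply (PS_mult_abs a b A B r m); assumption|].
assert (Hrm : 0 < r ^ m) by pos.
replace (A * B / (r / 2) ^ m) with (2 ^ m * (A * B / r ^ m)).
- apply Rmult_le_compat_r; [|apply pow2_ge]. apply Rmult_le_pos; [nra|pos].
- unfold Rdiv. rewrite Rpow_mult_distr, pow_inv. field. split; [apply pow_nonzero; lra|lra].
Qed.

Lemma PS_derive_bound (a : nat -> R) (A r : R) : 0 < r -> 0 <= A ->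
  geom_bound a A r -> geom_bound (PS_derive a) (2 * A / r) (r / 2).
Proof.
intros Hr HA Ha m. unfold PS_derive. rewrite Rabs_mult, (Rabs_pos_eq (INR (S m))) by apply pos_INR.
assert (Hrm : 0 < r ^ m) by pos.
specialize (Ha (S m)). pose proof (pow2_ge m) as H2. pose proof (pos_INR (S m)). pose proof (Rabs_pos (a (S m))).
replace (2 * A / r / (r / 2) ^ m) with (2 ^ m * (2 * (A / r ^ S m))).
- apply Rle_trans with (2 ^ m * (A / r ^ S m)); [apply Rmult_le_compat; assumption|].
  apply Rmult_le_compat_l; [pos|]. lra.
- unfold Rdiv. rewrite Rpow_mult_distr, pow_inv. simpl pow. field. split; [apply pow_nonzero; lra|lra].
Qed.

Lemma PSeries_coef_ext (a b : nat -> R) (A r : R) : 0 < r -> 0 <= A -> geom_bound a A r -> geom_bound b A r ->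
  (forall x, Rabs x < r -> PSeries a x = PSeries b x) -> forall n, a n = b n.
Proof.
intros Hr HA Ha Hb H n.
apply PSeries_ext_recip.
- rewrite <- Rabs_R0. apply (geom_bound_radius a A r); [exact Hr|exact Ha|rewrite Rabs_R0; exact Hr].
- rewrite <- Rabs_R0. apply (geom_bound_radius b A r); [exact Hr|exact Hb|rewrite Rabs_R0; exact Hr].
- exists (mkposreal r Hr). intros x Hx. apply H.
  unfold ball in Hx; simpl in Hx; unfold AbsRing_ball, abs, minus, plus, opp in Hx; simpl in Hx.
  rewrite Ropp_0, Rplus_0_r in Hx. exact Hx.
Qed.

Definition one (n : nat) : R := 1.
Lemma one_abs n : Rabs (one n) <= 1. Proof. unfold one. rewrite Rabs_R1; lra. Qed.
Lemma one_mul m n : one (m * n) = one m * one n. Proof. unfold one; ring. Qed.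

Definition shift (a : nat -> R) (m : nat) : R := match m with O => 0 | S m' => a m' end.

(* Coefficients at [s] of [(s-1) zeta_N(s) + N^(1-s)], which converge to those of [(s-1) zeta(s)]. *)
Definition ZN (s : R) (N m : nat) : R :=
  (s - 1) * coefN one s 0 0 N m + shift (coefN one s 0 0 N) m + G (s - 1) m (lg N).
Definition Zc (s : R) (m : nat) : R := (s - 1) * coef one s 0 0 m + shift (coef one s 0 0) m.

Lemma kern_zero s m n : kern s 0 0 m n = G s m (lg n).
Proof. unfold kern. rewrite Rmult_0_l, Rplus_0_l, cos_0. ring. Qed.

Lemma kern_half s m n : kern s 0 (PI / 2) m n = 0.
Proof. unfold kern. rewrite Rmult_0_l, Rplus_0_l, cos_PI2. ring. Qed.

(** Coefficient of [z^m] in [(s + z - 1) exp (- (s+z) x)]. In the variable [u = exp x] it is minus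
    the derivative of [G (s - 1) m (ln u)], the coefficient of [u^(1-s-z)]. *)
Definition zk (s : R) (m : nat) (x : R) : R := (s - 1) * G s m x + Gp s m x.

Lemma ZN_sum s N m : ZN s N m = S1 (fun n => zk s m (lg n)) N + G (s - 1) m (lg N).
Proof.
unfold ZN. f_equal. unfold coefN, zk. rewrite S1_plus, S1_scal. f_equal.
- f_equal. apply S1_ext. intros n _. rewrite kern_zero. unfold one. ring.
- destruct m as [|m]; simpl; [rewrite S1_zero; reflexivity|].
  apply S1_ext. intros n _. rewrite kern_zero. unfold one. ring.
Qed.

Lemma ZN_telescope s N m : ZN s (S N) m = G (s - 1) m 0 + zk s m (lg (S N)) +
  S1 (fun n => zk s m (lg n) + G (s - 1) m (lg (S n)) - G (s - 1) m (lg n)) N.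
Proof.
rewrite ZN_sum. induction N as [|N IH].
- simpl. rewrite ln_1. ring.
- change (S1 (fun n => zk s m (lg n)) (S (S N))) with (S1 (fun n => zk s m (lg n)) (S N) + zk s m (lg (S (S N)))).
  change (S1 (fun n => zk s m (lg n) + G (s - 1) m (lg (S n)) - G (s - 1) m (lg n)) (S N))
   with (S1 (fun n => zk s m (lg n) + G (s - 1) m (lg (S n)) - G (s - 1) m (lg n)) N +
     (zk s m (lg (S N)) + G (s - 1) m (lg (S (S N))) - G (s - 1) m (lg (S N)))). lra.
Qed.

Lemma G_shift s m x : G s m x = exp (- x) * G (s - 1) m x.
Proof.
unfold G. rewrite <- Rmult_assoc, <- exp_plus. f_equal. f_equal. ring.
Qed.

Lemma zk_increment s m n : (1 <= n)%nat -> exists y, lg n <= y <= lg (S n) /\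
  G (s - 1) m (lg (S n)) - G (s - 1) m (lg n) = - zk s m y.
Proof.
intros Hn. assert (Hn0 : 0 < INR n) by pos.
set (f := fun u => G (s - 1) m (ln u)).
destruct (MVT_gen f (INR n) (INR (S n)) (fun u => - zk s m (ln u))) as (u & Hu & E).
- intros u Hu. rewrite Rmin_left in Hu by (apply le_INR; lia). unfold f.
  evar_last.
  { apply (is_derive_comp (G (s - 1) m) ln); [apply G_derive|apply is_derive_ln; lra]. }
  unfold scal; simpl; unfold mult; simpl. unfold zk. rewrite (G_shift s m (ln u)), exp_Ropp, exp_ln by lra.
  destruct m as [|m]; simpl; [ring|]. rewrite (G_shift s m (ln u)), exp_Ropp, exp_ln by lra. ring.
- intros u Hu. rewrite Rmin_left in Hu by (apply le_INR; lia).
  apply continuity_pt_filterlim. unfold f. eapply (continuous_is_derive (fun u => G (s - 1) m (ln u)) u).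
  apply (is_derive_comp (G (s - 1) m) ln u); [apply G_derive|apply is_derive_ln; lra].
- rewrite Rmin_left, Rmax_right in Hu by (apply le_INR; lia).
  exists (ln u). split; [split; apply ln_le; lra|]. fold (f (INR (S n))). fold (f (INR n)).
  rewrite E, S_INR. ring.
Qed.

Lemma zk_bound s m x r : 1 <= s -> 0 <= r -> 0 <= x -> r ^ m * Rabs (zk s m x) <= (s - 1 + r) * exp (- (s - r) * x).
Proof.
intros Hs Hr Hx. unfold zk.
assert (G1 := G_bound s m x r Hr Hx). assert (G2 := Gp_bound s m x r Hr Hx).
assert (Hrm : 0 <= r ^ m) by pos.
apply Rle_trans with (r ^ m * ((s - 1) * Rabs (G s m x) + Rabs (Gp s m x))).
- apply Rmult_le_compat_l; [exact Hrm|]. eapply Rle_trans; [apply Rabs_triang|]. rewrite Rabs_mult, (Rabs_pos_eq (s - 1)) by lra. lra.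
- replace (r ^ m * ((s - 1) * Rabs (G s m x) + Rabs (Gp s m x))) with ((s - 1) * (r ^ m * Rabs (G s m x)) + r ^ m * Rabs (Gp s m x)) by ring.
  assert ((s - 1) * (r ^ m * Rabs (G s m x)) <= (s - 1) * exp (- (s - r) * x)) by (apply Rmult_le_compat_l; lra). lra.
Qed.

Definition CZ (s r : R) : R := 1 + (s - 1 + r) + (s - 1 + r) * (s + r) * (1 + / (s - r)).

(** By [zk_increment] each step of the telescoped sum compares [zk] at [log n] with [zk] at a point
    of [[log n, log (n+1)]], so it is [O(n^(-1-(s-r)))]. The correction [N^(1-s)] thus continues
    [(s-1) zeta(s)] to every radius [r < s]. The summands of [CZ] belong to the starting term, the
    last term and these variations. *)
Lemma ZN_bound s r N : 1 <= s -> 0 < r < s -> geom_bound (ZN s N) (CZ s r) r.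
Proof.
intros Hs Hr m. assert (Hrm : 0 < r ^ m) by pos.
assert (Hi : 0 < / (s - r)) by pos.
set (D := (s - 1 + r) * (s + r)). assert (HD : 0 <= D) by (unfold D; nra).
apply Rmult_le_reg_l with (r ^ m); [exact Hrm|].
replace (r ^ m * (CZ s r / r ^ m)) with (CZ s r) by (field; lra).
assert (G0 : r ^ m * Rabs (G (s - 1) m 0) <= 1).
{ eapply Rle_trans; [apply G_bound; lra|]. rewrite Rmult_0_r, exp_0. lra. }
destruct N as [|N].
- assert (E0 : ZN s 0 m = G (s - 1) m 0).
  { rewrite ZN_sum. simpl. replace (ln 0) with 0; [ring|]. unfold ln. destruct (Rlt_dec 0 0) as [H|H]; [exfalso; apply (Rlt_irrefl 0 H)|reflexivity]. }
  rewrite E0. unfold CZ. fold D. assert (0 <= D * (1 + / (s - r))) by nra. lra.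
- rewrite ZN_telescope.
  eapply Rle_trans; [apply Rmult_le_compat_l; [lra|]; eapply Rle_trans; [apply Rabs_triang|apply Rplus_le_compat_r, Rabs_triang]|].
  rewrite !Rmult_plus_distr_l. unfold CZ. fold D. apply Rplus_le_compat; [apply Rplus_le_compat|].
  + exact G0.
  + eapply Rle_trans; [apply zk_bound; [lra|lra|apply ln_INR_pos]|].
    assert (exp (- (s - r) * lg (S N)) <= 1) by (apply (pw_le_1 (S N) (s - r)); lra). nra.
  + apply Rle_trans with (S1 (fun n => D * pw n (1 + (s - r))) N).
    2:{ rewrite S1_scal. apply Rmult_le_compat_l; [exact HD|]. apply S1_pw_bound; lra. }
    rewrite <- (Rabs_pos_eq (r ^ m)) by lra. rewrite <- Rabs_mult, <- S1_scal.
    apply S1_abs_le. intros n Hn.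
    destruct (zk_increment s m n ltac:(lia)) as (y & Hy & E).
    replace (r ^ m * (zk s m (lg n) + G (s - 1) m (lg (S n)) - G (s - 1) m (lg n)))
      with (r ^ m * zk s m (lg n) - r ^ m * zk s m y) by (rewrite <- Rmult_minus_distr_l; f_equal; lra).
    apply (variation_bound (fun x => r ^ m * zk s m x)
      (fun x => r ^ m * ((s - 1) * (- s * G s m x - Gp s m x) + (- s * Gp s m x - Gpp s m x))) (s - r) D n); [lia|lra|exact HD| | |exact Hy].
    * intros x. apply is_derive_scal. unfold zk. apply (is_derive_plus (V := R_NormedModule) (fun x => (s - 1) * G s m x)); [apply is_derive_scal, G_derive|apply Gp_derive].
    * intros x Hx. rewrite Rabs_mult, (Rabs_pos_eq (r ^ m)) by lra.
      assert (G1 := G_bound s m x r ltac:(lra) Hx). assert (G2 := Gp_bound s m x r ltac:(lra) Hx). assert (G3 := Gpp_bound s m x r ltac:(lra) Hx).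
      set (e := exp (- (s - r) * x)) in *. set (g := G s m x) in *. set (g' := Gp s m x) in *. set (g'' := Gpp s m x) in *.
      replace ((s - 1) * (- s * g - g') + (- s * g' - g'')) with (- ((s - 1) * s * g) + (- ((2 * s - 1) * g') + - g'')) by ring.
      apply Rle_trans with (r ^ m * ((s - 1) * s * Rabs g + ((2 * s - 1) * Rabs g' + Rabs g''))).
      { apply Rmult_le_compat_l; [lra|]. eapply Rle_trans; [apply Rabs_triang|]. apply Rplus_le_compat.
        - rewrite Rabs_Ropp, Rabs_mult, (Rabs_pos_eq ((s - 1) * s)) by nra. lra.
        - eapply Rle_trans; [apply Rabs_triang|]. rewrite !Rabs_Ropp, Rabs_mult, (Rabs_pos_eq (2 * s - 1)) by lra. lra. }
      replace (r ^ m * ((s - 1) * s * Rabs g + ((2 * s - 1) * Rabs g' + Rabs g''))) with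
        ((s - 1) * s * (r ^ m * Rabs g) + ((2 * s - 1) * (r ^ m * Rabs g') + r ^ m * Rabs g'')) by ring.
      assert ((s - 1) * s * (r ^ m * Rabs g) <= (s - 1) * s * e) by (apply Rmult_le_compat_l; nra).
      assert ((2 * s - 1) * (r ^ m * Rabs g') <= (2 * s - 1) * (r * e)) by (apply Rmult_le_compat_l; nra).
      unfold D. replace ((s - 1 + r) * (s + r) * e) with ((s - 1) * s * e + ((2 * s - 1) * (r * e) + r * (r * e))) by ring. lra.
Qed.

Lemma ZN_lim s m : 3 <= s -> is_lim_seq (fun N => ZN s N m) (Zc s m).
Proof.
intros Hs. unfold ZN, Zc.
replace (Finite ((s - 1) * coef one s 0 0 m + shift (coef one s 0 0) m)) with
  (Finite ((s - 1) * coef one s 0 0 m + shift (coef one s 0 0) m + 0)) by (f_equal; ring).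
apply is_lim_seq_plus'; [apply is_lim_seq_plus'|].
- apply (is_lim_seq_scal_l _ (s - 1) (coef one s 0 0 m)). apply coef_lim; [apply one_abs|exact Hs].
- destruct m as [|m]; simpl; [apply is_lim_seq_const|apply coef_lim; [apply one_abs|exact Hs]].
- apply is_lim_seq_abs_0. apply is_lim_seq_le_le with (fun _ => 0) (fun N => pw N (s - 1 - 1)).
  + intros N. split; [apply Rabs_pos|].
    assert (B := G_bound (s - 1) m (lg N) 1 ltac:(lra) (ln_INR_pos N)). rewrite pow1, Rmult_1_l in B. exact B.
  + apply is_lim_seq_const.
  + apply pw_lim0. lra.
Qed.

Definition zero_seq (m : nat) : R := 0.

Lemma geom_bound_zero C r : 0 <= C -> 0 < r -> geom_bound zero_seq C r.
Proof.
intros HC Hr m. unfold zero_seq. rewrite Rabs_R0. apply Rmult_le_pos; [exact HC|].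
left. apply Rinv_0_lt_compat, pow_lt, Hr.
Qed.

(* Real and imaginary part of [(s-1) zeta_N(s) + N^(1-s)] at [s + i t]. *)
Definition PzRe (s t : R) (N : nat) : R :=
  (s - 1) * dval one s t 0 N - t * dval one s t (PI / 2) N + pw N (s - 1) * cos (t * lg N + 0).
Definition PzIm (s t : R) (N : nat) : R :=
  (s - 1) * dval one s t (PI / 2) N + t * dval one s t 0 N + pw N (s - 1) * cos (t * lg N + PI / 2).

Lemma real_kern_series s n x th :
  is_series (fun m => rot (fun m => G s m (lg n)) zero_seq th m * x ^ m)
    (pw n (s + x * cos th) * cos (x * sin th * lg n + 0)) /\
  is_series (fun m => rot zero_seq (oppseq (fun m => G s m (lg n))) th m * x ^ m)
    (pw n (s + x * cos th) * cos (x * sin th * lg n + PI / 2)).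
Proof.
split.
- assert (K := kern_PSeries s 0 0 n x th). rewrite ?Rplus_0_l in K.
  eapply is_series_ext_R; [|exact K]. intros m. unfold rot. rewrite kern_zero, ?Rplus_0_l, kern_half. reflexivity.
- assert (K := kern_PSeries s 0 (PI / 2) n x th). rewrite ?Rplus_0_l in K.
  eapply is_series_ext_R; [|exact K]. intros m. unfold rot, oppseq. rewrite kern_half, kern_shift. replace (0 * lg n + PI / 2) with (PI / 2) by ring. rewrite sin_PI2.
  unfold zero_seq. ring.
Qed.

(** Multiplication by [z = x e^(i th)], separated into real and imaginary parts. *)
Lemma shift_series (g : nat -> R) (x th A B : R) :
  is_series (fun m => rot g zero_seq th m * x ^ m) A ->
  is_series (fun m => rot zero_seq (oppseq g) th m * x ^ m) B ->
  is_series (fun m => rot (shift g) zero_seq th m * x ^ m) (x * cos th * A - x * sin th * B) /\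
  is_series (fun m => rot zero_seq (oppseq (shift g)) th m * x ^ m) (x * cos th * B + x * sin th * A).
Proof.
intros HA HB.
assert (sc : forall c f l, is_series f l -> is_series (fun m : nat => c * f m) (c * l)).
{ intros c f l H. apply (is_series_scal (V := R_NormedModule) c f l H). }
assert (pl : forall f g l l', is_series f l -> is_series g l' -> is_series (fun m : nat => f m + g m) (l + l')).
{ intros f g0 l l' H H'. apply (is_series_plus (V := R_NormedModule) f g0 l l' H H'). }
assert (de : forall f l, f 0%nat = 0 -> is_series (fun m => f (S m)) l -> is_series f l).
{ intros f l H0 H. apply (is_series_decr_1 (V := R_NormedModule) f l).
  unfold plus, opp; simpl. rewrite H0, Ropp_0, Rplus_0_r. exact H. }
split.
- apply de.
  + unfold rot, shift, zero_seq. ring.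
  + replace (x * cos th * A - x * sin th * B) with (x * cos th * A + - (x * sin th) * B) by ring.
    eapply is_series_ext_R; [|apply pl; [apply (sc (x * cos th)), HA|apply (sc (- (x * sin th))), HB]].
    intros m. unfold rot, shift, zero_seq, oppseq. rewrite S_INR, Rmult_plus_distr_r, Rmult_1_l, cos_plus. simpl pow. ring.
- apply de.
  + unfold rot, shift, zero_seq, oppseq. simpl. ring.
  + eapply is_series_ext_R; [|apply pl; [apply (sc (x * cos th)), HB|apply (sc (x * sin th)), HA]].
    intros m. unfold rot, shift, zero_seq, oppseq. rewrite S_INR, Rmult_plus_distr_r, Rmult_1_l, sin_plus. simpl pow. ring.
Qed.

Lemma ZN_PSeries s x th N :
  PSeries (rot (ZN s N) zero_seq th) x = PzRe (s + x * cos th) (x * sin th) N /\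
  PSeries (rot zero_seq (oppseq (ZN s N)) th) x = PzIm (s + x * cos th) (x * sin th) N.
Proof.
assert (sc : forall c f l, is_series f l -> is_series (fun m : nat => c * f m) (c * l)).
{ intros c f l H. apply (is_series_scal (V := R_NormedModule) c f l H). }
assert (pl : forall f g l l', is_series f l -> is_series g l' -> is_series (fun m : nat => f m + g m) (l + l')).
{ intros f g0 l l' H H'. apply (is_series_plus (V := R_NormedModule) f g0 l l' H H'). }
set (S := s + x * cos th). set (T := x * sin th).
assert (Hz : is_series (fun m => rot (coefN one s 0 0 N) zero_seq th m * x ^ m) (dval one S T 0 N) /\
             is_series (fun m => rot zero_seq (oppseq (coefN one s 0 0 N)) th m * x ^ m) (dval one S T (PI / 2) N)).
{ induction N as [|N [IH1 IH2]].
  - split; (eapply is_series_ext_R; [|apply is_series_0]); intros m; unfold rot, oppseq, zero_seq, coefN; simpl; ring.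
  - destruct (real_kern_series s (Datatypes.S N) x th) as [K1 K2]. split.
    + replace (dval one S T 0 (Datatypes.S N)) with (dval one S T 0 N + pw (Datatypes.S N) S * cos (T * lg (Datatypes.S N) + 0)) by (unfold dval; rewrite S1_S; unfold one; ring).
      eapply is_series_ext_R; [|apply (pl _ _ _ _ IH1 K1)].
      intros m. unfold rot, zero_seq, coefN. rewrite S1_S, kern_zero. unfold one. ring.
    + replace (dval one S T (PI / 2) (Datatypes.S N)) with (dval one S T (PI / 2) N + pw (Datatypes.S N) S * cos (T * lg (Datatypes.S N) + PI / 2)) by (unfold dval; rewrite S1_S; unfold one; ring).
      eapply is_series_ext_R; [|apply (pl _ _ _ _ IH2 K2)].
      intros m. unfold rot, zero_seq, oppseq, coefN. rewrite S1_S, kern_zero. unfold one. ring. }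
destruct Hz as [Hz1 Hz2].
destruct (shift_series _ _ _ _ _ Hz1 Hz2) as [Hs1 Hs2].
destruct (real_kern_series (s - 1) N x th) as [K1 K2].
split; unfold PSeries; apply is_series_unique.
- replace (PzRe S T N) with ((s - 1) * dval one S T 0 N + (x * cos th * dval one S T 0 N - x * sin th * dval one S T (PI / 2) N) +
     pw N (s - 1 + x * cos th) * cos (x * sin th * lg N + 0)).
  + eapply is_series_ext_R; [|apply (pl _ _ _ _ (pl _ _ _ _ (sc (s - 1) _ _ Hz1) Hs1) K1)].
    intros m. unfold rot, zero_seq, ZN. ring.
  + unfold PzRe. replace (s - 1 + x * cos th) with (S - 1) by (unfold S; ring). unfold S, T. ring.
- replace (PzIm S T N) with ((s - 1) * dval one S T (PI / 2) N + (x * cos th * dval one S T (PI / 2) N + x * sin th * dval one S T 0 N) +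
     pw N (s - 1 + x * cos th) * cos (x * sin th * lg N + PI / 2)).
  + eapply is_series_ext_R; [|apply (pl _ _ _ _ (pl _ _ _ _ (sc (s - 1) _ _ Hz2) Hs2) K2)].
    intros m. unfold rot, zero_seq, oppseq, ZN. ring.
  + unfold PzIm. replace (s - 1 + x * cos th) with (S - 1) by (unfold S; ring). unfold S, T. ring.
Qed.

(* Log-derivative coefficients of [(s-1) zeta(s)]: those of zeta plus those of [1/(s-1)]. *)
Definition zp (s : R) (j : nat) : R := coef (lamal one) s 0 0 j + (-1) ^ j / (s - 1) ^ S j.

Lemma inv_series (w x : R) : 0 < w -> Rabs x < w -> PSeries (fun j => (-1) ^ j / w ^ S j) x = / (w + x).
Proof.
intros Hw Hx. unfold PSeries.
assert (Hq : Rabs (- x / w) < 1).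
{ unfold Rdiv. rewrite Rabs_mult, Rabs_Ropp, (Rabs_pos_eq (/ w)) by pos.
  apply Rmult_lt_reg_r with w; [exact Hw|]. rewrite Rmult_assoc, Rinv_l; lra. }
rewrite (Series_ext _ (fun j => / w * (- x / w) ^ j)).
- rewrite Series_scal_l, Series_geom by exact Hq. apply Rabs_def2 in Hx. field. split; lra.
- intros j. unfold Rdiv. rewrite Rpow_mult_distr, pow_inv. replace (- x) with (-1 * x) by ring. rewrite Rpow_mult_distr.
  simpl pow. field. split; [apply pow_nonzero; lra|lra].
Qed.

(** The product rule for [(w + z) zeta], with [w = s - 1], is verified for the sums of the series
    near the centre and carried back to coefficients by uniqueness; no Cauchy product with the
    series of [1/(w + z)] has to be rearranged. *)
Lemma Zc_log_derivative s : 3 <= s ->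
  (forall m, PS_derive (Zc s) m = PS_mult (zp s) (Zc s) m - PS_mult zero_seq zero_seq m) /\
  (forall m, PS_derive zero_seq m = PS_mult (zp s) zero_seq m + PS_mult zero_seq (Zc s) m).
Proof.
intros Hs.
assert (Hz0 : forall f m, PS_mult zero_seq f m = 0).
{ intros f m. unfold PS_mult, zero_seq. rewrite (sum_eq _ (fun _ => 0)) by (intros; ring). rewrite sum_cte. ring. }
assert (Hz1 : forall f m, PS_mult f zero_seq m = 0).
{ intros f m. unfold PS_mult, zero_seq. rewrite (sum_eq _ (fun _ => 0)) by (intros; ring). rewrite sum_cte. ring. }
split.
2:{ intros m. rewrite Hz0, Hz1. unfold PS_derive, zero_seq. ring. }
intros m. rewrite Hz0, Rminus_0_r. revert m.
set (z := coef one s 0 0). set (p := coef (lamal one) s 0 0). set (w := s - 1).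
assert (Hz : forall m, PS_derive z m = PS_mult p z m).
{ destruct (dirichlet_log_derivative one one_mul one_abs s 0 Hs) as [H _]. intros m.
  transitivity (PS_mult p z m - PS_mult (coef (lamal one) s 0 (PI / 2)) (coef one s 0 (PI / 2)) m); [exact (H m)|].
  replace (PS_mult (coef (lamal one) s 0 (PI / 2)) (coef one s 0 (PI / 2)) m) with 0; [ring|].
  assert (E : forall k, coef one s 0 (PI / 2) k = 0).
  { intros k. unfold coef, Slim. rewrite (Lim_seq_ext _ (fun _ => 0)).
    - rewrite Lim_seq_const. reflexivity.
    - intros N. rewrite (S1_ext _ (fun _ => 0)); [apply S1_zero|]. intros n _. rewrite kern_half. ring. }
  unfold PS_mult. rewrite (sum_eq _ (fun _ => 0)); [rewrite sum_cte; ring|]. intros k _. rewrite E. ring. }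
assert (Bz : geom_bound z (1 + / 1) 1) by (apply (coef_abs_bound one one_abs s 0 0 1 1); lra).
assert (Bp : geom_bound p (/ (1/2) * (1 + / (1/2))) 1) by (apply (pcoef_bound one one_abs s 0 0 1 (1/2)); lra).
assert (Bi : geom_bound (fun j => (-1) ^ j / w ^ S j) 1 1).
{ intros j. unfold Rdiv. rewrite Rabs_mult, pow_1_abs, Rmult_1_l, pow1, Rinv_1, Rmult_1_r.
  rewrite Rabs_pos_eq by (left; apply Rinv_0_lt_compat, pow_lt; unfold w; lra).
  rewrite <- Rinv_1. apply Rinv_le_contravar; [lra|]. apply pow_R1_Rle. unfold w; lra. }
assert (BP : geom_bound (zp s) 7 1).
{ intros j. unfold zp. eapply Rle_trans; [apply Rabs_triang|]. fold p w. specialize (Bp j). specialize (Bi j).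
  rewrite pow1 in *. lra. }
assert (BZ : geom_bound (Zc s) (2 * (s + 1)) 1).
{ intros j. unfold Zc. fold z w. eapply Rle_trans; [apply Rabs_triang|].
  rewrite pow1, Rdiv_1_r. rewrite Rabs_mult, (Rabs_pos_eq w) by (unfold w; lra).
  assert (Rabs (z j) <= 2) by (specialize (Bz j); rewrite pow1 in Bz; lra).
  assert (Rabs (shift z j) <= 2).
  { destruct j; simpl; [rewrite Rabs_R0; lra|]. specialize (Bz j); rewrite pow1 in Bz; lra. }
  unfold w. nra. }
assert (R1 : forall f B x, geom_bound f B 1 -> Rabs x < 1 / 2 -> Rbar_lt (Rabs x) (CV_radius f)).
{ intros f B x Hf Hx. apply (geom_bound_radius f B 1); [lra|exact Hf|lra]. }
assert (HZ : forall x, Rabs x < 1 -> PSeries (Zc s) x = (w + x) * PSeries z x).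
{ intros x Hx. assert (Rz : Rbar_lt (Rabs x) (CV_radius z)) by (apply (geom_bound_radius z (1 + / 1) 1); [lra|exact Bz|exact Hx]).
  rewrite (PSeries_ext _ (PS_plus (PS_scal w z) (PS_incr_1 z))).
  - rewrite PSeries_plus, PSeries_scal, PSeries_incr_1; [ring| |].
    + apply (ex_pseries_scal w z x); [apply Rmult_comm|apply CV_radius_inside, Rz].
    + apply (ex_pseries_incr_1 z x). apply CV_radius_inside, Rz.
  - intros n. unfold Zc, PS_plus, PS_scal, PS_incr_1. fold z w. destruct n; reflexivity. }
apply (PSeries_coef_ext _ _ (14 * (s + 1) + 4 * (s + 1)) (1 / 2)).
- lra.
- lra.
- intros m. eapply Rle_trans; [apply (PS_derive_bound (Zc s) (2 * (s + 1)) 1); [lra|lra|exact BZ]|].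
  apply Rmult_le_compat_r; [pos|]. lra.
- intros m. eapply Rle_trans; [apply (PS_mult_bound (zp s) (Zc s) 7 (2 * (s + 1)) 1); [lra|lra|lra|exact BP|exact BZ]|].
  apply Rmult_le_compat_r; [pos|]. lra.
- intros x Hx.
  assert (Rz := R1 z _ x Bz Hx). assert (Rp := R1 p _ x Bp Hx). assert (RP := R1 (zp s) _ x BP Hx). assert (RZ := R1 (Zc s) _ x BZ Hx).
  assert (Ri := R1 _ _ x Bi Hx).
  rewrite PSeries_mult by assumption. rewrite HZ by lra.
  assert (EP : PSeries (zp s) x = PSeries p x + / (w + x)).
  { rewrite (PSeries_ext _ (PS_plus p (fun j => (-1) ^ j / w ^ S j))) by reflexivity.
    rewrite PSeries_plus by (apply CV_radius_inside; assumption). rewrite inv_series by (unfold w; lra). reflexivity. }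
  rewrite EP.
  assert (D1 : is_derive (PSeries (Zc s)) x (PSeries (PS_derive (Zc s)) x)) by (apply is_derive_PSeries, RZ).
  assert (D2 : is_derive (PSeries (Zc s)) x (1 * PSeries z x + (w + x) * (PSeries p x * PSeries z x))).
  { apply (is_derive_ext_loc (fun x => (w + x) * PSeries z x)).
    - assert (Hp : 0 < 1 - Rabs x) by lra. exists (mkposreal _ Hp). intros y Hy. symmetry. apply HZ.
      assert (Hy' : Rabs (y - x) < 1 - Rabs x) by exact Hy.
      assert (Ht : Rabs (y - x + x) <= Rabs (y - x) + Rabs x) by apply Rabs_triang.
      unfold Rminus in Ht at 1. rewrite Rplus_assoc, Rplus_opp_l, Rplus_0_r in Ht. lra.
    - evar_last.
      { apply (is_derive_mult (fun x => w + x) (PSeries z) x 1 (PSeries (PS_derive z) x)); [|apply is_derive_PSeries, Rz|intros; apply Rmult_comm].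
        auto_derive; [exact I|ring]. }
      rewrite (PSeries_ext (PS_derive z) (PS_mult p z) x Hz), PSeries_mult by assumption. reflexivity. }
  apply is_derive_unique in D1. apply is_derive_unique in D2. rewrite <- D1, D2.
  apply Rabs_def2 in Hx. field. unfold w; lra.
Qed.

(** * Nonvanishing on the closed half-plane of absolute convergence *)

Lemma coefN_pi al s t N m : coefN al s t (PI / 2 + PI / 2) N m = - coefN al s t 0 N m.
Proof.
unfold coefN. rewrite <- S1_opp. apply S1_ext. intros n _. rewrite kern_shift. unfold kern.
replace (t * lg n + PI / 2) with (PI / 2 + t * lg n) by ring.
rewrite sin_plus, cos_PI2, sin_PI2, Rplus_0_r. ring.
Qed.

Lemma is_lim_seq_rot (f g : nat -> nat -> R) (a b : nat -> R) th m :
  is_lim_seq (fun N => f N m) (a m) -> is_lim_seq (fun N => g N m) (b m) ->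
  is_lim_seq (fun N => rot (f N) (g N) th m) (rot a b th m).
Proof.
intros Hf Hg. unfold rot. apply is_lim_seq_minus'.
- apply (is_lim_seq_scal_r _ (cos (INR m * th)) (a m)), Hf.
- apply (is_lim_seq_scal_r _ (sin (INR m * th)) (b m)), Hg.
Qed.

(** The input of [PSeries_dominated]: a Cauchy bound at radius [r] uniform in [N], and convergence
    of every coefficient. *)
Definition has_coefs (al : nat -> R) (C r s t : R) : Prop :=
  0 < r /\ 0 <= C /\ (forall ph N, geom_bound (coefN al s t ph N) C r) /\
  (forall ph m, is_lim_seq (fun N => coefN al s t ph N m) (coef al s t ph m)).

Lemma has_coefs_bound al C r s t ph : has_coefs al C r s t -> geom_bound (coef al s t ph) C r.
Proof.
intros (Hr & HC & Hb & Hl) m.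
apply (is_lim_seq_le (fun N => Rabs (coefN al s t ph N m)) (fun _ => C / r ^ m) (Rabs (coef al s t ph m)) (C / r ^ m)).
- intros N. apply Hb.
- apply (is_lim_seq_abs _ (coef al s t ph m)), Hl.
- apply is_lim_seq_const.
Qed.

Lemma dval_lim al C r s t x th : has_coefs al C r s t -> Rabs x < r ->
  let a := coef al s t 0 in let b := coef al s t (PI / 2) in
  is_lim_seq (dval al (s + x * cos th) (t + x * sin th) 0) (PSeries (rot a b th) x) /\
  is_lim_seq (dval al (s + x * cos th) (t + x * sin th) (PI / 2)) (PSeries (rot b (oppseq a) th) x).
Proof.
intros (Hr & HC & Hb & Hl) Hx a b. split.
- eapply is_lim_seq_ext; [intros N; apply dval_PSeries|].
  apply (PSeries_dominated (fun N => rot (coefN al s t 0 N) (coefN al s t (0 + PI / 2) N) th) (rot a b th) (2 * C) r x); [exact Hr|lra| | |exact Hx].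
  + intros N. apply rot_bound; auto.
  + intros m. rewrite Rplus_0_l. apply is_lim_seq_rot; apply Hl.
- eapply is_lim_seq_ext; [intros N; apply dval_PSeries|].
  apply (PSeries_dominated (fun N => rot (coefN al s t (PI / 2) N) (coefN al s t (PI / 2 + PI / 2) N) th) (rot b (oppseq a) th) (2 * C) r x); [exact Hr|lra| | |exact Hx].
  + intros N. apply rot_bound; auto.
  + intros m. apply is_lim_seq_rot; [apply Hl|].
    eapply is_lim_seq_ext; [intros N; symmetry; apply coefN_pi|].
    apply (is_lim_seq_opp _ (a m)). apply Hl.
Qed.

Lemma rot_0 a b m : rot a b 0 m = a m.
Proof. unfold rot. rewrite Rmult_0_r, cos_0, sin_0. ring. Qed.

Lemma dval_lim_real al C r s t x : has_coefs al C r s t -> Rabs x < r ->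
  is_lim_seq (dval al (s + x) t 0) (PSeries (coef al s t 0) x) /\
  is_lim_seq (dval al (s + x) t (PI / 2)) (PSeries (coef al s t (PI / 2)) x).
Proof.
intros H Hx. destruct (dval_lim al C r s t x 0 H Hx) as [H1 H2].
rewrite cos_0, sin_0, Rmult_1_r, Rmult_0_r, Rplus_0_r in H1, H2.
rewrite (PSeries_ext _ (coef al s t 0)) in H1 by apply rot_0.
rewrite (PSeries_ext _ (coef al s t (PI / 2))) in H2 by apply rot_0.
split; assumption.
Qed.

Lemma coef_lim_gen (al : nat -> R) (K s t ph : R) (m : nat) : (forall n, Rabs (al n) <= K) -> 3 <= s ->
  is_lim_seq (fun N => coefN al s t ph N m) (coef al s t ph m).
Proof.
intros Hal Hs. assert (HK : 0 <= K) by (eapply Rle_trans; [apply Rabs_pos|apply (Hal 0%nat)]).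
apply (Slim_correct _ (fun n => K * pw n (1 + 1)) (K * (1 + / 1))).
- intros n _. rewrite Rabs_mult. specialize (Hal n).
  assert (B := kern_bound s t ph m n 1 ltac:(lra)). rewrite pow1, Rmult_1_l in B.
  assert (P := pw_le n (1 + 1) (s - 1) ltac:(lra)).
  apply Rmult_le_compat; [apply Rabs_pos|apply Rabs_pos|exact Hal|lra].
- intros N. rewrite S1_scal. apply Rmult_le_compat_l; [exact HK|]. apply S1_pw_bound; lra.
Qed.

Lemma has_coefs_bounded_sums al B K s t r : (forall N, Rabs (S1 al N) <= B) -> (forall n, Rabs (al n) <= K) ->
  3 <= s -> 0 < r < s -> has_coefs al (B * (1 + (s + Rabs t + r) * (1 + / (s - r)))) r s t.
Proof.
intros HB HK Hs Hr. split; [lra|split; [|split]].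
- assert (0 <= B) by (eapply Rle_trans; [apply Rabs_pos|apply (HB 0%nat)]).
  assert (0 < / (s - r)) by pos. pose proof (Rabs_pos t).
  apply Rmult_le_pos; [assumption|]. nra.
- intros ph N. apply coefN_bound; assumption.
- intros ph m. eapply coef_lim_gen; eassumption.
Qed.

Lemma has_coefs_abs al e s t r : (forall n, Rabs (al n) <= 1) -> 3 <= s -> 0 < e -> 0 < r -> s - r >= 1 + e ->
  has_coefs al (1 + / e) r s t.
Proof.
intros Hal Hs He Hr Hsr. split; [exact Hr|split; [|split]].
- assert (0 < / e) by pos. lra.
- intros ph N. apply coefN_abs_bound; assumption.
- intros ph m. apply coef_lim; assumption.
Qed.

Lemma G_0 s x : G s 0 x = exp (- s * x).
Proof. unfold G. simpl. field. Qed.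

(** The term [n = 1] equals [1], and all others together are at most the sum of [n^(-3)] over
    [n >= 2], which is below [1/2]. *)
Lemma coef0_lower (al : nat -> R) s t : al 1%nat = 1 -> (forall n, Rabs (al n) <= 1) -> 3 <= s ->
  1 / 2 <= coef al s t 0 0.
Proof.
intros H1 Hal Hs.
apply (is_lim_seq_le_loc (fun _ => 1 / 2) (fun N => coefN al s t 0 N 0%nat) (1 / 2) (coef al s t 0 0)).
- exists 1%nat. intros N HN. unfold coefN.
  assert (E : S1 (fun n => al n * kern s t 0 0 n) 1 = 1).
  { simpl. rewrite H1. unfold kern. rewrite G_0. simpl. rewrite ln_1, !Rmult_0_r, Rplus_0_r, exp_0, cos_0. ring. }
  assert (T := S1_tail (fun n => al n * kern s t 0 0 n) 2 1 N ltac:(lra) ltac:(lia)).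
  assert (T' : Rabs (S1 (fun n => al n * kern s t 0 0 n) N - S1 (fun n => al n * kern s t 0 0 n) 1) <= / 2 * pw 1 2).
  { apply T. intros n Hn. rewrite Rabs_mult. specialize (Hal n).
    assert (B := kern_bound s t 0 0 n 0 ltac:(lra)). simpl pow in B. rewrite Rmult_1_l, Rminus_0_r in B.
    assert (P := pw_le n (1 + 2) s ltac:(lra)). pose proof (Rabs_pos (kern s t 0 0 n)). nra. }
  rewrite E, pw_1 in T'. apply Rabs_le_between in T'. lra.
- apply is_lim_seq_const.
- apply coef_lim; assumption.
Qed.

Section RightHalfPlane.
Variable (al : nat -> R).
Hypothesis Hmul : forall m n, al (m * n)%nat = al m * al n.
Hypothesis Habs : forall n, Rabs (al n) <= 1.
Hypothesis H1 : al 1%nat = 1.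

Lemma modulus_right_of_one s t y : 3 <= s -> 0 <= y < s - 1 ->
  let a := coef al s t 0 in let b := coef al s t (PI / 2) in
  PSeries a (- y) ^ 2 + PSeries b (- y) ^ 2 =
  (a 0%nat ^ 2 + b 0%nat ^ 2) * exp (2 * PSeries (PS_Int (coef (lamal al) s t 0)) (- y)).
Proof.
intros Hs Hy a b. set (e := (s - 1 - y) / 4). assert (He : 0 < e) by (unfold e; lra).
set (r := s - 1 - 2 * e). assert (Hr : 0 < r) by (unfold r, e; lra).
assert (Hyr : y < r) by (unfold r, e; lra).
set (K := (1 + / e) + / e * (1 + / e)).
assert (Hie : 0 < / e) by pos.
assert (HK1 : 1 + / e <= K) by (unfold K; nra). assert (HK2 : / e * (1 + / e) <= K) by (unfold K; nra).
assert (W : forall f k, k <= K -> geom_bound f k r -> geom_bound f K r).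
{ intros f k Hk Hf m. eapply Rle_trans; [apply Hf|]. apply Rmult_le_compat_r; [pos|exact Hk]. }
destruct (dirichlet_log_derivative al Hmul Habs s t Hs) as [Da Db].
apply (modulus_along_ray a b (coef (lamal al) s t 0) (coef (lamal al) s t (PI / 2)) Da Db K r).
- exact Hr.
- apply (W _ _ HK1). apply coef_abs_bound; try assumption. unfold r; lra.
- apply (W _ _ HK1). apply coef_abs_bound; try assumption. unfold r; lra.
- apply (W _ _ HK2). apply pcoef_bound; try assumption. unfold r; lra.
- apply (W _ _ HK2). apply pcoef_bound; try assumption. unfold r; lra.
- rewrite Rabs_Ropp, Rabs_pos_eq; lra.
Qed.

(** On the real ray from a centre [s0 >= 3] down to [s] the squared modulus is its nonzero value at
    [s0] times an exponential. *)
Lemma right_of_one s t : 1 < s -> exists u v, is_lim_seq (dval al s t 0) (Finite u) /\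
  is_lim_seq (dval al s t (PI / 2)) (Finite v) /\ 0 < u ^ 2 + v ^ 2.
Proof.
intros Hs. set (s0 := Rmax 3 s). assert (Hs0 : 3 <= s0) by apply Rmax_l. assert (Hs0' : s <= s0) by apply Rmax_r.
set (y := s0 - s). assert (Hy : 0 <= y < s0 - 1) by (unfold y; lra).
set (e := (s0 - 1 - y) / 2). assert (HC : has_coefs al (1 + / e) (s0 - 1 - e) s0 t).
{ apply has_coefs_abs; try assumption; unfold e; lra. }
destruct (dval_lim_real al _ _ s0 t (- y) HC) as [L1 L2].
{ rewrite Rabs_Ropp, Rabs_pos_eq; unfold e; lra. }
replace (s0 + - y) with s in L1, L2 by (unfold y; ring).
eexists. eexists. split; [exact L1|split; [exact L2|]].
rewrite (modulus_right_of_one s0 t y Hs0 Hy). apply Rmult_lt_0_compat; [|apply exp_pos].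
assert (B := coef0_lower al s0 t H1 Habs Hs0). nra.
Qed.
End RightHalfPlane.

(** * The 3-4-1 inequality *)

Section ThreeFourOne.
Variable (al : nat -> R).
Hypothesis Hmul : forall m n, al (m * n)%nat = al m * al n.
Hypothesis Hval : forall n, al n = -1 \/ al n = 0 \/ al n = 1.
Hypothesis H1 : al 1%nat = 1.

Lemma val_abs n : Rabs (al n) <= 1.
Proof.
destruct (Hval n) as [-> | [-> | ->]]; [rewrite Rabs_left; lra|rewrite Rabs_R0; lra|rewrite Rabs_R1; lra].
Qed.

(** The last cosine carries no factor [c^2], so zeta itself can be used at [2 t] for every
    character. For [c = 0] the sum is [3] plus a cosine, otherwise it is [2 (1 + c cos)^2]. *)
Lemma trig_341 (c t L : R) : c = -1 \/ c = 0 \/ c = 1 ->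
  0 <= 3 * cos (0 * L + 0) + 4 * (c * cos (t * L + 0)) + cos (2 * t * L + 0).
Proof.
intros Hc. rewrite !Rplus_0_r, Rmult_0_l, cos_0. replace (2 * t * L) with (2 * (t * L)) by ring.
rewrite cos_2a_cos. pose proof (COS_bound (t * L)). destruct Hc as [-> | [-> | ->]]; nra.
Qed.

Lemma G_sign s j x : 0 <= x -> 0 <= (-1) ^ j * G s j x.
Proof.
intros Hx. unfold G. replace (- x) with (-1 * x) by ring. rewrite Rpow_mult_distr.
replace ((-1) ^ j * (exp (- s * x) * ((-1) ^ j * x ^ j / INR (fact j)))) with
  ((-1 * -1) ^ j * (exp (- s * x) * (x ^ j / INR (fact j)))) by (rewrite Rpow_mult_distr; unfold Rdiv; ring).
replace (-1 * -1) with 1 by ring. rewrite pow1, Rmult_1_l.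
apply Rmult_le_pos; [pos|]. apply Rmult_le_pos; [pos|pos].
Qed.

Lemma coef_341_sign s t j : 3 <= s ->
  0 <= (-1) ^ (S j) * (3 * coef (lamal one) s 0 0 j + 4 * coef (lamal al) s t 0 j + coef (lamal one) s (2 * t) 0 j).
Proof.
intros Hs.
apply (is_lim_seq_le (fun _ => 0) (fun N => (-1) ^ (S j) * (3 * coefN (lamal one) s 0 0 N j + 4 * coefN (lamal al) s t 0 N j + coefN (lamal one) s (2 * t) 0 N j)) 0
  ((-1) ^ (S j) * (3 * coef (lamal one) s 0 0 j + 4 * coef (lamal al) s t 0 j + coef (lamal one) s (2 * t) 0 j))).
- intros N. unfold coefN. rewrite <- !S1_scal, <- !S1_plus, <- S1_scal. apply S1_pos. intros n _.
  unfold lamal, one, kern.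
  replace ((-1) ^ S j * (3 * (- (vonM n * 1) * (G s j (lg n) * cos (0 * lg n + 0))) +
   4 * (- (vonM n * al n) * (G s j (lg n) * cos (t * lg n + 0))) +
   - (vonM n * 1) * (G s j (lg n) * cos (2 * t * lg n + 0)))) with
   (vonM n * ((-1) ^ j * G s j (lg n)) * (3 * cos (0 * lg n + 0) + 4 * (al n * cos (t * lg n + 0)) + cos (2 * t * lg n + 0))) by (simpl pow; ring).
  apply Rmult_le_pos; [apply Rmult_le_pos; [apply vonM_ge0|apply G_sign, ln_INR_pos]|apply trig_341, Hval].
- apply is_lim_seq_const.
- apply (is_lim_seq_scal_l _ ((-1) ^ S j) (3 * coef (lamal one) s 0 0 j + 4 * coef (lamal al) s t 0 j + coef (lamal one) s (2 * t) 0 j)).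
  apply is_lim_seq_plus'; [apply is_lim_seq_plus'|].
  + apply (is_lim_seq_scal_l _ 3 (coef (lamal one) s 0 0 j)), pcoef_lim; [apply one_abs|exact Hs].
  + apply (is_lim_seq_scal_l _ 4 (coef (lamal al) s t 0 j)), pcoef_lim; [apply val_abs|exact Hs].
  + apply pcoef_lim; [apply one_abs|exact Hs].
Qed.

(** By [coef_341_sign] every Taylor coefficient of the combined logarithm contributes nonnegatively
    when moving left by [y], so the product is at least its value at the centre, where each of the
    [3 + 4 + 1] squared moduli is at least [1/4]. *)
Lemma product_341 t y : 0 <= y < 2 ->
  let U f u := PSeries (coef f 3 u 0) (- y) ^ 2 + PSeries (coef f 3 u (PI / 2)) (- y) ^ 2 in
  (1 / 4) ^ 8 <= U one 0 ^ 3 * U al t ^ 4 * U one (2 * t).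
Proof.
intros Hy U.
assert (M1 := modulus_right_of_one one one_mul one_abs 3 0 y ltac:(lra) ltac:(lra)).
assert (M2 := modulus_right_of_one al Hmul val_abs 3 t y ltac:(lra) ltac:(lra)).
assert (M3 := modulus_right_of_one one one_mul one_abs 3 (2 * t) y ltac:(lra) ltac:(lra)).
cbv zeta in M1, M2, M3. fold (U one 0) in M1. fold (U al t) in M2. fold (U one (2 * t)) in M3.
set (p1 := coef (lamal one) 3 0 0) in *. set (p2 := coef (lamal al) 3 t 0) in *. set (p3 := coef (lamal one) 3 (2 * t) 0) in *.
set (e := (2 - y) / 4). assert (He : 0 < e) by (unfold e; lra).
set (r := 2 - 2 * e). assert (Hr : 0 < r) by (unfold r, e; lra). assert (Hyr : y < r) by (unfold r, e; lra).
set (K := / e * (1 + / e)). assert (Hie : 0 < / e) by pos.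
assert (HK : 0 <= K) by (unfold K; nra).
assert (B1 : geom_bound p1 K r) by (apply pcoef_bound; try assumption; [apply one_abs|lra|unfold r; lra]).
assert (B2 : geom_bound p2 K r) by (apply pcoef_bound; try assumption; [apply val_abs|lra|unfold r; lra]).
assert (B3 : geom_bound p3 K r) by (apply pcoef_bound; try assumption; [apply one_abs|lra|unfold r; lra]).
assert (Ex : forall p, geom_bound p K r -> ex_series (fun k => PS_Int p k * (- y) ^ k)).
{ intros p Bp. apply ex_series_Rabs, CV_disk_inside. apply (geom_bound_radius _ (K * r) r); [exact Hr|apply PS_Int_bound; assumption|].
  rewrite Rabs_Ropp, Rabs_pos_eq; lra. }
assert (E1 : ex_series (fun k => 3 * (PS_Int p1 k * (- y) ^ k))) by (apply (ex_series_scal (V := R_NormedModule) 3 (fun k => PS_Int p1 k * (- y) ^ k)), Ex, B1).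
assert (E2 : ex_series (fun k => 4 * (PS_Int p2 k * (- y) ^ k))) by (apply (ex_series_scal (V := R_NormedModule) 4 (fun k => PS_Int p2 k * (- y) ^ k)), Ex, B2).
assert (E12 := ex_series_plus (V := R_NormedModule) _ _ E1 E2).
assert (E123 := ex_series_plus (V := R_NormedModule) _ _ E12 (Ex p3 B3)).
assert (HF : 0 <= 3 * PSeries (PS_Int p1) (- y) + 4 * PSeries (PS_Int p2) (- y) + PSeries (PS_Int p3) (- y)).
{ unfold PSeries. rewrite <- !Series_scal_l, <- !Series_plus.
  - assert (Z0 : Series (fun _ => 0) = 0) by (apply is_series_unique, is_series_0). rewrite <- Z0. apply Series_le.
    + intros k. split; [lra|]. destruct k as [|k]; [unfold PS_Int; simpl; lra|].
      assert (Sg := coef_341_sign 3 t k ltac:(lra)). fold p1 p2 p3 in Sg.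
      unfold PS_Int. replace (- y) with (-1 * y) by ring. rewrite Rpow_mult_distr.
      replace (3 * (p1 k / INR (S k) * ((-1) ^ S k * y ^ S k)) + 4 * (p2 k / INR (S k) * ((-1) ^ S k * y ^ S k)) + p3 k / INR (S k) * ((-1) ^ S k * y ^ S k))
       with (((-1) ^ S k * (3 * p1 k + 4 * p2 k + p3 k)) * (y ^ S k / INR (S k))) by (unfold Rdiv; ring).
      apply Rmult_le_pos; [exact Sg|]. apply Rmult_le_pos; [pos|pos].
    + exact E123.
  - exact E12.
  - exact (Ex p3 B3).
  - exact E1.
  - exact E2. }
assert (L1 := coef0_lower one 3 0 eq_refl one_abs ltac:(lra)).
assert (L2 := coef0_lower al 3 t H1 val_abs ltac:(lra)).
assert (L3 := coef0_lower one 3 (2 * t) eq_refl one_abs ltac:(lra)).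
set (F1 := PSeries (PS_Int p1) (- y)) in *. set (F2 := PSeries (PS_Int p2) (- y)) in *. set (F3 := PSeries (PS_Int p3) (- y)) in *.
set (c1 := coef one 3 0 0 0 ^ 2 + coef one 3 0 (PI / 2) 0 ^ 2) in *.
set (c2 := coef al 3 t 0 0 ^ 2 + coef al 3 t (PI / 2) 0 ^ 2) in *.
set (c3 := coef one 3 (2 * t) 0 0 ^ 2 + coef one 3 (2 * t) (PI / 2) 0 ^ 2) in *.
assert (C1 : 1 / 4 <= c1) by (unfold c1; nra). assert (C2 : 1 / 4 <= c2) by (unfold c2; nra). assert (C3 : 1 / 4 <= c3) by (unfold c3; nra).
rewrite M1, M2, M3.
assert (Ee : (c1 * exp (2 * F1)) ^ 3 * (c2 * exp (2 * F2)) ^ 4 * (c3 * exp (2 * F3)) =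
   c1 ^ 3 * c2 ^ 4 * c3 * exp (2 * (3 * F1 + 4 * F2 + F3))).
{ rewrite !Rpow_mult_distr, <- !exp_nat_pow.
  replace (2 * (3 * F1 + 4 * F2 + F3)) with (INR 3 * (2 * F1) + INR 4 * (2 * F2) + 2 * F3) by (simpl; ring).
  rewrite !exp_plus. ring. }
rewrite Ee.
assert (Ex1 : 1 <= exp (2 * (3 * F1 + 4 * F2 + F3))) by (rewrite <- exp_0; apply exp_le_compat; lra).
assert (P1 : (1 / 4) ^ 3 <= c1 ^ 3) by (apply pow_incr; lra).
assert (P2 : (1 / 4) ^ 4 <= c2 ^ 4) by (apply pow_incr; lra).
assert (Y : (1 / 4) ^ 3 * (1 / 4) ^ 4 * (1 / 4) <= c1 ^ 3 * c2 ^ 4 * c3) by (apply Rmult_le_compat; nra).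
replace ((1 / 4) ^ 8) with ((1 / 4) ^ 3 * (1 / 4) ^ 4 * (1 / 4)) by ring. nra.
Qed.

End ThreeFourOne.

(** * Zeros on the line of real part one *)

Lemma lim_unique (f : nat -> R) (u v : R) : is_lim_seq f u -> is_lim_seq f v -> u = v.
Proof.
intros H1 H2. apply is_lim_seq_unique in H1. apply is_lim_seq_unique in H2. rewrite H1 in H2. injection H2. auto.
Qed.

Lemma lim_scal (f : nat -> R) (x c : R) : is_lim_seq f x -> is_lim_seq (fun n => c * f n) (c * x).
Proof. apply (is_lim_seq_scal_l f c x). Qed.

(** Squared modulus of the Dirichlet series at [3 - y + it]; the line of real part one is approached
    as [y -> 2]. *)
Definition modsq (al : nat -> R) (t y : R) : R :=
  PSeries (coef al 3 t 0) (- y) ^ 2 + PSeries (coef al 3 t (PI / 2)) (- y) ^ 2.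

Lemma dval_lim_one al t y : (forall n, Rabs (al n) <= 1) -> 0 <= y < 2 ->
  is_lim_seq (dval al (3 - y) t 0) (PSeries (coef al 3 t 0) (- y)) /\
  is_lim_seq (dval al (3 - y) t (PI / 2)) (PSeries (coef al 3 t (PI / 2)) (- y)).
Proof.
intros Hal Hy. apply (dval_lim_real al (1 + / ((2 - y) / 2)) (2 - (2 - y) / 2) 3 t (- y)).
- apply has_coefs_abs; [exact Hal|lra|lra|lra|lra].
- rewrite Rabs_Ropp, Rabs_pos_eq; lra.
Qed.

Lemma modsq_zeta_real y : 0 <= y < 2 -> modsq one 0 y <= (1 + / (2 - y)) ^ 2.
Proof.
intros Hy. destruct (dval_lim_one one 0 y one_abs Hy) as [L1 L2].
assert (E : PSeries (coef one 3 0 (PI / 2)) (- y) = 0).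
{ apply (lim_unique _ _ _ L2). apply (is_lim_seq_ext (fun _ => 0)); [|apply is_lim_seq_const].
  intros N. unfold dval. rewrite (S1_ext _ (fun _ => 0)); [symmetry; apply S1_zero|].
  intros n _. rewrite Rmult_0_l, Rplus_0_l, cos_PI2. ring. }
unfold modsq. rewrite E.
assert (B : forall N, 0 <= dval one (3 - y) 0 0 N <= 1 + / (2 - y)).
{ intros N. unfold dval.
  rewrite (S1_ext _ (fun n => pw n (1 + (2 - y)))).
  - split; [apply S1_pos; intros; left; apply pw_pos|apply S1_pw_bound; lra].
  - intros n _. rewrite Rmult_0_l, Rplus_0_l, cos_0. unfold one. replace (3 - y) with (1 + (2 - y)) by ring. ring. }
set (u := PSeries (coef one 3 0 0) (- y)) in *.
assert (U1 : u <= 1 + / (2 - y)).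
{ apply (is_lim_seq_le _ (fun _ => 1 + / (2 - y)) u (1 + / (2 - y)) (fun N => proj2 (B N)) L1). apply is_lim_seq_const. }
assert (U0 : 0 <= u).
{ apply (is_lim_seq_le (fun _ => 0) _ 0 u (fun N => proj1 (B N))); [apply is_lim_seq_const|exact L1]. }
assert (u ^ 2 <= (1 + / (2 - y)) ^ 2) by (apply pow_incr; lra). simpl in *; lra.
Qed.

Lemma derive_zero_bound (f : R -> R) (x l : R) : is_derive f x l -> f x = 0 ->
  exists d K, 0 < d /\ 0 <= K /\ forall h, Rabs h < d -> Rabs (f (x + h)) <= K * Rabs h.
Proof.
intros Hf H0. apply is_derive_Reals in Hf. destruct (Hf 1 Rlt_0_1) as [d Hd].
exists d, (Rabs l + 1). split; [apply cond_pos|split; [pose proof (Rabs_pos l); lra|]].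
intros h Hh. destruct (Req_dec h 0) as [-> | N]; [rewrite Rplus_0_r, H0, Rabs_R0; lra|].
specialize (Hd h N Hh). rewrite H0, Rminus_0_r in Hd.
assert (E : f (x + h) = (f (x + h) / h - l + l) * h) by (field; exact N).
rewrite E, Rabs_mult. apply Rmult_le_compat_r; [apply Rabs_pos|].
eapply Rle_trans; [apply Rabs_triang|]. lra.
Qed.

(** With [h = 2 - y], the zeta factor cubed is [O(h^(-6))], the fourth power at a zero is [O(h^8)]
    and the last factor is bounded: the product is [O(h^2)], against [product_341]. [A] and [B]
    merely dominate the series of [al], since for zeta the functions differentiable at [-2] come
    from [altl]. *)
Lemma no_zero_341 (al : nat -> R) (t c C2 d0 dA dB : R) (A B : R -> R) :
  (forall m n, al (m * n)%nat = al m * al n) -> (forall n, al n = -1 \/ al n = 0 \/ al n = 1) -> al 1%nat = 1 ->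
  is_derive A (-2) dA -> is_derive B (-2) dB -> A (-2) = 0 -> B (-2) = 0 -> 0 < c -> 0 < d0 ->
  (forall y, 2 - d0 < y < 2 -> 0 <= y -> c * modsq al t y <= A (- y) ^ 2 + B (- y) ^ 2) ->
  (forall y, 2 - d0 < y < 2 -> 0 <= y -> modsq one (2 * t) y <= C2) -> False.
Proof.
intros Hm Hv H1 DA DB A0 B0 Hc Hd0 HU HC2.
destruct (derive_zero_bound A (-2) dA DA A0) as (d1 & K1 & Hd1 & HK1 & HA).
destruct (derive_zero_bound B (-2) dB DB B0) as (d2 & K2 & Hd2 & HK2 & HB).
set (K := (K1 ^ 2 + K2 ^ 2) / c). assert (HK : 0 <= K).
{ apply Rmult_le_pos; [nra|pos]. }
set (Q := 64 * K ^ 4 * (Rabs C2 + 1)).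
assert (HQ : 0 <= Q). { unfold Q. apply Rmult_le_pos; [pos|pose proof (Rabs_pos C2); lra]. }
assert (Hs8 : 0 < (1 / 4) ^ 8) by pos.
set (h := Rmin (Rmin (Rmin d1 d2) (Rmin d0 1)) ((1 / 4) ^ 8 / (Q + 1)) / 2).
assert (Hh0 : 0 < h).
{ unfold h. apply Rdiv_lt_0_compat; [|lra]. repeat apply Rmin_glb_lt; try lra. apply Rdiv_lt_0_compat; lra. }
assert (Hh : h < d1 /\ h < d2 /\ h < d0 /\ h < 1 /\ h < (1 / 4) ^ 8 / (Q + 1)).
{ assert (Hm1 := Rmin_l (Rmin (Rmin d1 d2) (Rmin d0 1)) ((1 / 4) ^ 8 / (Q + 1))).
  assert (Hm2 := Rmin_r (Rmin (Rmin d1 d2) (Rmin d0 1)) ((1 / 4) ^ 8 / (Q + 1))).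
  assert (Hm3 := Rmin_l (Rmin d1 d2) (Rmin d0 1)). assert (Hm4 := Rmin_r (Rmin d1 d2) (Rmin d0 1)).
  assert (Hm5 := Rmin_l d1 d2). assert (Hm6 := Rmin_r d1 d2). assert (Hm7 := Rmin_l d0 1). assert (Hm8 := Rmin_r d0 1).
  set (m := Rmin (Rmin (Rmin d1 d2) (Rmin d0 1)) ((1 / 4) ^ 8 / (Q + 1))) in *. unfold h in *. lra. }
destruct Hh as (h1 & h2 & h3 & h4 & h5).
set (y := 2 - h). assert (Hy : 0 <= y < 2) by (unfold y; lra).
specialize (HU y ltac:(unfold y; lra) ltac:(lra)). specialize (HC2 y ltac:(unfold y; lra) ltac:(lra)).
assert (HAh := HA h ltac:(rewrite Rabs_pos_eq; lra)). assert (HBh := HB h ltac:(rewrite Rabs_pos_eq; lra)).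
replace (-2 + h) with (- y) in HAh, HBh by (unfold y; ring). rewrite (Rabs_pos_eq h) in HAh, HBh by lra.
assert (UA : modsq al t y <= K * h ^ 2).
{ apply Rmult_le_reg_l with c; [exact Hc|]. eapply Rle_trans; [exact HU|].
  replace (c * (K * h ^ 2)) with ((K1 * h) ^ 2 + (K2 * h) ^ 2) by (unfold K; field; lra).
  rewrite <- (pow2_abs (A (- y))), <- (pow2_abs (B (- y))).
  apply Rplus_le_compat; apply pow_incr; split; auto using Rabs_pos. }
assert (U1 := modsq_zeta_real y Hy).
assert (U1' : modsq one 0 y <= (2 / h) ^ 2).
{ eapply Rle_trans; [exact U1|]. apply pow_incr. replace (2 - y) with h by (unfold y; ring).
  assert (0 < / h) by pos. split; [lra|].
  assert (1 <= / h) by (rewrite <- Rinv_1; apply Rinv_le_contravar; lra). unfold Rdiv. lra. }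
assert (P := product_341 al Hm Hv H1 t y Hy). cbv zeta in P.
fold (modsq one 0 y) in P. fold (modsq al t y) in P. fold (modsq one (2 * t) y) in P.
assert (N1 : 0 <= modsq one 0 y) by (unfold modsq; nra). assert (N2 : 0 <= modsq al t y) by (unfold modsq; nra).
assert (N3 : 0 <= modsq one (2 * t) y) by (unfold modsq; nra).
assert (X1 : modsq one 0 y ^ 3 <= ((2 / h) ^ 2) ^ 3) by (apply pow_incr; lra).
assert (X2 : modsq al t y ^ 4 <= (K * h ^ 2) ^ 4) by (apply pow_incr; lra).
assert (X3 : modsq one (2 * t) y <= Rabs C2 + 1) by (pose proof (Rle_abs C2); lra).
assert (X : modsq one 0 y ^ 3 * modsq al t y ^ 4 * modsq one (2 * t) y <= ((2 / h) ^ 2) ^ 3 * (K * h ^ 2) ^ 4 * (Rabs C2 + 1)).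
{ apply Rmult_le_compat; [apply Rmult_le_pos; apply pow_le; assumption|exact N3| |exact X3].
  apply Rmult_le_compat; [pos|pos|exact X1|exact X2]. }
replace (((2 / h) ^ 2) ^ 3 * (K * h ^ 2) ^ 4 * (Rabs C2 + 1)) with (Q * h ^ 2) in X by (unfold Q; field; lra).
assert (Hqh : (Q + 1) * h < (1 / 4) ^ 8).
{ apply (Rmult_lt_compat_l (Q + 1)) in h5; [|lra]. replace ((Q + 1) * ((1 / 4) ^ 8 / (Q + 1))) with ((1 / 4) ^ 8) in h5 by (field; lra). exact h5. }
assert (h ^ 2 <= h) by (simpl; nra).
assert (Q * h ^ 2 <= Q * h) by (apply Rmult_le_compat_l; assumption).
apply (Rlt_irrefl ((1 / 4) ^ 8)). eapply Rle_lt_trans; [exact P|]. eapply Rle_lt_trans; [exact X|].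
eapply Rle_lt_trans; [exact H0|]. eapply Rle_lt_trans; [|exact Hqh]. lra.
Qed.

(* [altl l] are the coefficients of [(1 - l^(1-s)) zeta(s)]; for [l = 2] this is eta. *)
Definition altl (l n : nat) : R := 1 - (if Nat.eqb (n mod l) 0 then INR l else 0).

Lemma altl_sum l N : (2 <= l)%nat -> S1 (altl l) N = INR (N mod l).
Proof.
intros Hl. induction N as [|N IH]; [rewrite Nat.Div0.mod_0_l; reflexivity|].
rewrite S1_S, IH. unfold altl.
pose proof (Nat.div_mod_eq N l). pose proof (Nat.div_mod_eq (S N) l).
pose proof (Nat.mod_upper_bound N l ltac:(lia)). pose proof (Nat.mod_upper_bound (S N) l ltac:(lia)).
revert H H0 H1 H2. generalize (N / l)%nat (S N / l)%nat (N mod l)%nat (S N mod l)%nat. intros u v r r' H H0 H1 H2.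
assert (Hc : (v <= u \/ v = S u \/ u + 2 <= v)%nat) by lia.
destruct (Nat.eqb_spec r' 0) as [E|E].
- assert (r = l - 1)%nat by (destruct Hc as [Hc|[Hc|Hc]]; [pose proof (Nat.mul_le_mono_l _ _ l Hc); lia|subst v; rewrite Nat.mul_succ_r in H0; lia|pose proof (Nat.mul_le_mono_l _ _ l Hc); rewrite Nat.mul_add_distr_l in *; lia]).
  subst r r'. rewrite minus_INR by lia. simpl. ring.
- assert (r' = S r)%nat by (destruct Hc as [Hc|[Hc|Hc]]; [|subst v; rewrite Nat.mul_succ_r in H0; lia|pose proof (Nat.mul_le_mono_l _ _ l Hc); rewrite Nat.mul_add_distr_l in *; lia];
    destruct (Nat.eq_dec v u) as [-> | Ne]; [lia|assert (Hv : (S v <= u)%nat) by lia; pose proof (Nat.mul_le_mono_l _ _ l Hv); rewrite Nat.mul_succ_r in *; lia]).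
  subst r'. rewrite S_INR. ring.
Qed.

Lemma altl_has_coefs l s t r : (2 <= l)%nat -> 3 <= s -> 0 < r < s ->
  has_coefs (altl l) (INR l * (1 + (s + Rabs t + r) * (1 + / (s - r)))) r s t.
Proof.
intros Hl Hs Hr. apply (has_coefs_bounded_sums _ _ (INR l)); [| |exact Hs|exact Hr].
- intros N. rewrite altl_sum by exact Hl. rewrite Rabs_pos_eq by apply pos_INR.
  apply le_INR. pose proof (Nat.mod_upper_bound N l ltac:(lia)). lia.
- intros n. unfold altl. assert (2 <= INR l) by (apply (le_INR 2); exact Hl).
  destruct (Nat.eqb _ _); [rewrite Rabs_left1; lra|rewrite Rabs_pos_eq; lra].
Qed.

Lemma dval_phase al s t ph d N : dval al s t (ph + d) N = cos d * dval al s t ph N + sin d * dval al s t (ph + PI / 2) N.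
Proof.
unfold dval. rewrite <- !S1_scal, <- S1_plus. apply S1_ext. intros n _.
rewrite <- !Rplus_assoc, !cos_plus, cos_PI2, sin_PI2. ring.
Qed.

Lemma dval_pi al s t N : dval al s t (PI / 2 + PI / 2) N = - dval al s t 0 N.
Proof.
unfold dval. rewrite <- S1_opp. apply S1_ext. intros n _.
replace (t * lg n + (PI / 2 + PI / 2)) with (t * lg n + 0 + PI) by field. rewrite neg_cos. ring.
Qed.

(** The multiples of [l] up to [l M] are [l] times the integers up to [M]; this realizes the factor
    [1 - l^(1-s)] on finite sums. *)
Lemma altl_dval l s t ph M : (2 <= l)%nat ->
  dval (altl l) s t ph (l * M) = dval one s t ph (l * M) - pw l (s - 1) * dval one s t (ph + t * lg l) M.
Proof.
intros Hl. assert (HL : 0 < INR l) by pos.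
set (H := fun n => INR l * (pw n s * cos (t * lg n + ph))).
transitivity (dval one s t ph (l * M) - S1 (fun n => if Nat.eqb (n mod l) 0 then H n else 0) (l * M)).
- unfold dval. rewrite <- S1_minus. apply S1_ext. intros n _. unfold altl, one, H. destruct (Nat.eqb _ _); ring.
- f_equal. transitivity (S1 (fun e => H (l * e)%nat) M).
  + rewrite S1_multiples by lia.
    assert (X : forall K, (M <= K)%nat -> S1 (fun e => if Nat.leb (l * e) (l * M) then H (l * e)%nat else 0) K = S1 (fun e => H (l * e)%nat) M).
    { intros K HK. induction HK as [|K HK IH].
      - apply S1_ext. intros e He. destruct (Nat.leb_spec (l * e) (l * M)); [reflexivity|nia].
      - rewrite S1_S, IH. destruct (Nat.leb_spec (l * S K) (l * M)); [nia|ring]. }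
    apply X. nia.
  + unfold dval. rewrite <- S1_scal. apply S1_ext. intros n Hn. unfold H, one.
    rewrite pw_mult, mult_INR, ln_mult by (try apply lt_0_INR; lia).
    replace (INR l * (pw l s * pw n s * cos (t * (lg l + lg n) + ph))) with
      ((INR l * pw l s) * (pw n s * cos (t * lg n + (ph + t * lg l)))) by (rewrite Rmult_plus_distr_l; replace (t * lg n + (ph + t * lg l)) with (t * lg l + t * lg n + ph) by ring; ring).
    rewrite Rmult_1_l. f_equal. unfold pw. rewrite <- (exp_ln (INR l)) at 1 by exact HL. rewrite <- exp_plus. f_equal. ring.
Qed.

Lemma is_lim_seq_mul_sub (f : nat -> R) (u : Rbar) l : (1 <= l)%nat -> is_lim_seq f u -> is_lim_seq (fun M => f (l * M)%nat) u.
Proof.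
intros Hl H. apply (is_lim_seq_subseq f u (fun M => (l * M)%nat)); [|exact H].
intros P [N HN]. exists N. intros n Hn. apply HN. nia.
Qed.

(** Real and imaginary part of [(s-1) (1 - l^(1-s)) zeta(s)]. The identity is exact because the
    corrections at [l M] and [M] cancel, by [l^(1-s) M^(1-s) = (l M)^(1-s)]. *)
Lemma pz_altl l s t M : (2 <= l)%nat -> (1 <= M)%nat ->
  let g := pw l (s - 1) in let d := t * lg l in
  let U := dval (altl l) s t 0 (l * M) in let V := dval (altl l) s t (PI / 2) (l * M) in
  (s - 1) * U - t * V = PzRe s t (l * M) - g * (cos d * PzRe s t M + sin d * PzIm s t M) /\
  (s - 1) * V + t * U = PzIm s t (l * M) - g * (cos d * PzIm s t M - sin d * PzRe s t M).
Proof.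
intros Hl HM g d U V. unfold U, V. rewrite !altl_dval by exact Hl. fold g d.
rewrite (dval_phase one s t 0 d), (dval_phase one s t (PI / 2) d), Rplus_0_l, dval_pi.
unfold PzRe, PzIm. rewrite !(pw_mult l M) by lia. fold g.
rewrite !mult_INR, !ln_mult by pos.
rewrite !Rplus_0_r, !(Rmult_plus_distr_l t). fold d.
set (x := t * lg M).
rewrite !(cos_plus _ (PI / 2)), cos_PI2, sin_PI2, cos_plus, sin_plus. split; ring.
Qed.

Lemma zeta_zero_altl l s t U V : (2 <= l)%nat -> (s <> 1 \/ t <> 0) ->
  is_lim_seq (PzRe s t) 0 -> is_lim_seq (PzIm s t) 0 ->
  is_lim_seq (dval (altl l) s t 0) (Finite U) -> is_lim_seq (dval (altl l) s t (PI / 2)) (Finite V) -> U = 0 /\ V = 0.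
Proof.
intros Hl Hst HR HI HU HV.
assert (HU' := is_lim_seq_mul_sub _ _ l ltac:(lia) HU). assert (HV' := is_lim_seq_mul_sub _ _ l ltac:(lia) HV).
assert (HR' := is_lim_seq_mul_sub _ _ l ltac:(lia) HR). assert (HI' := is_lim_seq_mul_sub _ _ l ltac:(lia) HI).
set (g := pw l (s - 1)). set (d := t * lg l).
assert (E1 : (s - 1) * U - t * V = 0 - g * (cos d * 0 + sin d * 0)).
{ apply (lim_unique (fun M => (s - 1) * dval (altl l) s t 0 (l * M) - t * dval (altl l) s t (PI / 2) (l * M))).
  - apply is_lim_seq_minus'; apply lim_scal; assumption.
  - apply (is_lim_seq_ext_loc (fun M => PzRe s t (l * M) - g * (cos d * PzRe s t M + sin d * PzIm s t M))).
    + exists 1%nat. intros M HM. symmetry. apply (proj1 (pz_altl l s t M Hl HM)).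
    + apply is_lim_seq_minus'; [exact HR'|]. apply lim_scal. apply is_lim_seq_plus'; apply lim_scal; assumption. }
assert (E2 : (s - 1) * V + t * U = 0 - g * (cos d * 0 - sin d * 0)).
{ apply (lim_unique (fun M => (s - 1) * dval (altl l) s t (PI / 2) (l * M) + t * dval (altl l) s t 0 (l * M))).
  - apply is_lim_seq_plus'; apply lim_scal; assumption.
  - apply (is_lim_seq_ext_loc (fun M => PzIm s t (l * M) - g * (cos d * PzIm s t M - sin d * PzRe s t M))).
    + exists 1%nat. intros M HM. symmetry. apply (proj2 (pz_altl l s t M Hl HM)).
    + apply is_lim_seq_minus'; [exact HI'|]. apply lim_scal. apply is_lim_seq_minus'; apply lim_scal; assumption. }
assert (Hpos : 0 < (s - 1) ^ 2 + t ^ 2).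
{ destruct Hst as [H|H]; [assert (0 < (s - 1) ^ 2) by (apply pow2_gt_0; lra)|assert (0 < t ^ 2) by (apply pow2_gt_0; lra)]; pose proof (pow2_ge_0 (s - 1)); pose proof (pow2_ge_0 t); lra. }
assert (F1 : ((s - 1) ^ 2 + t ^ 2) * U = 0).
{ transitivity ((s - 1) * ((s - 1) * U - t * V) + t * ((s - 1) * V + t * U)); [ring|]. rewrite E1, E2. ring. }
assert (F2 : ((s - 1) ^ 2 + t ^ 2) * V = 0).
{ transitivity ((s - 1) * ((s - 1) * V + t * U) - t * ((s - 1) * U - t * V)); [ring|]. rewrite E1, E2. ring. }
apply Rmult_integral in F1. apply Rmult_integral in F2. split; [destruct F1|destruct F2]; lra.
Qed.

(** If [l^(it)] and [(l+1)^(it)] were both [1], so would be [e^(iw)] with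
    [w = t (log (l+1) - log l)]; but [0 < |w| < 1] as soon as [l > |t|]. *)
Lemma exists_good_l t : t <> 0 -> exists l, (2 <= l)%nat /\ cos (t * lg l) < 1.
Proof.
intros Ht. destruct (nfloor_ex (Rabs t)) as [n [_ Hn]]; [apply Rabs_pos|].
set (l := S (S n)). assert (HL : Rabs t < INR l) by (unfold l; rewrite !S_INR in *; lra).
assert (Hl : (2 <= l)%nat) by (unfold l; lia).
destruct (Rlt_dec (cos (t * lg l)) 1) as [H|H]; [exists l; auto|].
exists (S l). split; [lia|]. apply Rnot_le_lt. intros H2.
assert (C1 : cos (t * lg l) = 1) by (pose proof (COS_bound (t * lg l)); lra).
assert (C2 : cos (t * lg (S l)) = 1) by (pose proof (COS_bound (t * lg (S l))); lra).
assert (S1' : sin (t * lg l) = 0) by (pose proof (sin2_cos2 (t * lg l)) as Q; unfold Rsqr in Q; rewrite C1 in Q; apply Rsqr_0_uniq; unfold Rsqr; lra).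
assert (S2' : sin (t * lg (S l)) = 0) by (pose proof (sin2_cos2 (t * lg (S l))) as Q; unfold Rsqr in Q; rewrite C2 in Q; apply Rsqr_0_uniq; unfold Rsqr; lra).
set (w := t * (lg (S l) - lg l)).
assert (Cw : cos w = 1).
{ unfold w. rewrite Rmult_minus_distr_l, cos_minus, C1, C2, S1', S2'. ring. }
assert (HLp : 0 < INR l) by pos.
assert (D1 : 0 < lg (S l) - lg l).
{ assert (lg l < lg (S l)) by (apply ln_increasing; [exact HLp|apply lt_INR; lia]). lra. }
assert (D2 := ln_succ_diff l ltac:(lia)).
assert (W1 : Rabs w < 1).
{ unfold w. rewrite Rabs_mult, (Rabs_pos_eq (_ - _)) by lra.
  apply Rle_lt_trans with (Rabs t * / INR l); [apply Rmult_le_compat_l; [apply Rabs_pos|exact D2]|].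
  apply Rmult_lt_reg_r with (INR l); [exact HLp|]. rewrite Rmult_assoc, Rinv_l; lra. }
assert (W0 : 0 < Rabs w).
{ unfold w. rewrite Rabs_mult, (Rabs_pos_eq (_ - _)) by lra. apply Rmult_lt_0_compat; [apply Rabs_pos_lt, Ht|exact D1]. }
assert (Cw' : cos (Rabs w) = 1) by (unfold Rabs; destruct (Rcase_abs w); [rewrite cos_neg|]; exact Cw).
assert (X : cos (Rabs w) < cos 0).
{ pose proof PI2_1. apply cos_decreasing_1; lra. }
rewrite cos_0 in X. lra.
Qed.

Lemma PSeries_derivable_at (a : nat -> R) (C r x : R) : 0 < r -> geom_bound a C r -> Rabs x < r ->
  is_derive (PSeries a) x (PSeries (PS_derive a) x).
Proof. intros Hr Ha Hx. apply is_derive_PSeries. apply (geom_bound_radius a C r); assumption. Qed.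

Lemma near_one_coefs l t : (2 <= l)%nat -> exists C, has_coefs (altl l) C (11 / 4) 3 t.
Proof. intros Hl. eexists. apply altl_has_coefs; [exact Hl|lra|lra]. Qed.

(* [|zeta(s+it)|^2] is controlled by the entire series [altl l] as soon as [l^(it) <> 1]. *)
Lemma zeta_via_altl l t : (2 <= l)%nat -> cos (t * lg l) < 1 -> exists d c, 0 < d /\ 0 < c /\
  forall y, 2 - d < y < 2 -> 0 <= y -> c * modsq one t y <= modsq (altl l) t y.
Proof.
intros Hl Hcos. assert (Hln : 0 < lg l) by (rewrite <- ln_1; apply ln_increasing; [lra|apply (lt_INR 1); lia]).
exists (/ (2 * lg l)), (1 - cos (t * lg l)).
split; [pos|split; [lra|]]. intros y Hy Hy0.
destruct (dval_lim_one one t y one_abs ltac:(lra)) as [L1 L2].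
destruct (near_one_coefs l t Hl) as [C HC].
destruct (dval_lim_real (altl l) C (11 / 4) 3 t (- y) HC) as [A1 A2]; [rewrite Rabs_Ropp, Rabs_pos_eq; lra|].
replace (3 + - y) with (3 - y) in A1, A2 by ring.
unfold modsq. set (u := PSeries (coef one 3 t 0) (- y)) in *. set (v := PSeries (coef one 3 t (PI / 2)) (- y)) in *.
set (U := PSeries (coef (altl l) 3 t 0) (- y)) in *. set (V := PSeries (coef (altl l) 3 t (PI / 2)) (- y)) in *.
set (s := 3 - y) in *. set (g := pw l (s - 1)). set (d := t * lg l) in *.
assert (EU : U = u - g * (cos d * u + sin d * v)).
{ apply (lim_unique (fun M => dval (altl l) s t 0 (l * M))); [apply is_lim_seq_mul_sub; [lia|exact A1]|].
  eapply is_lim_seq_ext; [intros M; symmetry; rewrite altl_dval by exact Hl; fold d; rewrite (dval_phase one s t 0 d), Rplus_0_l; reflexivity|].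
  apply is_lim_seq_minus'; [apply is_lim_seq_mul_sub; [lia|exact L1]|]. apply lim_scal, is_lim_seq_plus'; apply lim_scal; assumption. }
assert (EV : V = v - g * (cos d * v + sin d * - u)).
{ apply (lim_unique (fun M => dval (altl l) s t (PI / 2) (l * M))); [apply is_lim_seq_mul_sub; [lia|exact A2]|].
  eapply is_lim_seq_ext; [intros M; symmetry; rewrite altl_dval by exact Hl; fold d; rewrite (dval_phase one s t (PI / 2) d), dval_pi; reflexivity|].
  apply is_lim_seq_minus'; [apply is_lim_seq_mul_sub; [lia|exact L2]|]. apply lim_scal, is_lim_seq_plus'; apply lim_scal; [exact L2|].
  apply (is_lim_seq_opp _ u), L1. }
(* The strip has width [1/(2 log l)] for this bound. *)
assert (Hg : 1 / 2 <= g).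
{ unfold g, pw. eapply Rle_trans; [|apply exp_ineq1_le].
  assert ((s - 1) * lg l <= 1 / 2); [|lra].
  apply Rle_trans with (/ (2 * lg l) * lg l); [apply Rmult_le_compat_r; unfold s; lra|]. right. field. lra. }
(* The first factor is the squared modulus of [1 - g e^(-id)], where [g e^(-id)] is [l] to the power
   [1 - s - it]. *)
assert (E : U ^ 2 + V ^ 2 = ((1 - g) ^ 2 + 2 * g * (1 - cos d)) * (u ^ 2 + v ^ 2)).
{ rewrite EU, EV. pose proof (sin2_cos2 d) as Q. unfold Rsqr in Q.
  transitivity ((1 - 2 * g * cos d + g ^ 2 * (sin d * sin d + cos d * cos d)) * (u ^ 2 + v ^ 2)); [ring|]. rewrite Q. ring. }
rewrite E. apply Rmult_le_compat_r; [nra|]. assert (0 <= (1 - g) ^ 2) by apply pow2_ge_0. nra.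
Qed.

Lemma modsq_altl_bounded l t : (2 <= l)%nat -> exists K, forall y, 0 <= y <= 2 -> modsq (altl l) t y <= K.
Proof.
intros Hl. destruct (near_one_coefs l t Hl) as [C HC]. pose proof HC as (Hr & HCp & _ & _).
set (D := C / (1 - 2 / (11 / 4))).
assert (bd : forall ph y, 0 <= y <= 2 -> Rabs (PSeries (coef (altl l) 3 t ph) (- y)) <= D).
{ intros ph y Hy. eapply Rle_trans; [apply (PSeries_geom_bound _ C (11 / 4) (- y)); [lra|exact HCp|apply has_coefs_bound; exact HC|rewrite Rabs_Ropp, Rabs_pos_eq; lra]|].
  rewrite Rabs_Ropp, Rabs_pos_eq by lra. unfold D, Rdiv at 1 3. apply Rmult_le_compat_l; [exact HCp|]. apply Rinv_le_contravar; lra. }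
exists (D ^ 2 + D ^ 2). intros y Hy. unfold modsq.
apply Rplus_le_compat; rewrite <- pow2_abs; apply pow_incr; split; auto using Rabs_pos.
Qed.

Lemma zeta_bounded_near_one t : t <> 0 -> exists d K, 0 < d /\ forall y, 2 - d < y < 2 -> 0 <= y -> modsq one t y <= K.
Proof.
intros Ht. destruct (exists_good_l t Ht) as (l & Hl & Hc).
destruct (zeta_via_altl l t Hl Hc) as (d & c & Hd & Hcp & H).
destruct (modsq_altl_bounded l t Hl) as [K HK].
exists d, (K / c). split; [exact Hd|]. intros y Hy Hy0.
apply Rmult_le_reg_l with c; [exact Hcp|]. replace (c * (K / c)) with K by (field; lra).
eapply Rle_trans; [apply H; assumption|apply HK; lra].
Qed.

Theorem zeta_line_one t : t <> 0 -> is_lim_seq (PzRe 1 t) 0 -> is_lim_seq (PzIm 1 t) 0 -> False.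
Proof.
intros Ht HR HI. destruct (exists_good_l t Ht) as (l & Hl & Hc).
destruct (zeta_via_altl l t Hl Hc) as (d & c & Hd & Hcp & H).
destruct (zeta_bounded_near_one (2 * t) ltac:(lra)) as (d2 & K & Hd2 & HK).
destruct (near_one_coefs l t Hl) as [C HC]. assert (X2 : Rabs (-2) < 11 / 4) by (rewrite Rabs_left; lra).
destruct (dval_lim_real (altl l) C (11 / 4) 3 t (-2) HC X2) as [A1 A2].
replace (3 + -2) with 1 in A1, A2 by ring.
destruct (zeta_zero_altl l 1 t _ _ Hl (or_intror Ht) HR HI A1 A2) as [Z1 Z2].
eapply (no_zero_341 one t c K (Rmin d d2) _ _ (PSeries (coef (altl l) 3 t 0)) (PSeries (coef (altl l) 3 t (PI / 2)))).
- apply one_mul.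
- intros n. right; right; reflexivity.
- reflexivity.
- apply (PSeries_derivable_at _ C (11 / 4)); [lra|apply has_coefs_bound, HC|exact X2].
- apply (PSeries_derivable_at _ C (11 / 4)); [lra|apply has_coefs_bound, HC|exact X2].
- exact Z1.
- exact Z2.
- exact Hcp.
- apply Rmin_glb_lt; assumption.
- intros y Hy Hy0. apply H; [|exact Hy0]. pose proof (Rmin_l d d2). lra.
- intros y Hy Hy0. apply HK; [|exact Hy0]. pose proof (Rmin_r d d2). lra.
Qed.

Lemma rchar_has_coefs q ch s t r : rchar q ch -> 3 <= s -> 0 < r < s ->
  has_coefs ch (INR q * (1 + (s + Rabs t + r) * (1 + / (s - r)))) r s t.
Proof.
intros HC Hs Hr. apply (has_coefs_bounded_sums _ _ 1); [intros; apply rchar_sum_bound, HC|intros; eapply rchar_abs, HC|exact Hs|exact Hr].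
Qed.

Theorem rchar_line_one q ch t : rchar q ch -> t <> 0 ->
  is_lim_seq (dval ch 1 t 0) 0 -> is_lim_seq (dval ch 1 t (PI / 2)) 0 -> False.
Proof.
intros Hch Ht HR HI.
destruct (zeta_bounded_near_one (2 * t) ltac:(lra)) as (d2 & K & Hd2 & HK).
assert (HC := rchar_has_coefs q ch 3 t (11 / 4) Hch ltac:(lra) ltac:(lra)).
set (C := INR q * _) in HC.
assert (X2 : Rabs (-2) < 11 / 4) by (rewrite Rabs_left; lra).
destruct (dval_lim_real ch C (11 / 4) 3 t (-2) HC X2) as [A1 A2].
replace (3 + -2) with 1 in A1, A2 by ring.
eapply (no_zero_341 ch t 1 K d2 _ _ (PSeries (coef ch 3 t 0)) (PSeries (coef ch 3 t (PI / 2)))).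
- apply Hch.
- apply Hch.
- eapply rchar_one, Hch.
- apply (PSeries_derivable_at _ C (11 / 4)); [lra|apply has_coefs_bound, HC|exact X2].
- apply (PSeries_derivable_at _ C (11 / 4)); [lra|apply has_coefs_bound, HC|exact X2].
- apply (lim_unique _ _ _ A1 HR).
- apply (lim_unique _ _ _ A2 HI).
- lra.
- exact Hd2.
- intros y _ _. unfold modsq. lra.
- exact HK.
Qed.

(** * Nonvanishing of L(1, chi) *)

Definition dsum (ch : nat -> R) (n : nat) : R := S1 (fun d => if Nat.eqb (n mod d) 0 then ch d else 0) n.

Lemma eqb_divide n d : Nat.eqb (n mod d) 0 = true <-> Nat.divide d n.
Proof. rewrite Nat.eqb_eq. apply Nat.Lcm0.mod_divide. Qed.

Lemma dsum_ext ch n N : (1 <= n <= N)%nat -> S1 (fun d => if Nat.eqb (n mod d) 0 then ch d else 0) N = dsum ch n.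
Proof.
intros [H1 H]. unfold dsum. induction H as [|N H IH]; [reflexivity|]. rewrite S1_S, IH.
rewrite Nat.mod_small by lia. destruct (Nat.eqb_spec n 0); [lia|ring].
Qed.

(** A divisor of [p^(k+1) m] either divides [p^k m] or is [p^(k+1)] times a divisor of [m]. *)
Lemma dsum_step ch p k m : (forall a b, ch (a * b)%nat = ch a * ch b) -> prime (Z.of_nat p) ->
  ~ Nat.divide p m -> (1 <= m)%nat ->
  dsum ch (p ^ S k * m) = dsum ch (p ^ k * m) + ch (p ^ S k)%nat * dsum ch m.
Proof.
intros Hm Hp Hpm H1. assert (P2 : (2 <= p)%nat) by (apply prime_ge_2 in Hp; lia).
set (P := (p ^ S k)%nat). assert (HP : (1 <= P)%nat) by (unfold P; assert (p ^ S k <> 0)%nat by (apply Nat.pow_nonzero; lia); lia).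
assert (EP : P = (p * p ^ k)%nat) by reflexivity.
set (N := (P * m)%nat). rewrite <- (dsum_ext ch (p ^ k * m) N) by (unfold N; rewrite EP; nia).
assert (E : S1 (fun d => if Nat.eqb (d mod P) 0 then (if Nat.eqb (m mod (d / P)) 0 then ch d else 0) else 0) N = ch P * dsum ch m).
{ rewrite (S1_multiples (fun d => if Nat.eqb (m mod (d / P)) 0 then ch d else 0)) by exact HP.
  rewrite <- (dsum_ext ch m N), <- S1_scal by (unfold N; nia). apply S1_ext. intros e He.
  rewrite (Nat.mul_comm P e), Nat.div_mul, Hm by lia.
  destruct (Nat.eqb_spec (m mod e) 0) as [D|D].
  - apply Nat.Lcm0.mod_divide in D. apply Nat.divide_pos_le in D; [|lia].
    destruct (Nat.leb_spec (e * P) N); [ring|unfold N in *; nia].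
  - destruct (Nat.leb _ _); ring. }
rewrite <- E. unfold dsum. fold N. rewrite <- S1_plus. apply S1_ext. intros d Hd.
destruct (Nat.eqb (N mod d) 0) eqn:D1.
- apply eqb_divide in D1. destruct D1 as [e De].
  destruct (classic (Nat.divide p e)) as [[e' De']|Ne].
  + assert (D2 : Nat.divide d (p ^ k * m)).
    { exists e'. unfold N in De. rewrite EP, De' in De. apply (Nat.mul_cancel_l _ _ p); nia. }
    rewrite (proj2 (eqb_divide _ _) D2).
    destruct (Nat.eqb (d mod P) 0) eqn:D3; [|ring]. apply eqb_divide in D3. exfalso. apply Hpm.
    destruct D2 as [u Du]. destruct D3 as [w Dw]. exists (u * w)%nat. subst d. rewrite EP in Du.
    apply (Nat.mul_cancel_l _ _ (p ^ k)); nia.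
  + assert (D3 : Nat.divide P d).
    { assert (rp : rel_prime (Z.of_nat p) (Z.of_nat e)).
      { apply prime_rel_prime; [exact Hp|]. intros [z Hz]. apply Ne. exists (Z.to_nat z). nia. }
      assert (R : rel_prime (Z.of_nat P) (Z.of_nat e)).
      { unfold P. clear -rp. induction (S k) as [|j IH]; [simpl; apply rel_prime_1|].
        rewrite Nat.pow_succ_r', Nat2Z.inj_mul. apply rel_prime_sym, rel_prime_mult; apply rel_prime_sym; assumption. }
      destruct (Gauss (Z.of_nat P) (Z.of_nat e) (Z.of_nat d)) as [z Hz]; [exists (Z.of_nat m); unfold N in De; nia|exact R|].
      exists (Z.to_nat z). nia. }
    assert (D2 : ~ Nat.divide d (p ^ k * m)).
    { intros [u Du]. destruct D3 as [w Dw]. apply Hpm. exists (u * w)%nat. subst d. rewrite EP in Du.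
      apply (Nat.mul_cancel_l _ _ (p ^ k)); nia. }
    rewrite (proj2 (eqb_divide _ _) D3).
    destruct (Nat.eqb ((p ^ k * m) mod d) 0) eqn:D4; [apply eqb_divide in D4; contradiction|].
    destruct D3 as [w Dw]. subst d. rewrite Nat.div_mul by lia.
    assert (D5 : Nat.divide w m) by (exists e; apply (Nat.mul_cancel_l _ _ P); unfold N in De; nia).
    rewrite (proj2 (eqb_divide _ _) D5). ring.
- assert (D2 : ~ Nat.divide d (p ^ k * m)).
  { intros [u Du]. assert (X : Nat.divide d N) by (exists (p * u)%nat; unfold N; rewrite EP; nia). apply eqb_divide in X. congruence. }
  destruct (Nat.eqb ((p ^ k * m) mod d) 0) eqn:D4; [apply eqb_divide in D4; contradiction|].
  destruct (Nat.eqb (d mod P) 0) eqn:D3; [|ring]. apply eqb_divide in D3. destruct D3 as [w Dw].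
  subst d. rewrite Nat.div_mul by lia. destruct (Nat.eqb (m mod w) 0) eqn:D5; [|ring].
  apply eqb_divide in D5. destruct D5 as [u Du].
  assert (X : Nat.divide (w * P) N) by (exists u; unfold N; rewrite Du; ring). apply eqb_divide in X. congruence.
Qed.

Lemma exists_prime_factor n : (2 <= n)%nat -> exists p m k, prime (Z.of_nat p) /\ ~ Nat.divide p m /\ (1 <= m < n)%nat /\ n = (p ^ S k * m)%nat.
Proof.
intros Hn. assert (X : exists p, prime (Z.of_nat p) /\ Nat.divide p n).
{ induction n as [n IH] using lt_wf_ind. destruct (prime_dec (Z.of_nat n)) as [P|P]; [exists n; split; [exact P|apply Nat.divide_refl]|].
  destruct (not_prime_divide (Z.of_nat n) ltac:(lia) P) as (z & Hz & w & Hw).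
  destruct (IH (Z.to_nat z) ltac:(lia) ltac:(lia)) as (p & Hp & u & Hu). exists p. split; [exact Hp|].
  exists (Z.to_nat w * u)%nat. rewrite <- Nat.mul_assoc, <- Hu, <- Z2Nat.inj_mul by lia. lia. }
destruct X as (p & Hp & Hpn). assert (P2 : (2 <= p)%nat) by (apply prime_ge_2 in Hp; lia).
assert (Y : forall n, (1 <= n)%nat -> exists m k, ~ Nat.divide p m /\ (1 <= m <= n)%nat /\ n = (p ^ k * m)%nat).
{ clear -P2. intros n. induction n as [n IH] using lt_wf_ind. intros H1.
  destruct (classic (Nat.divide p n)) as [[u Hu]|D]; [|exists n, 0%nat; simpl; repeat split; [exact D|lia|lia|lia]].
  destruct (IH u ltac:(destruct u; nia) ltac:(destruct u; nia)) as (m & k & H2 & H3 & H4). exists m, (S k). split; [exact H2|]. simpl. split; nia. }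
destruct (Y n ltac:(lia)) as (m & [|k] & H2 & H3 & H4).
- simpl in H4. rewrite Nat.add_0_r in H4. subst m. contradiction.
- exists p, m, k. split; [exact Hp|split; [exact H2|split; [|exact H4]]].
  assert (2 <= p ^ S k)%nat by (rewrite Nat.pow_succ_r'; assert (p ^ k <> 0)%nat by (apply Nat.pow_nonzero; lia); nia).
  rewrite H4. set (P := (p ^ S k)%nat) in *. nia.
Qed.

(** The factor [c] is [1 + ch p + ... + (ch p)^k]. For [ch p = -1] it alternates between [1] and
    [0], which is why the lower bound [1] is claimed for even exponents and later used at
    squares. *)
Lemma dsum_primepow ch p m : (forall a b, ch (a * b)%nat = ch a * ch b) -> ch 1%nat = 1 -> prime (Z.of_nat p) ->
  ~ Nat.divide p m -> (1 <= m)%nat -> (ch p = -1 \/ ch p = 0 \/ ch p = 1) ->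
  forall k, exists c, dsum ch (p ^ k * m) = c * dsum ch m /\ 0 <= c /\ (Nat.even k = true -> 1 <= c).
Proof.
intros Hm H1 Hp Hpm Hm1 Hv.
assert (X : forall k, dsum ch (p ^ k * m) = sum_f_R0 (fun i => ch p ^ i) k * dsum ch m).
{ assert (Hpow : forall k, ch (p ^ k)%nat = ch p ^ k) by (induction k as [|k IH]; [exact H1|rewrite Nat.pow_succ_r', Hm, IH; reflexivity]).
  induction k as [|k IH]; [simpl; rewrite Nat.add_0_r; ring|].
  rewrite (dsum_step ch p k m) by assumption. rewrite IH, Hpow. simpl. ring. }
intros k. exists (sum_f_R0 (fun i => ch p ^ i) k). split; [apply X|].
destruct Hv as [-> | [-> | ->]].
- assert (E : sum_f_R0 (fun i => (-1) ^ i) k = if Nat.even k then 1 else 0).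
  { induction k as [|k IH]; [reflexivity|]. simpl sum_f_R0. rewrite IH. change (-1 * (-1) ^ k) with ((-1) ^ S k).
    rewrite Nat.even_succ, <- Nat.negb_even. destruct (Nat.even k) eqn:Ev.
    - apply Nat.even_spec in Ev. destruct Ev as [j ->]. simpl. rewrite Nat.add_0_r. replace (j + j)%nat with (2 * j)%nat by lia. rewrite pow_1_even. simpl. ring.
    - assert (Od : Nat.odd k = true) by (rewrite <- Nat.negb_even, Ev; reflexivity). apply Nat.odd_spec in Od. destruct Od as [j ->].
      replace (S (2 * j + 1)) with (2 * S j)%nat by lia. rewrite pow_1_even. simpl. ring. }
  rewrite E. destruct (Nat.even k); split; intros; try lra; discriminate.
- assert (E : sum_f_R0 (fun i => 0 ^ i) k = 1).
  { induction k as [|k IH]; [reflexivity|]. simpl sum_f_R0. rewrite IH. ring. }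
  rewrite E. lra.
- assert (E : 1 <= sum_f_R0 (fun i => 1 ^ i) k).
  { induction k as [|k IH]; [simpl; lra|]. simpl sum_f_R0. rewrite pow1 in *. lra. }
  lra.
Qed.

Lemma dsum_nonneg q ch : rchar q ch -> forall n, (1 <= n)%nat -> 0 <= dsum ch n.
Proof.
intros Hch n. induction n as [n IH] using lt_wf_ind. intros Hn.
destruct (Nat.eq_dec n 1) as [-> | N1]; [unfold dsum; simpl; rewrite (rchar_one q ch Hch); lra|].
destruct (exists_prime_factor n ltac:(lia)) as (p & m & k & Hp & Hpm & Hm & ->).
destruct (dsum_primepow ch p m (proj1 (proj2 Hch)) (rchar_one q ch Hch) Hp Hpm ltac:(lia) (proj1 (proj2 (proj2 (proj2 Hch))) p) (S k)) as (c & -> & Hc & _).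
apply Rmult_le_pos; [exact Hc|apply IH; lia].
Qed.

Lemma dsum_square q ch : rchar q ch -> forall n, (1 <= n)%nat -> 1 <= dsum ch (n * n).
Proof.
intros Hch n. induction n as [n IH] using lt_wf_ind. intros Hn.
destruct (Nat.eq_dec n 1) as [-> | N1]; [unfold dsum; simpl; rewrite (rchar_one q ch Hch); lra|].
destruct (exists_prime_factor n ltac:(lia)) as (p & m & k & Hp & Hpm & Hm & ->).
assert (Hpmm : ~ Nat.divide p (m * m)).
{ intros [z Hz]. destruct (prime_mult (Z.of_nat p) Hp (Z.of_nat m) (Z.of_nat m)) as [[w Hw]|[w Hw]];
  [exists (Z.of_nat z); lia|apply Hpm; exists (Z.to_nat w); nia|apply Hpm; exists (Z.to_nat w); nia]. }
replace (p ^ S k * m * (p ^ S k * m))%nat with (p ^ (S k + S k) * (m * m))%nat by (rewrite Nat.pow_add_r; ring).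
destruct (dsum_primepow ch p (m * m) (proj1 (proj2 Hch)) (rchar_one q ch Hch) Hp Hpmm ltac:(nia) (proj1 (proj2 (proj2 (proj2 Hch))) p) (S k + S k)) as (c & -> & _ & Hc).
assert (1 <= c) by (apply Hc; apply Nat.even_spec; exists (S k); lia).
assert (1 <= dsum ch (m * m)) by (apply IH; lia). nra.
Qed.

(** * Lambert series *)

Fixpoint geo (x : R) (n : nat) : R := match n with O => 0 | S n' => 1 + x * geo x n' end.

Lemma geo_eq x n : (1 - x) * geo x n = 1 - x ^ n.
Proof. induction n as [|n IH]; simpl; [ring|]. transitivity (1 - x + x * ((1 - x) * geo x n)); [ring|rewrite IH; ring]. Qed.

Lemma geo_last x n : geo x (S n) = geo x n + x ^ n.
Proof. induction n as [|n IH]; [simpl; ring|]. change (geo x (S (S n))) with (1 + x * geo x (S n)). rewrite IH at 1. simpl. ring. Qed.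

(** The arithmetic-geometric mean inequality for [1, x, ..., x^n] with [x = z^2], so that the
    half-integral power [x^(n/2)] is [z^n]. Two consecutive cases are carried along because the
    induction passes from [n] to [n + 2] by pairing the extreme terms. *)
Lemma geo_amgm z n : 0 < z -> INR (S n) * z ^ n <= geo (z ^ 2) (S n) /\ INR (S (S n)) * z ^ S n <= geo (z ^ 2) (S (S n)).
Proof.
intros Hz. induction n as [|n [IH1 IH2]].
- split; [simpl; lra|]. simpl. assert (0 <= (1 - z) ^ 2) by apply pow2_ge_0. simpl in H. lra.
- split; [exact IH2|]. change (geo (z ^ 2) (S (S (S n)))) with (1 + z ^ 2 * geo (z ^ 2) (S (S n))).
  rewrite geo_last. rewrite !S_INR in *.
  assert (0 <= (1 - z ^ S (S n)) ^ 2) by apply pow2_ge_0.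
  assert (E : z ^ 2 * (z ^ 2) ^ S n = (z ^ S (S n)) ^ 2) by (rewrite <- !pow_mult, <- pow_add; f_equal; lia).
  assert (z ^ 2 * ((INR n + 1) * z ^ n) <= z ^ 2 * geo (z ^ 2) (S n)) by (apply Rmult_le_compat_l; [apply pow2_ge_0|exact IH1]).
  assert (E2 : z ^ 2 * z ^ n = z ^ S (S n)) by (simpl; ring).
  rewrite Rmult_plus_distr_l, E. set (w := z ^ S (S n)) in *.
  replace (z ^ 2 * ((INR n + 1) * z ^ n)) with ((INR n + 1) * w) in H0 by (rewrite <- E2; ring).
  replace ((1 - w) ^ 2) with (1 - 2 * w + w ^ 2) in H by ring. lra.
Qed.

Lemma geometric_multiples x n N : 0 < x < 1 -> (1 <= n)%nat ->
  0 <= x ^ n / (1 - x ^ n) - S1 (fun m => if Nat.eqb (m mod n) 0 then x ^ m else 0) N <= x ^ N / (1 - x).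
Proof.
intros Hx Hn. assert (Hxn : x ^ n <= x) by (destruct n as [|n]; [lia|]; simpl; assert (x ^ n <= 1) by (apply pow_le_one; lra); nra).
assert (P : forall k, 0 < x ^ k) by (intros; apply pow_lt; lra).
assert (X : exists K, (n * K <= N < n * K + n)%nat /\
  x ^ n / (1 - x ^ n) - S1 (fun m => if Nat.eqb (m mod n) 0 then x ^ m else 0) N = x ^ (n * K + n) / (1 - x ^ n)).
{ induction N as [|N (K & HK & IH)].
  - exists 0%nat. split; [lia|]. rewrite Nat.mul_0_r. simpl. ring.
  - rewrite S1_S. destruct (Nat.eq_dec (S N) (n * K + n)) as [E|E].
    + exists (S K). split; [lia|]. replace (Nat.eqb (S N mod n) 0) with true.
      * replace (x ^ n / (1 - x ^ n) - (S1 (fun m => if Nat.eqb (m mod n) 0 then x ^ m else 0) N + x ^ S N)) with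
          (x ^ n / (1 - x ^ n) - S1 (fun m => if Nat.eqb (m mod n) 0 then x ^ m else 0) N - x ^ S N) by ring.
        rewrite IH, E. replace (n * S K + n)%nat with ((n * K + n) + n)%nat by lia. rewrite (pow_add x (n * K + n)). field. lra.
      * symmetry. apply eqb_divide. exists (S K). lia.
    + exists K. split; [lia|]. replace (Nat.eqb (S N mod n) 0) with false; [rewrite Rplus_0_r; exact IH|].
      symmetry. destruct (Nat.eqb (S N mod n) 0) eqn:D; [|reflexivity]. apply eqb_divide in D. destruct D as [w Hw]. exfalso.
      assert (K < w)%nat by nia. assert (w < S K)%nat by nia. lia. }
destruct X as (K & HK & ->). split; [apply Rmult_le_pos; [left; apply P|pos]|].
apply Rmult_le_compat; [left; apply P|pos| |apply Rinv_le_contravar; lra].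
replace (n * K + n)%nat with (N + (n * K + n - N))%nat by lia. rewrite pow_add.
assert (x ^ (n * K + n - N) <= 1) by (apply pow_le_one; lra). specialize (P N). nra.
Qed.

(* Monsky's argument: with [b n = 1/n - x^n/(1+...+x^(n-1))] decreasing, [sum ch(n) b(n)] is [O(1-x)], whereas
   [sum ch(n) x^n/(1-x^n) = sum (sum_(d|n) ch d) x^n] is unbounded as [x -> 1]. *)
Lemma lambert_bound q ch z N : rchar q ch -> 0 < z < 1 ->
  let x := z ^ 2 in Rabs (S1 (fun n => ch n * (/ INR n - x ^ n / geo x n)) N) <= INR q * (1 - x).
Proof.
intros Hch Hz x. assert (Hx : 0 < x < 1) by (unfold x; simpl; nra).
set (b := fun n => / INR n - x ^ n / geo x n).
assert (Hg : forall n, INR (S n) * z ^ n <= geo x (S n)) by (intros n; apply geo_amgm; lra).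
assert (Hgp : forall n, 0 < geo x (S n)).
{ intros n. eapply Rlt_le_trans; [|apply Hg]. apply Rmult_lt_0_compat; [pos|pos]. }
assert (E2 : forall n, x ^ n = z ^ n * z ^ n) by (intros n; unfold x; rewrite <- pow_mult, <- pow_add; f_equal; lia).
assert (Zp : forall n, 0 < z ^ n <= 1) by (intros n; split; [pos|apply pow_le_one; lra]).
assert (Ip : forall n, 0 < INR (S n)) by (intros; apply lt_0_INR; lia).
assert (b1 : b 1%nat = 1 - x) by (unfold b; simpl; field).
(* By the identity [D] below, the difference has the sign of [geo x n * geo x (n+1) - n (n+1) x^n],
   which is nonnegative by [geo_amgm]. *)
assert (bdec : forall n, (1 <= n)%nat -> b (S n) <= b n).
{ intros [|n] H; [lia|]. unfold b.
  assert (Y : 0 <= geo x (S n) * geo x (S (S n)) - INR (S n) * INR (S (S n)) * x ^ S n).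
  { assert (INR (S n) * z ^ n * (INR (S (S n)) * z ^ S n) <= geo x (S n) * geo x (S (S n))).
    { apply Rmult_le_compat; try apply Hg; apply Rmult_le_pos; try (left; apply Ip); left; apply Zp. }
    assert (INR (S n) * INR (S (S n)) * x ^ S n <= INR (S n) * z ^ n * (INR (S (S n)) * z ^ S n)); [|lra].
    replace (INR (S n) * z ^ n * (INR (S (S n)) * z ^ S n)) with (INR (S n) * INR (S (S n)) * (z ^ n * z ^ S n)) by ring.
    apply Rmult_le_compat_l; [apply Rmult_le_pos; left; apply Ip|]. rewrite E2.
    apply Rmult_le_compat_r; [left; apply Zp|]. simpl. destruct (Zp n). nra. }
  assert (D : / INR (S n) - x ^ S n / geo x (S n) - (/ INR (S (S n)) - x ^ S (S n) / geo x (S (S n))) =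
    (geo x (S n) * geo x (S (S n)) - INR (S n) * INR (S (S n)) * x ^ S n) / (INR (S n) * INR (S (S n)) * (geo x (S n) * geo x (S (S n))))).
  { assert (A1 : x ^ S n / geo x (S n) - x ^ S (S n) / geo x (S (S n)) = x ^ S n / (geo x (S n) * geo x (S (S n)))).
    { assert (geo x (S (S n)) = 1 + x * geo x (S n)) by reflexivity. pose proof (Hgp n). pose proof (Hgp (S n)).
      replace (x ^ S (S n)) with (x * x ^ S n) by reflexivity. rewrite H0 in *. field. split; lra. }
    assert (A2 : / INR (S n) - / INR (S (S n)) = 1 / (INR (S n) * INR (S (S n)))).
    { rewrite (S_INR (S n)). pose proof (Ip n). field. split; lra. }
    replace (/ INR (S n) - x ^ S n / geo x (S n) - (/ INR (S (S n)) - x ^ S (S n) / geo x (S (S n)))) with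
      (/ INR (S n) - / INR (S (S n)) - (x ^ S n / geo x (S n) - x ^ S (S n) / geo x (S (S n)))) by ring.
    rewrite A1, A2. pose proof (Hgp n). pose proof (Hgp (S n)). pose proof (Ip n). pose proof (Ip (S n)). field. repeat split; lra. }
  assert (0 <= / INR (S n) - x ^ S n / geo x (S n) - (/ INR (S (S n)) - x ^ S (S n) / geo x (S (S n)))); [|lra].
  rewrite D. apply Rmult_le_pos; [exact Y|]. left. apply Rinv_0_lt_compat. repeat apply Rmult_lt_0_compat; auto. }
assert (bpos : forall n, (1 <= n)%nat -> 0 <= b n).
{ intros [|n] H; [lia|]. unfold b. assert (x ^ S n / geo x (S n) <= / INR (S n)); [|lra].
  apply Rmult_le_reg_r with (geo x (S n)); [apply Hgp|]. unfold Rdiv. rewrite Rmult_assoc, Rinv_l, Rmult_1_r by (apply Rgt_not_eq, Hgp).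
  apply Rmult_le_reg_l with (INR (S n)); [apply Ip|]. rewrite <- Rmult_assoc, Rinv_r, Rmult_1_l by (apply Rgt_not_eq, Ip).
  eapply Rle_trans; [|apply Hg]. apply Rmult_le_compat_l; [left; apply Ip|]. rewrite E2. destruct (Zp n). destruct (Zp (S n)). simpl in *. nra. }
change (Rabs (S1 (fun n => ch n * b n) N) <= INR q * (1 - x)).
assert (Hq : 0 <= INR q) by apply pos_INR.
destruct N as [|N]; [simpl; rewrite Rabs_R0; nra|].
rewrite S1_abel.
assert (T : S1 (fun n => INR q * (b n - b (S n))) N = INR q * (b 1%nat - b (S N))).
{ rewrite S1_scal. f_equal. induction N as [|N IH]; [simpl; ring|]. rewrite S1_S, IH. ring. }
eapply Rle_trans; [apply Rabs_triang|].
assert (Rabs (S1 (fun n => S1 ch n * (b n - b (S n))) N) <= INR q * (b 1%nat - b (S N))).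
{ rewrite <- T. apply S1_abs_le. intros n Hn. rewrite Rabs_mult, (Rabs_pos_eq (b n - b (S n))) by (pose proof (bdec n ltac:(lia)); lra).
  apply Rmult_le_compat_r; [pose proof (bdec n ltac:(lia)); lra|apply rchar_sum_bound, Hch]. }
assert (Rabs (S1 ch (S N) * b (S N)) <= INR q * b (S N)).
{ rewrite Rabs_mult, (Rabs_pos_eq (b (S N))) by (apply bpos; lia). apply Rmult_le_compat_r; [apply bpos; lia|apply rchar_sum_bound, Hch]. }
rewrite <- b1. lra.
Qed.

Lemma dsum_series_lower q ch x J0 : rchar q ch -> 0 < x < 1 -> forall J, (J <= J0)%nat ->
  INR J * x ^ (J0 * J0) <= S1 (fun m => dsum ch m * x ^ m) (J * J).
Proof.
intros Hch Hx J. induction J as [|J IH]; intros HJ; [simpl; lra|].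
specialize (IH ltac:(lia)). rewrite S_INR.
replace (S J * S J)%nat with (S (J * J + 2 * J)) by lia. rewrite S1_S.
assert (S1 (fun m => dsum ch m * x ^ m) (J * J) <= S1 (fun m => dsum ch m * x ^ m) (J * J + 2 * J)).
{ apply S1_mono; [lia|]. intros n Hn. apply Rmult_le_pos; [apply (dsum_nonneg q ch Hch); lia|pos]. }
assert (1 <= dsum ch (S (J * J + 2 * J))) by (replace (S (J * J + 2 * J)) with (S J * S J)%nat by lia; apply (dsum_square q ch Hch); lia).
assert (x ^ (J0 * J0) <= x ^ S (J * J + 2 * J)).
{ replace (J0 * J0)%nat with (S (J * J + 2 * J) + (J0 * J0 - S (J * J + 2 * J)))%nat by nia. rewrite pow_add.
  assert (x ^ (J0 * J0 - S (J * J + 2 * J)) <= 1) by (apply pow_le_one; lra).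
  assert (0 < x ^ S (J * J + 2 * J)) by pos. nra. }
assert (0 < x ^ (J0 * J0)) by pos. nra.
Qed.

(** Expanding [x^n/(1 - x^n)] rearranges the Lambert series into [sum dsum(m) x^m], where the
    squares alone contribute [J x^(J^2)]. The last summand pays for cutting the geometric series at
    [N]. *)
Lemma lambert_lower q ch x J N : rchar q ch -> 0 < x < 1 -> (J * J <= N)%nat ->
  INR J * x ^ (J * J) <= S1 (fun n => ch n * (x ^ n / (1 - x ^ n))) N + INR N * (x ^ N / (1 - x)).
Proof.
intros Hch Hx HJ. eapply Rle_trans; [apply (dsum_series_lower q ch x J Hch Hx J (Nat.le_refl J))|].
apply Rle_trans with (S1 (fun m => dsum ch m * x ^ m) N).
{ apply S1_mono; [exact HJ|]. intros n Hn. apply Rmult_le_pos; [apply (dsum_nonneg q ch Hch); lia|pos]. }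
assert (E : S1 (fun m => dsum ch m * x ^ m) N = S1 (fun n => ch n * S1 (fun m => if Nat.eqb (m mod n) 0 then x ^ m else 0) N) N).
{ transitivity (S1 (fun m => S1 (fun n => (if Nat.eqb (m mod n) 0 then ch n else 0) * x ^ m) N) N).
  - apply S1_ext. intros m Hm. rewrite <- (dsum_ext ch m N) by exact Hm. rewrite Rmult_comm, <- S1_scal. apply S1_ext. intros; ring.
  - rewrite S1_exchange. apply S1_ext. intros n _. rewrite <- S1_scal. apply S1_ext. intros m _. destruct (Nat.eqb _ _); ring. }
rewrite E, <- S1_const, <- S1_plus. apply S1_le. intros n Hn.
assert (B := geometric_multiples x n N Hx ltac:(lia)). set (T := S1 _ N) in *.
assert (A := rchar_abs q ch n Hch). apply Rabs_le_between in A. nra.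
Qed.

Theorem L_one_nonzero q ch : rchar q ch -> is_lim_seq (S1 (fun n => ch n * / INR n)) 0 -> False.
Proof.
(* [x] is taken so close to [1] that [x^(J^2) >= 1/2] by Bernoulli's inequality; the lower bound
   [J/2 = q + 1/2] then exceeds the upper bound [q]. *)
intros Hch HL. set (J := (2 * q + 1)%nat).
set (e := / (4 * INR (J * J))).
assert (HJJ : 1 <= INR (J * J)) by (apply (le_INR 1); nia).
assert (He : 0 < e <= 1 / 4).
{ unfold e. split; [pos|]. replace (1 / 4) with (/ 4) by field. apply Rinv_le_contravar; lra. }
set (z := 1 - e). assert (Hz : 0 < z < 1) by (unfold z; lra).
set (x := z ^ 2). assert (Hx : 0 < x < 1) by (unfold x; simpl; nra).
assert (HxJ : 1 / 2 <= x ^ (J * J)).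
{ unfold x. rewrite <- pow_mult.
  assert (Bern : forall n, 1 - INR n * e <= z ^ n).
  { induction n as [|n IH]; [simpl; lra|]. rewrite S_INR. simpl pow. pose proof (pos_INR n). unfold z in *. nra. }
  eapply Rle_trans; [|apply Bern]. rewrite mult_INR. unfold e. simpl (INR 2). right. field. lra. }
assert (U : INR J * x ^ (J * J) <= INR q).
{ assert (Lim : is_lim_seq (fun N => INR q + / (1 - x) * S1 (fun n => ch n * / INR n) N + z ^ N * / (1 - x) ^ 2) (INR q + / (1 - x) * 0 + 0 * / (1 - x) ^ 2)).
  { apply is_lim_seq_plus'; [apply is_lim_seq_plus'; [apply is_lim_seq_const|apply (is_lim_seq_scal_l _ (/ (1 - x)) 0 HL)]|].
    apply (is_lim_seq_scal_r _ (/ (1 - x) ^ 2) 0). apply is_lim_seq_geom. rewrite Rabs_pos_eq; lra. }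
  replace (INR q + / (1 - x) * 0 + 0 * / (1 - x) ^ 2) with (INR q) in Lim by ring.
  refine (is_lim_seq_le_loc (fun _ => INR J * x ^ (J * J)) _ (INR J * x ^ (J * J)) (INR q) _ (is_lim_seq_const _) Lim).
  exists (S (J * J)). intros N HN.
  assert (A := lambert_lower q ch x J N Hch Hx ltac:(lia)). assert (B := lambert_bound q ch z N Hch Hz). cbv zeta in B. fold x in B.
  assert (E : S1 (fun n => ch n * (/ INR n - x ^ n / geo x n)) N = S1 (fun n => ch n * / INR n) N - (1 - x) * S1 (fun n => ch n * (x ^ n / (1 - x ^ n))) N).
  { rewrite <- S1_scal, <- S1_minus. apply S1_ext. intros n Hn. rewrite <- (geo_eq x n).
    assert (geo x n <> 0).
    { intros Z. pose proof (geo_eq x n) as G. rewrite Z, Rmult_0_r in G. assert (x ^ n < 1) by (apply pow_lt_1_compat; [lra|lia]). lra. }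
    field. repeat split; try lra; try exact H. apply not_0_INR; lia. }
  rewrite E in B. apply Rabs_le_between in B.
  assert (C : INR N * (x ^ N / (1 - x)) <= z ^ N * / (1 - x) ^ 2).
  { destruct N as [|N]; [lia|]. assert (G := proj1 (geo_amgm z N ltac:(lra))). fold x in G.
    assert (Gb : geo x (S N) <= / (1 - x)).
    { apply Rmult_le_reg_l with (1 - x); [lra|]. rewrite geo_eq, Rinv_r by lra. assert (0 < x ^ S N) by pos. lra. }
    assert (E2 : x ^ S N = z ^ N * z * z ^ S N) by (unfold x; rewrite <- pow_mult; replace (2 * S N)%nat with (N + 1 + S N)%nat by lia; rewrite !pow_add; simpl; ring).
    rewrite E2. replace (INR (S N) * (z ^ N * z * z ^ S N / (1 - x))) with (z ^ S N * (/ (1 - x) * (z * (INR (S N) * z ^ N)))) by (unfold Rdiv; ring).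
    apply Rmult_le_compat_l; [pos|]. replace (/ (1 - x) ^ 2) with (/ (1 - x) * / (1 - x)) by (field; lra).
    apply Rmult_le_compat_l; [pos|].
    assert (0 <= INR (S N) * z ^ N) by (apply Rmult_le_pos; [apply pos_INR|pos]). nra. }
  assert (D : S1 (fun n => ch n * (x ^ n / (1 - x ^ n))) N <= INR q + / (1 - x) * S1 (fun n => ch n * / INR n) N).
  { apply Rmult_le_reg_l with (1 - x); [lra|]. rewrite Rmult_plus_distr_l, <- Rmult_assoc, Rinv_r by lra. lra. }
  lra. }
assert (INR J = 2 * INR q + 1) by (unfold J; rewrite plus_INR, mult_INR; simpl; ring).
pose proof (pos_INR q). nra.
Qed.

(** * Consequences of GRH *)

Lemma DS_partial_dval (al : nat -> R) s t N :
  DS_partial (fun n => RtoC (al n)) (s, t) N = (dval al s t 0 N, dval al s t (PI / 2) N).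
Proof.
induction N as [|N IH]; [reflexivity|].
change (DS_partial (fun n => RtoC (al n)) (s, t) (S N)) with
  (Cplus (DS_partial (fun n => RtoC (al n)) (s, t) N) (Cmult (RtoC (al (S N))) (cpow_neg (S N) (s, t)))).
rewrite IH. unfold dval. rewrite !S1_S. unfold cpow_neg, Cmult, Cplus, RtoC, pw. cbn [fst snd Re Im].
rewrite Rplus_0_r, cos_plus, cos_PI2, sin_PI2. f_equal; ring.
Qed.

Lemma DS_partial_ext (a b : nat -> C) s N : (forall n, (1 <= n)%nat -> a n = b n) -> DS_partial a s N = DS_partial b s N.
Proof. intros H. induction N as [|N IH]; [reflexivity|]. simpl DS_partial. rewrite IH, H by lia. reflexivity. Qed.

Lemma is_DSval_dval (a : nat -> C) (al : nat -> R) s t u v : (forall n, (1 <= n)%nat -> a n = RtoC (al n)) ->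
  is_lim_seq (dval al s t 0) (Finite u) -> is_lim_seq (dval al s t (PI / 2)) (Finite v) -> is_DSval a (s, t) (u, v).
Proof.
intros Ha Hu Hv. unfold is_DSval. apply filterlim_locally. intros eps.
apply is_lim_seq_spec in Hu. apply is_lim_seq_spec in Hv.
destruct (Hu eps) as [N1 H1]. destruct (Hv eps) as [N2 H2].
exists (N1 + N2)%nat. intros n Hn. rewrite (DS_partial_ext a (fun n => RtoC (al n))) by exact Ha. rewrite DS_partial_dval.
split; [apply H1; lia|apply H2; lia].
Qed.

Lemma right_of_one_nz al s t u v : (forall m n, al (m * n)%nat = al m * al n) -> (forall n, Rabs (al n) <= 1) -> al 1%nat = 1 -> 1 < s ->
  is_lim_seq (dval al s t 0) (Finite u) -> is_lim_seq (dval al s t (PI / 2)) (Finite v) -> 0 < u ^ 2 + v ^ 2.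
Proof.
intros Hm Ha H1 Hs Hu Hv. destruct (right_of_one al Hm Ha H1 s t Hs) as (u' & v' & L1 & L2 & P).
rewrite (lim_unique _ _ _ Hu L1), (lim_unique _ _ _ Hv L2). exact P.
Qed.

Theorem nonvanishing_char q ch s t u v : GRH -> rchar q ch -> 1 / 2 < s ->
  is_lim_seq (dval ch s t 0) (Finite u) -> is_lim_seq (dval ch s t (PI / 2)) (Finite v) -> ~ (u = 0 /\ v = 0).
Proof.
intros [_ HG] Hch Hs Hu Hv [E1 E2]. subst u v.
destruct (Rtotal_order s 1) as [Hlt|[-> | Hgt]].
- destruct (rchar_dirichlet q ch Hch) as [D1 D2].
  apply (HG q _ D1 D2 (s, t) (0, 0)); [simpl; lra| |reflexivity].
  apply (is_DSval_dval _ ch); [intros; reflexivity|exact Hu|exact Hv].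
- destruct (Req_dec t 0) as [-> | Ht]; [|exact (rchar_line_one q ch t Hch Ht Hu Hv)].
  apply (L_one_nonzero q ch Hch). eapply is_lim_seq_ext; [|exact Hu].
  intros N. unfold dval. apply S1_ext. intros n Hn. rewrite pw_one, Rmult_0_l, Rplus_0_l, cos_0 by lia. ring.
- assert (P := right_of_one_nz ch s t 0 0 (proj1 (proj2 Hch)) (fun n => rchar_abs q ch n Hch) (rchar_one q ch Hch) Hgt Hu Hv). simpl in P. lra.
Qed.

Lemma altl_2 n : (1 <= n)%nat -> altl 2 n = (-1) ^ (n - 1).
Proof.
intros Hn. unfold altl. destruct (Nat.even n) eqn:Ev.
- apply Nat.even_spec in Ev. destruct Ev as [j ->]. rewrite Nat.mul_comm, Nat.Div0.mod_mul. simpl (Nat.eqb 0 0). cbv iota.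
  replace (j * 2 - 1)%nat with (S (2 * (j - 1))) by lia. rewrite pow_1_odd. simpl. ring.
- assert (Od : Nat.odd n = true) by (rewrite <- Nat.negb_even, Ev; reflexivity). apply Nat.odd_spec in Od. destruct Od as [j ->].
  rewrite Nat.add_comm, Nat.mul_comm, Nat.Div0.mod_add. simpl (Nat.eqb _ _). cbv iota.
  replace (1 + j * 2 - 1)%nat with (2 * j)%nat by lia. rewrite pow_1_even. ring.
Qed.

Theorem nonvanishing_zeta s t : GRH -> 1 / 2 < s -> is_lim_seq (PzRe s t) 0 -> is_lim_seq (PzIm s t) 0 -> False.
Proof.
intros [HG _] Hs HR HI. destruct (Rtotal_order s 1) as [Hlt|[-> | Hgt]].
- assert (HC := altl_has_coefs 2 3 t (11 / 4) ltac:(lia) ltac:(lra) ltac:(lra)).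
  destruct (dval_lim_real (altl 2) _ (11 / 4) 3 t (s - 3) HC) as [A1 A2]; [rewrite Rabs_left; lra|].
  replace (3 + (s - 3)) with s in A1, A2 by ring.
  destruct (zeta_zero_altl 2 s t _ _ ltac:(lia) ltac:(left; lra) HR HI A1 A2) as [Z1 Z2].
  apply (HG (s, t) (0, 0)); [simpl; lra| |reflexivity].
  rewrite Z1 in A1. rewrite Z2 in A2.
  apply (is_DSval_dval _ (altl 2)); [|exact A1|exact A2].
  intros n Hn. unfold eta_coef. rewrite altl_2 by exact Hn. reflexivity.
- destruct (Req_dec t 0) as [-> | Ht]; [|exact (zeta_line_one t Ht HR HI)].
  (* At the pole [(s-1) zeta(s)] has the value [1]: [PzRe 1 0 N] reduces to its correction term
     [N^0]. *)
  assert (1 = 0); [|lra]. apply (lim_unique (PzRe 1 0)); [|exact HR].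
  apply (is_lim_seq_ext (fun _ => 1)); [|apply is_lim_seq_const].
  intros N. unfold PzRe, pw. replace (0 * lg N + 0) with 0 by ring.
  replace (- (1 - 1) * lg N) with 0 by ring. rewrite exp_0, cos_0. ring.
- destruct (right_of_one one one_mul one_abs eq_refl s t Hgt) as (u & v & L1 & L2 & P).
  assert (Z : forall ph, is_lim_seq (fun N => pw N (s - 1) * cos (t * lg N + ph)) 0).
  { intros ph. apply is_lim_seq_abs_0. apply (is_lim_seq_le_le (fun _ => 0) _ (fun N => pw N (s - 1))); [|apply is_lim_seq_const|apply pw_lim0; lra].
    intros N. split; [apply Rabs_pos|]. rewrite Rabs_mult, (Rabs_pos_eq (pw _ _)) by pos.
    pose proof (Rabs_cos_le (t * lg N + ph)). pose proof (pw_pos N (s - 1)). nra. }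
  assert (E1 : (s - 1) * u - t * v + 0 = 0).
  { apply (lim_unique (PzRe s t)); [|exact HR]. apply is_lim_seq_plus'; [apply is_lim_seq_minus'; apply lim_scal; assumption|apply Z]. }
  assert (E2 : (s - 1) * v + t * u + 0 = 0).
  { apply (lim_unique (PzIm s t)); [|exact HI]. apply is_lim_seq_plus'; [apply is_lim_seq_plus'; apply lim_scal; assumption|apply Z]. }
  assert (((s - 1) ^ 2 + t ^ 2) * (u ^ 2 + v ^ 2) = 0).
  { transitivity (((s - 1) * u - t * v) ^ 2 + ((s - 1) * v + t * u) ^ 2); [ring|].
    replace ((s - 1) * u - t * v) with 0 by lra. replace ((s - 1) * v + t * u) with 0 by lra. ring. }
  apply Rmult_integral in H. destruct H; [|lra]. assert (0 < (s - 1) ^ 2) by pos. pose proof (pow2_ge_0 t). lra.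
Qed.

(** The disk of radius [R0 = s - 1/2] around [s + it] lies in [Re > 1/2], where there are no zeros,
    and the series is bounded through [R1 = s - 1/4]. As [R1 - R0 = 1/4], the constant [32] is [16]
    times the [2] coming from modulus at least [1/2] at the centre; [11 s + 5 |t|] is the constant
    of partial summation with [1/(s - R1) = 4]. *)
Theorem char_coef_bound q ch s t j : GRH -> rchar q ch -> 3 <= s ->
  let B := 2 * INR (S j) * (lg q + ln (32 * s * (11 * s + 5 * Rabs t))) / (s - 1 / 2) ^ S j in
  Rabs (coef (lamal ch) s t 0 j) <= B /\ Rabs (coef (lamal ch) s t (PI / 2) j) <= B.
Proof.
intros HG Hch Hs B. assert (HC := rchar_has_coefs q ch s t (s - 1 / 4) Hch Hs ltac:(lra)).
set (C0 := INR q * _) in HC. assert (Hq : 1 <= INR q) by (apply (le_INR 1); apply Hch).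
assert (Ht := Rabs_pos t).
assert (EC : C0 = INR q * (1 + 5 * (2 * s + Rabs t - 1 / 4))) by (unfold C0; field; lra). clearbody C0.
assert (Habs : forall n, Rabs (ch n) <= 1) by (intros; eapply rchar_abs, Hch).
destruct (dirichlet_log_derivative ch (proj1 (proj2 Hch)) Habs s t Hs) as [Da Db].
assert (B0 := coef0_lower ch s t (rchar_one q ch Hch) Habs Hs).
assert (Bp : forall ph, geom_bound (coef (lamal ch) s t ph) (/ (1 / 2) * (1 + / (1 / 2))) (s - 2)) by (intros; apply pcoef_bound; try assumption; lra).
assert (Hmod : 1 / 4 <= coef ch s t 0 0%nat ^ 2 + coef ch s t (PI / 2) 0%nat ^ 2).
{ assert ((1 / 2) ^ 2 <= coef ch s t 0 0%nat ^ 2) by (apply pow_incr; lra). pose proof (pow2_ge_0 (coef ch s t (PI / 2) 0)). simpl in *; lra. }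
assert (CC : 0 < C0) by (rewrite EC; pos).
assert (NV : forall x th, 0 <= x < s - 1 / 2 ->
  ~ (PSeries (rot (coef ch s t 0) (coef ch s t (PI / 2)) th) x = 0 /\ PSeries (rot (coef ch s t (PI / 2)) (oppseq (coef ch s t 0)) th) x = 0)).
{ intros x th Hx. destruct (dval_lim ch C0 (s - 1 / 4) s t x th HC) as [L1 L2]; [rewrite Rabs_pos_eq; lra|].
  refine (nonvanishing_char q ch (s + x * cos th) (t + x * sin th) _ _ HG Hch _ L1 L2).
  pose proof (COS_bound th). nra. }
destruct (log_derivative_coef_bound _ _ _ _ C0 (s - 1 / 4) (/ (1 / 2) * (1 + / (1 / 2))) (s - 2) (s - 1 / 2) ltac:(lra) CC
  (has_coefs_bound _ _ _ _ _ 0 HC) (has_coefs_bound _ _ _ _ _ (PI / 2) HC) ltac:(lra) ltac:(lra) (Bp 0) (Bp (PI / 2)) Da Db NV j ltac:(lra)) as [M1 M2].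
enough (HB : 2 * INR (S j) * (ln (4 * C0 * (s - 1 / 4) / (s - 1 / 4 - (s - 1 / 2))) - / 2 * ln (coef ch s t 0 0%nat ^ 2 + coef ch s t (PI / 2) 0%nat ^ 2)) / (s - 1 / 2) ^ S j <= B)
  by (split; eapply Rle_trans; [exact M1|exact HB|exact M2|exact HB]).
apply Rmult_le_compat_r; [pos|].
apply Rmult_le_compat_l; [pose proof (pos_INR (S j)); lra|].
assert (H2 : - / 2 * ln (coef ch s t 0 0%nat ^ 2 + coef ch s t (PI / 2) 0%nat ^ 2) <= ln 2).
{ assert (ln (1 / 4) <= ln (coef ch s t 0 0%nat ^ 2 + coef ch s t (PI / 2) 0%nat ^ 2)) by (apply ln_le; lra).
  assert (ln (1 / 4) = - (2 * ln 2)).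
  { replace (1 / 4) with (/ (2 * 2)) by field. rewrite ln_Rinv, ln_mult by lra. ring. }
  lra. }
rewrite <- ln_mult; [|lra|pos].
assert (ln (4 * C0 * (s - 1 / 4) / (s - 1 / 4 - (s - 1 / 2))) + ln 2 <= ln (INR q * (32 * s * (11 * s + 5 * Rabs t)))); [|lra].
replace (4 * C0 * (s - 1 / 4) / (s - 1 / 4 - (s - 1 / 2))) with (16 * C0 * (s - 1 / 4)) by (field; lra).
rewrite <- ln_mult by (try lra; repeat pos).
apply ln_le; [pos|]. rewrite EC.
replace (16 * (INR q * (1 + 5 * (2 * s + Rabs t - 1 / 4))) * (s - 1 / 4) * 2) with (INR q * (32 * ((s - 1 / 4) * (1 + 5 * (2 * s + Rabs t - 1 / 4))))) by ring.
rewrite Rmult_assoc. apply Rmult_le_compat_l; [lra|]. apply Rmult_le_compat_l; [lra|]. apply Rmult_le_compat; lra.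
Qed.

(** Here the series is that of [(s-1) zeta(s)], with [C0 <= 21 s^2] and [336 = 16 * 21]; its value
    at the centre is at least [1], so the centre adds nothing. *)
Theorem zeta_coef_bound s j : GRH -> 3 <= s ->
  Rabs (zp s j) <= 2 * INR (S j) * ln (336 * s ^ 3) / (s - 1 / 2) ^ S j.
Proof.
intros HG Hs. destruct (Zc_log_derivative s Hs) as [Da Db].
set (C0 := CZ s (s - 1 / 4)).
assert (EC : C0 = 1 + (2 * s - 5 / 4) + 5 * ((2 * s - 5 / 4) * (2 * s - 1 / 4))) by (unfold C0, CZ; field; lra).
assert (CC : 0 < C0 <= 21 * s ^ 2) by (rewrite EC; simpl; nra).
assert (BN := fun N => ZN_bound s (s - 1 / 4) N ltac:(lra) ltac:(lra)). fold C0 in BN. clearbody C0.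
assert (BZ : geom_bound (Zc s) C0 (s - 1 / 4)).
{ intros m. apply (is_lim_seq_le (fun N => Rabs (ZN s N m)) (fun _ => C0 / (s - 1 / 4) ^ m) (Rabs (Zc s m)) (C0 / (s - 1 / 4) ^ m)).
  - intros N. apply BN.
  - apply (is_lim_seq_abs _ (Zc s m)), ZN_lim, Hs.
  - apply is_lim_seq_const. }
assert (Bz0 : forall C r, 0 <= C -> 0 < r -> geom_bound zero_seq C r) by apply geom_bound_zero.
assert (B0 := coef0_lower one s 0 eq_refl one_abs Hs).
assert (EZ : Zc s 0 = (s - 1) * coef one s 0 0 0) by (unfold Zc, shift; ring).
assert (HZ : 1 <= Zc s 0) by (rewrite EZ; nra).
assert (Hmod : 1 <= Zc s 0 ^ 2 + zero_seq 0 ^ 2).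
{ unfold zero_seq. assert (1 ^ 2 <= Zc s 0 ^ 2) by (apply pow_incr; lra). simpl in *; lra. }
set (Cp := / (1 / 2) * (1 + / (1 / 2)) + 1).
assert (HCp : 0 <= Cp) by (unfold Cp; lra).
assert (Bp : geom_bound (zp s) Cp (s - 2)).
{ intros m. unfold zp. eapply Rle_trans; [apply Rabs_triang|].
  assert (A1 := pcoef_bound one one_abs s 0 0 (s - 2) (1 / 2) Hs ltac:(lra) ltac:(lra) ltac:(lra) m).
  assert (A2 : Rabs ((-1) ^ m / (s - 1) ^ S m) <= 1 / (s - 2) ^ m).
  { unfold Rdiv. rewrite Rabs_mult, pow_1_abs, !Rmult_1_l, Rabs_pos_eq by pos.
    apply Rinv_le_contravar; [pos|].
    apply Rle_trans with ((s - 1) ^ m); [apply pow_incr; lra|]. simpl. assert (0 < (s - 1) ^ m) by pos. nra. }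
  unfold Cp, Rdiv. rewrite Rmult_plus_distr_r. apply Rplus_le_compat; [exact A1|exact A2]. }
assert (NV : forall x th, 0 <= x < s - 1 / 2 ->
  ~ (PSeries (rot (Zc s) zero_seq th) x = 0 /\ PSeries (rot zero_seq (oppseq (Zc s)) th) x = 0)).
{ intros x th Hx [E1 E2].
  assert (L1 : is_lim_seq (PzRe (s + x * cos th) (x * sin th)) 0).
  { rewrite <- E1. eapply is_lim_seq_ext; [intros N; apply (proj1 (ZN_PSeries s x th N))|].
    apply (PSeries_dominated (fun N => rot (ZN s N) zero_seq th) (rot (Zc s) zero_seq th) (2 * C0) (s - 1 / 4) x); try lra.
    - intros N. apply rot_bound; [lra|apply BN|apply Bz0; lra].
    - intros m. apply (is_lim_seq_rot (ZN s) (fun _ => zero_seq)); [apply ZN_lim, Hs|apply is_lim_seq_const].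
    - rewrite Rabs_pos_eq; lra. }
  assert (L2 : is_lim_seq (PzIm (s + x * cos th) (x * sin th)) 0).
  { rewrite <- E2. eapply is_lim_seq_ext; [intros N; apply (proj2 (ZN_PSeries s x th N))|].
    apply (PSeries_dominated (fun N => rot zero_seq (oppseq (ZN s N)) th) (rot zero_seq (oppseq (Zc s)) th) (2 * C0) (s - 1 / 4) x); try lra.
    - intros N. apply rot_bound; [lra|apply Bz0; lra|]. intros m. unfold oppseq. rewrite Rabs_Ropp. apply BN.
    - intros m. apply (is_lim_seq_rot (fun _ => zero_seq) (fun N => oppseq (ZN s N))); [apply is_lim_seq_const|].
      apply (is_lim_seq_opp _ (Zc s m)), ZN_lim, Hs.
    - rewrite Rabs_pos_eq; lra. }
  apply (nonvanishing_zeta (s + x * cos th) (x * sin th) HG); [|exact L1|exact L2].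
  pose proof (COS_bound th). nra. }
assert (M := proj1 (log_derivative_coef_bound _ _ _ _ C0 (s - 1 / 4) Cp (s - 2) (s - 1 / 2) ltac:(lra) (proj1 CC)
  BZ (Bz0 C0 (s - 1 / 4) ltac:(lra) ltac:(lra)) ltac:(lra) HCp Bp (Bz0 Cp (s - 2) HCp ltac:(lra)) Da Db NV j ltac:(lra))).
eapply Rle_trans; [exact M|].
apply Rmult_le_compat_r; [pos|].
apply Rmult_le_compat_l; [pose proof (pos_INR (S j)); lra|].
assert (0 <= ln (Zc s 0 ^ 2 + zero_seq 0 ^ 2)) by (rewrite <- ln_1; apply ln_le; lra).
assert (ln (4 * C0 * (s - 1 / 4) / (s - 1 / 4 - (s - 1 / 2))) <= ln (336 * s ^ 3)); [|lra].
replace (4 * C0 * (s - 1 / 4) / (s - 1 / 4 - (s - 1 / 2))) with (16 * C0 * (s - 1 / 4)) by (field; lra).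
apply ln_le; [pos|].
replace (336 * s ^ 3) with (16 * (21 * s ^ 2) * s) by ring. apply Rmult_le_compat; lra.
Qed.

(** * Smooth cutoffs *)

Definition psum (K : nat) (x : R) : R := S1 (fun i => x ^ (i - 1) / INR (fact (i - 1))) K.

Lemma psum_term_pos x j : 0 <= x -> 0 <= x ^ j / INR (fact j).
Proof. intros Hx. apply Rmult_le_pos; [pos|pos]. Qed.

Lemma psum_lim x : is_lim_seq (fun K => psum K x) (exp x).
Proof.
assert (H := is_exp_Reals x). unfold is_pseries in H.
assert (H2 : is_series (fun k => x ^ k / INR (fact k)) (exp x)).
{ eapply is_series_ext_R; [|exact H]. intros n. cbv beta. rewrite pow_n_pow. unfold scal; simpl. unfold mult; simpl. unfold Rdiv. reflexivity. }
apply (is_lim_seq_incr_1 (fun K => psum K x)). eapply is_lim_seq_ext; [|exact H2].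
intros n. induction n as [|n IH]; [unfold psum; rewrite sum_O; simpl; field|].
rewrite sum_Sn, IH. unfold psum. rewrite (S1_S _ (S n)). replace (S (S n) - 1)%nat with (S n) by lia. reflexivity.
Qed.

Lemma psum_le_exp K x : 0 <= x -> psum K x <= exp x.
Proof.
intros Hx. apply (is_lim_seq_le_loc (fun _ => psum K x) (fun M => psum M x) (psum K x) (exp x)); [|apply is_lim_seq_const|apply psum_lim].
exists K. intros M HM. apply S1_mono; [exact HM|]. intros n _. apply psum_term_pos, Hx.
Qed.

(** Rankin's trick: the factors [r^j] with [j < K] are at most [r^K] when [r >= 1]. In [psum_tail]
    the same is done for [j >= K] and [r <= 1]. *)
Lemma psum_upper K r y : 0 <= y -> 1 <= r -> psum K (r * y) <= r ^ K * exp y.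
Proof.
intros Hy Hr. apply Rle_trans with (r ^ K * psum K y); [|apply Rmult_le_compat_l; [pos|apply psum_le_exp, Hy]].
unfold psum. rewrite <- S1_scal. apply S1_le. intros i Hi. rewrite Rpow_mult_distr. unfold Rdiv. rewrite Rmult_assoc.
apply Rmult_le_compat_r; [apply psum_term_pos, Hy|]. apply Rle_pow; [exact Hr|lia].
Qed.

Lemma psum_tail K r y : 0 <= y -> 0 <= r <= 1 -> exp (r * y) - psum K (r * y) <= r ^ K * exp y.
Proof.
intros Hy Hr. refine (is_lim_seq_le_loc (fun M => psum M (r * y) - psum K (r * y)) (fun _ => r ^ K * exp y) (exp (r * y) - psum K (r * y)) (r ^ K * exp y) _ _ (is_lim_seq_const _)).
- exists K. intros M HM. apply Rle_trans with (r ^ K * (psum M y - psum K y)).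
  + unfold psum. induction HM as [|M HM IH]; [lra|]. rewrite !S1_S.
    assert ((r * y) ^ (S M - 1) / INR (fact (S M - 1)) <= r ^ K * (y ^ (S M - 1) / INR (fact (S M - 1)))).
    { rewrite Rpow_mult_distr. unfold Rdiv. rewrite Rmult_assoc. apply Rmult_le_compat_r; [apply psum_term_pos, Hy|].
      replace (S M - 1)%nat with (K + (M - K))%nat by lia. rewrite pow_add.
      assert (0 <= r ^ K) by pos. assert (r ^ (M - K) <= 1) by (apply pow_le_one; lra).
      nra. }
    lra.
  + apply Rmult_le_compat_l; [pos|]. pose proof (psum_le_exp M y Hy).
    assert (0 <= psum K y) by (apply S1_pos; intros; apply psum_term_pos, Hy). lra.
- apply is_lim_seq_minus'; [apply psum_lim|apply is_lim_seq_const].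
Qed.

(* A smooth approximation of the indicator function of [log n <= K / D]. *)
Definition vK (D : R) (K n : nat) : R := pw n D * psum K (D * lg n).

Lemma vK_pos D K n : 0 <= D -> 0 <= vK D K n.
Proof.
intros HD. apply Rmult_le_pos; [pos|]. apply S1_pos. intros. apply psum_term_pos, Rmult_le_pos; [exact HD|apply ln_INR_pos].
Qed.

(** [vK D K n] is the probability that a Poisson variable of mean [D log n] is below [K]; this bound
    and [vK_lower] are Chernoff bounds with free parameter [s]. *)
Lemma vK_upper D K n s : 0 <= s < D -> vK D K n <= (D / (D - s)) ^ K * pw n s.
Proof.
intros Hs. unfold vK. pose proof (ln_INR_pos n) as Hl.
replace (D * lg n) with (D / (D - s) * ((D - s) * lg n)) by (field; lra).
assert (B := psum_upper K (D / (D - s)) ((D - s) * lg n) ltac:(nra)).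
assert (1 <= D / (D - s)).
{ apply Rle_div_r; lra. }
specialize (B H). apply Rle_trans with (pw n D * ((D / (D - s)) ^ K * exp ((D - s) * lg n))).
- apply Rmult_le_compat_l; [pos|exact B].
- right. unfold pw. replace (- s * lg n) with (- D * lg n + (D - s) * lg n) by ring. rewrite exp_plus. ring.
Qed.

Lemma vK_le_1 D K n : 0 < D -> vK D K n <= 1.
Proof.
intros HD. eapply Rle_trans; [apply (vK_upper D K n 0); lra|]. rewrite Rminus_0_r.
replace (D / D) with 1 by (field; lra). rewrite pow1. unfold pw. rewrite Ropp_0, Rmult_0_l, exp_0. lra.
Qed.

Lemma vK_lower D K n s : 0 < D -> 0 <= s -> 1 - vK D K n <= (D / (D + s)) ^ K * pw n (- s).
Proof.
intros HD Hs. unfold vK. pose proof (ln_INR_pos n) as Hl.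
assert (R1 : 0 <= D / (D + s) <= 1).
{ split; [pos|].
  apply Rle_div_l; lra. }
assert (B := psum_tail K (D / (D + s)) ((D + s) * lg n) ltac:(nra) R1).
replace (D / (D + s) * ((D + s) * lg n)) with (D * lg n) in B by (field; lra).
apply Rle_trans with (pw n D * (exp (D * lg n) - psum K (D * lg n))).
- right. unfold pw. rewrite Rmult_minus_distr_l, <- exp_plus. replace (- D * lg n + D * lg n) with 0 by ring. rewrite exp_0. ring.
- apply Rle_trans with (pw n D * ((D / (D + s)) ^ K * exp ((D + s) * lg n))); [apply Rmult_le_compat_l; [pos|exact B]|].
  right. unfold pw. replace (- - s * lg n) with (- D * lg n + (D + s) * lg n) by ring. rewrite exp_plus. ring.
Qed.

Lemma is_lim_seq_S1 (f : nat -> nat -> R) (l : nat -> R) K :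
  (forall i, is_lim_seq (fun N => f N i) (l i)) -> is_lim_seq (fun N => S1 (f N) K) (S1 l K).
Proof.
intros H. induction K as [|K IH]; [apply is_lim_seq_const|]. simpl. apply is_lim_seq_plus'; [exact IH|apply H].
Qed.

(** A finite combination of Taylor coefficients at one centre is a Dirichlet series whose weight is
    [n^(-s)] times a polynomial in [log n]. The signs undo [(- log n)^j] and the minus in
    [lamal]. *)
Lemma smooth_lim al s t (c : nat -> R) K : (forall n, Rabs (al n) <= 1) -> 3 <= s ->
  is_lim_seq (S1 (fun n => vonM n * al n * cos (t * lg n) * (pw n s * S1 (fun i => c (i - 1)%nat * (lg n ^ (i - 1) / INR (fact (i - 1)))) K)))
    (S1 (fun i => c (i - 1)%nat * (- (-1) ^ (i - 1) * coef (lamal al) s t 0 (i - 1))) K).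
Proof.
intros Hal Hs.
apply (is_lim_seq_ext (fun N => S1 (fun i => c (i - 1)%nat * (- (-1) ^ (i - 1) * coefN (lamal al) s t 0 N (i - 1))) K)).
- intros N. unfold coefN.
  rewrite (S1_ext (fun i => _) (fun i => S1 (fun n => c (i - 1)%nat * (- (-1) ^ (i - 1)) * (lamal al n * kern s t 0 (i - 1) n)) N)) by (intros; rewrite S1_scal; ring).
  rewrite S1_exchange. apply S1_ext. intros n _. rewrite <- (S1_scal (pw n s)), <- S1_scal. apply S1_ext. intros i _.
  unfold lamal, kern, G, pw. rewrite Rplus_0_r. replace (- lg n) with (-1 * lg n) by ring. rewrite Rpow_mult_distr.
  assert ((-1) ^ (i - 1) * (-1) ^ (i - 1) = 1) by (rewrite <- Rpow_mult_distr; replace (-1 * -1) with 1 by ring; apply pow1).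
  replace (c (i - 1)%nat * - (-1) ^ (i - 1) * (- (vonM n * al n) * (exp (- s * lg n) * ((-1) ^ (i - 1) * lg n ^ (i - 1) / INR (fact (i - 1))) * cos (t * lg n))))
    with (((-1) ^ (i - 1) * (-1) ^ (i - 1)) * (c (i - 1)%nat * (vonM n * al n * (exp (- s * lg n) * (lg n ^ (i - 1) / INR (fact (i - 1))) * cos (t * lg n))))) by (unfold Rdiv; ring).
  rewrite H. ring.
- apply (is_lim_seq_S1 (fun N i => c (i - 1)%nat * (- (-1) ^ (i - 1) * coefN (lamal al) s t 0 N (i - 1)))).
  intros i. apply (is_lim_seq_scal_l _ (c (i - 1)%nat) (- (-1) ^ (i - 1) * coef (lamal al) s t 0 (i - 1))).
  apply (is_lim_seq_scal_l _ (- (-1) ^ (i - 1)) (coef (lamal al) s t 0 (i - 1))). apply pcoef_lim; assumption.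
Qed.

Lemma vK_smooth_lim al D K : (forall n, Rabs (al n) <= 1) -> 3 <= D ->
  is_lim_seq (S1 (fun n => vonM n * al n * vK D K n)) (S1 (fun i => D ^ (i - 1) * (- (-1) ^ (i - 1) * coef (lamal al) D 0 0 (i - 1))) K).
Proof.
intros Hal HD. eapply is_lim_seq_ext; [|exact (smooth_lim al D 0 (fun j => D ^ j) K Hal HD)].
intros N. apply S1_ext. intros n _. rewrite Rmult_0_l, cos_0, Rmult_1_r. f_equal. unfold vK, psum. f_equal. apply S1_ext. intros i _.
rewrite Rpow_mult_distr. unfold Rdiv. ring.
Qed.

Lemma sign_abs i : Rabs (- (-1) ^ i) = 1.
Proof. rewrite Rabs_Ropp. apply pow_1_abs. Qed.

Lemma weighted_geom_sum (f : nat -> R) A D K : 3 <= D -> 0 <= A ->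
  (forall j, Rabs (f j) <= 2 * INR (S j) * A / (D - 1 / 2) ^ S j) ->
  Rabs (S1 (fun i => D ^ (i - 1) * (- (-1) ^ (i - 1) * f (i - 1)%nat)) K) <= 2 * A * INR K ^ 2 * (D / (D - 1 / 2)) ^ K.
Proof.
intros HD HA Hf. set (B := 2 * A * INR K * (D / (D - 1 / 2)) ^ K).
replace (2 * A * INR K ^ 2 * (D / (D - 1 / 2)) ^ K) with (INR K * B) by (unfold B; ring).
rewrite <- S1_const. apply S1_abs_le. intros i Hi.
rewrite !Rabs_mult, sign_abs, Rmult_1_l, Rabs_pos_eq by pos.
specialize (Hf (i - 1)%nat). replace (S (i - 1)) with i in Hf by lia.
assert (HDi : 0 < D ^ (i - 1)) by pos.
apply Rle_trans with (D ^ (i - 1) * (2 * INR i * A / (D - 1 / 2) ^ i)); [apply Rmult_le_compat_l; lra|].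
assert (HR : 1 <= D / (D - 1 / 2)).
{ apply Rle_div_r; lra. }
assert (E : D ^ (i - 1) / (D - 1 / 2) ^ i <= (D / (D - 1 / 2)) ^ K).
{ apply Rle_trans with ((D / (D - 1 / 2)) ^ i); [|apply Rle_pow; [exact HR|lia]].
  unfold Rdiv. rewrite Rpow_mult_distr, pow_inv. apply Rmult_le_compat_r; [pos|].
  apply Rle_pow; [lra|lia]. }
assert (Hi2 : INR i <= INR K) by (apply le_INR; lia). pose proof (pos_INR i).
replace (D ^ (i - 1) * (2 * INR i * A / (D - 1 / 2) ^ i)) with (2 * A * INR i * (D ^ (i - 1) / (D - 1 / 2) ^ i)) by (unfold Rdiv; ring).
unfold B. apply Rmult_le_compat; [nra| |nra|exact E].
apply Rmult_le_pos; [lra|pos].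
Qed.

Theorem smooth_char q ch D K : GRH -> rchar q ch -> 3 <= D ->
  exists l : R, is_lim_seq (S1 (fun n => vonM n * ch n * vK D K n)) l /\
    Rabs l <= 2 * (lg q + ln (352 * D ^ 2)) * INR K ^ 2 * (D / (D - 1 / 2)) ^ K.
Proof.
intros HG Hch HD. eexists. split; [apply vK_smooth_lim; [intros; eapply rchar_abs, Hch|exact HD]|].
apply weighted_geom_sum; [exact HD| |].
- assert (0 <= lg q) by apply ln_INR_pos.
  assert (0 <= ln (352 * D ^ 2)) by (rewrite <- ln_1; apply ln_le; simpl; nra). lra.
- intros j. destruct (char_coef_bound q ch D 0 j HG Hch HD) as [B _]. rewrite Rabs_R0 in B.
  replace (32 * D * (11 * D + 5 * 0)) with (352 * D ^ 2) in B by ring. exact B.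
Qed.

Theorem smooth_zeta D K : GRH -> 3 <= D ->
  exists l : R, is_lim_seq (S1 (fun n => vonM n * vK D K n)) l /\
    Rabs (l - ((D / (D - 1)) ^ K - 1)) <= 2 * ln (336 * D ^ 3) * INR K ^ 2 * (D / (D - 1 / 2)) ^ K.
Proof.
intros HG HD. eexists. split.
{ eapply is_lim_seq_ext; [|exact (vK_smooth_lim one D K one_abs HD)]. intros N. apply S1_ext. intros n _. unfold one. ring. }
(* The pole at [1] contributes the terms [(-1)^j / (D-1)^(j+1)] of [zp], which sum to a geometric
   progression. *)
assert (E : (D / (D - 1)) ^ K - 1 = S1 (fun i => D ^ (i - 1) / (D - 1) ^ i) K).
{ induction K as [|K IH]; [simpl; ring|]. rewrite S1_S, <- IH. replace (S K - 1)%nat with K by lia.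
  simpl pow. unfold Rdiv. rewrite Rpow_mult_distr, pow_inv. field. split; [|lra]. apply pow_nonzero; lra. }
rewrite E, <- S1_minus.
rewrite (S1_ext _ (fun i => D ^ (i - 1) * (- (-1) ^ (i - 1) * zp D (i - 1)))).
- apply weighted_geom_sum; [exact HD| |].
  + rewrite <- ln_1. apply ln_le; [lra|]. assert (1 <= D ^ 3) by (apply pow_R1_Rle; lra). lra.
  + intros j. apply zeta_coef_bound; assumption.
- intros i Hi. unfold zp. replace (S (i - 1)) with i by lia.
  assert ((-1) ^ (i - 1) * (-1) ^ (i - 1) = 1) by (rewrite <- Rpow_mult_distr; replace (-1 * -1) with 1 by ring; apply pow1).
  replace (D ^ (i - 1) / (D - 1) ^ i) with (((-1) ^ (i - 1) * (-1) ^ (i - 1)) * (D ^ (i - 1) / (D - 1) ^ i)) by (rewrite H; ring).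
  unfold Rdiv. ring.
Qed.

Lemma linear_geom_bound (f : nat -> R) A r r' : 0 < r' < r -> 0 <= A -> (forall j, Rabs (f j) <= 2 * INR (S j) * A / r ^ S j) ->
  geom_bound f (2 * A / (r * (1 - r' / r))) r'.
Proof.
intros Hr HA Hf j. eapply Rle_trans; [apply Hf|].
assert (Hy : 0 < r' / r < 1).
{ split; [pos|]. apply Rlt_div_l; lra. }
set (y := r' / r) in *.
assert (G : INR (S j) * y ^ j <= / (1 - y)).
{ apply Rle_trans with (geo y (S j)).
  - induction j as [|j IH]; [simpl; lra|]. rewrite geo_last, S_INR, Rmult_plus_distr_r, Rmult_1_l. apply Rplus_le_compat; [|lra].
    eapply Rle_trans; [|exact IH]. apply Rmult_le_compat_l; [apply pos_INR|]. simpl. assert (0 < y ^ j) by pos. nra.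
  - apply Rmult_le_reg_l with (1 - y); [lra|]. rewrite geo_eq, Rinv_r by lra. assert (0 < y ^ S j) by pos. lra. }
assert (E : / r ^ S j = / r * (y ^ j * / r' ^ j)).
{ unfold y, Rdiv. rewrite Rpow_mult_distr, pow_inv. simpl. field. repeat split; try apply pow_nonzero; lra. }
unfold Rdiv. rewrite E. rewrite Rinv_mult.
replace (2 * INR (S j) * A * (/ r * (y ^ j * / r' ^ j))) with (2 * A * / r * / r' ^ j * (INR (S j) * y ^ j)) by ring.
replace (2 * A * (/ r * / (1 - y)) * / r' ^ j) with (2 * A * / r * / r' ^ j * / (1 - y)) by ring.
apply Rmult_le_compat_l; [|exact G]. apply Rmult_le_pos; [pos|pos].
Qed.

Lemma sum_f_R0_S1 (f : nat -> R) K : sum_f_R0 f K = f 0%nat + S1 f K.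
Proof. induction K as [|K IH]; simpl; [ring|rewrite IH; ring]. Qed.

(** Result of integrating the first [K] Taylor terms of the logarithmic derivative from the centre
    [3] over the distance [lam]. By [ln_wK] it approximates [(n^(lam-3) - n^(-3)) / log n]. *)
Definition wK (lam : R) (K n : nat) : R :=
  pw n 3 * S1 (fun i => lam ^ i / INR i * (lg n ^ (i - 1) / INR (fact (i - 1)))) K.

(** Here the centre stays at [3]: GRH gives radius [5/2], and [lam < 5/2], so the tail of the series
    of the logarithm decays geometrically and depends on the modulus only through [log q]. The
    summand [2] bounds the log modulus at [3 + it]. *)
Theorem log_L_formula q ch sigma t K : GRH -> rchar q ch -> 1 / 2 < sigma < 1 ->
  let lam := 3 - sigma in
  exists u v l : R, is_lim_seq (dval ch sigma t 0) u /\ is_lim_seq (dval ch sigma t (PI / 2)) v /\ 0 < u ^ 2 + v ^ 2 /\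
    is_lim_seq (S1 (fun n => vonM n * ch n * cos (t * lg n) * wK lam K n)) l /\
    Rabs (/ 2 * ln (u ^ 2 + v ^ 2) - l) <=
      2 + 2 * (lg q + ln (32 * 3 * (11 * 3 + 5 * Rabs t))) * (lam / (5 / 2)) ^ S K / (1 - lam / (5 / 2)).
Proof.
intros HG Hch Hsig lam. set (A := lg q + ln (32 * 3 * (11 * 3 + 5 * Rabs t))).
assert (HA : 0 <= A).
{ assert (0 <= lg q) by apply ln_INR_pos. pose proof (Rabs_pos t).
  assert (0 <= ln (32 * 3 * (11 * 3 + 5 * Rabs t))) by (rewrite <- ln_1; apply ln_le; lra). unfold A; lra. }
assert (Habs : forall n, Rabs (ch n) <= 1) by (intros; eapply rchar_abs, Hch).
assert (HC := rchar_has_coefs q ch 3 t (11 / 4) Hch ltac:(lra) ltac:(lra)). set (C0 := INR q * _) in HC.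
pose proof HC as (_ & HC0 & _ & _).
assert (Hlam : 2 < lam < 5 / 2) by (unfold lam; lra).
assert (Hxl : Rabs (- lam) = lam) by (rewrite Rabs_Ropp, Rabs_pos_eq; lra).
destruct (dval_lim_real ch C0 (11 / 4) 3 t (- lam) HC) as [L1 L2]; [rewrite Hxl; lra|].
replace (3 + - lam) with sigma in L1, L2 by (unfold lam; ring).
set (a := coef ch 3 t 0) in *. set (b := coef ch 3 t (PI / 2)) in *.
set (p := coef (lamal ch) 3 t 0). set (p' := coef (lamal ch) 3 t (PI / 2)).
assert (Hp : forall j, Rabs (p j) <= 2 * INR (S j) * A / (5 / 2) ^ S j).
{ intros j. destruct (char_coef_bound q ch 3 t j HG Hch ltac:(lra)) as [X _]. replace (5 / 2) with (3 - 1 / 2) by field. exact X. }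
assert (Hp' : forall j, Rabs (p' j) <= 2 * INR (S j) * A / (5 / 2) ^ S j).
{ intros j. destruct (char_coef_bound q ch 3 t j HG Hch ltac:(lra)) as [_ X]. replace (5 / 2) with (3 - 1 / 2) by field. exact X. }
set (rho := (lam + 5 / 2) / 2). assert (Hrho : lam < rho < 5 / 2) by (unfold rho; lra).
set (C1 := 2 * A / (5 / 2 * (1 - rho / (5 / 2)))).
assert (HC1 : 0 <= C1).
{ unfold C1. apply Rmult_le_pos; [lra|]. left. apply Rinv_0_lt_compat. lra. }
assert (W : forall f k r, 0 <= k -> k <= C0 + C1 -> rho <= r -> geom_bound f k r -> geom_bound f (C0 + C1) rho).
{ intros f k r Hk Hk2 Hr Hf m. eapply Rle_trans; [apply (geom_bound_weaken f k r rho ltac:(lra) Hk Hf)|].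
  apply Rmult_le_compat_r; [pos|lra]. }
destruct (dirichlet_log_derivative ch (proj1 (proj2 Hch)) Habs 3 t ltac:(lra)) as [Da Db].
assert (M := modulus_along_ray a b p p' Da Db (C0 + C1) rho (- lam) ltac:(lra)
  (W _ C0 (11 / 4) HC0 ltac:(lra) ltac:(lra) (has_coefs_bound _ _ _ _ _ 0 HC)) (W _ C0 (11 / 4) HC0 ltac:(lra) ltac:(lra) (has_coefs_bound _ _ _ _ _ (PI / 2) HC))
  (W _ C1 rho HC1 ltac:(lra) ltac:(lra) (linear_geom_bound p A (5 / 2) rho ltac:(lra) HA Hp))
  (W _ C1 rho HC1 ltac:(lra) ltac:(lra) (linear_geom_bound p' A (5 / 2) rho ltac:(lra) HA Hp')) ltac:(rewrite Hxl; lra)).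
assert (B0 := coef0_lower ch 3 t (rchar_one q ch Hch) Habs ltac:(lra)). fold a in B0.
assert (Hm1 : 1 / 4 <= a 0%nat ^ 2 + b 0%nat ^ 2).
{ assert ((1 / 2) ^ 2 <= a 0%nat ^ 2) by (apply pow_incr; lra). pose proof (pow2_ge_0 (b 0%nat)). simpl in *; lra. }
assert (Hm2 : a 0%nat ^ 2 + b 0%nat ^ 2 <= 8).
{ assert (U : forall ph, coef ch 3 t ph 0%nat ^ 2 <= 2 ^ 2).
  { intros ph. rewrite <- pow2_abs. apply pow_incr. split; [apply Rabs_pos|].
    assert (X := coef_abs_bound ch Habs 3 t ph 1 1 ltac:(lra) ltac:(lra) ltac:(lra) ltac:(lra) 0%nat). simpl in X. lra. }
  pose proof (U 0) as U1. pose proof (U (PI / 2)) as U2. fold a in U1. fold b in U2. simpl in *; lra. }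
set (I := PSeries (PS_Int p) (- lam)) in *.
assert (HI : Rabs (I - sum_f_R0 (fun m => PS_Int p m * (- lam) ^ m) K) <= 2 * A * (lam / (5 / 2)) ^ S K / (1 - lam / (5 / 2))).
{ assert (X := PSeries_geom_tail (PS_Int p) (2 * A) (5 / 2) (- lam) K). rewrite Hxl in X. apply X; [lra|lra| |lra].
  intros [|j]; unfold PS_Int; [rewrite Rabs_R0; simpl; lra|].
  unfold Rdiv at 1. rewrite Rabs_mult, (Rabs_pos_eq (/ INR (S j))) by pos.
  specialize (Hp j). apply Rle_trans with (2 * INR (S j) * A / (5 / 2) ^ S j * / INR (S j)).
  - apply Rmult_le_compat_r; [pos|exact Hp].
  - right. field. split; [apply pow_nonzero; lra|apply not_0_INR; lia]. }
exists (PSeries a (- lam)), (PSeries b (- lam)), (S1 (fun i => (lam ^ i / INR i) * (- (-1) ^ (i - 1) * p (i - 1)%nat)) K).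
split; [exact L1|split; [exact L2|]]. rewrite M.
split; [apply Rmult_lt_0_compat; [lra|apply exp_pos]|split].
- assert (X := smooth_lim ch 3 t (fun j => lam ^ S j / INR (S j)) K Habs ltac:(lra)).
  eapply is_lim_seq_ext; [|eapply is_lim_seq_ext_loc; [|]]; [| |].
  3: { assert (EL : S1 (fun i => lam ^ i / INR i * (- (-1) ^ (i - 1) * p (i - 1)%nat)) K = S1 (fun i => (fun j => lam ^ S j / INR (S j)) (i - 1)%nat * (- (-1) ^ (i - 1) * coef (lamal ch) 3 t 0 (i - 1))) K).
       { apply S1_ext. intros i Hi. cbv beta. replace (S (i - 1)) with i by lia. reflexivity. }
       rewrite EL. exact X. }
  2: { exists 0%nat. intros N _. reflexivity. }
  intros N. apply S1_ext. intros n _. unfold wK. f_equal. f_equal. apply S1_ext. intros i Hi. cbv beta. replace (S (i - 1)) with i by lia. reflexivity.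
- rewrite ln_mult, ln_exp by (try lra; apply exp_pos).
  rewrite sum_f_R0_S1 in HI. unfold PS_Int at 1 in HI. rewrite Rmult_0_l, Rplus_0_l in HI.
  rewrite (S1_ext (fun i => PS_Int p i * (- lam) ^ i) (fun i => lam ^ i / INR i * (- (-1) ^ (i - 1) * p (i - 1)%nat))) in HI.
  + set (Q := S1 _ K) in *.
    assert (H0 : Rabs (/ 2 * ln (a 0%nat ^ 2 + b 0%nat ^ 2)) <= 2).
    { assert (ln (1 / 4) <= ln (a 0%nat ^ 2 + b 0%nat ^ 2)) by (apply ln_le; lra).
      assert (ln (a 0%nat ^ 2 + b 0%nat ^ 2) <= ln 8) by (apply ln_le; lra).
      assert (ln 2 < 1) by (pose proof (ln_increasing 2 (exp 1) ltac:(lra)); rewrite ln_exp in *; apply H1; pose proof (exp_ineq1 1 ltac:(lra)); lra).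
      replace 8 with (2 * (2 * 2)) in H0 by ring. rewrite !ln_mult in H0 by lra.
      replace (1 / 4) with (/ (2 * 2)) in H by field. rewrite ln_Rinv, ln_mult in H by lra.
      apply Rabs_le. lra. }
    replace (/ 2 * (ln (a 0%nat ^ 2 + b 0%nat ^ 2) + 2 * I) - Q) with (/ 2 * ln (a 0%nat ^ 2 + b 0%nat ^ 2) + (I - Q)) by field.
    eapply Rle_trans; [apply Rabs_triang|]. lra.
  + intros [|i] Hi; [lia|]. unfold PS_Int. replace (S i - 1)%nat with i by lia.
    replace (- lam) with (-1 * lam) by ring. rewrite Rpow_mult_distr. simpl ((-1) ^ S i). unfold Rdiv. ring.
Qed.

(** * The prime number theorem *)

Definition pr (n : nat) : R := if prime_dec (Z.of_nat n) then 1 else 0.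

Definition powLam (n : nat) : R := vonM n - pr n * lg n.

Lemma pr_01 n : 0 <= pr n <= 1. Proof. unfold pr. destruct prime_dec; lra. Qed.

Lemma powLam_nonneg n : 0 <= powLam n.
Proof.
unfold powLam, pr. destruct (prime_dec (Z.of_nat n)) as [P|P]; [rewrite vonM_prime by exact P; lra|].
pose proof (vonM_ge0 n). lra.
Qed.

Lemma powLam_form n : powLam n <> 0 -> exists p k, (2 <= p)%nat /\ (1 <= k)%nat /\ n = (p ^ S k)%nat /\ powLam n <= lg p.
Proof.
unfold powLam, pr. destruct (prime_dec (Z.of_nat n)) as [P|P]; [rewrite vonM_prime by exact P; lra|].
rewrite Rmult_0_l, Rminus_0_r. intros H. destruct (vonM_primepow_nat n H) as (p & k & Hp & Hk & En & Ev).
destruct k as [|[|k]]; [lia| |].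
- rewrite Nat.pow_1_r in En. subst. contradiction.
- exists p, (S k). apply prime_ge_2 in Hp. split; [lia|split; [lia|split; [exact En|lra]]].
Qed.

Lemma pw_pow p k s : (1 <= p)%nat -> pw (p ^ k) s = pw p s ^ k.
Proof.
intros Hp. induction k as [|k IH]; [apply pw_1|]. rewrite Nat.pow_succ_r', pw_mult, IH; [reflexivity|exact Hp|].
assert (p ^ k <> 0)%nat by (apply Nat.pow_nonzero; lia). lia.
Qed.

Lemma S1_indicator m c N : 0 <= c -> S1 (fun n => if Nat.eqb n m then c else 0) N <= c.
Proof.
intros Hc. assert (X : S1 (fun n => if Nat.eqb n m then c else 0) N <= c /\ ((N < m)%nat -> S1 (fun n => if Nat.eqb n m then c else 0) N = 0)).
{ induction N as [|N [IH1 IH2]]; [simpl; split; [lra|reflexivity]|]. rewrite S1_S.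
  destruct (Nat.eqb_spec (S N) m); split; intros; try lra; try lia; [rewrite IH2 by lia; lra|rewrite IH2 by lia; lra]. }
apply X.
Qed.

Lemma S1_member f k N : (1 <= k <= N)%nat -> (forall n, 0 <= f n) -> f k <= S1 f N.
Proof.
intros Hk Hf. destruct k as [|k]; [lia|]. apply Rle_trans with (S1 f (S k)).
- rewrite S1_S. assert (0 <= S1 f k) by (apply S1_pos; auto). lra.
- apply S1_mono; [lia|auto].
Qed.

Lemma prime_powers_bounded s : 1 / 2 < s -> exists C, 0 <= C /\ forall N, S1 (fun n => powLam n * pw n s) N <= C.
Proof.
intros Hs. set (e := s - 1 / 2). assert (He : 0 < e) by (unfold e; lra).
set (r := pw 2 s). assert (Hr : 0 < r < 1).
{ unfold r. split; [apply pw_pos|]. unfold pw. rewrite <- exp_0. apply exp_increasing.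
  assert (0 < lg 2) by (rewrite <- ln_1; apply ln_increasing; simpl; lra). nra. }
(* The powers of one prime form a geometric series of ratio at most [r], with leading term
   [log p * p^(-2s) <= p^(-1-e) / e]. *)
set (C := / e * (1 + / e) * / (1 - r)).
assert (Hie : 0 < / e) by pos.
assert (Hir : 0 < / (1 - r)) by pos.
exists C. split; [unfold C; apply Rmult_le_pos; [nra|lra]|]. intros N.
set (h := fun p k => if Nat.leb 2 p then lg p * pw p s ^ S k else 0).
assert (Hh : forall p k, 0 <= h p k).
{ intros. unfold h. destruct (Nat.leb 2 p); [|lra]. apply Rmult_le_pos; [apply ln_INR_pos|pos]. }
apply Rle_trans with (S1 (fun n => S1 (fun p => S1 (fun k => if Nat.eqb n (p ^ S k) then h p k else 0) N) N) N).
- apply S1_le. intros n Hn.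
  assert (P0 : forall p k, 0 <= (if Nat.eqb n (p ^ S k) then h p k else 0)) by (intros; destruct (Nat.eqb _ _); [apply Hh|lra]).
  assert (P1 : forall p, 0 <= S1 (fun k => if Nat.eqb n (p ^ S k) then h p k else 0) N) by (intros; apply S1_pos; auto).
  destruct (Req_dec (powLam n) 0) as [Z|Z]; [rewrite Z, Rmult_0_l; apply S1_pos; auto|].
  destruct (powLam_form n Z) as (p & k & Hp & Hk & En & Hle).
  assert (Hk1 : (k < p ^ k)%nat) by (apply Nat.pow_gt_lin_r; lia).
  assert (Hpn : (p <= n /\ k <= n)%nat) by (rewrite En, Nat.pow_succ_r'; nia).
  eapply Rle_trans; [|apply (S1_member _ p N ltac:(lia) P1)].
  eapply Rle_trans; [|apply (S1_member (fun k => if Nat.eqb n (p ^ S k) then h p k else 0) k N ltac:(lia) (P0 p))].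
  cbv beta. rewrite (proj2 (Nat.eqb_eq n (p ^ S k)) En). unfold h. rewrite (proj2 (Nat.leb_le 2 p) Hp).
  rewrite En at 2. rewrite pw_pow by lia. apply Rmult_le_compat_r; [pos|exact Hle].
- rewrite S1_exchange. apply Rle_trans with (S1 (fun p => S1 (h p) N) N).
  { apply S1_le. intros p _. rewrite S1_exchange. apply S1_le. intros k _. apply S1_indicator, Hh. }
  unfold C. rewrite (Rmult_comm _ (/ (1 - r))). rewrite <- Rmult_assoc.
  apply Rle_trans with (S1 (fun p => / (1 - r) * / e * pw p (1 + e)) N).
  2: { rewrite S1_scal. apply Rmult_le_compat_l; [nra|apply S1_pw_bound, He]. }
  apply S1_le. intros p Hp.
  assert (Pp : 0 < / (1 - r) * / e * pw p (1 + e)) by (repeat apply Rmult_lt_0_compat; try lra; apply pw_pos).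
  destruct (Nat.leb_spec 2 p) as [H2|H2]; cycle 1.
  { rewrite (S1_ext _ (fun _ => 0)); [rewrite S1_zero; lra|]. intros k _. unfold h. destruct (Nat.leb_spec 2 p); [lia|reflexivity]. }
  set (y := pw p s). assert (Hy : 0 < y <= r) by (split; [apply pw_pos|apply pw_decr; [lra|lia]]).
  assert (G : forall M, S1 (fun k => y ^ S k) M = y * y * geo y M).
  { induction M as [|M IH]; [simpl; ring|]. rewrite S1_S, IH, geo_last. simpl. ring. }
  assert (Gb : geo y N <= / (1 - r)).
  { apply Rle_trans with (/ (1 - y)); [|apply Rinv_le_contravar; lra].
    apply Rmult_le_reg_l with (1 - y); [lra|]. rewrite geo_eq, Rinv_r by lra. assert (0 < y ^ N) by pos. lra. }
  rewrite (S1_ext _ (fun k => lg p * y ^ S k)) by (intros k _; unfold h; rewrite (proj2 (Nat.leb_le 2 p) H2); reflexivity).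
  rewrite S1_scal, G.
  assert (Hl : lg p * (y * y) <= / e * pw p (1 + e)).
  { unfold y. rewrite <- pw_plus. replace (/ e * pw p (1 + e)) with ((/ e * pw p (- e)) * pw p (s + s)).
    - apply Rmult_le_compat_r; [pos|apply ln_le_pw, He].
    - rewrite Rmult_assoc, <- pw_plus. do 2 f_equal. unfold e. field. }
  assert (0 <= geo y N).
  { clear -Hy Hr. induction N as [|N IH]; simpl; nra. }
  replace (lg p * (y * y * geo y N)) with (geo y N * (lg p * (y * y))) by ring. rewrite (Rmult_assoc (/ (1 - r))).
  pose proof (ln_INR_pos p).
  apply Rmult_le_compat; [exact H|apply Rmult_le_pos; nra|exact Gb|exact Hl].
Qed.

(** * Inequalities for large arguments and choice of the cutoff *)

Definition ev (P : R -> Prop) : Prop := exists M, forall x, M <= x -> P x.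

Lemma ev_and P Q : ev P -> ev Q -> ev (fun x => P x /\ Q x).
Proof.
intros [M HM] [N HN]. exists (Rmax M N). intros x Hx. pose proof (Rmax_l M N). pose proof (Rmax_r M N).
split; [apply HM|apply HN]; lra.
Qed.

Lemma ev_imp P Q : (forall x, P x -> Q x) -> ev P -> ev Q.
Proof. intros H [M HM]. exists M. intros x Hx. apply H, HM, Hx. Qed.

Lemma ev_ge c : ev (fun x => c <= x). Proof. exists c. auto. Qed.

Lemma ev_poly c m e : 0 < e -> ev (fun x => c * x ^ m <= exp (e * x)).
Proof.
intros He. set (F := INR (fact (S m))). assert (HF : 0 < F) by pos.
exists (Rmax 0 (Rabs c * F / e ^ S m)). intros x Hx.
assert (H0 := Rle_trans _ _ _ (Rmax_l _ _) Hx). assert (H1 := Rle_trans _ _ _ (Rmax_r _ _) Hx).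
eapply Rle_trans; [|apply (exp_term_le (e * x) (S m)); nra]. fold F.
apply Rmult_le_reg_r with F; [exact HF|]. replace ((e * x) ^ S m / F * F) with ((e * x) ^ S m) by (field; lra).
rewrite Rpow_mult_distr. simpl (x ^ S m).
assert (H2 : Rabs c * F <= e ^ S m * x).
{ apply Rmult_le_reg_r with (/ e ^ S m); [pos|]. replace (e ^ S m * x * / e ^ S m) with x by (field; apply pow_nonzero; lra). exact H1. }
assert (0 <= x ^ m) by pos. pose proof (Rle_abs c).
apply Rle_trans with (x ^ m * (Rabs c * F)).
{ replace (c * x ^ m * F) with (x ^ m * (c * F)) by ring. apply Rmult_le_compat_l; [exact H|apply Rmult_le_compat_r; lra]. }
apply Rle_trans with (x ^ m * (e ^ S m * x)); [apply Rmult_le_compat_l; assumption|]. right. ring.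
Qed.

Lemma pow_exp_ln r K : 0 < r -> r ^ K = exp (INR K * ln r).
Proof. intros Hr. rewrite <- (exp_ln r Hr) at 1. rewrite <- exp_nat_pow. reflexivity. Qed.

(** With [K = D T], this and the next two lemmas compare the Chernoff factors [(D/(D - s))^K] and
    [(D/(D + s))^K] with [e^(Ts)] and [e^(-Ts)]; thus [e^T] is the cutoff point of [vK D K]. *)
Lemma ratio_up D T s K : INR K = D * T -> 0 < T -> 0 <= s -> 2 * s <= D -> 0 < D -> (D / (D - s)) ^ K <= exp (T * s + 2 * T * s ^ 2 / D).
Proof.
intros HK HT Hs HD HD0. assert (0 < D / (D - s)) by pos.
rewrite pow_exp_ln by assumption. apply exp_le_compat. rewrite HK.
assert (Hl : ln (D / (D - s)) <= s / (D - s)).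
{ eapply Rle_trans; [apply ln_le_minus_1; assumption|]. right. field. lra. }
apply Rle_trans with (D * T * (s / (D - s))); [apply Rmult_le_compat_l; [nra|exact Hl]|].
assert (E : D * T * (s / (D - s)) = T * s + T * s ^ 2 / (D - s)) by (field; lra). rewrite E.
apply Rplus_le_compat_l. unfold Rdiv. rewrite (Rmult_comm 2 T), !Rmult_assoc. apply Rmult_le_compat_l; [lra|].
replace (2 * (s ^ 2 * / D)) with (s ^ 2 * (2 * / D)) by ring. apply Rmult_le_compat_l; [apply pow2_ge_0|].
replace (2 * / D) with (/ (D / 2)) by (field; lra). apply Rinv_le_contravar; lra.
Qed.

Lemma ratio_low D T s K : INR K = D * T -> 0 < T -> 0 <= s < D -> exp (T * s) <= (D / (D - s)) ^ K.
Proof.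
intros HK HT Hs. assert (0 < D / (D - s)) by pos.
rewrite pow_exp_ln by assumption. apply exp_le_compat. rewrite HK.
assert (Hl : s / D <= ln (D / (D - s))).
{ replace (D / (D - s)) with (/ ((D - s) / D)) by (field; lra). rewrite ln_Rinv by pos.
  assert (ln ((D - s) / D) <= (D - s) / D - 1) by (apply ln_le_minus_1, Rdiv_lt_0_compat; lra).
  assert ((D - s) / D - 1 = - (s / D)) by (field; lra). lra. }
apply Rle_trans with (D * T * (s / D)); [right; field; lra|]. apply Rmult_le_compat_l; [nra|exact Hl].
Qed.

Lemma ratio_down D T s K : INR K = D * T -> 0 < T -> 0 <= s -> 0 < D -> (D / (D + s)) ^ K <= exp (- (T * s) + T * s ^ 2 / D).
Proof.
intros HK HT Hs HD0. assert (0 < D / (D + s)) by pos.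
rewrite pow_exp_ln by assumption. apply exp_le_compat. rewrite HK.
assert (Hl : ln (D / (D + s)) <= - (s / (D + s))).
{ eapply Rle_trans; [apply ln_le_minus_1; assumption|]. right. field. lra. }
apply Rle_trans with (D * T * - (s / (D + s))); [apply Rmult_le_compat_l; [nra|exact Hl]|].
assert (E : D * T * - (s / (D + s)) = - (T * s) + T * s ^ 2 / (D + s)) by (field; lra). rewrite E.
apply Rplus_le_compat_l. unfold Rdiv. apply Rmult_le_compat_l; [pose proof (pow2_ge_0 s); nra|]. apply Rinv_le_contravar; lra.
Qed.

Lemma vK_tail D K s N M : 3 <= s < D -> (1 <= N <= M)%nat ->
  S1 (fun n => lg n * vK D K n) M - S1 (fun n => lg n * vK D K n) N <= (D / (D - s)) ^ K * pw N (s - 2).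
Proof.
intros Hs HN. set (r := (D / (D - s)) ^ K).
assert (Hr : 0 < r) by pos.
set (f := fun n => / r * (lg n * vK D K n)).
assert (B := S1_tail f (s - 2) N M ltac:(lra) HN).
assert (B' : Rabs (S1 f M - S1 f N) <= / (s - 2) * pw N (s - 2)).
{ apply B. intros n Hn. unfold f. rewrite Rabs_pos_eq.
  - apply Rmult_le_reg_l with r; [exact Hr|]. rewrite <- Rmult_assoc, Rinv_r, Rmult_1_l by lra.
    assert (L := ln_le_pw n 1 ltac:(lra)). rewrite Rinv_1, Rmult_1_l in L.
    assert (V := vK_upper D K n s ltac:(lra)). fold r in V.
    apply Rle_trans with (pw n (-1) * (r * pw n s)).
    + apply Rmult_le_compat; [apply ln_INR_pos|apply vK_pos; lra|exact L|exact V].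
    + right. replace (1 + (s - 2)) with (-1 + s) by ring. rewrite pw_plus. ring.
  - apply Rmult_le_pos; [pos|]. apply Rmult_le_pos; [apply ln_INR_pos|apply vK_pos; lra]. }
unfold f in B'. rewrite !S1_scal, <- Rmult_minus_distr_l in B'. clear B. set (X := S1 _ M - S1 _ N) in B' |- *.
assert (Y : / r * X <= 1 * pw N (s - 2)).
{ eapply Rle_trans; [apply Rle_abs|]. eapply Rle_trans; [exact B'|]. apply Rmult_le_compat_r; [pos|].
  rewrite <- Rinv_1. apply Rinv_le_contravar; lra. }
apply (Rmult_le_compat_l r) in Y; [|lra]. rewrite <- Rmult_assoc, Rinv_r, !Rmult_1_l in Y by lra. exact Y.
Qed.

(** In the variable [log n] the weight [vK D K] drops over a width of about [sqrt (T/D)], of order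
    [L^(-3/2)] for [D] of order [L^4], while the factor [K^2] in the error costs only a power of
    [L]. [K] is an integer near [L^5], and [D] is then [K/T] exactly. *)
Lemma smoothing_params L T : 10 <= L -> L / 2 <= T <= 2 * L ->
  exists (K : nat) (D : R), INR K = D * T /\ (L ^ 4 / 2 <= D <= 4 * L ^ 4 /\ 500 * L <= D) /\ INR K <= 2 * L ^ 5.
Proof.
intros HL HT. assert (H5 : 1 <= L ^ 5) by (apply pow_R1_Rle; lra).
assert (H3 : 1000 <= L ^ 3) by (replace 1000 with (10 ^ 3) by ring; apply pow_incr; lra).
destruct (nfloor_ex (L ^ 5)) as [n [Hn1 Hn2]]; [lra|].
exists (S n), (INR (S n) / T). rewrite S_INR. set (k := INR n + 1) in *.
split; [field; lra|]. split; [|unfold k; lra].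
assert (Hk : L ^ 5 < k <= 2 * L ^ 5) by (split; [exact Hn2|unfold k; lra]).
assert (HD : L ^ 4 / 2 <= k / T <= 4 * L ^ 4).
{ split; apply Rmult_le_reg_r with T; try lra; replace (k / T * T) with k by (field; lra); nra. }
split; [exact HD|]. nra.
Qed.

(** [24 = 2 * 4 * 3]: here [K^2 <= 4 L^10], and [3] bounds the factor [e] lost in comparing the
    power with [e^(T/2)]. *)
Lemma smoothing_error L T D K A : 10 <= L -> L / 2 <= T <= 2 * L -> INR K = D * T -> 500 * L <= D -> INR K <= 2 * L ^ 5 -> 0 <= A ->
  2 * A * INR K ^ 2 * (D / (D - 1 / 2)) ^ K <= 24 * A * L ^ 10 * exp (T / 2).
Proof.
intros HL HT HK HD HK2 HA.
assert (R := ratio_up D T (1 / 2) K HK ltac:(lra) ltac:(lra) ltac:(lra) ltac:(lra)).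
assert (B : 2 * T * (1 / 2) ^ 2 / D <= 1).
{ apply Rle_div_l; lra. }
assert (R2 : (D / (D - 1 / 2)) ^ K <= 3 * exp (T / 2)).
{ eapply Rle_trans; [exact R|]. apply Rle_trans with (exp (1 + T / 2)); [apply exp_le_compat; lra|].
  rewrite exp_plus. apply Rmult_le_compat_r; [pos|apply exp_le_3]. }
assert (K2 : INR K ^ 2 <= 4 * L ^ 10).
{ replace (4 * L ^ 10) with ((2 * L ^ 5) ^ 2) by ring. apply pow_incr. split; [apply pos_INR|exact HK2]. }
replace (24 * A * L ^ 10 * exp (T / 2)) with ((2 * A * (4 * L ^ 10)) * (3 * exp (T / 2))) by ring.
apply Rmult_le_compat; [pose proof (pow2_ge_0 (INR K)); nra|pos| |exact R2].
apply Rmult_le_compat_l; lra.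
Qed.

(** The logarithm is simply bounded by its argument, at most [336 * 64 L^12]; times [24 L^10] this
    stays below [600000 L^22]. *)
Lemma zeta_smoothing_error L T D K : 10 <= L -> L / 2 <= T <= 2 * L -> INR K = D * T -> L ^ 4 / 2 <= D <= 4 * L ^ 4 /\ 500 * L <= D -> INR K <= 2 * L ^ 5 ->
  2 * ln (336 * D ^ 3) * INR K ^ 2 * (D / (D - 1 / 2)) ^ K <= 600000 * L ^ 22 * exp (T / 2).
Proof.
intros HL HT HK [HD HD5] HK2. assert (D1 : 1 <= D ^ 3) by (apply pow_R1_Rle; lra).
assert (D3 : D ^ 3 <= 64 * L ^ 12) by (replace (64 * L ^ 12) with ((4 * L ^ 4) ^ 3) by ring; apply pow_incr; lra).
assert (L0 : 0 <= ln (336 * D ^ 3)) by (rewrite <- ln_1; apply ln_le; lra).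
assert (L1 : ln (336 * D ^ 3) <= 336 * D ^ 3 - 1) by (apply ln_le_minus_1; lra).
eapply Rle_trans; [apply (smoothing_error L T D K _ HL HT HK HD5 HK2 L0)|]. apply Rmult_le_compat_r; [pos|].
replace (600000 * L ^ 22) with (600000 * L ^ 12 * L ^ 10) by ring. apply Rmult_le_compat_r; [pos|].
lra.
Qed.

Definition theta (N : nat) : R := S1 (fun n => pr n * lg n) N.

(** [s = 3 L/d] is the Chernoff exponent: a displacement [d] of the cutoff gains
    [e^(-sd) = e^(-3L)], which beats trivial bounds for sums of length [e^L]. The second order error
    [2 T s^2 / D] stays below [1] because [72/d^2 <= L]. *)
Lemma psi_smoothing L T d : GRH -> 0 < d <= 1 / 4 -> 10 <= L -> 72 / d ^ 2 <= L -> L - d <= T <= L + d ->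
  exists (K : nat) (D s l : R), 5000 <= D /\ INR K = D * T /\ 3 <= s /\ s * d = 3 * L /\ 2 * s <= D /\ 2 * T * s ^ 2 <= D /\ 2 * T <= d * D /\
    is_lim_seq (S1 (fun n => vonM n * vK D K n)) l /\ Rabs (l - ((D / (D - 1)) ^ K - 1)) <= 600000 * L ^ 22 * exp (T / 2).
Proof.
intros HG Hd HL HL2 HT. assert (Hd2 : 0 < d ^ 2) by pos.
assert (HLd : 72 <= L * d ^ 2).
{ apply Rle_div_l in HL2; lra. }
destruct (smoothing_params L T HL ltac:(lra)) as (K & D & HK & HD & HK2).
set (s := 3 * L / d). assert (Hsd : s * d = 3 * L) by (unfold s; field; lra).
assert (Hs3 : 3 <= s) by nra. assert (HsD : 2 * T * s ^ 2 <= D).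
{ assert (X : 2 * T * s ^ 2 * d ^ 2 <= D * d ^ 2); [|nra].
  replace (2 * T * s ^ 2 * d ^ 2) with (2 * T * (s * d) ^ 2) by ring. rewrite Hsd.
  apply Rle_trans with (36 * L ^ 3); [assert (0 < L ^ 2) by pos; replace (L ^ 3) with (L * L ^ 2) by ring; nra|].
  apply Rle_trans with (L ^ 4 / 2 * d ^ 2); [replace (L ^ 4) with (L * L ^ 3) by ring; nra|apply Rmult_le_compat_r; lra]. } destruct (smooth_zeta D K HG ltac:(lra)) as (l & Hl & HE).
exists K, D, s, l. repeat (split; [first [assumption | lra | nra]|]). eapply Rle_trans; [exact HE|].
apply zeta_smoothing_error; try assumption; lra.
Qed.

(** With the cutoff at [e^(L-d)], just below [N], the terms beyond [N] weigh at most [1] in total.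
    [psi_upper] moves it to [e^(L+d)], where the weight is almost [1] up to [N]. *)
Lemma psi_lower N d : GRH -> 0 < d <= 1 / 4 -> let L := lg N in (1 <= N)%nat -> 10 <= L -> 72 / d ^ 2 <= L ->
  exp (L - d) - 2 - 600000 * L ^ 22 * exp (L / 2) <= S1 vonM N.
Proof.
intros HG Hd L HN HL HL2.
destruct (psi_smoothing L (L - d) d HG Hd HL HL2 ltac:(lra)) as (K & D & s & l & HD3 & HK & Hs3 & Hsd & HsD2 & HsD & _ & Hl & HE).
set (T := L - d) in *. assert (HT : 1 <= T) by (unfold T; lra).
assert (R := ratio_low D T 1 K HK ltac:(lra) ltac:(lra)). rewrite Rmult_1_r in R.
assert (R2 := ratio_up D T s K HK ltac:(lra) ltac:(lra) HsD2 ltac:(lra)).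
assert (TL : (D / (D - s)) ^ K * pw N (s - 2) <= 1).
{ apply Rle_trans with (exp (T * s + 1) * pw N (s - 2)).
  - apply Rmult_le_compat_r; [pos|]. eapply Rle_trans; [exact R2|]. apply exp_le_compat.
    assert (2 * T * s ^ 2 / D <= 1); [|lra]. apply Rle_div_l; [lra|]. lra.
  - unfold pw. rewrite <- exp_plus. apply Rle_trans with (exp 0); [|rewrite exp_0; lra]. apply exp_le_compat. fold L. unfold T.
    replace ((L - d) * s + 1 + - (s - 2) * L) with (2 * L + 1 - s * d) by ring. lra. }
assert (Hup : l <= S1 vonM N + 1).
{ apply (is_lim_seq_le_loc (S1 (fun n => vonM n * vK D K n)) (fun _ => S1 vonM N + 1) l (S1 vonM N + 1)); [|exact Hl|apply is_lim_seq_const].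
  exists N. intros M HM. assert (VT := vK_tail D K s N M ltac:(lra) ltac:(lia)).
  assert (A1 : S1 (fun n => vonM n * vK D K n) N <= S1 vonM N).
  { apply S1_le. intros n _. pose proof (vonM_ge0 n). pose proof (vK_le_1 D K n ltac:(lra)). nra. }
  assert (A2 : S1 (fun n => lg n * vK D K n - vonM n * vK D K n) N <= S1 (fun n => lg n * vK D K n - vonM n * vK D K n) M).
  { apply S1_mono; [exact HM|]. intros n _. pose proof (vonM_le_ln n). pose proof (vK_pos D K n ltac:(lra)). nra. }
  rewrite !S1_minus in A2. lra. }
apply Rabs_le_between in HE.
assert (600000 * L ^ 22 * exp (T / 2) <= 600000 * L ^ 22 * exp (L / 2)) by (apply Rmult_le_compat_l; [pos|apply exp_le_compat; unfold T; lra]).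
lra.
Qed.

Lemma psi_upper N d : GRH -> 0 < d <= 1 / 4 -> let L := lg N in (1 <= N)%nat -> 10 <= L -> 72 / d ^ 2 <= L ->
  S1 vonM N <= exp (L + 2 * d) + 1 + 1200000 * L ^ 22 * exp (L / 2).
Proof.
intros HG Hd L HN HL HL2.
destruct (psi_smoothing L (L + d) d HG Hd HL HL2 ltac:(lra)) as (K & D & s & l & HD3 & HK & Hs3 & Hsd & _ & HsD & HTd & Hl & HE).
set (T := L + d) in *. assert (HT : 1 <= T) by (unfold T; lra).
assert (R := ratio_up D T 1 K HK ltac:(lra) ltac:(lra) ltac:(lra) ltac:(lra)). rewrite Rmult_1_r in R.
assert (R' : (D / (D - 1)) ^ K <= exp (L + 2 * d)).
{ eapply Rle_trans; [exact R|]. apply exp_le_compat. assert (2 * T * 1 ^ 2 / D <= d); [|assert (T = L + d) by reflexivity; lra].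
  apply Rle_div_l; lra. }
assert (R2 := ratio_down D T s K HK ltac:(lra) ltac:(lra) ltac:(lra)).
assert (HNL : INR N = exp L) by (unfold L; rewrite exp_ln; [reflexivity|pos]).
assert (Hup : S1 vonM N <= l + 1).
{ assert (A0 : S1 (fun n => vonM n * vK D K n) N <= l).
  { apply (is_lim_seq_le_loc (fun _ => S1 (fun n => vonM n * vK D K n) N) (S1 (fun n => vonM n * vK D K n)) (S1 (fun n => vonM n * vK D K n) N) l); [|apply is_lim_seq_const|exact Hl].
    exists N. intros M HM. apply S1_mono; [exact HM|]. intros n _. apply Rmult_le_pos; [apply vonM_ge0|apply vK_pos; lra]. }
  assert (A1 : S1 (fun n => vonM n * (1 - vK D K n)) N <= INR N * (exp L * (exp (- (T * s) + 1) * exp (s * L)))).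
  { rewrite <- S1_const. apply S1_le. intros n Hn.
    assert (Hln : lg n <= L) by (apply ln_le; [pos|apply le_INR; lia]).
    apply Rmult_le_compat; [apply vonM_ge0|pose proof (vK_le_1 D K n ltac:(lra)); lra| |].
    - eapply Rle_trans; [apply vonM_le_ln|]. eapply Rle_trans; [exact Hln|]. pose proof (exp_ineq1_le L). lra.
    - eapply Rle_trans; [apply (vK_lower D K n s); lra|]. apply Rmult_le_compat; [pos|pos| |].
      + eapply Rle_trans; [exact R2|]. apply exp_le_compat. assert (T * s ^ 2 / D <= 1); [|lra].
        apply Rle_div_l; [lra|]. nra.
      + unfold pw. apply exp_le_compat. nra. }
  assert (A2 : INR N * (exp L * (exp (- (T * s) + 1) * exp (s * L))) <= 1).
  { rewrite HNL, <- !exp_plus. apply Rle_trans with (exp 0); [|rewrite exp_0; lra]. apply exp_le_compat. unfold T.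
    replace (L + (L + (- ((L + d) * s) + 1 + s * L))) with (2 * L + 1 - s * d) by ring. lra. }
  rewrite (S1_ext _ (fun n => vonM n - vonM n * vK D K n)), S1_minus in A1 by (intros; ring). lra. }
apply Rabs_le_between in HE.
assert (He2 : exp (T / 2) <= 2 * exp (L / 2)).
{ unfold T. replace ((L + d) / 2) with (d / 2 + L / 2) by field. rewrite exp_plus. apply Rmult_le_compat_r; [pos|].
  assert (X := exp_ineq1_le (- (d / 2))). rewrite exp_Ropp in X. pose proof (exp_pos (d / 2)).
  apply (Rmult_le_compat_r (exp (d / 2))) in X; [|lra]. rewrite Rinv_l in X by lra. nra. }
assert (600000 * L ^ 22 * exp (T / 2) <= 600000 * L ^ 22 * (2 * exp (L / 2))) by (apply Rmult_le_compat_l; [pos|exact He2]).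
lra.
Qed.

Lemma ev_nat P : ev P -> exists N0, (1 <= N0)%nat /\ forall N, (N0 <= N)%nat -> P (lg N).
Proof.
intros [M HM]. destruct (nfloor_ex (exp M)) as [n [_ Hn]]; [pos|].
exists (S n). split; [lia|]. intros N HN. apply HM. rewrite <- (ln_exp M). apply ln_le; [apply exp_pos|].
apply le_INR in HN. rewrite S_INR in HN. lra.
Qed.

Theorem prime_number_theorem delta : GRH -> 0 < delta <= 1 -> exists N0, forall N, (N0 <= N)%nat ->
  (1 - delta) * INR N <= theta N <= (1 + delta) * INR N.
Proof.
intros HG Hd0. set (d := delta / 8). assert (Hd : 0 < d <= 1 / 8) by (unfold d; lra).
destruct (prime_powers_bounded (3 / 4) ltac:(lra)) as (C & HC & HCN).
destruct (ev_nat _ (ev_and _ _ (ev_and _ _ (ev_ge 10) (ev_ge (72 / d ^ 2))) (ev_and _ _ (ev_poly (1200000 / d) 22 (1 / 2) ltac:(lra)) (ev_and _ _ (ev_poly (2 / d) 0 1 ltac:(lra)) (ev_poly (C / d) 0 (1 / 4) ltac:(lra)))))) as (N0 & HN0 & H).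
exists N0. intros N HN. destruct (H N HN) as [[E1 E2] [E3 [E4 E5]]].
set (L := lg N) in *. assert (HNL : INR N = exp L) by (unfold L; rewrite exp_ln; [reflexivity|pos]).
assert (Psi : S1 powLam N <= C * exp (3 / 4 * L)).
{ apply Rle_trans with (exp (3 / 4 * L) * S1 (fun n => powLam n * pw n (3 / 4)) N).
  - rewrite <- S1_scal. apply S1_le. intros n Hn. rewrite (Rmult_comm (powLam n)), <- Rmult_assoc.
    assert (1 <= exp (3 / 4 * L) * pw n (3 / 4)).
    { unfold pw. rewrite <- exp_plus, <- exp_0. apply exp_le_compat.
      assert (lg n <= L) by (apply ln_le; [pos|apply le_INR; lia]). lra. }
    pose proof (powLam_nonneg n). nra.
  - rewrite Rmult_comm. apply Rmult_le_compat_r; [pos|apply HCN]. }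
assert (Eth : theta N = S1 vonM N - S1 powLam N) by (unfold theta; rewrite <- S1_minus; apply S1_ext; intros; unfold powLam; ring).
assert (Hp0 : 0 <= S1 powLam N) by (apply S1_pos; intros; apply powLam_nonneg).
assert (F3 : 1200000 * L ^ 22 * exp (L / 2) <= d * exp L).
{ replace L with (1 / 2 * L + L / 2) at 3 by field. rewrite exp_plus, <- Rmult_assoc. apply Rmult_le_compat_r; [pos|].
  apply (Rmult_le_compat_l d) in E3; [|lra]. replace (d * (1200000 / d * L ^ 22)) with (1200000 * L ^ 22) in E3 by (field; lra). exact E3. }
assert (F4 : 2 <= d * exp L).
{ apply (Rmult_le_compat_l d) in E4; [|lra]. replace (d * (2 / d * L ^ 0)) with 2 in E4 by (simpl; field; lra). rewrite Rmult_1_l in E4. exact E4. }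
assert (F5 : C * exp (3 / 4 * L) <= d * exp L).
{ replace (exp L) with (exp (1 / 4 * L) * exp (3 / 4 * L)) by (rewrite <- exp_plus; f_equal; field). rewrite <- Rmult_assoc. apply Rmult_le_compat_r; [pos|].
  apply (Rmult_le_compat_l d) in E5; [|lra]. replace (d * (C / d * L ^ 0)) with C in E5 by (simpl; field; lra). exact E5. }
assert (L1 := psi_lower N d HG ltac:(lra) ltac:(lia) E1 E2). assert (U1 := psi_upper N d HG ltac:(lra) ltac:(lia) E1 E2).
cbv zeta in L1, U1. fold L in L1, U1.
pose proof (exp_pos L).
assert (G1 : (1 - d) * exp L <= exp (L - d)).
{ unfold Rminus. rewrite exp_plus, Rmult_comm. apply Rmult_le_compat_l; [lra|apply exp_ineq1_le]. }
assert (G2 : exp (L + 2 * d) <= (1 + 4 * d) * exp L).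
{ rewrite exp_plus, Rmult_comm. apply Rmult_le_compat_r; [lra|].
  assert (X := exp_ineq1_le (- (2 * d))). rewrite exp_Ropp in X. pose proof (exp_pos (2 * d)).
  apply (Rmult_le_compat_r (exp (2 * d))) in X; [|lra]. rewrite Rinv_l in X by lra. nra. }
rewrite HNL, Eth. replace delta with (8 * d) by (unfold d; field).
split; nra.
Qed.

(** * Averages over primes *)

Definition opr (n : nat) : R := if Nat.leb 3 n then pr n else 0.
Definition leg (p q : nat) : R := IZR (legendre p q).

Lemma opr_cases n : (opr n = 1 /\ odd_prime n) \/ (opr n = 0 /\ ~ odd_prime n).
Proof.
unfold opr, pr, odd_prime. destruct (Nat.leb_spec 3 n); [|right; split; [reflexivity|lia]].
destruct (prime_dec (Z.of_nat n)); [left; split; [reflexivity|split; [assumption|lia]]|right; tauto].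
Qed.

Lemma leg_abs p q : Rabs (leg p q) <= 1.
Proof. unfold leg. destruct (leg_values p q) as [-> | [-> | ->]]; [rewrite Rabs_left|rewrite Rabs_R0|rewrite Rabs_R1]; lra. Qed.

Lemma psi_cons q I p : List.Forall odd_prime (q :: I) -> odd_prime p -> IZR (psi (q :: I) p) = leg p q * IZR (psi I p).
Proof.
intros HI Hp. inversion HI; subst. rewrite !psi_prime by assumption. simpl. unfold leg. rewrite <- mult_IZR. reflexivity.
Qed.

Definition evN (P : nat -> Prop) : Prop := exists N0, forall N, (N0 <= N)%nat -> P N.

Lemma evN_and P Q : evN P -> evN Q -> evN (fun N => P N /\ Q N).
Proof. intros [M HM] [N HN]. exists (M + N)%nat. intros n Hn. split; [apply HM|apply HN]; lia. Qed.

Lemma evN_imp (P Q : nat -> Prop) : (forall N, P N -> Q N) -> evN P -> evN Q.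
Proof. intros H [M HM]. exists M. auto. Qed.

Lemma evN_all (P : nat -> nat -> Prop) Z : (forall q, (q <= Z)%nat -> evN (P q)) -> evN (fun N => forall q, (q <= Z)%nat -> P q N).
Proof.
induction Z as [|Z IH]; intros H.
- eapply evN_imp; [|apply (H 0%nat); lia]. intros N HN q Hq. replace q with 0%nat by lia. exact HN.
- eapply evN_imp; [|apply evN_and; [apply IH; intros; apply H; lia|apply (H (S Z)); lia]].
  intros N [H1 H2] q Hq. destruct (Nat.eq_dec q (S Z)) as [-> | Ne]; [exact H2|apply H1; lia].
Qed.

(** * Primes with prescribed residue symbols *)

Section Selection.
Variables (v : nat -> R) (E : R) (Z m : nat) (eps : nat -> R).
Hypothesis Hv : forall n, 0 <= v n <= 1.
Hypothesis HE0 : 0 <= E.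
Hypothesis Heps : forall q, eps q = 1 \/ eps q = -1.
(** Up to [m + 2] primes occur because the second moment joins two further primes to a subset of
    [Q]. The threshold in [N] may depend on [I], as finitely many [I] are combined. *)
Hypothesis HE : forall I, NoDup I -> List.Forall odd_prime I -> (forall q, In q I -> (q <= Z)%nat) -> (length I <= m + 2)%nat -> I <> nil ->
  evN (fun N => Rabs (S1 (fun n => opr n * lg n * v n * IZR (psi I n)) N) <= E).

(** At a prime [p] outside [Q] this is [2^|Q|] if all symbols are as prescribed, and [0]
    otherwise. *)
Definition prodQ (Q : list nat) (p : nat) : R := fold_right (fun q z => (1 + eps q * leg p q) * z) 1 Q.
Definition g (n : nat) : R := opr n * lg n * v n.

Lemma g_nonneg n : 0 <= g n.
Proof.
unfold g. apply Rmult_le_pos; [|apply Hv]. apply Rmult_le_pos; [|apply ln_INR_pos].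
destruct (opr_cases n) as [[-> _]|[-> _]]; lra.
Qed.

Lemma prodQ_bounds Q p : 0 <= prodQ Q p <= 2 ^ length Q.
Proof.
induction Q as [|q Q IH]; simpl; [lra|]. fold (prodQ Q p). pose proof (leg_abs p q) as L. apply Rabs_le_between in L.
assert (0 <= 1 + eps q * leg p q <= 2) by (destruct (Heps q) as [-> | ->]; lra).
split; [pos|apply Rmult_le_compat; lra].
Qed.

(** One factor is expanded at a time: [q] is either omitted or joined to [I0]. Since [I0] is
    nonempty, each of the [2^|Q|] terms is a sum of a nonprincipal character. *)
Lemma average_twisted Q : forall I0, NoDup (Q ++ I0) -> List.Forall odd_prime (Q ++ I0) -> (forall q, In q (Q ++ I0) -> (q <= Z)%nat) ->
  (length Q + length I0 <= m + 2)%nat -> I0 <> nil ->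
  evN (fun N => Rabs (S1 (fun n => g n * prodQ Q n * IZR (psi I0 n)) N) <= 2 ^ length Q * E).
Proof.
induction Q as [|q Q IH]; intros I0 ND HF HZ HL NE.
- eapply evN_imp; [|exact (HE I0 ND HF HZ HL NE)]. intros N HN. simpl. rewrite Rmult_1_l.
  erewrite S1_ext; [exact HN|]. intros n _. unfold g. simpl. ring.
- simpl in ND, HF, HZ, HL. inversion ND as [|? ? N1 N2]; subst. inversion HF as [|? ? F1 F2]; subst.
  assert (X1 := IH I0 N2 F2 ltac:(intros; apply HZ; simpl; auto) ltac:(lia) NE).
  assert (Hin : forall z, In z (Q ++ q :: I0) <-> In z (q :: Q ++ I0)) by (intros z; rewrite !in_app_iff; simpl; rewrite in_app_iff; tauto).
  assert (X2 : evN (fun N => Rabs (S1 (fun n => g n * prodQ Q n * IZR (psi (q :: I0) n)) N) <= 2 ^ length Q * E)).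
  { apply IH.
    - apply (Permutation_NoDup (l := q :: Q ++ I0)); [apply Permutation_middle|exact ND].
    - apply Forall_forall. intros z Hz. apply Hin in Hz. rewrite Forall_forall in HF. apply HF, Hz.
    - intros z Hz. apply Hin in Hz. apply HZ, Hz.
    - simpl. lia.
    - discriminate. }
  eapply evN_imp; [|exact (evN_and _ _ X1 X2)]. intros N [Y1 Y2].
  rewrite (S1_ext _ (fun n => g n * prodQ Q n * IZR (psi I0 n) + eps q * (g n * prodQ Q n * IZR (psi (q :: I0) n)))).
  + rewrite S1_plus, S1_scal. eapply Rle_trans; [apply Rabs_triang|]. rewrite Rabs_mult.
    assert (Rabs (eps q) = 1) by (destruct (Heps q) as [-> | ->]; [apply Rabs_R1|rewrite Rabs_left; lra]).
    rewrite H. simpl pow. lra.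
  + intros n _. destruct (opr_cases n) as [[_ O]|[O _]].
    * rewrite psi_cons; [simpl; ring| |exact O]. constructor; [exact F1|]. apply Forall_app in F2. apply F2.
    * unfold g. rewrite O. ring.
Qed.

Lemma average_main Q : NoDup Q -> List.Forall odd_prime Q -> (forall q, In q Q -> (q <= Z)%nat) -> (length Q <= m)%nat ->
  evN (fun N => Rabs (S1 (fun n => g n * prodQ Q n) N - S1 g N) <= 2 ^ length Q * E).
Proof.
(* The induction counts the nonempty subsets of [Q]; the empty one is the main term. *)
intros ND HF HZ HL. enough (X : evN (fun N => Rabs (S1 (fun n => g n * prodQ Q n) N - S1 g N) <= (2 ^ length Q - 1) * E)).
{ eapply evN_imp; [|exact X]. intros N HN. simpl in HN. lra. }
induction Q as [|q Q IH].
- exists 0%nat. intros N _. simpl. rewrite (S1_ext _ g) by (intros; ring). rewrite Rminus_diag, Rabs_R0. lra.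
- inversion ND as [|? ? N1 N2]; subst. inversion HF as [|? ? F1 F2]; subst. simpl in HL.
  assert (X1 := IH N2 F2 ltac:(intros; apply HZ; simpl; auto) ltac:(lia)).
  assert (X2 : evN (fun N => Rabs (S1 (fun n => g n * prodQ Q n * IZR (psi (q :: nil) n)) N) <= 2 ^ length Q * E)).
  { apply average_twisted.
    - apply (Permutation_NoDup (l := q :: Q)); [apply Permutation_cons_append|exact ND].
    - apply Forall_app. auto.
    - intros z Hz. apply in_app_iff in Hz. apply HZ. simpl in *. tauto.
    - simpl. lia.
    - discriminate. }
  eapply evN_imp; [|exact (evN_and _ _ X1 X2)]. intros N [Y1 Y2].
  rewrite (S1_ext _ (fun n => g n * prodQ Q n + eps q * (g n * prodQ Q n * IZR (psi (q :: nil) n)))).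
  + rewrite S1_plus, S1_scal. unfold Rminus. rewrite Rplus_assoc, (Rplus_comm (eps q * _)), <- Rplus_assoc.
    eapply Rle_trans; [apply Rabs_triang|]. rewrite Rabs_mult.
    assert (Rabs (eps q) = 1) by (destruct (Heps q) as [-> | ->]; [apply Rabs_R1|rewrite Rabs_left; lra]).
    rewrite H. unfold Rminus in Y1. simpl pow. lra.
  + intros n _. destruct (opr_cases n) as [[_ O]|[O _]].
    * rewrite psi_cons; [simpl; ring|constructor; auto|exact O].
    * unfold g. rewrite O. ring.
Qed.

(** The diagonal contributes [sum a_q^2] times the mass. For distinct [q], [q'] outside [Q] the two
    symbols make every subset of [Q] nonempty, so only errors remain. *)
Lemma second_moment Q a : NoDup Q -> List.Forall odd_prime Q -> (forall q, In q Q -> (q <= Z)%nat) -> (length Q <= m)%nat ->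
  (forall q, Rabs (a q) <= 1) -> (forall q, a q <> 0 -> odd_prime q /\ ~ In q Q) ->
  evN (fun N => S1 (fun n => g n * prodQ Q n * S1 (fun q => a q * leg n q) Z ^ 2) N <=
    S1 (fun q => a q ^ 2) Z * S1 (fun n => g n * prodQ Q n) N + INR Z ^ 2 * (2 ^ length Q * E)).
Proof.
intros ND HF HZ HL Ha Ha2. set (P := 2 ^ length Q * E).
assert (HP : 0 <= P) by (apply Rmult_le_pos; [pos|exact HE0]).
assert (X : evN (fun N => forall q, (q <= Z)%nat -> forall q', (q' <= Z)%nat ->
   S1 (fun n => g n * prodQ Q n * ((a q * leg n q) * (a q' * leg n q'))) N <=
   (if Nat.eqb q q' then a q ^ 2 * S1 (fun n => g n * prodQ Q n) N else 0) + P)).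
{ apply evN_all. intros q Hq. apply evN_all. intros q' Hq'. destruct (Nat.eqb_spec q q') as [<- | Ne].
  - exists 0%nat. intros N _. rewrite <- S1_scal.
    assert (S1 (fun n => g n * prodQ Q n * (a q * leg n q * (a q * leg n q))) N <= S1 (fun n => a q ^ 2 * (g n * prodQ Q n)) N); [|lra].
    apply S1_le. intros n _. pose proof (g_nonneg n). pose proof (prodQ_bounds Q n). pose proof (leg_abs n q) as L.
    assert (leg n q ^ 2 <= 1) by (rewrite <- pow2_abs; pose proof (Rabs_pos (leg n q)); simpl; nra).
    replace (g n * prodQ Q n * (a q * leg n q * (a q * leg n q))) with ((a q ^ 2 * (g n * prodQ Q n)) * leg n q ^ 2) by ring.
    assert (0 <= a q ^ 2 * (g n * prodQ Q n)) by (apply Rmult_le_pos; [apply pow2_ge_0|pos]). nra.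
  - destruct (Req_dec (a q) 0) as [Z1|Z1].
    { exists 0%nat. intros N _. rewrite (S1_ext _ (fun _ => 0)) by (intros; rewrite Z1; ring). rewrite S1_zero. lra. }
    destruct (Req_dec (a q') 0) as [Z2|Z2].
    { exists 0%nat. intros N _. rewrite (S1_ext _ (fun _ => 0)) by (intros; rewrite Z2; ring). rewrite S1_zero. lra. }
    destruct (Ha2 q Z1) as [O1 I1]. destruct (Ha2 q' Z2) as [O2 I2].
    assert (Y : evN (fun N => Rabs (S1 (fun n => g n * prodQ Q n * IZR (psi (q :: q' :: nil) n)) N) <= P)).
    { apply average_twisted.
      - apply (Permutation_NoDup (l := (q :: q' :: nil) ++ Q)); [apply Permutation_app_comm|].
        simpl. constructor; [simpl; intros [X|X]; [congruence|contradiction]|constructor; assumption].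
      - apply Forall_app. split; [exact HF|constructor; [exact O1|constructor; [exact O2|constructor]]].
      - intros z Hz. apply in_app_iff in Hz. destruct Hz as [Hz|[<- |[<- |[]]]]; [apply HZ, Hz|exact Hq|exact Hq'].
      - simpl. lia.
      - discriminate. }
    eapply evN_imp; [|exact Y]. intros N HN. rewrite Rplus_0_l.
    rewrite (S1_ext _ (fun n => (a q * a q') * (g n * prodQ Q n * IZR (psi (q :: q' :: nil) n)))).
    + rewrite S1_scal. eapply Rle_trans; [apply Rle_abs|]. rewrite !Rabs_mult.
      pose proof (Ha q). pose proof (Ha q'). pose proof (Rabs_pos (a q)). pose proof (Rabs_pos (S1 (fun n => g n * prodQ Q n * IZR (psi (q :: q' :: nil) n)) N)).
      assert (Rabs (a q) * Rabs (a q') <= 1) by nra. nra.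
    + intros n _. destruct (opr_cases n) as [[_ O]|[O _]].
      * rewrite psi_cons; [|constructor; [exact O1|constructor; [exact O2|constructor]]|exact O].
        rewrite psi_cons; [simpl; ring|constructor; [exact O2|constructor]|exact O].
      * unfold g. rewrite O. ring. }
eapply evN_imp; [|exact X]. intros N HN.
rewrite (S1_ext _ (fun n => S1 (fun q => S1 (fun q' => g n * prodQ Q n * ((a q * leg n q) * (a q' * leg n q'))) Z) Z)).
- rewrite S1_exchange.
  apply Rle_trans with (S1 (fun q => a q ^ 2 * S1 (fun n => g n * prodQ Q n) N + INR Z * P) Z).
  + apply S1_le. intros q Hq. rewrite S1_exchange.
    eapply Rle_trans; [apply S1_le; intros q' Hq'; apply HN; lia|]. rewrite S1_plus, S1_const. apply Rplus_le_compat_r.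
    rewrite (S1_single _ q); [rewrite Nat.eqb_refl; lra|lia|]. intros q' _ Nq. destruct (Nat.eqb_spec q q'); [congruence|reflexivity].
  + rewrite S1_plus, S1_const. right. f_equal; [|unfold P; ring].
    rewrite (S1_ext _ (fun q => S1 (fun n => g n * prodQ Q n) N * a q ^ 2)) by (intros; ring). rewrite S1_scal. ring.
- intros n _. replace (S1 (fun q => a q * leg n q) Z ^ 2) with (S1 (fun q => a q * leg n q) Z * S1 (fun q => a q * leg n q) Z) by ring.
  rewrite S1_mul, <- S1_scal. apply S1_ext. intros q _. rewrite <- S1_scal. reflexivity.
Qed.

Lemma prodQ_nonzero Q p : odd_prime p -> List.Forall odd_prime Q -> prodQ Q p <> 0 -> forall q, In q Q -> leg p q = eps q \/ q = p.
Proof.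
intros Hp HF H. induction HF as [|q0 Q F1 F2 IH]; intros q [].
- subst q0. simpl in H. unfold leg in *. destruct (leg_values p q) as [L|[L|L]]; rewrite L in *; destruct (Heps q) as [X|X]; rewrite X in *; auto.
  + exfalso. apply H. simpl. ring.
  + right. apply leg_zero in L; [|exact Hp]. destruct L as [w Hw]. destruct F1 as [F1 _]. destruct Hp as [Hp Hp2].
    destruct (prime_divisors _ F1 (Z.of_nat p)) as [D|[D|[D|D]]]; try lia. exists (Z.of_nat w). lia.
  + right. apply leg_zero in L; [|exact Hp]. destruct L as [w Hw]. destruct F1 as [F1 _]. destruct Hp as [Hp Hp2].
    destruct (prime_divisors _ F1 (Z.of_nat p)) as [D|[D|[D|D]]]; try lia. exists (Z.of_nat w). lia.
  + exfalso. apply H. simpl. ring.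
- apply IH; [|assumption]. intros X. apply H. simpl. fold (prodQ Q p). rewrite X. ring.
Qed.

Lemma filter_count (b : nat -> bool) (f : nat -> R) (B : R) X : (forall n, (1 <= n <= X)%nat -> b n = true -> f n <= B) ->
  S1 (fun n => if b n then f n else 0) X <= INR (length (filter b (seq 1 X))) * B.
Proof.
induction X as [|X IH]; intros H; [simpl; lra|]. rewrite S1_S, seq_S, filter_app, length_app, plus_INR, Rmult_plus_distr_r.
apply Rplus_le_compat; [apply IH; intros; apply H; [lia|assumption]|]. simpl (filter b _). replace (1 + X)%nat with (S X) by lia.
destruct (b (S X)) eqn:Eb; simpl; [|lra]. rewrite Rmult_1_l. apply H; [lia|exact Eb].
Qed.

(** As [sum a_q^2 <= 1/2], the second moment is at most half the mass up to errors; by Chebyshev the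
    other half sits on primes whose tail sum has square at most [1]. Each prime up to [X] weighs at
    most [2^|Q| log X], which turns mass into a count; [tau] bounds the mass of [g] beyond [X]. *)
Theorem selection Q a X M0 tau : NoDup Q -> List.Forall odd_prime Q -> (forall q, In q Q -> (q <= Z)%nat) -> (length Q <= m)%nat ->
  (forall q, Rabs (a q) <= 1) -> (forall q, a q <> 0 -> odd_prime q /\ ~ In q Q) -> S1 (fun q => a q ^ 2) Z <= 1 / 2 ->
  evN (fun N => M0 <= S1 g N) -> (forall N, (X <= N)%nat -> S1 g N - S1 g X <= tau) ->
  exists l, NoDup l /\ (forall p, In p l -> odd_prime p /\ (p <= X)%nat /\ (forall q, In q Q -> leg p q = eps q \/ q = p) /\ S1 (fun q => a q * leg p q) Z ^ 2 <= 1) /\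
    M0 / 2 <= 2 ^ length Q * (INR (length l) * lg X + (INR Z ^ 2 + 1) * E + tau).
Proof.
intros ND HF HZ HL Ha Ha2 Hal HM Htau.
set (W := fun n => g n * prodQ Q n). set (Tl := fun n => S1 (fun q => a q * leg n q) Z ^ 2).
assert (HW : forall n, 0 <= W n) by (intros n; apply Rmult_le_pos; [apply g_nonneg|apply prodQ_bounds]).
set (b := fun n => if Rlt_dec 0 (W n) then (if Rle_dec (Tl n) 1 then true else false) else false).
exists (filter b (seq 1 X)). split; [apply NoDup_filter, seq_NoDup|split].
- intros p Hp. apply filter_In in Hp. destruct Hp as [Hp1 Hp2]. apply in_seq in Hp1. unfold b in Hp2.
  destruct (Rlt_dec 0 (W p)) as [W0|]; [|discriminate]. destruct (Rle_dec (Tl p) 1) as [T1|]; [|discriminate].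
  assert (O : odd_prime p).
  { destruct (opr_cases p) as [[_ O]|[O _]]; [exact O|]. unfold W, g in W0. rewrite O in W0. lra. }
  split; [exact O|split; [lia|split; [|exact T1]]]. apply prodQ_nonzero; [exact O|exact HF|].
  intros Z0. unfold W in W0. rewrite Z0 in W0. lra.
- destruct (evN_and _ _ HM (evN_and _ _ (average_main Q ND HF HZ HL) (second_moment Q a ND HF HZ HL Ha Ha2))) as [N0 HN].
  destruct (HN (N0 + X)%nat ltac:(lia)) as [H1 [H2 H3]]. set (N := (N0 + X)%nat) in *.
  specialize (Htau N ltac:(unfold N; lia)). fold W in H2, H3. change (fun n => g n * prodQ Q n * S1 (fun q => a q * leg n q) Z ^ 2) with (fun n => W n * Tl n) in H3.
  set (P := 2 ^ length Q) in *. assert (HP : 1 <= P) by (apply pow_R1_Rle; lra).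
  assert (Hcnt : S1 (fun n => if b n then W n else 0) X <= INR (length (filter b (seq 1 X))) * (lg X * P)).
  { apply filter_count. intros n Hn _. unfold W, g. apply Rmult_le_compat; [apply g_nonneg|apply prodQ_bounds| |apply prodQ_bounds].
    assert (lg n <= lg X) by (apply ln_le; [pos|apply le_INR; lia]).
    pose proof (ln_INR_pos n). pose proof (Hv n). destruct (opr_cases n) as [[-> _]|[-> _]]; [rewrite Rmult_1_l|rewrite !Rmult_0_l; lra]. nra. }
  (* Where [b] fails although [W n > 0], the factor [Tl n] exceeds [1]. *)
  assert (Hsplit : S1 W X <= S1 (fun n => if b n then W n else 0) X + S1 (fun n => W n * Tl n) X).
  { rewrite <- S1_plus. apply S1_le. intros n _. assert (0 <= Tl n) by (unfold Tl; apply pow2_ge_0). pose proof (HW n). unfold b.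
    destruct (Rlt_dec 0 (W n)) as [W0|W0]; [destruct (Rle_dec (Tl n) 1)|]; nra. }
  assert (Hmono : S1 (fun n => W n * Tl n) X <= S1 (fun n => W n * Tl n) N).
  { apply S1_mono; [unfold N; lia|]. intros n _. apply Rmult_le_pos; [apply HW|unfold Tl; apply pow2_ge_0]. }
  assert (Htl : S1 W N - S1 W X <= P * tau).
  { assert (0 <= S1 (fun n => P * g n - W n) N - S1 (fun n => P * g n - W n) X).
    { assert (S1 (fun n => P * g n - W n) X <= S1 (fun n => P * g n - W n) N); [|lra].
      apply S1_mono; [unfold N; lia|]. intros n _. unfold W. pose proof (g_nonneg n). pose proof (prodQ_bounds Q n). fold P in H0. nra. }
    rewrite !S1_minus, !S1_scal in H. nra. }
  apply Rabs_le_between in H2.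
  assert (HWN : 0 <= S1 W N) by (apply S1_pos; auto).
  assert (S1 (fun q => a q ^ 2) Z * S1 W N <= 1 / 2 * S1 W N) by (apply Rmult_le_compat_r; assumption).
  set (cnt := INR (length (filter b (seq 1 X)))) in *.
  replace (P * (cnt * lg X + (INR Z ^ 2 + 1) * E + tau)) with (cnt * (lg X * P) + INR Z ^ 2 * (P * E) + P * E + P * tau) by ring.
  lra.
Qed.

End Selection.

(** * Sums of p^(-sigma) cos^2 (t log p) *)

(** The ratio of [beta] to [beta_sigma] for [a = 1 - sigma]; see [beta_kap]. *)
Definition kap (a t : R) : R := if Req_EM_T t 0 then 1 else t ^ 2 / (a ^ 2 + 4 * t ^ 2).

Section PrimeSum.
Variables (sigma t : R).
Hypothesis Hsig : 1 / 2 < sigma < 1.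

Let a := 1 - sigma.
Let D := sigma + 2 * Rabs t.
Definition hcos (x : R) : R := exp (- sigma * x) * cos (t * x) ^ 2.
(** Primitive of [e^(a x) cos^2 (t x)], that is of [hcos] integrated with respect to [u = e^x],
    where [a = 1 - sigma]. *)
Definition Hcos (x : R) : R := exp (a * x) * (/ (2 * a) + (a * cos (2 * t * x) + 2 * t * sin (2 * t * x)) / (2 * (a ^ 2 + 4 * t ^ 2))).

Lemma quad_pos : 0 < a ^ 2 + 4 * t ^ 2.
Proof. assert (0 < a ^ 2) by (apply pow_lt; unfold a; lra). pose proof (pow2_ge_0 t). lra. Qed.

Lemma cos_sq u : cos u ^ 2 = (1 + cos (2 * u)) / 2.
Proof. rewrite cos_2a_cos. field. Qed.

Lemma Hcos_derive x : is_derive Hcos x (exp (a * x) * cos (t * x) ^ 2).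
Proof.
pose proof quad_pos as Q. assert (Ha : 0 < a) by (unfold a; lra).
unfold Hcos. auto_derive; [exact I|]. rewrite cos_sq. replace (2 * (t * x)) with (2 * t * x) by ring. field. split; lra.
Qed.

Lemma hcos_bounds x : 0 <= hcos x <= exp (- sigma * x).
Proof.
unfold hcos. pose proof (exp_pos (- sigma * x)). assert (cos (t * x) ^ 2 <= 1) by (rewrite <- pow2_abs; pose proof (Rabs_cos_le (t * x)); pose proof (Rabs_pos (cos (t * x))); simpl; nra). nra.
Qed.

Lemma hcos_variation n y : (1 <= n)%nat -> lg n <= y <= lg (S n) -> Rabs (hcos (lg n) - hcos y) <= D * pw n (1 + sigma).
Proof.
intros Hn Hy. pose proof (Rabs_pos t).
apply (variation_bound hcos (fun x => - sigma * (exp (- sigma * x) * cos (t * x) ^ 2) - exp (- sigma * x) * (2 * t * (sin (t * x) * cos (t * x)))) sigma D n Hn); [lra|unfold D; lra| | |exact Hy].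
- intros x. unfold hcos. auto_derive; [exact I|]. ring.
- intros x Hx. pose proof (exp_pos (- sigma * x)). pose proof (pow2_ge_0 (cos (t * x))).
  assert (C2 : cos (t * x) ^ 2 <= 1) by (rewrite <- pow2_abs; pose proof (Rabs_cos_le (t * x)); pose proof (Rabs_pos (cos (t * x))); simpl; nra).
  eapply Rle_trans; [unfold Rminus; apply Rabs_triang|]. rewrite Rabs_Ropp.
  assert (A1 : Rabs (- sigma * (exp (- sigma * x) * cos (t * x) ^ 2)) <= sigma * exp (- sigma * x)).
  { set (e := exp (- sigma * x)) in *. set (c := cos (t * x) ^ 2) in *. assert (0 <= e * c <= e) by (split; nra).
    rewrite Rabs_left1; nra. }
  assert (A2 : Rabs (exp (- sigma * x) * (2 * t * (sin (t * x) * cos (t * x)))) <= 2 * Rabs t * exp (- sigma * x)).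
  { rewrite !Rabs_mult, (Rabs_pos_eq (exp _)), (Rabs_pos_eq 2) by lra.
    pose proof (Rabs_cos_le (t * x)). pose proof (Rabs_sin_le (t * x)). pose proof (Rabs_pos (cos (t * x))). assert (Rabs (sin (t * x)) * Rabs (cos (t * x)) <= 1) by nra. assert (0 <= exp (- sigma * x) * (2 * Rabs t)) by nra. nra. }
  unfold D. lra.
Qed.

Lemma kap_pos : 0 <= kap a t <= 1.
Proof.
unfold kap. pose proof quad_pos. destruct (Req_EM_T t 0); [lra|]. pose proof (pow2_ge_0 a).
split; [pos|].
apply Rle_div_l; lra.
Qed.

Lemma Hcos_lower x : kap a t / a * exp (a * x) <= Hcos x.
Proof.
pose proof quad_pos as Q. assert (Ha : 0 < a) by (unfold a; lra). unfold Hcos, kap. rewrite (Rmult_comm _ (exp (a * x))).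
apply Rmult_le_compat_l; [pos|]. destruct (Req_EM_T t 0) as [-> | Ht].
- replace (2 * 0 * x) with 0 by ring. rewrite cos_0, sin_0. right. field. lra.
- set (C := cos (2 * t * x)). set (S := sin (2 * t * x)).
  assert (CS : C * C + S * S = 1) by (pose proof (sin2_cos2 (2 * t * x)) as X; unfold Rsqr in X; fold C S in X; lra).
  set (A := sqrt (a ^ 2 + 4 * t ^ 2)). assert (HA : A * A = a ^ 2 + 4 * t ^ 2) by (apply sqrt_sqrt; lra).
  assert (A0 : 0 < A) by (apply sqrt_lt_R0; lra).
  assert (B : - A <= a * C + 2 * t * S).
  { assert ((a * C + 2 * t * S) ^ 2 <= A ^ 2).
    { replace (A ^ 2) with ((a ^ 2 + 4 * t ^ 2) * (C * C + S * S)) by (rewrite CS; simpl; lra).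
      assert (0 <= (a * S - 2 * t * C) ^ 2) by apply pow2_ge_0. simpl in *. nra. }
    assert (Rabs (a * C + 2 * t * S) <= Rabs A) by (apply Rsqr_le_abs_0; unfold Rsqr; simpl in H; lra).
    rewrite (Rabs_pos_eq A) in H0 by lra. apply Rabs_le_between in H0. lra. }
  apply Rle_trans with (/ (2 * a) + - A / (2 * (a ^ 2 + 4 * t ^ 2))).
  (* With [A^2 = a^2 + 4 t^2], Cauchy-Schwarz leaves [1/(2a) - 1/(2A) = (A - a)/(2 a A)]. Since
     [A + a <= 2 A], this is at least [(A^2 - a^2)/(4 a A^2) = t^2/(a A^2)], the shape required by
     [beta]. *)
  + rewrite <- HA. replace (t ^ 2) with ((A * A - a * a) / 4) by (simpl in *; lra).
    apply Rmult_le_reg_r with (4 * a * (A * A)); [apply Rmult_lt_0_compat; [lra|nra]|].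
    replace ((A * A - a * a) / 4 / (A * A) / a * (4 * a * (A * A))) with (A * A - a * a) by (field; lra).
    replace ((/ (2 * a) + - A / (2 * (A * A))) * (4 * a * (A * A))) with (2 * (A * A) - 2 * a * A) by (field; lra). nra.
  + apply Rplus_le_compat_l. apply Rmult_le_compat_r; [pos|exact B].
Qed.

Lemma Hcos_0 : Hcos 0 <= / a.
Proof.
pose proof quad_pos as Q. assert (Ha : 0 < a) by (unfold a; lra). unfold Hcos. rewrite !Rmult_0_r, exp_0, cos_0, sin_0, Rmult_1_l, Rmult_1_r, Rmult_0_r, Rplus_0_r.
assert (a / (2 * (a ^ 2 + 4 * t ^ 2)) <= a / (2 * a ^ 2)).
{ apply Rmult_le_compat_l; [lra|]. assert (0 < a ^ 2) by pos. pose proof (pow2_ge_0 t). apply Rinv_le_contravar; lra. }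
replace (/ a) with (/ (2 * a) + a / (2 * a ^ 2)) by (field; lra). lra.
Qed.

Lemma ln_le_S n : (1 <= n)%nat -> lg n <= lg (S n).
Proof. intros Hn. apply ln_le; [pos|apply le_INR; lia]. Qed.

Lemma Hcos_step n : (1 <= n)%nat -> Hcos (lg (S n)) - Hcos (lg n) <= hcos (lg n) + (D + 1) * pw n (1 + sigma).
Proof.
intros Hn. pose proof (ln_le_S n Hn) as Hln.
assert (Hnp : 0 < INR n) by pos.
destruct (MVT_gen Hcos (lg n) (lg (S n)) (fun x => exp (a * x) * cos (t * x) ^ 2)) as (xi & Hxi & Exi).
- intros x _. apply Hcos_derive.
- intros x _. apply continuity_pt_filterlim. apply (continuous_is_derive Hcos x _ (Hcos_derive x)).
- rewrite Rmin_left, Rmax_right in Hxi by exact Hln. rewrite Exi.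
  assert (E : exp (a * xi) * cos (t * xi) ^ 2 = exp xi * hcos xi).
  { unfold hcos. rewrite <- Rmult_assoc, <- exp_plus. f_equal. f_equal. unfold a. ring. }
  rewrite E. assert (B := hcos_variation n xi Hn Hxi). apply Rabs_le_between in B. destruct (hcos_bounds xi) as [B0 B1].
  assert (Ex : exp xi <= INR n + 1).
  { rewrite <- S_INR, <- (exp_ln (INR (S n))) by pos. apply exp_le_compat. lra. }
  assert (Dl := ln_succ_diff n Hn).
  assert (P0 := exp_pos xi).
  apply Rle_trans with ((INR n + 1) * hcos xi * / INR n).
  { apply Rmult_le_compat; [nra|lra|apply Rmult_le_compat_r; lra|exact Dl]. }
  replace ((INR n + 1) * hcos xi * / INR n) with (hcos xi + hcos xi * / INR n) by (field; lra).
  assert (hcos xi * / INR n <= pw n (1 + sigma)).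
  { rewrite Rplus_comm, pw_plus, pw_one by exact Hn. apply Rmult_le_compat_r; [pos|].
    eapply Rle_trans; [exact B1|]. apply exp_le_compat. nra. }
  lra.
Qed.

Lemma hcos_sum_lower Y : (1 <= Y)%nat -> kap a t / a * exp (a * lg Y) - / a - (D + 1) * (1 + / sigma) <= S1 (fun n => hcos (lg n)) Y.
Proof.
intros HY. assert (Ha : 0 < a) by (unfold a; lra).
assert (T : Hcos (lg (S Y)) - Hcos 0 <= S1 (fun n => hcos (lg n) + (D + 1) * pw n (1 + sigma)) Y).
{ clear HY. induction Y as [|Y IH]; [simpl; rewrite ln_1; lra|].
  rewrite S1_S. assert (X := Hcos_step (S Y) ltac:(lia)). lra. }
rewrite S1_plus, S1_scal in T. assert (B := S1_pw_bound sigma Y ltac:(lra)).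
assert (D0 : 0 <= D + 1) by (unfold D; pose proof (Rabs_pos t); lra).
assert ((D + 1) * S1 (fun n => pw n (1 + sigma)) Y <= (D + 1) * (1 + / sigma)) by (apply Rmult_le_compat_l; assumption).
assert (L1 := Hcos_lower (lg (S Y))). assert (L0 := Hcos_0).
assert (kap a t / a * exp (a * lg Y) <= kap a t / a * exp (a * lg (S Y))).
{ apply Rmult_le_compat_l; [apply Rmult_le_pos; [apply kap_pos|pos]|]. apply exp_le_compat.
  apply Rmult_le_compat_l; [lra|apply ln_le_S, HY]. }
lra.
Qed.

Lemma pw_sum_upper Y : (1 <= Y)%nat -> S1 (fun n => pw n sigma) Y <= / a * exp (a * lg Y).
Proof.
intros HY. assert (Ha : 0 < a < 1) by (unfold a; lra). assert (1 <= / a) by (rewrite <- Rinv_1; apply Rinv_le_contravar; lra).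
induction HY as [|Y HY IH]; [simpl; rewrite ln_1, Rmult_0_r, exp_0, pw_1; lra|].
rewrite S1_S. assert (HYp : 0 < INR Y) by pos.
destruct (MVT_gen (fun u => exp (a * ln u)) (INR Y) (INR (S Y)) (fun u => a * exp (- sigma * ln u))) as (xi & Hxi & Exi).
- rewrite S_INR, Rmin_left, Rmax_right by lra. intros u Hu. auto_derive; [lra|].
  replace (- sigma * ln u) with (a * ln u + - ln u) by (unfold a; ring). rewrite exp_plus, exp_Ropp, exp_ln by lra. field. lra.
- rewrite S_INR, Rmin_left, Rmax_right by lra. intros u Hu. apply derivable_continuous_pt. exists (a * / u * exp (a * ln u)).
  apply is_derive_Reals. auto_derive; [lra|]. field. lra.
- rewrite S_INR in Exi, Hxi. rewrite Rmin_left, Rmax_right in Hxi by lra. replace (INR Y + 1 - INR Y) with 1 in Exi by ring.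
  assert (pw (S Y) sigma <= exp (- sigma * ln xi)).
  { unfold pw. rewrite S_INR. apply exp_le_compat. assert (ln xi <= ln (INR Y + 1)) by (apply ln_le; lra). nra. }
  rewrite S_INR.
  assert (/ a * exp (a * ln (INR Y + 1)) = / a * exp (a * lg Y) + exp (- sigma * ln xi)).
  { replace (exp (a * ln (INR Y + 1))) with (exp (a * lg Y) + a * exp (- sigma * ln xi)) by lra. field. lra. }
  lra.
Qed.

(** Partial summation of [pr n * log n - 1] against [hcos], with [|theta(n) - n| <= dl n + C]. The
    total effect of [dl] is at most [eps/(2a)] times [Y^a], and the constants gathered in [C2] fall
    below another such share for large [Y]. *)
Theorem prime_cos_sum eps : GRH -> 0 < eps -> exists Y0, forall Y, (Y0 <= Y)%nat ->
  (kap a t - eps) / a * exp (a * lg Y) <= S1 (fun n => pr n * lg n * hcos (lg n)) Y.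
Proof.
intros HG He. assert (Ha : 0 < a < 1) by (unfold a; lra). assert (D0 : 0 < D) by (unfold D; pose proof (Rabs_pos t); lra).
set (dl := Rmin 1 (eps / (2 * (a + D)))).
assert (Hdl : 0 < dl <= 1).
{ split; [apply Rmin_glb_lt; [lra|pos]|apply Rmin_l]. }
assert (Hdl2 : dl * (a + D) <= eps / 2).
{ apply Rle_trans with (eps / (2 * (a + D)) * (a + D)); [apply Rmult_le_compat_r; [lra|apply Rmin_r]|]. right. field. lra. }
destruct (prime_number_theorem dl HG Hdl) as [N0 HP].
set (C := theta N0 + INR N0).
assert (th0 : forall n, 0 <= theta n) by (intros n; apply S1_pos; intros k _; apply Rmult_le_pos; [apply pr_01|apply ln_INR_pos]).
assert (HC : 0 <= C) by (unfold C; pose proof (th0 N0); pose proof (pos_INR N0); lra).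
assert (Hth : forall n, Rabs (theta n - INR n) <= dl * INR n + C).
{ intros n. pose proof (pos_INR n). destruct (le_lt_dec N0 n) as [H1|H1].
  - specialize (HP n H1). apply Rabs_le. nra.
  - assert (theta n <= theta N0) by (apply S1_mono; [lia|intros k _; apply Rmult_le_pos; [apply pr_01|apply ln_INR_pos]]).
    assert (INR n <= INR N0) by (apply le_INR; lia). pose proof (th0 n). unfold C. apply Rabs_le. nra. }
set (C2 := C + C * D * (1 + / sigma) + / a + (D + 1) * (1 + / sigma)).
destruct (ev_nat _ (ev_and _ _ (ev_ge 0) (ev_poly (2 * a * C2 / eps) 0 a ltac:(lra)))) as (Y1 & HY1 & HE).
exists (S Y1). intros Y HY. destruct Y as [|Y]; [lia|].
destruct (HE (S Y) ltac:(lia)) as [_ HE2]. set (V := exp (a * lg (S Y))) in *. simpl pow in HE2. rewrite Rmult_1_r in HE2.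
assert (HV : C2 <= eps / (2 * a) * V).
{ apply (Rmult_le_compat_l (eps / (2 * a))) in HE2; [|pos].
  replace (eps / (2 * a) * (2 * a * C2 / eps)) with C2 in HE2 by (field; lra). exact HE2. }
set (al := fun n => pr n * lg n - 1). set (h := fun n => hcos (lg n)).
assert (Eal : forall n, S1 al n = theta n - INR n).
{ intros n. unfold al. rewrite S1_minus, S1_const. unfold theta. ring. }
assert (Es : S1 (fun n => pr n * lg n * h n) (S Y) = S1 h (S Y) + S1 (fun n => al n * h n) (S Y)).
{ rewrite <- S1_plus. apply S1_ext. intros. unfold al. ring. }
change (fun n => pr n * lg n * hcos (lg n)) with (fun n => pr n * lg n * h n). rewrite Es, S1_abel.
assert (Hp : forall n, (1 <= n)%nat -> INR n * pw n (1 + sigma) = pw n sigma).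
{ intros n Hn. rewrite pw_plus, pw_one by exact Hn. rewrite <- Rmult_assoc, Rinv_r, Rmult_1_l; [reflexivity|apply not_0_INR; lia]. }
assert (B1 : Rabs (S1 al (S Y) * h (S Y)) <= dl * V + C).
{ rewrite Eal, Rabs_mult. unfold h. destruct (hcos_bounds (lg (S Y))) as [b0 b1]. rewrite (Rabs_pos_eq (hcos _)) by exact b0.
  change (exp (- sigma * lg (S Y))) with (pw (S Y) sigma) in b1.
  apply Rle_trans with ((dl * INR (S Y) + C) * pw (S Y) sigma); [apply Rmult_le_compat; [apply Rabs_pos|exact b0|apply Hth|exact b1]|].
  assert (INR (S Y) * pw (S Y) sigma = V).
  { unfold V, pw. rewrite <- (exp_ln (INR (S Y))) at 1 by pos. rewrite <- exp_plus. f_equal. unfold a. ring. }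
  pose proof (pw_le_1 (S Y) sigma ltac:(lra)). nra. }
assert (B2 : Rabs (S1 (fun n => S1 al n * (h n - h (S n))) Y) <= dl * D * (/ a * V) + C * D * (1 + / sigma)).
{ apply Rle_trans with (S1 (fun n => dl * D * pw n sigma + C * D * pw n (1 + sigma)) Y).
  - apply S1_abs_le. intros n Hn. rewrite Eal, Rabs_mult.
    assert (X := hcos_variation n (lg (S n)) ltac:(lia) ltac:(pose proof (ln_le_S n ltac:(lia)); lra)).
    apply Rle_trans with ((dl * INR n + C) * (D * pw n (1 + sigma))); [apply Rmult_le_compat; [apply Rabs_pos|apply Rabs_pos|apply Hth|exact X]|].
    rewrite <- (Hp n) by lia. right. ring.
  - rewrite S1_plus, !S1_scal. apply Rplus_le_compat.
    + apply Rmult_le_compat_l; [pos|]. eapply Rle_trans; [|apply (pw_sum_upper (S Y)); lia].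
      apply S1_mono; [lia|]. intros; left; apply pw_pos.
    + apply Rmult_le_compat_l; [pos|apply S1_pw_bound; lra]. }
assert (B3 := hcos_sum_lower (S Y) ltac:(lia)). fold h in B3. change (exp (a * lg (S Y))) with V in B3.
apply Rabs_le_between in B1. apply Rabs_le_between in B2.
assert (HV0 : 0 < V) by apply exp_pos.
assert (B4 : dl * V + dl * D * (/ a * V) <= eps / (2 * a) * V).
{ replace (dl * V + dl * D * (/ a * V)) with (dl * (a + D) * (V * / a)) by (field; lra).
  replace (eps / (2 * a) * V) with (eps / 2 * (V * / a)) by (field; lra). apply Rmult_le_compat_r; [|exact Hdl2].
  apply Rmult_le_pos; [lra|pos]. }
replace ((kap a t - eps) / a * V) with (kap a t / a * V - eps / (2 * a) * V - eps / (2 * a) * V) by (field; lra).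
unfold C2 in HV. unfold h in *. lra.
Qed.

End PrimeSum.

(** * Truncated expansion of log |L| *)

Lemma psum_S K x : psum (S K) x = 1 + S1 (fun i => x ^ i / INR (fact i)) K.
Proof.
unfold psum. induction K as [|K IH]; [simpl; field|]. rewrite S1_S, IH, (S1_S (fun i => x ^ i / INR (fact i))).
replace (S (S K) - 1)%nat with (S K) by lia. ring.
Qed.

Lemma wK_nonneg lam K n : 0 <= lam -> 0 <= wK lam K n.
Proof.
intros Hl. apply Rmult_le_pos; [pos|]. apply S1_pos. intros i Hi. apply Rmult_le_pos; [|apply psum_term_pos, ln_INR_pos].
apply Rmult_le_pos; [pos|pos].
Qed.

Lemma ln_wK lam K n : lg n * wK lam K n = pw n 3 * (psum (S K) (lam * lg n) - 1).
Proof.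
rewrite psum_S. unfold wK. replace (1 + S1 (fun i => (lam * lg n) ^ i / INR (fact i)) K - 1) with (S1 (fun i => (lam * lg n) ^ i / INR (fact i)) K) by ring.
rewrite <- Rmult_assoc, (Rmult_comm _ (pw n 3)), Rmult_assoc. f_equal. rewrite <- S1_scal. apply S1_ext. intros [|i] Hi; [lia|].
replace (S i - 1)%nat with i by lia. rewrite Rpow_mult_distr, fact_simpl, mult_INR. simpl (lg n ^ S i).
field. split; [apply INR_fact_neq_0|apply not_0_INR; lia].
Qed.

Lemma ln_wK_upper sigma K n : sigma <= 3 -> lg n * wK (3 - sigma) K n <= pw n sigma.
Proof.
intros Hs. rewrite ln_wK. pose proof (ln_INR_pos n).
assert (B := psum_le_exp (S K) ((3 - sigma) * lg n) ltac:(nra)).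
apply Rle_trans with (pw n 3 * exp ((3 - sigma) * lg n)); [apply Rmult_le_compat_l; [pos|lra]|].
right. unfold pw. rewrite <- exp_plus. f_equal. ring.
Qed.

(** With [y = 3 log n] in [psum_tail] the factor [e^y] is exactly cancelled by [n^(-3)], so the
    truncation error does not depend on [n]. *)
Lemma ln_wK_lower sigma K n : 0 <= sigma <= 3 -> pw n sigma - pw n 3 - ((3 - sigma) / 3) ^ S K <= lg n * wK (3 - sigma) K n.
Proof.
intros Hs. rewrite ln_wK. pose proof (ln_INR_pos n).
assert (B := psum_tail (S K) ((3 - sigma) / 3) (3 * lg n) ltac:(nra) ltac:(lra)).
replace ((3 - sigma) / 3 * (3 * lg n)) with ((3 - sigma) * lg n) in B by field.
assert (E1 : pw n sigma = pw n 3 * exp ((3 - sigma) * lg n)) by (unfold pw; rewrite <- exp_plus; f_equal; ring).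
assert (E2 : pw n 3 * exp (3 * lg n) = 1) by (unfold pw; rewrite <- exp_plus, <- exp_0; f_equal; ring).
apply (Rmult_le_compat_l (pw n 3)) in B; [|pos].
replace (pw n 3 * (((3 - sigma) / 3) ^ S K * exp (3 * lg n))) with (((3 - sigma) / 3) ^ S K * (pw n 3 * exp (3 * lg n))) in B by ring.
rewrite E2 in B. rewrite E1. lra.
Qed.

(** With [y = (log n)/2] in [psum_upper] the decay is [n^(-5/2)], so the terms beyond any
    [Z >= 5^(K+1)] are negligible. *)
Lemma ln_wK_tail lam K n : 1 / 2 <= lam <= 5 / 2 -> lg n * wK lam K n <= 5 ^ S K * pw n (1 + 3 / 2).
Proof.
intros Hl. rewrite ln_wK. pose proof (ln_INR_pos n).
assert (B := psum_upper (S K) (2 * lam) (lg n / 2) ltac:(lra) ltac:(lra)).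
replace (2 * lam * (lg n / 2)) with (lam * lg n) in B by field.
assert (C : (2 * lam) ^ S K <= 5 ^ S K) by (apply pow_incr; lra).
apply Rle_trans with (pw n 3 * (5 ^ S K * exp (lg n / 2))).
- apply Rmult_le_compat_l; [pos|]. pose proof (exp_pos (lg n / 2)). nra.
- right. rewrite <- Rmult_assoc, (Rmult_comm (pw n 3)), Rmult_assoc. f_equal. unfold pw. rewrite <- exp_plus. f_equal. field.
Qed.

Lemma ln2_bounds : 1 / 2 < ln 2 < 1.
Proof.
split; [pose proof ln_lt_2; lra|]. pose proof (ln_increasing 2 (exp 1) ltac:(lra)) as H. rewrite ln_exp in H. apply H.
pose proof (exp_ineq1 1 ltac:(lra)). lra.
Qed.

(** What [vonM] carries besides the odd primes: proper prime powers and the prime [2], where no sign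
    is prescribed. *)
Definition evenLam (n : nat) : R := vonM n - opr n * lg n.

Lemma evenLam_eq n : evenLam n = powLam n + (if Nat.eqb n 2 then ln 2 else 0).
Proof.
unfold evenLam, powLam, opr. destruct (Nat.leb_spec 3 n); destruct (Nat.eqb_spec n 2); try lia; try (unfold pr; ring).
- subst n. unfold pr. destruct (prime_dec (Z.of_nat 2)) as [P|P]; [replace (INR 2) with 2 by (simpl; ring); ring|]. exfalso. apply P. apply prime_2.
- destruct n as [|[|n]]; [| |lia]; unfold pr; destruct prime_dec as [P|P]; try (apply prime_ge_2 in P; lia); ring.
Qed.

Lemma evenLam_nonneg n : 0 <= evenLam n.
Proof. rewrite evenLam_eq. pose proof (powLam_nonneg n). pose proof ln2_bounds. destruct (Nat.eqb n 2); lra. Qed.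

Lemma evenLam_wK sigma K n : 0 <= sigma <= 3 -> (1 <= n)%nat -> evenLam n * wK (3 - sigma) K n <= 2 * (powLam n * pw n sigma) + (if Nat.eqb n 2 then 1 else 0).
Proof.
intros Hs Hn. rewrite evenLam_eq, Rmult_plus_distr_r. pose proof ln2_bounds as L2.
assert (W := ln_wK_upper sigma K n ltac:(lra)). assert (W0 := wK_nonneg (3 - sigma) K n ltac:(lra)).
assert (P0 := powLam_nonneg n). apply Rplus_le_compat.
- destruct (Nat.eq_dec n 1) as [-> | N1].
  + assert (powLam 1 = 0).
    { pose proof (vonM_le_ln 1) as V. simpl in V. rewrite ln_1 in V. unfold powLam. pose proof (vonM_ge0 1). simpl. rewrite ln_1. lra. }
    rewrite H. lra.
  + assert (ln 2 <= lg n) by (apply ln_le; [lra|apply (le_INR 2); lia]).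
    assert (wK (3 - sigma) K n <= 2 * pw n sigma) by nra. nra.
- destruct (Nat.eqb_spec n 2) as [-> | N2]; [|lra]. simpl (INR 2) in W. replace (1 + 1) with 2 in W by ring.
  pose proof (pw_le_1 2 sigma ltac:(lra)). lra.
Qed.

(** Coefficient of [leg p q] for the primes beyond [Y], whose symbols are controlled only in mean
    square. *)
Definition tailc (sigma t : R) (K Y q : nat) : R :=
  if Nat.ltb Y q then opr q * cos (t * lg q) * (lg q * wK (3 - sigma) K q) else 0.

Definition mainsum (sigma t : R) (Y : nat) : R := S1 (fun q => opr q * (Rabs (cos (t * lg q)) * pw q sigma)) Y.

Lemma S1_trunc (f : nat -> R) Y Z : (Y <= Z)%nat -> S1 (fun n => if Nat.ltb Y n then 0 else f n) Z = S1 f Y.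
Proof.
intros H. induction H as [|Z H IH].
- apply S1_ext. intros n Hn. destruct (Nat.ltb_spec Y n); [lia|reflexivity].
- rewrite S1_S, IH. destruct (Nat.ltb_spec Y (S Z)); [ring|lia].
Qed.

(** Losses: [2C + 1] from proper powers and the prime [2], [1] from [n > Z], [1] from [Y < q <= Z],
    and [4] from the odd primes up to [Y] (the sum of [n^(-3)], the truncation error, the case
    [q = p]). The centre costs [2], and the last summand of [C2] is the tail of the series of the
    logarithm. *)
Theorem log_L_selected sigma t : GRH -> 1 / 2 < sigma < 1 -> exists C2, forall (p K Y Z : nat) (kp : R) (eps : nat -> R),
  odd_prime p -> (kp = 1 \/ kp = -1) -> (forall q, eps q * cos (t * lg q) = kp * Rabs (cos (t * lg q))) ->
  ((3 - sigma) / (5 / 2)) ^ S K * lg p <= 1 -> INR Y * ((3 - sigma) / 3) ^ S K <= 1 -> 5 ^ S K <= INR Z -> (Y <= Z)%nat ->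
  (forall q, odd_prime q -> (q <= Y)%nat -> leg p q = eps q \/ q = p) ->
  S1 (fun q => tailc sigma t K Y q * leg p q) Z ^ 2 <= 1 ->
  exists u v : R, is_lim_seq (dval (leg p) sigma t 0) u /\ is_lim_seq (dval (leg p) sigma t (PI / 2)) v /\ 0 < u ^ 2 + v ^ 2 /\
    mainsum sigma t Y - C2 <= kp * (/ 2 * ln (u ^ 2 + v ^ 2)).
Proof.
intros HG Hsig. destruct (prime_powers_bounded sigma ltac:(lra)) as (C & HC & HCN).
set (rho := (3 - sigma) / (5 / 2)). assert (Hrho : 0 < rho < 1) by (unfold rho; lra).
set (ct := ln (32 * 3 * (11 * 3 + 5 * Rabs t))).
assert (Hct : 0 <= ct) by (pose proof (Rabs_pos t); unfold ct; rewrite <- ln_1; apply ln_le; lra).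
exists (2 * C + 9 + 2 * (1 + ct) / (1 - rho)).
intros p K Y Z kp eps Hp Hkp Heps H1 H2 H3 HYZ Hsel Htail.
destruct (log_L_formula p (leg p) sigma t K HG (leg_rchar p Hp) Hsig) as (u & v & l & Lu & Lv & Huv & Ll & HE).
exists u, v. split; [exact Lu|split; [exact Lv|split; [exact Huv|]]].
set (lam := 3 - sigma) in *. fold rho in H1, HE. fold ct in HE.
assert (Hl0 : 2 <= lam <= 5 / 2) by (unfold lam; lra).
assert (kpa : forall x, Rabs x <= 1 -> - 1 <= kp * x) by (intros x Hx; apply Rabs_le_between in Hx; destruct Hkp as [-> | ->]; lra).
assert (kpb : forall x b, Rabs x <= b -> - b <= kp * x) by (intros x b Hx; apply Rabs_le_between in Hx; destruct Hkp as [-> | ->]; lra).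
set (F := fun n => opr n * (lg n * wK lam K n) * (cos (t * lg n) * leg p n)).
assert (HW : forall n, 0 <= lg n * wK lam K n) by (intros; apply Rmult_le_pos; [apply ln_INR_pos|apply wK_nonneg; lra]).
assert (Hcl : forall n, Rabs (cos (t * lg n) * leg p n) <= 1).
{ intros n. rewrite Rabs_mult. pose proof (Rabs_cos_le (t * lg n)). pose proof (leg_abs p n). pose proof (Rabs_pos (cos (t * lg n))). nra. }
assert (HFb : forall n, Rabs (F n) <= lg n * wK lam K n).
{ intros n. unfold F. rewrite !Rabs_mult, <- (Rabs_mult (cos _)). rewrite <- (Rabs_mult (ln _)), (Rabs_pos_eq (lg n * wK lam K n)) by apply HW.
  specialize (Hcl n). specialize (HW n).
  destruct (opr_cases n) as [[-> _]|[-> _]]; [rewrite Rabs_R1|rewrite Rabs_R0]; nra. }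
assert (HZ1 : (1 <= Z)%nat) by (apply INR_le; assert (1 <= 5 ^ S K) by (apply pow_R1_Rle; lra); simpl; lra).
assert (A1 : forall N, (Z <= N)%nat -> mainsum sigma t Y - (2 * C + 7) <= kp * S1 (fun n => vonM n * leg p n * cos (t * lg n) * wK lam K n) N).
{ intros N HN.
  assert (B1 : Rabs (S1 (fun n => vonM n * leg p n * cos (t * lg n) * wK lam K n) N - S1 F N) <= 2 * C + 1).
  { rewrite <- S1_minus. apply Rle_trans with (S1 (fun n => 2 * (powLam n * pw n sigma) + (if Nat.eqb n 2 then 1 else 0)) N).
    - apply S1_abs_le. intros n Hn. eapply Rle_trans; [|apply (evenLam_wK sigma K n); [lra|lia]]. fold lam.
      replace (vonM n * leg p n * cos (t * lg n) * wK lam K n - F n) with ((evenLam n * wK lam K n) * (cos (t * lg n) * leg p n)) by (unfold F, evenLam; ring).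
      assert (P : 0 <= evenLam n * wK lam K n) by (apply Rmult_le_pos; [apply evenLam_nonneg|apply wK_nonneg; lra]).
      rewrite Rabs_mult, (Rabs_pos_eq (evenLam n * _)) by exact P. specialize (Hcl n). nra.
    - rewrite S1_plus, S1_scal. pose proof (HCN N). pose proof (S1_indicator 2 1 N ltac:(lra)). lra. }
  assert (B2 : Rabs (S1 F N - S1 F Z) <= 1).
  { set (f5 := 5 ^ S K) in *. assert (H5 : 0 < f5) by pos.
    assert (X := S1_tail (fun n => / f5 * F n) (3 / 2) Z N ltac:(lra) ltac:(lia)).
    rewrite !S1_scal, <- Rmult_minus_distr_l, Rabs_mult, (Rabs_pos_eq (/ f5)) in X by pos.
    assert (X' : / f5 * Rabs (S1 F N - S1 F Z) <= / (3 / 2) * pw Z (3 / 2)).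
    { apply X. intros n Hn. rewrite Rabs_mult, (Rabs_pos_eq (/ f5)) by pos.
      apply Rmult_le_reg_l with f5; [exact H5|]. rewrite <- Rmult_assoc, Rinv_r, Rmult_1_l by lra.
      eapply Rle_trans; [apply HFb|apply ln_wK_tail; lra]. }
    assert (Q : pw Z (3 / 2) <= / f5).
    { apply Rle_trans with (pw Z 1); [apply pw_le; lra|]. rewrite pw_one by exact HZ1. apply Rinv_le_contravar; assumption. }
    apply (Rmult_le_compat_l f5) in X'; [|lra]. rewrite <- Rmult_assoc, Rinv_r, Rmult_1_l in X' by lra.
    eapply Rle_trans; [exact X'|]. assert (f5 * pw Z (3 / 2) <= 1) by (apply (Rmult_le_compat_l f5) in Q; [|lra]; rewrite Rinv_r in Q by lra; exact Q). lra. }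
  assert (B3 : S1 F Z = S1 F Y + S1 (fun q => tailc sigma t K Y q * leg p q) Z).
  { rewrite <- (S1_trunc F Y Z HYZ), <- S1_plus. apply S1_ext. intros n _. unfold tailc. fold lam. destruct (Nat.ltb Y n); unfold F; ring. }
  assert (B4 : Rabs (S1 (fun q => tailc sigma t K Y q * leg p q) Z) <= 1).
  { rewrite <- Rabs_R1. apply Rsqr_le_abs_0. unfold Rsqr. simpl in Htail. lra. }
  assert (B5 : mainsum sigma t Y - 4 <= kp * S1 F Y).
  { rewrite <- S1_scal.
    apply Rle_trans with (S1 (fun q => opr q * (Rabs (cos (t * lg q)) * pw q sigma) - pw q (1 + 2) - ((3 - sigma) / 3) ^ S K - (if Nat.eqb q p then 1 else 0)) Y).
    - rewrite !S1_minus, S1_const. fold (mainsum sigma t Y). pose proof (S1_indicator p 1 Y ltac:(lra)).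
      pose proof (S1_pw_bound 2 Y ltac:(lra)). fold lam. lra.
    - apply S1_le. intros q Hq. unfold F. assert (Lw := ln_wK_lower sigma K q ltac:(lra)). assert (Uw := ln_wK_upper sigma K q ltac:(lra)). fold lam in Lw, Uw |- *.
      replace (1 + 2) with 3 by ring. pose proof (pw_le_1 q sigma ltac:(lra)). specialize (HW q).
      pose proof (Rabs_cos_le (t * lg q)) as C1. destruct (opr_cases q) as [[O1 O2]|[O1 _]]; rewrite O1; [|destruct (Nat.eqb q p); lra].
      destruct (Nat.eqb_spec q p) as [-> | Ne].
      + assert (E0 : leg p p = 0).
        { unfold leg. replace (legendre p p) with 0%Z; [reflexivity|]. symmetry. apply leg_zero; [exact Hp|apply Nat.divide_refl]. }
        rewrite E0. nra.
      + destruct (Hsel q O2 ltac:(lia)) as [E0|E0]; [|congruence]. rewrite E0.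
        replace (kp * (1 * (lg q * wK lam K q) * (cos (t * lg q) * eps q))) with (lg q * wK lam K q * (kp * (eps q * cos (t * lg q)))) by ring.
        rewrite Heps. replace (kp * (kp * Rabs (cos (t * lg q)))) with (Rabs (cos (t * lg q))) by (destruct Hkp as [-> | ->]; ring). nra. }
  apply kpb in B1. apply kpa in B2. apply kpa in B4. rewrite B3 in B2. lra. }
assert (A2 : mainsum sigma t Y - (2 * C + 7) <= kp * l).
{ apply (is_lim_seq_le_loc (fun _ => mainsum sigma t Y - (2 * C + 7)) (fun N => kp * S1 (fun n => vonM n * leg p n * cos (t * lg n) * wK lam K n) N) (mainsum sigma t Y - (2 * C + 7)) (kp * l)).
  - exists Z. exact A1.
  - apply is_lim_seq_const.
  - apply (is_lim_seq_scal_l _ kp l Ll). }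
apply kpb in HE.
assert (A3 : 2 * (lg p + ct) * rho ^ S K / (1 - rho) <= 2 * (1 + ct) / (1 - rho)).
{ apply Rmult_le_compat_r; [pos|]. assert (0 <= rho ^ S K <= 1) by (split; [pos|apply pow_le_one; lra]). nra. }
lra.
Qed.

(** * Uniform averages and the count of selected primes *)

Lemma ln_prodl I Z : List.Forall odd_prime I -> (forall q, In q I -> (q <= Z)%nat) -> (1 <= prodl I)%nat /\ lg (prodl I) <= INR (length I) * lg Z.
Proof.
intros HF HZ. induction HF as [|q I [_ Hq] HF IH]; [simpl; rewrite ln_1; split; [lia|lra]|].
destruct IH as [IH1 IH2]; [intros; apply HZ; simpl; auto|]. change (prodl (q :: I)) with (q * prodl I)%nat. split; [nia|].
rewrite mult_INR, ln_mult by pos. change (length (q :: I)) with (S (length I)). rewrite S_INR.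
assert (lg q <= lg Z) by (apply ln_le; [pos|apply le_INR, HZ; simpl; auto]). lra.
Qed.

Lemma powLam_smooth s C D K N : 1 / 2 < s < D -> (forall N, S1 (fun n => powLam n * pw n s) N <= C) ->
  S1 (fun n => powLam n * vK D K n) N <= (D / (D - s)) ^ K * C.
Proof.
intros Hs HC. apply Rle_trans with ((D / (D - s)) ^ K * S1 (fun n => powLam n * pw n s) N).
- rewrite <- S1_scal. apply S1_le. intros n _. pose proof (powLam_nonneg n). pose proof (vK_upper D K n s ltac:(lra)). nra.
- apply Rmult_le_compat_l; [pos|apply HC].
Qed.

Lemma lim_evN f (l : R) : is_lim_seq f l -> evN (fun N => Rabs (f N - l) <= 1).
Proof.
intros H. apply is_lim_seq_spec in H. destruct (H (mkposreal 1 Rlt_0_1)) as [N0 HN]. exists N0. intros N HNN. left. apply HN, HNN.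
Qed.

(** The modulus [4 q_1 ... q_k] is at most [4 Z^(m+2)], with [log 4 <= 2]. The prime [2] drops out
    since the modulus is even; proper prime powers cost [(D/(D - s))^K], about [e^(Ts)]. *)
Lemma char_average I Z m s C D K : GRH -> NoDup I -> List.Forall odd_prime I -> (forall q, In q I -> (q <= Z)%nat) -> (length I <= m + 2)%nat -> I <> nil ->
  1 / 2 < s < 1 -> 3 <= D -> (forall N, S1 (fun n => powLam n * pw n s) N <= C) ->
  evN (fun N => Rabs (S1 (fun n => opr n * lg n * vK D K n * IZR (psi I n)) N) <=
    2 * (2 + (INR m + 2) * lg Z + ln (352 * D ^ 2)) * INR K ^ 2 * (D / (D - 1 / 2)) ^ K + 1 + (D / (D - s)) ^ K * C).
Proof.
intros HG ND HF HZ HL NE Hs HD HC. assert (Hch := psi_rchar I HF ND NE).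
destruct (smooth_char _ _ D K HG Hch HD) as (l & Hl & HB). set (ch := fun n => IZR (psi I n)) in *.
destruct (ln_prodl I Z HF HZ) as [P1 P2].
assert (HA : lg (4 * prodl I) <= 2 + (INR m + 2) * lg Z).
{ rewrite mult_INR, ln_mult by (try apply lt_0_INR; lia). replace (INR 4) with (2 * 2) by (simpl; ring). rewrite ln_mult by lra. pose proof ln2_bounds.
  pose proof (ln_INR_pos Z). assert (INR (length I) <= INR m + 2) by (replace 2 with (INR 2) by (simpl; ring); rewrite <- plus_INR; apply le_INR, HL). nra. }
eapply evN_imp; [|exact (lim_evN _ _ Hl)]. intros N HN.
assert (Ez : ch 2%nat = 0).
{ destruct Hch as (_ & _ & _ & _ & H5 & _). apply NNPP. intros X. apply (proj1 (H5 2%nat)) in X.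
  assert (D2 : Nat.divide 2 (Nat.gcd 2 (4 * prodl I))) by (apply Nat.gcd_greatest; [exists 1%nat; lia|exists (2 * prodl I)%nat; lia]).
  rewrite X in D2. apply Nat.divide_1_r in D2. lia. }
assert (E : S1 (fun n => opr n * lg n * vK D K n * ch n) N = S1 (fun n => vonM n * ch n * vK D K n) N - S1 (fun n => powLam n * ch n * vK D K n) N).
{ rewrite <- S1_minus. apply S1_ext. intros n _. pose proof (evenLam_eq n) as X. unfold evenLam in X.
  destruct (Nat.eqb_spec n 2) as [E2|N2]; [rewrite E2, Ez; ring|]. replace (opr n * lg n) with (vonM n - powLam n) by lra. ring. }
change (Rabs (S1 (fun n => opr n * lg n * vK D K n * ch n) N) <= 2 * (2 + (INR m + 2) * lg Z + ln (352 * D ^ 2)) * INR K ^ 2 * (D / (D - 1 / 2)) ^ K + 1 + (D / (D - s)) ^ K * C).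
rewrite E. unfold Rminus. eapply Rle_trans; [apply Rabs_triang|]. rewrite Rabs_Ropp. apply Rplus_le_compat.
- replace (S1 (fun n => vonM n * ch n * vK D K n) N) with (l + (S1 (fun n => vonM n * ch n * vK D K n) N - l)) by ring.
  eapply Rle_trans; [apply Rabs_triang|]. apply Rplus_le_compat; [|exact HN]. eapply Rle_trans; [exact HB|].
  apply Rmult_le_compat_r; [pos|]. apply Rmult_le_compat_r; [apply pow2_ge_0|]. lra.
- eapply Rle_trans; [|apply (powLam_smooth s C D K N ltac:(lra) HC)]. apply S1_abs_le. intros n _.
  assert (P := powLam_nonneg n). assert (V := vK_pos D K n ltac:(lra)). rewrite !Rabs_mult, (Rabs_pos_eq (powLam n)), (Rabs_pos_eq (vK D K n)) by assumption.
  assert (A := rchar_abs _ _ n Hch). fold (ch n) in A. assert (0 <= powLam n * vK D K n) by (apply Rmult_le_pos; assumption). nra.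
Qed.

Lemma main_average s C D K : GRH -> 1 / 2 < s < 1 -> 3 <= D -> (forall N, S1 (fun n => powLam n * pw n s) N <= C) ->
  evN (fun N => (D / (D - 1)) ^ K - 3 - 2 * ln (336 * D ^ 3) * INR K ^ 2 * (D / (D - 1 / 2)) ^ K - (D / (D - s)) ^ K * C <= S1 (fun n => opr n * lg n * vK D K n) N).
Proof.
intros HG Hs HD HC. destruct (smooth_zeta D K HG HD) as (l & Hl & HB). apply Rabs_le_between in HB.
eapply evN_imp; [|exact (lim_evN _ _ Hl)]. intros N HN. apply Rabs_le_between in HN.
assert (E : S1 (fun n => opr n * lg n * vK D K n) N = S1 (fun n => vonM n * vK D K n) N - S1 (fun n => evenLam n * vK D K n) N).
{ rewrite <- S1_minus. apply S1_ext. intros n _. unfold evenLam. ring. }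
assert (B : S1 (fun n => evenLam n * vK D K n) N <= (D / (D - s)) ^ K * C + 1).
{ apply Rle_trans with (S1 (fun n => powLam n * vK D K n + (if Nat.eqb n 2 then 1 else 0)) N).
  - apply S1_le. intros n _. rewrite evenLam_eq, Rmult_plus_distr_r. apply Rplus_le_compat_l.
    pose proof (vK_le_1 D K n ltac:(lra)). pose proof ln2_bounds. destruct (Nat.eqb n 2); nra.
  - rewrite S1_plus. apply Rplus_le_compat; [apply powLam_smooth; [lra|exact HC]|apply S1_indicator; lra]. }
lra.
Qed.

Definition oprimes (Y : nat) : list nat := filter (fun n => if Req_EM_T (opr n) 1 then true else false) (seq 1 Y).

Lemma oprimes_In Y q : In q (oprimes Y) <-> odd_prime q /\ (q <= Y)%nat.
Proof.
unfold oprimes. rewrite filter_In, in_seq. destruct (opr_cases q) as [[-> O]|[-> O]]; destruct Req_EM_T; try lra.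
- split; [intros; split; [exact O|lia]|intros [_ H]; destruct O; split; [lia|reflexivity]].
- split; [intros [_ H]; discriminate|tauto].
Qed.

Lemma oprimes_length Y : INR (length (oprimes Y)) = S1 opr Y.
Proof.
unfold oprimes. induction Y as [|Y IH]; [reflexivity|]. rewrite seq_S, filter_app, length_app, plus_INR, IH, S1_S. f_equal.
simpl. destruct (opr_cases (S Y)) as [[-> _]|[-> _]]; destruct Req_EM_T; simpl; lra.
Qed.

Lemma exp_pow2 m : exp (INR m * ln 2) = 2 ^ m.
Proof. rewrite exp_nat_pow, exp_ln by lra. reflexivity. Qed.

(** A [K] of order [log L] already gives [rho^(K+1) <= L^(-2)], so [5^(K+1)] is a mere power of [L],
    far below [e^(dl L)]. *)
Lemma truncation_level rho dl : 0 < rho < 1 -> 0 < dl -> ev (fun L => exists K : nat, rho ^ S K * L ^ 2 <= 1 /\ 5 ^ S K <= exp (dl * L)).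
Proof.
intros Hr Hd. set (c := - ln rho). assert (Hc : 0 < c) by (unfold c; pose proof (ln_increasing rho 1 (proj1 Hr) (proj2 Hr)) as X; rewrite ln_1 in X; lra).
eapply ev_imp; [|exact (ev_and _ _ (ev_ge (1 + 4 / dl)) (ev_poly 1 1 (c * dl / 8) ltac:(apply Rdiv_lt_0_compat; nra)))].
intros L [H1 H2]. rewrite pow_1, Rmult_1_l in H2. assert (0 < 4 / dl) by pos.
assert (Hl : ln L <= c * dl / 8 * L) by (rewrite <- (ln_exp (c * dl / 8 * L)); apply ln_le; [lra|exact H2]).
assert (Hl0 : 0 <= ln L) by (rewrite <- ln_1; apply ln_le; lra).
destruct (nfloor_ex (2 * ln L / c)) as [K [K1 K2]]; [pos|].
exists K. rewrite <- S_INR in K2.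
assert (K3 : 2 * ln L < INR (S K) * c).
{ apply (Rmult_lt_compat_r c) in K2; [|exact Hc]. replace (2 * ln L / c * c) with (2 * ln L) in K2 by (field; lra). exact K2. }
split.
- rewrite pow_exp_ln by lra. rewrite <- (exp_ln L) at 1 by lra. rewrite <- exp_nat_pow, <- exp_plus, <- exp_0. apply exp_le_compat. simpl (INR 2). fold c. unfold c in K3. lra.
- rewrite pow_exp_ln by lra. apply exp_le_compat. rewrite S_INR.
  assert (L5 : 0 <= ln 5 <= 2).
  { split; [rewrite <- ln_1; apply ln_le; lra|]. rewrite <- (ln_exp 2). apply ln_le; [lra|].
    pose proof (exp_ineq1_le (1 / 2)) as X. set (y := exp (1 / 2)) in *.
    assert (Q : exp 2 = (y * y) * (y * y)) by (unfold y; rewrite <- !exp_plus; f_equal; field).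
    rewrite Q. assert (9 / 4 <= y * y) by nra. nra. }
  assert (K4 : INR K <= dl * L / 4).
  { eapply Rle_trans; [exact K1|]. apply Rle_div_l; lra. }
  assert (4 <= dl * L).
  { apply Rle_trans with (dl * (1 + 4 / dl)); [replace (dl * (1 + 4 / dl)) with (dl + 4) by (field; lra); lra|]. apply Rmult_le_compat_l; lra. }
  nra.
Qed.

Definition sgnc (kp t : R) (q : nat) : R := if Rle_dec 0 (cos (t * lg q)) then kp else - kp.

Lemma sgnc_cos kp t q : sgnc kp t q * cos (t * lg q) = kp * Rabs (cos (t * lg q)).
Proof. unfold sgnc. destruct Rle_dec; [rewrite Rabs_pos_eq by assumption; ring|rewrite Rabs_left by lra; ring]. Qed.

Lemma tailc_square_sum sigma t K Y Z : 1 / 2 < sigma < 1 -> (1 <= Y <= Z)%nat -> / (2 * sigma - 1) * pw Y (2 * sigma - 1) <= 1 / 2 ->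
  (forall q, Rabs (tailc sigma t K Y q) <= pw q sigma) /\ S1 (fun q => tailc sigma t K Y q ^ 2) Z <= 1 / 2.
Proof.
intros Hs HY HB.
assert (A : forall q, Rabs (tailc sigma t K Y q) <= pw q sigma).
{ intros q. unfold tailc. pose proof (pw_pos q sigma). destruct (Nat.ltb Y q); [|rewrite Rabs_R0; lra].
  assert (W := ln_wK_upper sigma K q ltac:(lra)). assert (W0 : 0 <= lg q * wK (3 - sigma) K q) by (apply Rmult_le_pos; [apply ln_INR_pos|apply wK_nonneg; lra]).
  rewrite !Rabs_mult, <- (Rabs_mult (ln _)), (Rabs_pos_eq (lg q * _)) by exact W0.
  pose proof (Rabs_cos_le (t * lg q)). assert (Rabs (opr q) * Rabs (cos (t * lg q)) <= 1) by (destruct (opr_cases q) as [[-> _]|[-> _]]; [rewrite Rabs_R1|rewrite Rabs_R0]; lra).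
  nra. }
split; [exact A|].
assert (X := S1_tail (fun q => tailc sigma t K Y q ^ 2) (2 * sigma - 1) Y Z ltac:(lra) HY).
assert (Z0 : S1 (fun q => tailc sigma t K Y q ^ 2) Y = 0).
{ rewrite (S1_ext _ (fun _ => 0)); [apply S1_zero|]. intros q Hq. unfold tailc. destruct (Nat.ltb_spec Y q); [lia|ring]. }
rewrite Z0, Rminus_0_r in X. eapply Rle_trans; [apply Rle_abs|]. eapply Rle_trans; [apply X|exact HB].
intros q Hq. rewrite <- RPow_abs. replace (1 + (2 * sigma - 1)) with (sigma + sigma) by ring. rewrite pw_plus.
replace (pw q sigma * pw q sigma) with (pw q sigma ^ 2) by ring. apply pow_incr. split; [apply Rabs_pos|apply A].
Qed.

Lemma ratio_bound3 L T D K s : 10 <= L -> L / 2 <= T <= 2 * L -> INR K = D * T -> L ^ 4 / 2 <= D <= 4 * L ^ 4 /\ 500 * L <= D -> 0 <= s -> 8 * s ^ 2 <= L ->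
  2 * s <= D /\ (D / (D - s)) ^ K <= exp (T * s + 1).
Proof.
intros HL HT HK [HD0 HD] Hs HsL. assert (Hs1 : 0 <= (s - 1) ^ 2) by apply pow2_ge_0.
assert (Hs2 : 2 * s <= D) by (simpl in *; lra).
split; [exact Hs2|]. eapply Rle_trans; [apply (ratio_up D T s K HK); lra|]. apply exp_le_compat.
assert (2 * T * s ^ 2 / D <= 1); [|lra]. apply Rle_div_l; [lra|].
pose proof (pow2_ge_0 s). apply Rle_trans with (4 * L * s ^ 2); [apply Rmult_le_compat_r; lra|].
replace (L ^ 4) with (L ^ 2 * L ^ 2) in HD0 by ring. apply Rle_trans with (L ^ 2 / 2); nra.
Qed.

Lemma le_mul_ge1 x y : 1 <= x -> 0 <= y -> y <= x * y.
Proof. intros Hx Hy. nra. Qed.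

Lemma exp_ge_1 x : 0 <= x -> 1 <= exp x.
Proof. intros H. pose proof (exp_ineq1_le x). lra. Qed.

Lemma exp1_le3 x : exp (x + 1) <= 3 * exp x.
Proof. rewrite exp_plus, Rmult_comm. apply Rmult_le_compat_r; [pos|apply exp_le_3]. Qed.

(** Exponents of [e^L]: the main mass has [1 - delta/4], the number [2^m] of subsets at most
    [1/2 - delta], the error [E] about [1/2 + delta/4], and [Z^2] at most [delta/16]. Dividing the
    main mass by the bound for [2^m] leaves [U] with exponent [1/2 + 3 delta/4], and the excess over
    [1/2] absorbs the powers of [L]. *)
Theorem chosen_primes sigma t delta : GRH -> 1 / 2 < sigma < 1 -> 0 < delta <= 1 / 8 -> exists C2,
  ev (fun L => forall (Y : nat) (kp : R), (1 <= Y)%nat -> INR Y <= L ^ 2 -> / (2 * sigma - 1) * pw Y (2 * sigma - 1) <= 1 / 2 ->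
    S1 opr Y * ln 2 <= (1 / 2 - delta) * L -> (kp = 1 \/ kp = -1) ->
    exists l, NoDup l /\ exp (L / 2) <= INR (length l) /\ forall p, In p l -> odd_prime p /\ INR p <= exp L /\
      exists u v : R, is_lim_seq (dval (leg p) sigma t 0) u /\ is_lim_seq (dval (leg p) sigma t (PI / 2)) v /\ 0 < u ^ 2 + v ^ 2 /\
        mainsum sigma t Y - C2 <= kp * (/ 2 * ln (u ^ 2 + v ^ 2))).
Proof.
intros HG Hsig Hdel. destruct (log_L_selected sigma t HG Hsig) as [C2 HC2]. exists C2.
set (s := 1 / 2 + delta / 4). assert (Hs : 1 / 2 < s < 1) by (unfold s; lra).
destruct (prime_powers_bounded s ltac:(lra)) as (C & HC & HCN).
(* Chernoff exponent for the mass beyond [x]: [delta S0 = 8 + 4 delta] gives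
   [T S0 = S0 L - (2 + delta) L], which beats the loss of two powers in [vK_tail]. *)
set (S0 := 8 / delta + 4). assert (HS0 : 4 <= S0) by (unfold S0; assert (0 < 8 / delta) by pos; lra).
set (B := 144001 + 3 * C). set (rho := (3 - sigma) / (5 / 2)). assert (Hrho : 4 / 5 <= rho < 1) by (unfold rho; lra).
eapply ev_imp; [|exact (ev_and _ _ (ev_and _ _ (ev_ge 10) (ev_and _ _ (ev_ge (8 * S0 ^ 2)) (ev_ge (2 * S0 / delta))))
  (ev_and _ _ (truncation_level rho (delta / 32) ltac:(lra) ltac:(lra))
  (ev_and _ _ (ev_poly (2 * (600003 + 3 * C)) 22 (1 / 4) ltac:(lra)) (ev_and _ _ (ev_poly (32 * B) 18 (7 * delta / 16) ltac:(lra))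
  (ev_and _ _ (ev_poly 16 0 (3 * delta / 4) ltac:(lra)) (ev_poly 8 1 (3 * delta / 4) ltac:(lra)))))))].
intros L [[e1 [e2 e3]] [[K' [e4 e4']] [e5 [e6 [e7 e8]]]]] Y kp HY HYL HYs Hm Hkp.
simpl pow in e7, e8. rewrite Rmult_1_r in e7, e8.
set (Q := oprimes Y). set (m := length Q). assert (Em : INR m = S1 opr Y) by apply oprimes_length.
set (Z := (5 ^ S K')%nat). assert (EZ : INR Z = 5 ^ S K') by (unfold Z; rewrite pow_INR; f_equal; simpl; ring).
assert (L2 := ln2_bounds). assert (HdL : 0 < delta * L <= L / 8) by (split; nra). assert (HddL : 0 <= delta * (delta * L)) by pos.
assert (HrS : 0 < rho ^ S K') by pos.
(* As [5 rho >= 1], one has [5^(K'+1) >= rho^(-(K'+1)) >= L^2 >= Y]. *)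
assert (HYZ : (Y <= Z)%nat).
{ apply INR_le. rewrite EZ. apply Rle_trans with (L ^ 2); [exact HYL|].
  assert (1 <= (5 * rho) ^ S K') by (apply pow_R1_Rle; lra). rewrite Rpow_mult_distr in H.
  nra. }
set (T := (1 - delta / 4) * L). assert (HT : L / 2 <= T <= 2 * L) by (unfold T; lra).
destruct (smoothing_params L T e1 HT) as (K & D & HK & HD & HK2).
destruct HD as [HD HD5]. set (v := vK D K). assert (Hv : forall n, 0 <= v n <= 1) by (intros; split; [apply vK_pos; lra|apply vK_le_1; lra]).
set (eps := sgnc kp t). assert (Heps : forall q, eps q = 1 \/ eps q = -1) by (intros q; unfold eps, sgnc; destruct Rle_dec; destruct Hkp as [-> | ->]; lra).
destruct (ratio_bound3 L T D K s e1 HT HK (conj HD HD5) ltac:(lra)) as [_ Rs]; [assert (s ^ 2 <= 1) by (simpl; nra); lra|].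
assert (Rs3 : (D / (D - s)) ^ K <= 3 * exp (T * s)) by (eapply Rle_trans; [exact Rs|apply exp1_le3]).
destruct (ratio_bound3 L T D K S0 e1 HT HK (conj HD HD5) ltac:(lra) e2) as [HS0D RS0].
set (Ex := exp ((1 / 2 + delta / 4) * L)). assert (HEx : 1 <= Ex) by (apply exp_ge_1; lra).
assert (TEx : exp (T / 2) <= Ex) by (apply exp_le_compat; unfold T; lra).
assert (TsEx : exp (T * s) <= Ex) by (apply exp_le_compat; unfold T, s; lra).
assert (HPL : forall k, 1 <= L ^ k) by (intros; apply pow_R1_Rle; lra).
set (A := 2 + (INR m + 2) * lg Z + ln (352 * D ^ 2)).
assert (HlnZ : 0 <= lg Z <= L).
{ split; [apply ln_INR_pos|]. rewrite <- (ln_exp L). apply ln_le; [rewrite EZ; apply pow_lt; lra|]. rewrite EZ. eapply Rle_trans; [exact e4'|]. apply exp_le_compat. nra. }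
assert (HmL : 0 <= INR m <= L) by (split; [apply pos_INR|rewrite <- Em in Hm; assert (INR m * (1 / 2) <= INR m * ln 2) by (apply Rmult_le_compat_l; [apply pos_INR|lra]); lra]).
assert (HA : 0 <= A <= 6000 * L ^ 8).
{ assert (D1 : 1 <= D ^ 2) by (apply pow_R1_Rle; lra).
  assert (0 <= ln (352 * D ^ 2)) by (rewrite <- ln_1; apply ln_le; lra).
  assert (ln (352 * D ^ 2) <= 352 * D ^ 2) by (eapply Rle_trans; [apply ln_le_minus_1|]; lra).
  assert (D ^ 2 <= 16 * L ^ 8) by (replace (16 * L ^ 8) with ((4 * L ^ 4) ^ 2) by ring; apply pow_incr; lra).
  assert (0 <= (INR m + 2) * lg Z) by pos.
  assert ((INR m + 2) * lg Z <= (2 * L) * L) by (apply Rmult_le_compat; lra).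
  assert (L ^ 2 <= L ^ 8) by (replace (L ^ 8) with (L ^ 6 * L ^ 2) by ring; apply le_mul_ge1; [apply HPL|pose proof (HPL 2%nat); lra]).
  replace (2 * L * L) with (2 * L ^ 2) in * by ring. unfold A. lra. }
set (E := 2 * A * INR K ^ 2 * (D / (D - 1 / 2)) ^ K + 1 + (D / (D - s)) ^ K * C).
assert (ER := smoothing_error L T D K A e1 HT HK HD5 HK2 (proj1 HA)).
assert (HrK2 : 0 < (D / (D - 1 / 2)) ^ K) by pos.
assert (HE0 : 0 <= E).
{ unfold E. assert (0 <= 2 * A * INR K ^ 2 * (D / (D - 1 / 2)) ^ K) by (apply Rmult_le_pos; [apply Rmult_le_pos; [lra|apply pow2_ge_0]|lra]). assert (0 <= (D / (D - s)) ^ K * C) by pos. lra. }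
assert (HEB : E <= B * L ^ 18 * Ex).
{ assert (24 * A * L ^ 10 * exp (T / 2) <= 144000 * L ^ 18 * Ex).
  { apply Rmult_le_compat; [pos|pos| |exact TEx].
    replace (144000 * L ^ 18) with (24 * (6000 * L ^ 8) * L ^ 10) by ring. apply Rmult_le_compat_r; [pos|lra]. }
  assert (1 <= L ^ 18 * Ex) by (pose proof (le_mul_ge1 (L ^ 18) Ex (HPL 18%nat) ltac:(lra)); lra).
  assert ((D / (D - s)) ^ K * C <= 3 * C * (L ^ 18 * Ex)).
  { apply Rle_trans with (3 * Ex * C); [apply Rmult_le_compat_r; lra|]. assert (Hq := le_mul_ge1 (L ^ 18) Ex (HPL 18%nat) ltac:(lra)). apply (Rmult_le_compat_l (3 * C)) in Hq; lra. }
  unfold E, B. lra. }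
destruct (nfloor_ex (exp L)) as [X [HX1 HX2]]; [pos|].
assert (HeL : 11 <= exp L) by (pose proof (exp_ineq1_le L); lra).
assert (HX1' : (1 <= X)%nat) by (apply INR_le; simpl; lra).
assert (HlnX : L - 2 <= lg X <= L).
{ split.
  - assert (ln (exp L / 3) <= lg X) by (apply ln_le; lra). unfold Rdiv in H. rewrite ln_mult, ln_exp, ln_Rinv in H by (try apply exp_pos; lra).
    assert (ln 3 <= 2) by (eapply Rle_trans; [apply ln_le_minus_1|]; lra). lra.
  - rewrite <- (ln_exp L). apply ln_le; lra. }
assert (Htau : forall N, (X <= N)%nat -> S1 (g v) N - S1 (g v) X <= 1).
{ intros N HN. assert (VT := vK_tail D K S0 X N ltac:(lra) ltac:(lia)).
  assert (A2 : S1 (fun n => lg n * vK D K n - g v n) X <= S1 (fun n => lg n * vK D K n - g v n) N).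
  { apply S1_mono; [exact HN|]. intros n _. unfold g, v. assert (0 <= lg n * vK D K n) by (apply Rmult_le_pos; [apply ln_INR_pos|apply vK_pos; lra]). destruct (opr_cases n) as [[-> _]|[-> _]]; lra. }
  rewrite !S1_minus in A2.
  assert ((D / (D - S0)) ^ K * pw X (S0 - 2) <= 1).
  { apply Rle_trans with (exp (T * S0 + 1) * pw X (S0 - 2)); [apply Rmult_le_compat_r; [pos|exact RS0]|].
    unfold pw. rewrite <- exp_plus. apply Rle_trans with (exp 0); [|rewrite exp_0; lra]. apply exp_le_compat.
    assert (e3' : 2 * S0 <= delta * L).
    { apply (Rmult_le_compat_l delta) in e3; [|lra]. replace (delta * (2 * S0 / delta)) with (2 * S0) in e3 by (field; lra). exact e3. }
    assert (ES : delta * S0 = 8 + 4 * delta) by (unfold S0; field; lra).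
    assert (T * S0 = S0 * L - (2 + delta) * L).
    { unfold T. replace ((1 - delta / 4) * L * S0) with (S0 * L - delta * S0 / 4 * L) by field. rewrite ES. field. }
    assert ((S0 - 2) * (L - 2) <= (S0 - 2) * lg X) by (apply Rmult_le_compat_l; lra). lra. }
  lra. }
assert (Hmain := main_average s C D K HG Hs ltac:(lra) HCN).
set (M0 := (D / (D - 1)) ^ K - 3 - 2 * ln (336 * D ^ 3) * INR K ^ 2 * (D / (D - 1 / 2)) ^ K - (D / (D - s)) ^ K * C) in Hmain.
assert (HQ1 : NoDup Q) by (apply NoDup_filter, seq_NoDup).
assert (HQ2 : List.Forall odd_prime Q) by (apply Forall_forall; intros q Hq; apply oprimes_In in Hq; apply Hq).
assert (HQ3 : forall q, In q Q -> (q <= Z)%nat) by (intros q Hq; apply oprimes_In in Hq; lia).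
destruct (tailc_square_sum sigma t K' Y Z Hsig ltac:(lia) HYs) as [Ta Ts].
destruct (selection v E Z m eps Hv HE0 Heps (fun I ND HF HZ HL NE => char_average I Z m s C D K HG ND HF HZ HL NE Hs ltac:(lra) HCN)
  Q (tailc sigma t K' Y) X M0 1 HQ1 HQ2 HQ3 ltac:(unfold m; lia)) as (l & Hl1 & Hl2 & Hl3).
{ intros q. eapply Rle_trans; [apply Ta|apply pw_le_1; lra]. }
{ intros q Hq. unfold tailc in Hq. destruct (Nat.ltb_spec Y q) as [H|H]; [|lra]. split.
  - destruct (opr_cases q) as [[_ O]|[O _]]; [exact O|]. rewrite O in Hq. lra.
  - intros I. apply oprimes_In in I. lia. }
{ exact Ts. }
{ exact Hmain. }
{ exact Htau. }
exists l. split; [exact Hl1|split].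
- fold m in Hl3. set (Pm := exp ((1 / 2 - delta) * L)).
  assert (HPm : 2 ^ m <= Pm) by (rewrite <- exp_pow2; apply exp_le_compat; rewrite Em; lra).
  assert (HPm0 : 0 < Pm) by apply exp_pos.
  set (U := exp ((1 / 2 + 3 * delta / 4) * L)). assert (EU : exp T = U * Pm) by (unfold U, Pm; rewrite <- exp_plus; f_equal; unfold T; field).
  assert (ET : Ex * exp ((1 / 2 - delta / 2) * L) = exp T) by (unfold Ex; rewrite <- exp_plus; f_equal; unfold T; field).
  assert (HM0 : exp T / 2 <= M0).
  { assert (R1 := ratio_low D T 1 K HK ltac:(lra) ltac:(lra)). rewrite Rmult_1_r in R1.
    assert (EZt := zeta_smoothing_error L T D K e1 HT HK (conj HD HD5) HK2).
    assert (600000 * L ^ 22 * exp (T / 2) <= 600000 * L ^ 22 * Ex) by (apply Rmult_le_compat_l; [pos|exact TEx]).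
    assert ((D / (D - s)) ^ K * C <= 3 * C * (L ^ 22 * Ex)).
    { apply Rle_trans with (3 * Ex * C); [apply Rmult_le_compat_r; lra|]. assert (Hq := le_mul_ge1 (L ^ 22) Ex (HPL 22%nat) ltac:(lra)). apply (Rmult_le_compat_l (3 * C)) in Hq; lra. }
    assert (3 <= 3 * (L ^ 22 * Ex)) by (pose proof (le_mul_ge1 (L ^ 22) Ex (HPL 22%nat) ltac:(lra)); lra).
    assert ((600003 + 3 * C) * (L ^ 22 * Ex) <= exp T / 2).
    { rewrite <- ET. assert (exp (1 / 4 * L) <= exp ((1 / 2 - delta / 2) * L)) by (apply exp_le_compat; lra).
      replace ((600003 + 3 * C) * (L ^ 22 * Ex)) with (Ex * (2 * (600003 + 3 * C) * L ^ 22) / 2) by field.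
      apply Rmult_le_compat_r; [lra|]. apply Rmult_le_compat_l; lra. }
    unfold M0. lra. }
  set (Rr := INR (length l) * lg X + (INR Z ^ 2 + 1) * E + 1) in Hl3.
  assert (HRr : 0 <= Rr).
  { unfold Rr. assert (0 <= INR (length l) * lg X) by (apply Rmult_le_pos; [apply pos_INR|apply ln_INR_pos]).
    assert (0 <= (INR Z ^ 2 + 1) * E) by (apply Rmult_le_pos; [pose proof (pow2_ge_0 (INR Z)); lra|exact HE0]). lra. }
  assert (HUR : U / 4 <= Rr).
  { apply Rmult_le_reg_r with Pm; [exact HPm0|]. apply Rle_trans with (2 ^ m * Rr); [|rewrite (Rmult_comm Rr); apply Rmult_le_compat_r; assumption].
    rewrite EU in HM0. lra. }
  (* The exponent [delta/16 + 1/2 + delta/4] falls short of that of [U] by [7 delta/16], which pays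
     for [32 B L^18]. *)
  assert (HZE : (INR Z ^ 2 + 1) * E <= U / 16).
  { set (Z2 := exp (delta / 16 * L)). assert (HZ2 : INR Z ^ 2 + 1 <= 2 * Z2).
    { assert (INR Z ^ 2 <= Z2).
      { unfold Z2. replace (delta / 16 * L) with (INR 2 * (delta / 32 * L)) by (simpl; field). rewrite exp_nat_pow. apply pow_incr. split; [apply pos_INR|rewrite EZ; exact e4']. }
      assert (1 <= Z2) by (apply exp_ge_1; lra). lra. }
    assert (EU2 : U = exp (7 * delta / 16 * L) * (Z2 * Ex)) by (unfold U, Z2, Ex; rewrite <- !exp_plus; f_equal; field).
    apply Rle_trans with (2 * Z2 * (B * L ^ 18 * Ex)).
    - apply Rmult_le_compat; [pose proof (pow2_ge_0 (INR Z)); lra|exact HE0|exact HZ2|exact HEB].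
    - rewrite EU2. replace (2 * Z2 * (B * L ^ 18 * Ex)) with ((32 * B * L ^ 18) * (Z2 * Ex) / 16) by field.
      apply Rmult_le_compat_r; [lra|]. apply Rmult_le_compat_r; [pos|exact e6]. }
  assert (EU3 : U = exp (3 * delta / 4 * L) * exp (L / 2)) by (unfold U; rewrite <- exp_plus; f_equal; field).
  assert (He2 : 1 <= exp (L / 2)) by (apply exp_ge_1; lra).
  assert (H16 : 16 <= U) by (rewrite EU3, Rmult_comm; pose proof (le_mul_ge1 (exp (L / 2)) (exp (3 * delta / 4 * L)) He2 ltac:(lra)); lra).
  assert (H8 : 8 * L * exp (L / 2) <= U) by (rewrite EU3; apply Rmult_le_compat_r; lra).
  assert (INR (length l) * lg X <= INR (length l) * L) by (apply Rmult_le_compat_l; [apply pos_INR|lra]).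
  apply Rmult_le_reg_r with L; [lra|]. unfold Rr in HUR. lra.
- intros p Hp. destruct (Hl2 p Hp) as (O & PX & Psel & Ptail). split; [exact O|].
  assert (HpX : INR p <= exp L) by (apply Rle_trans with (INR X); [apply le_INR, PX|exact HX1]).
  split; [exact HpX|].
  apply (HC2 p K' Y Z kp eps O Hkp).
  + intros q. apply sgnc_cos.
  + fold rho. assert (lg p <= L) by (rewrite <- (ln_exp L); apply ln_le; [apply lt_0_INR; destruct O; lia|exact HpX]).
    apply Rle_trans with (rho ^ S K' * L ^ 2); [|exact e4]. apply Rmult_le_compat_l; [lra|].
    apply Rle_trans with L; [exact H|]. replace (L ^ 2) with (L * L) by ring. apply le_mul_ge1; lra.
  + apply Rle_trans with (L ^ 2 * rho ^ S K'); [|lra]. apply Rmult_le_compat; [apply pos_INR|pos|exact HYL|apply pow_incr; unfold rho; lra].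
  + rewrite EZ. lra.
  + exact HYZ.
  + intros q Oq Hq. apply Psel. apply oprimes_In. auto.
  + exact Ptail.
Qed.

(** * Choice of parameters *)

Lemma ev_ln P : ev P -> ev (fun x => P (ln x)).
Proof.
intros [M HM]. exists (exp M). intros x Hx. apply HM. rewrite <- (ln_exp M). apply ln_le; [apply exp_pos|exact Hx].
Qed.

Lemma opr_le_pr n : 0 <= opr n <= pr n.
Proof. unfold opr. pose proof (pr_01 n). destruct (Nat.leb 3 n); lra. Qed.

(** Integers up to [W] are counted trivially, and a prime beyond [W] has [log n >= log W]. *)
Lemma prime_count_bound Y W : S1 opr Y * lg W <= INR W * lg W + theta Y.
Proof.
pose proof (ln_INR_pos W) as HW.
apply Rle_trans with (S1 (fun n => (if Nat.leb n W then lg W else 0) + pr n * lg n) Y).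
- rewrite Rmult_comm, <- S1_scal. apply S1_le. intros n Hn. destruct (opr_le_pr n). pose proof (pr_01 n). pose proof (ln_INR_pos n).
  assert (0 <= pr n * lg n) by pos.
  destruct (Nat.leb_spec n W) as [H4|H4].
  { assert (lg W * opr n <= lg W * 1) by (apply Rmult_le_compat_l; lra). lra. }
  assert (HWn : lg W <= lg n).
  { destruct W as [|W]; [change (INR 0) with 0; replace (ln 0) with 0; [exact H2|]; unfold ln; destruct (Rlt_dec 0 0) as [r|r]; [elim (Rlt_irrefl 0 r)|reflexivity]|].
    apply ln_le; [pos|apply le_INR; lia]. }
  assert (lg W * opr n <= lg n * pr n) by (apply Rmult_le_compat; lra). lra.
- rewrite S1_plus. apply Rplus_le_compat; [|apply Rle_refl].
  assert (X : S1 (fun n => if Nat.leb n W then lg W else 0) Y <= INR (Nat.min Y W) * lg W).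
  { induction Y as [|Y IH]; [simpl; lra|]. rewrite S1_S. destruct (Nat.leb_spec (S Y) W).
    - replace (Nat.min (S Y) W) with (S (Nat.min Y W)) by lia. rewrite S_INR. lra.
    - replace (Nat.min (S Y) W) with (Nat.min Y W) by lia. lra. }
  eapply Rle_trans; [exact X|]. apply Rmult_le_compat_r; [exact HW|apply le_INR; lia].
Qed.

(** The weight [log n] needed for [theta] is traded for [log Y], and the [1] pays for the prime
    [2]. *)
Lemma mainsum_lower sigma t Y : 0 <= sigma ->
  S1 (fun n => pr n * lg n * hcos sigma t (lg n)) Y - 1 <= mainsum sigma t Y * lg Y.
Proof.
intros Hs. apply Rle_trans with (S1 (fun n => pr n * lg n * hcos sigma t (lg n) - (if Nat.eqb n 2 then 1 else 0)) Y).
- rewrite S1_minus. pose proof (S1_indicator 2 1 Y ltac:(lra)). lra.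
- rewrite Rmult_comm. unfold mainsum. rewrite <- S1_scal. apply S1_le. intros n Hn.
  pose proof ln2_bounds as L2. pose proof (ln_INR_pos n) as Ln. pose proof (pw_pos n sigma) as Pp.
  pose proof (Rabs_cos_le (t * lg n)) as C1. pose proof (Rabs_pos (cos (t * lg n))) as C0.
  assert (HL : lg n <= lg Y) by (apply ln_le; [pos|apply le_INR; lia]).
  assert (Hh : 0 <= hcos sigma t (lg n) <= Rabs (cos (t * lg n)) * pw n sigma).
  { unfold hcos. change (exp (- sigma * lg n)) with (pw n sigma). rewrite <- pow2_abs. set (c := Rabs (cos (t * lg n))) in *.
    rewrite (Rmult_comm (pw n sigma)). split; [apply Rmult_le_pos; [apply pow2_ge_0|lra]|]. apply Rmult_le_compat_r; [lra|]. simpl. nra. }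
  assert (E : (pr n - opr n) * lg n * hcos sigma t (lg n) <= (if Nat.eqb n 2 then 1 else 0)).
  { pose proof (evenLam_eq n) as X. unfold evenLam, powLam in X. replace ((pr n - opr n) * lg n) with (if Nat.eqb n 2 then ln 2 else 0) by lra.
    assert (hcos sigma t (lg n) <= 1).
    { pose proof (pw_le_1 n sigma Hs). eapply Rle_trans; [apply Hh|]. nra. }
    destruct (Nat.eqb n 2); [|lra]. nra. }
  destruct (opr_le_pr n) as [O1 O2].
  assert (opr n * lg n * hcos sigma t (lg n) <= opr n * (lg Y * (Rabs (cos (t * lg n)) * pw n sigma))).
  { rewrite Rmult_assoc. apply Rmult_le_compat_l; [exact O1|]. apply Rmult_le_compat; lra. }
  lra.
Qed.

Lemma exp_ln_scale a c y : 0 < a < 1 -> 0 < c <= 1 -> 0 < y -> c * exp (a * ln y) <= exp (a * ln (c * y)).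
Proof.
intros Ha Hc Hy. rewrite ln_mult, Rmult_plus_distr_l, exp_plus by lra. apply Rmult_le_compat_r; [pos|].
rewrite <- (exp_ln c) at 1 by lra. apply exp_le_compat. assert (ln c <= 0) by (rewrite <- ln_1; apply ln_le; lra). nra.
Qed.

(** [Y] is about [(1 - 6 delta) L log L / (2 log 2)], so the prime number theorem makes
    [pi(Y) log 2] about [(1/2 - 3 delta) L]; the margin covers the loss in counting. As [log Y] is
    about [log L], the quotient [Y^a / log Y] produces [(2 log 2)^(-a) L^a (log L)^(-sigma)]. *)
Lemma choice_of_Y sigma t delta Y0 : GRH -> 1 / 2 < sigma < 1 -> 0 < delta <= 1 / 16 ->
  let a := 1 - sigma in delta <= kap a t ->
  ev (fun L => exists Y, (Y0 <= Y)%nat /\ (1 <= Y)%nat /\ INR Y <= L ^ 2 /\ S1 opr Y * ln 2 <= (1 / 2 - delta) * L /\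
    (kap a t - delta) * (1 - 8 * delta) * (exp (- a * ln (2 * ln 2)) / a) * (exp (a * ln L) * exp (- sigma * ln (ln L))) - 1 <= mainsum sigma t Y).
Proof.
intros HG Hs Hd a Hk. assert (Ha : 0 < a < 1) by (unfold a; lra). assert (L2 := ln2_bounds).
destruct (prime_number_theorem delta HG ltac:(lra)) as [N1 HN1].
destruct (prime_cos_sum sigma t Hs delta HG ltac:(lra)) as [N2 HN2]. fold a in HN2.
eapply ev_imp; [|exact (ev_and _ _ (ev_and _ _ (ev_ge (2 * INR (Y0 + N1 + N2 + 1))) (ev_ge (1 / delta)))
  (ev_ln _ (ev_and _ _ (ev_ge (4 + 1 / delta)) (ev_and _ _ (ev_poly 1 1 delta ltac:(lra)) (ev_poly (2 / delta) 0 delta ltac:(lra))))))].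
intros L [[h1 h2] [h3 [h4 h5]]]. set (ell := ln L) in *. simpl pow in h4, h5. rewrite ?Rmult_1_r, ?Rmult_1_l in h4, h5.
assert (hd : 0 < 1 / delta) by pos.
assert (Hde : 1 <= delta * ell).
{ assert (X : delta * (1 / delta) <= delta * ell) by (apply Rmult_le_compat_l; lra). replace (delta * (1 / delta)) with 1 in X by (field; lra). exact X. }
assert (HLp : 0 < L) by lra.
assert (HeL : exp ell = L) by (unfold ell; apply exp_ln, HLp).
assert (HdL : 1 <= delta * L).
{ assert (X : delta * (1 / delta) <= delta * L) by (apply Rmult_le_compat_l; lra). replace (delta * (1 / delta)) with 1 in X by (field; lra). exact X. }
set (y := (1 - 6 * delta) * L * ell / (2 * ln 2)).
assert (Ey : y * (2 * ln 2) = (1 - 6 * delta) * L * ell) by (unfold y; field; lra).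
assert (HLe : 4 * L <= L * ell) by nra.
assert (Hy1 : L <= y).
{ apply Rmult_le_reg_r with (2 * ln 2); [lra|]. rewrite Ey. nra. }
assert (Hy2 : y <= L * ell).
{ apply Rmult_le_reg_r with (2 * ln 2); [lra|]. rewrite Ey. nra. }
destruct (nfloor_ex y) as [Y [HY1 HY2]]; [lra|].
assert (HYd : (1 - delta) * y <= INR Y) by nra.
assert (HYL : L / 2 <= INR Y) by nra.
assert (HYbig : (Y0 + N1 + N2 + 1 <= Y)%nat) by (apply INR_le; lra).
exists Y. split; [lia|split; [lia|]].
assert (Hell : ell <= L) by (rewrite <- HeL; pose proof (exp_ineq1_le ell); lra).
split; [|split].
- apply Rle_trans with (L * ell); [lra|]. simpl. nra.
(* [W] is about [L^(1-delta)]: its logarithm is almost [log L], while [W] itself is at most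
   [delta L / 2]. *)
- set (w := exp ((1 - delta) * ell)).
  assert (Hw : 2 <= w) by (pose proof (exp_ineq1_le ((1 - delta) * ell)); unfold w; nra).
  destruct (nfloor_ex w) as [W [HW1 HW2]]; [lra|].
  assert (HlW : (1 - 2 * delta) * ell <= lg W).
  { assert (ln (w / 2) <= lg W) by (apply ln_le; lra). unfold w, Rdiv in H. rewrite ln_mult, ln_exp, ln_Rinv in H by (try apply exp_pos; lra). lra. }
  assert (PB := prime_count_bound Y W). assert (PT := proj2 (HN1 Y ltac:(lia))).
  assert (Hlw0 : 0 < (1 - 2 * delta) * ell) by nra.
  assert (Hw2 : w <= delta / 2 * L).
  { unfold w. replace ((1 - delta) * ell) with (ell + - (delta * ell)) by ring. rewrite exp_plus, exp_Ropp, HeL, Rmult_comm. apply Rmult_le_compat_r; [lra|].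
    replace (delta / 2) with (/ (2 / delta)) by (field; lra). apply Rinv_le_contravar; [pos|exact h5]. }
  set (s := S1 opr Y) in *.
  destruct (Rle_dec s (INR W)) as [Hsw|Hsw].
  { assert (s * ln 2 <= INR W * 1); [|nra]. nra. }
  assert (B1 : (s - INR W) * ((1 - 2 * delta) * ell) <= (1 + delta) * y).
  { apply Rle_trans with ((s - INR W) * lg W); [apply Rmult_le_compat_l; lra|]. nra. }
  assert (B2 : (s - INR W) * (2 * ln 2) <= (1 - 3 * delta) * L).
  { apply Rmult_le_reg_r with ((1 - 2 * delta) * ell); [exact Hlw0|].
    apply Rle_trans with ((1 + delta) * (y * (2 * ln 2))).
    - replace ((s - INR W) * (2 * ln 2) * ((1 - 2 * delta) * ell)) with ((s - INR W) * ((1 - 2 * delta) * ell) * (2 * ln 2)) by ring. rewrite <- (Rmult_assoc (1 + delta) y (2 * ln 2)). apply Rmult_le_compat_r; lra.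
    - rewrite Ey. replace ((1 + delta) * ((1 - 6 * delta) * L * ell)) with ((L * ell) * ((1 + delta) * (1 - 6 * delta))) by ring.
      replace ((1 - 3 * delta) * L * ((1 - 2 * delta) * ell)) with ((L * ell) * ((1 - 3 * delta) * (1 - 2 * delta))) by ring.
      apply Rmult_le_compat_l; nra. }
  assert (INR W * ln 2 <= w * 1) by (apply Rmult_le_compat; try lra; apply pos_INR). lra.
- assert (M1 := mainsum_lower sigma t Y ltac:(lra)). assert (M2 := HN2 Y ltac:(lia)).
  assert (HlY : lg Y <= (1 + delta) * ell).
  { apply Rle_trans with (ln (L * ell)); [apply ln_le; lra|]. rewrite ln_mult by lra. fold ell.
    assert (ln ell <= delta * ell) by (rewrite <- (ln_exp (delta * ell)); apply ln_le; lra). lra. } set (k := kap a t - delta) in *. assert (Hk0 : 0 <= k <= 1) by (pose proof (kap_pos sigma t Hs) as X; fold a in X; unfold k; lra).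
  set (b1 := exp (- a * ln (2 * ln 2))) in *.
  assert (Hb1 : 0 < b1) by apply exp_pos.
  set (La := exp (a * ell)). set (la := exp (a * ln ell)).
  assert (V : (1 - 7 * delta) * (La * la * b1) <= exp (a * lg Y)).
  { assert (Ety : exp (a * ln (L * ell / (2 * ln 2))) = La * la * b1).
    { unfold Rdiv. rewrite ln_mult, ln_mult, ln_Rinv by (try apply Rinv_0_lt_compat; try pos). fold ell.
      rewrite !Rmult_plus_distr_l, !exp_plus. unfold La, la, b1. do 2 f_equal. ring. }
    assert (X := exp_ln_scale a ((1 - delta) * (1 - 6 * delta)) (L * ell / (2 * ln 2)) Ha ltac:(split; nra) ltac:(apply Rdiv_lt_0_compat; nra)).
    rewrite Ety in X. assert (P : 0 < La * la * b1) by (apply Rmult_lt_0_compat; [pos|exact Hb1]).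
    apply Rle_trans with ((1 - delta) * (1 - 6 * delta) * (La * la * b1)); [apply Rmult_le_compat_r; nra|]. eapply Rle_trans; [exact X|].
    apply exp_le_compat, Rmult_le_compat_l; [lra|]. apply ln_le; [apply Rmult_lt_0_compat; [nra|apply Rdiv_lt_0_compat; nra]|].
    replace ((1 - delta) * (1 - 6 * delta) * (L * ell / (2 * ln 2))) with ((1 - delta) * y) by (unfold y; field; lra). exact HYd. }
  set (G := k / a * ((1 - 7 * delta) * (La * la * b1))).
  assert (HG0 : G - 1 <= mainsum sigma t Y * lg Y).
  { assert (G <= k / a * exp (a * lg Y)) by (apply Rmult_le_compat_l; [pos|exact V]). lra. }
  assert (Esc : exp (- sigma * ln ell) = la / ell).
  { unfold la. rewrite <- (exp_ln ell) at 3 by lra. unfold Rdiv. rewrite <- exp_Ropp, <- exp_plus. f_equal. unfold a. ring. }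
  rewrite Esc. fold La.
  assert (Hms : 0 <= mainsum sigma t Y).
  { apply S1_pos. intros n _. apply Rmult_le_pos; [apply opr_le_pr|]. apply Rmult_le_pos; [apply Rabs_pos|pos]. }
  assert (HG1 : G - 1 <= mainsum sigma t Y * ((1 + delta) * ell)) by (eapply Rle_trans; [exact HG0|apply Rmult_le_compat_l; assumption]).
  apply Rmult_le_reg_r with ((1 + delta) * ell); [nra|]. eapply Rle_trans; [|exact HG1].
  set (H0 := k / a * (La * la * b1)). assert (HH0 : 0 <= H0).
  { unfold H0. apply Rmult_le_pos; [pos|]. left. apply Rmult_lt_0_compat; [pos|exact Hb1]. }
  replace ((k * (1 - 8 * delta) * (b1 / a) * (La * (la / ell)) - 1) * ((1 + delta) * ell)) with (H0 * ((1 - 8 * delta) * (1 + delta)) - (1 + delta) * ell) by (unfold H0; field; lra).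
  replace G with (H0 * (1 - 7 * delta)) by (unfold G, H0; ring).
  nra.
Qed.

(** The sign [kp] is [1] for large and [-1] for small values of the L-function; a fixed loss [e]
    replaces the o(1). *)
Definition large_values (sigma t kp x e : R) : Prop :=
  exists S : list nat, NoDup S /\ sqrt x <= INR (length S) /\ forall p, In p S -> prime (Z.of_nat p) /\ (2 < p)%nat /\ INR p <= x /\
    exists l : C, is_DSval (chi_leg p) (sigma, t) l /\ (beta sigma t - e) * scale sigma x <= kp * ln (Cmod l).

Lemma scale_exp sigma x : scale sigma x = exp ((1 - sigma) * ln (ln x)) * exp (- sigma * ln (ln (ln x))).
Proof. reflexivity. Qed.

Lemma beta_kap sigma t : 1 / 2 < sigma < 1 -> beta sigma t = kap (1 - sigma) t * (exp (- (1 - sigma) * ln (2 * ln 2)) / (1 - sigma)).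
Proof.
intros Hs. unfold beta, kap, beta_sigma, Rpower. replace (sigma - 1) with (- (1 - sigma)) by ring.
destruct (Req_EM_T t 0); [ring|]. unfold Rdiv. ring.
Qed.

Lemma scale_large sigma M : 1 / 2 < sigma < 1 -> ev (fun L => M <= exp ((1 - sigma) * ln L) * exp (- sigma * ln (ln L))).
Proof.
intros Hs. set (a := 1 - sigma). assert (Ha : 0 < a < 1) by (unfold a; lra).
apply (ev_imp (fun L => 1 <= ln L /\ (1 * ln L ^ 1 <= exp (a / 2 * ln L) /\ M * ln L ^ 0 <= exp (a / 2 * ln L)))).
- intros L [h1 [h2 h3]]. set (ell := ln L) in *. simpl pow in h2, h3. rewrite ?Rmult_1_r, ?Rmult_1_l in h2, h3.
  eapply Rle_trans; [exact h3|]. rewrite <- exp_plus. apply exp_le_compat.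
  assert (0 <= ln ell) by (rewrite <- ln_1; apply ln_le; lra).
  assert (ln ell <= a / 2 * ell) by (rewrite <- (ln_exp (a / 2 * ell)); apply ln_le; lra). nra.
- apply (ev_ln (fun ell => 1 <= ell /\ (1 * ell ^ 1 <= exp (a / 2 * ell) /\ M * ell ^ 0 <= exp (a / 2 * ell)))).
  apply ev_and; [apply ev_ge|apply ev_and; apply ev_poly; lra].
Qed.

Lemma ev_pw_small c M : 0 < c -> exists Y0, forall Y, (Y0 <= Y)%nat -> M * pw Y c <= 1 / 2.
Proof.
intros Hc. destruct (ev_nat _ (ev_poly (2 * M) 0 c Hc)) as (Y0 & H0 & H). exists Y0. intros Y HY. specialize (H Y HY). simpl in H. rewrite Rmult_1_r in H.
unfold pw. replace (- c * lg Y) with (- (c * lg Y)) by ring. rewrite exp_Ropp. pose proof (exp_pos (c * lg Y)).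
apply Rmult_le_reg_r with (exp (c * lg Y)); [assumption|]. rewrite Rmult_assoc, Rinv_l by lra. lra.
Qed.

Theorem large_values_eventually sigma t kp e : GRH -> 1 / 2 < sigma < 1 -> (kp = 1 \/ kp = -1) -> 0 < e -> ev (fun x => large_values sigma t kp x e).
Proof.
intros HG Hs Hkp He. set (a := 1 - sigma). assert (Ha : 0 < a < 1) by (unfold a; lra).
set (b1 := exp (- a * ln (2 * ln 2)) / a). assert (Hb1 : 0 < b1) by (apply Rdiv_lt_0_compat; [apply exp_pos|lra]).
assert (Hkap : 0 < kap a t <= 1).
{ split; [|apply (kap_pos sigma t Hs)]. unfold kap. destruct (Req_EM_T t 0) as [Et|Et]; [lra|]. apply Rdiv_lt_0_compat; [apply pow2_gt_0, Et|apply (quad_pos sigma t Hs)]. }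
set (delta := Rmin (Rmin (1 / 16) (kap a t)) (e / (18 * b1))).
assert (Hd : 0 < delta /\ delta <= 1 / 16 /\ delta <= kap a t /\ delta <= e / (18 * b1)).
{ unfold delta. repeat split.
  - repeat apply Rmin_glb_lt; try lra. apply Rdiv_lt_0_compat; lra.
  - eapply Rle_trans; apply Rmin_l.
  - eapply Rle_trans; [apply Rmin_l|apply Rmin_r].
  - apply Rmin_r. }
clearbody delta. destruct Hd as (d0 & d1 & d2 & d3).
assert (d4 : 9 * delta * b1 <= e / 2).
{ apply (Rmult_le_compat_r (9 * b1)) in d3; [|lra]. replace (e / (18 * b1) * (9 * b1)) with (e / 2) in d3 by (field; lra). lra. }
destruct (ev_pw_small (2 * sigma - 1) (/ (2 * sigma - 1)) ltac:(lra)) as [Y0 HY0].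
destruct (chosen_primes sigma t delta HG Hs ltac:(lra)) as [C2 HC2].
assert (HY := choice_of_Y sigma t delta Y0 HG Hs ltac:(lra) d2). cbv zeta in HY. fold a b1 in HY.
assert (HS := scale_large sigma ((Rabs C2 + 1) * (2 / e)) Hs). fold a in HS.
eapply ev_imp; [|exact (ev_and _ _ (ev_ge 1) (ev_ln _ (ev_and _ _ HC2 (ev_and _ _ HY HS))))].
intros x [x1 [P1 [[Y (y0 & y1 & y2 & y3 & y4)] P3]]].
assert (Ex : exp (ln x) = x) by (apply exp_ln; lra).
destruct (P1 Y kp y1 y2 (HY0 Y y0) y3 Hkp) as (l & ND & Hlen & Hl).
exists l. split; [exact ND|split].
- replace (sqrt x) with (exp (ln x / 2)); [exact Hlen|]. symmetry. apply sqrt_lem_1; [lra|pos|]. rewrite <- exp_plus, <- Ex. f_equal. rewrite Ex. field.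
- intros p Hp. destruct (Hl p Hp) as ([O1 O2] & Hpx & u & v & Lu & Lv & Huv & Hm). rewrite Ex in Hpx.
  split; [exact O1|split; [exact O2|split; [exact Hpx|]]]. exists (u, v). split; [apply (is_DSval_dval _ (leg p)); [intros; reflexivity|exact Lu|exact Lv]|].
  assert (El : ln (Cmod (u, v)) = / 2 * ln (u ^ 2 + v ^ 2)).
  { unfold Cmod. simpl (fst _). simpl (snd _). rewrite <- (Rpower_sqrt (u ^ 2 + v ^ 2)) by exact Huv. unfold Rpower. rewrite ln_exp. reflexivity. }
  rewrite El. eapply Rle_trans; [|exact Hm]. rewrite scale_exp, (beta_kap sigma t Hs). fold a b1.
  set (sc := exp (a * ln (ln x)) * exp (- sigma * ln (ln (ln x)))) in *.
  assert (Hsc : 0 < sc) by pos.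
  assert (T1 : Rabs C2 + 1 <= e / 2 * sc).
  { apply (Rmult_le_compat_l (e / 2)) in P3; [|lra]. replace (e / 2 * ((Rabs C2 + 1) * (2 / e))) with (Rabs C2 + 1) in P3 by (field; lra). exact P3. }
  pose proof (Rle_abs C2).
  assert (T2 : kap a t * b1 - 9 * delta * b1 <= (kap a t - delta) * (1 - 8 * delta) * b1).
  { rewrite <- Rmult_minus_distr_r. apply Rmult_le_compat_r; [lra|]. nra. }
  assert ((kap a t * b1 - e / 2) * sc <= (kap a t - delta) * (1 - 8 * delta) * b1 * sc) by (apply Rmult_le_compat_r; lra).
  lra.
Qed.

(** * From a fixed loss to o(1) *)

Lemma finite_max (P : nat -> Prop) M : P 0%nat -> exists n, (n <= M)%nat /\ P n /\ forall k, (k <= M)%nat -> P k -> (k <= n)%nat.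
Proof.
intros H0. induction M as [|M (n & H1 & H2 & H3)]; [exists 0%nat; repeat split; auto|].
destruct (classic (P (S M))) as [H|H]; [exists (S M); auto|]. exists n. split; [lia|split; [exact H2|]].
intros k Hk Pk. destruct (Nat.eq_dec k (S M)) as [-> | Ne]; [contradiction|apply H3; [lia|exact Pk]].
Qed.

(** For each [x] the index [n] dominates every [k <= x] for which [P x (1/(k+1))] holds, and is
    itself such that [P x (1/(n+1))]; it tends to infinity because each fixed [k] is eventually
    admissible. The restriction [k <= x] makes a maximum exist, and the minus sign matches the form
    [beta + eta]. *)
Lemma diagonal (P : R -> R -> Prop) : (forall e, 0 < e -> ev (fun x => P x e)) ->
  exists eta : R -> R, filterlim eta (Rbar_locally p_infty) (locally 0) /\ exists X0, forall x, X0 <= x -> P x (- eta x).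
Proof.
intros H. assert (Hpos : forall n, 0 < / INR (S n)) by (intros; apply Rinv_0_lt_compat, lt_0_INR; lia).
set (Q := fun x n => P x (/ INR (S n))).
assert (Sel : forall x, exists n, Q x 0%nat -> Q x n /\ forall k, INR k <= x -> Q x k -> (k <= n)%nat).
{ intros x. destruct (Rle_dec 0 x) as [Hx|Hx].
  - destruct (nfloor_ex x Hx) as [M [_ HM]]. destruct (classic (Q x 0%nat)) as [H0|H0]; [|exists 0%nat; tauto].
    destruct (finite_max (Q x) M H0) as (n & _ & H2 & H3). exists n. intros _. split; [exact H2|].
    intros k Hk Qk. apply H3; [|exact Qk]. rewrite <- S_INR in HM. assert (k < S M)%nat by (apply INR_lt; lra). lia.
  - exists 0%nat. intros H0. split; [exact H0|]. intros k Hk. pose proof (pos_INR k). lra. }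
set (nx := fun x => proj1_sig (constructive_indefinite_description _ (Sel x))).
assert (Hnx : forall x, Q x 0%nat -> Q x (nx x) /\ forall k, INR k <= x -> Q x k -> (k <= nx x)%nat) by (intros x; apply (proj2_sig (constructive_indefinite_description _ (Sel x)))).
clearbody nx. destruct (H (/ INR 1) (Hpos 0%nat)) as [X0 HX0].
exists (fun x => - / INR (S (nx x))). split.
- apply filterlim_locally. intros eps. destruct (nfloor_ex (/ eps)) as [k [_ Hk]]; [left; apply Rinv_0_lt_compat, cond_pos|].
  destruct (H (/ INR (S k)) (Hpos k)) as [X1 HX1]. exists (Rmax (Rmax X0 X1) (INR k)). intros x Hx.
  pose proof (Rmax_l (Rmax X0 X1) (INR k)). pose proof (Rmax_r (Rmax X0 X1) (INR k)). pose proof (Rmax_l X0 X1). pose proof (Rmax_r X0 X1).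
  destruct (Hnx x) as [_ Hn]; [apply HX0; lra|]. specialize (Hn k ltac:(lra) ltac:(apply HX1; lra)).
  change (Rabs (- / INR (S (nx x)) - 0) < eps). rewrite Rminus_0_r, Rabs_Ropp, Rabs_pos_eq by (left; apply Hpos).
  apply Rle_lt_trans with (/ INR (S k)); [apply Rinv_le_contravar; [pos|apply le_INR; lia]|].
  rewrite <- S_INR in Hk. rewrite <- (Rinv_inv eps). apply Rinv_lt_contravar; [|exact Hk]. apply Rmult_lt_0_compat; [apply Rinv_0_lt_compat, cond_pos|pos].
- exists X0. intros x Hx. rewrite Ropp_involutive. apply Hnx. apply HX0, Hx.
Qed.

Theorem theorem1p8 :
  GRH ->
  forall sigma t : R, 1/2 < sigma < 1 ->
  (exists c : R, 0 < c /\
   exists eta : R -> R, filterlim eta (Rbar_locally p_infty) (locally 0) /\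
   exists X0 : R, forall x : R, X0 <= x ->
     exists S : list nat, NoDup S /\ c * sqrt x <= INR (length S) /\
       forall p, In p S ->
         prime (Z.of_nat p) /\ (2 < p)%nat /\ INR p <= x /\
         exists l : C, is_DSval (chi_leg p) (sigma, t) l /\
           ln (Cmod l) >= (beta sigma t + eta x) * scale sigma x)
  /\
  (exists c : R, 0 < c /\
   exists eta : R -> R, filterlim eta (Rbar_locally p_infty) (locally 0) /\
   exists X0 : R, forall x : R, X0 <= x ->
     exists S : list nat, NoDup S /\ c * sqrt x <= INR (length S) /\
       forall q, In q S ->
         prime (Z.of_nat q) /\ (2 < q)%nat /\ INR q <= x /\
         exists l : C, is_DSval (chi_leg q) (sigma, t) l /\
           ln (Cmod l) <= - (beta sigma t + eta x) * scale sigma x).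
Proof.
intros HG sigma t Hs. split.
- destruct (diagonal (large_values sigma t 1) (fun e => large_values_eventually sigma t 1 e HG Hs (or_introl eq_refl))) as (eta & Heta & X0 & H).
  (* The implied constant is [1]: the selection already supplies [sqrt x] primes. *)
  exists 1. split; [lra|]. exists eta. split; [exact Heta|]. exists X0. intros x Hx. destruct (H x Hx) as (S & ND & Hlen & HP).
  exists S. split; [exact ND|split; [lra|]]. intros p Hp. destruct (HP p Hp) as (A1 & A2 & A3 & l & A4 & A5).
  split; [exact A1|split; [exact A2|split; [exact A3|]]]. exists l. split; [exact A4|]. rewrite Rmult_1_l in A5.
  replace (beta sigma t + eta x) with (beta sigma t - - eta x) by ring. lra.
- destruct (diagonal (large_values sigma t (-1)) (fun e => large_values_eventually sigma t (-1) e HG Hs (or_intror eq_refl))) as (eta & Heta & X0 & H).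
  exists 1. split; [lra|]. exists eta. split; [exact Heta|]. exists X0. intros x Hx. destruct (H x Hx) as (S & ND & Hlen & HP).
  exists S. split; [exact ND|split; [lra|]]. intros p Hp. destruct (HP p Hp) as (A1 & A2 & A3 & l & A4 & A5).
  split; [exact A1|split; [exact A2|split; [exact A3|]]]. exists l. split; [exact A4|].
  replace (beta sigma t - - eta x) with (beta sigma t + eta x) in A5 by ring. lra.
Qed.
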